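(* Let $r\in(0,2)$ and let $X=\{X(t):t\ge0\}$ be either (a) a symmetric $r$-stable process with stationary independent increments and cadlag sample paths, i.e. for some constant $c\in(0,\infty)$, $\mathbb E\exp\{iuX(t)\}=\exp\{-ct|u|^r\}$ for all $t\ge0,u\in\mathbb R$; or (b) a centered sample-continuous fractional Brownian motion with parameter $r$, i.e. a centered Gaussian process with $\mathbb E(X(s)X(t))=\frac12[t^r+s^r-|t-s|^r]$, $s,t\ge0$. Assume $P(X(0)=0)=1$, let $X_1,X_2,\dots$ be i.i.d. copies of $X$ with sample paths of the same type, build from them the empirical quantile processes $\tau^n_\alpha(t)$, and let $I$ be a closed subinterval of $(0,1)$. Then for each $T\in(0,\infty)$ the processes $\{\sqrt n(\tau^n_\alpha(t)-\tau_\alpha(t)):(t,\alpha)\in[0,T]\times I\}$ converge weakly in $\ell_\infty([0,T]\times I)$ to a centered Gaussian process $\{\tilde G(t,\alpha):(t,\alpha)\in[0,T]\times I\}$ with $\tilde G(0,\alpha)=0$ for $\alpha\in I$ and, for $(s,\beta),(t,\alpha)\in(0,T]\times I$, $$\mathbb E(\tilde G(s,\beta)\tilde G(t,\alpha))=\frac{P(X(s)\le\tau_\beta(s),X(t)\le\tau_\alpha(t))-\alpha\beta}{f(s,\tau_\beta(s))\,f(t,\tau_\alpha(t))},$$ where $f(t,\cdot)$ is the density of $X(t)$.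
   Context: Notation: $F(t,x)=P(X(t)\le x)$, $F_n(t,x)=\frac1n\sum_{i=1}^n I(X_i(t)\le x)$, $\tau_\alpha(t)=\inf\{x:F(t,x)\ge\alpha\}$, $\tau^n_\alpha(t)=\inf\{x:F_n(t,x)\ge\alpha\}$. Weak convergence $W_n\Rightarrow G$ in $\ell_\infty(T)$ (sup-norm) to a Gaussian process $G$ means: the law of $G$ is Radon on $\ell_\infty(T)$ (equivalently $G$ has bounded sample paths uniformly continuous w.r.t. $d(s,t)=(\mathbb E[G(s)-G(t)]^2)^{1/2}$), and $\mathbb E^*F(W_n)\to\mathbb E F(G)$ for every bounded continuous $F:\ell_\infty(T)\to\mathbb R$, where $\mathbb E^*$ is outer expectation. *)

(* Defs.v *)
From HB Require Import structures.
From mathcomp Require Import all_boot all_order all_algebra.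
From mathcomp Require Import all_classical all_reals all_analysis.
Set Implicit Arguments. Unset Strict Implicit. Unset Printing Implicit Defensive.
Import Order.TTheory GRing.Theory Num.Theory.
Import numFieldNormedType.Exports.
Local Open Scope classical_set_scope.
Local Open Scope ring_scope.

Section defs.
Context {R : realType} {d : measure_display} {Omega : measurableType d}
  (P : probability Omega R).

(** mutual independence of finitely many real random variables
    (product rule; taking B i = setT covers all subfamilies) *)
Definition indep_rvs (n : nat) (Y : 'I_n -> Omega -> R) : Prop :=
  forall B : 'I_n -> set R, (forall i, measurable (B i)) ->
    P (\bigcap_(i in [set: 'I_n]) (Y i @^-1` B i)) =
    (\prod_(i < n) P (Y i @^-1` B i))%E.

Definition stationary_indep_increments (X : R -> Omega -> R) : Prop :=
  (forall n (ts : 'I_n.+1 -> R), 0 <= ts ord0 ->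
     (forall i j : 'I_n.+1, (i < j)%N -> ts i < ts j) ->
     indep_rvs (fun (i : 'I_n) w =>
        X (ts (lift ord0 i)) w - X (ts (widen_ord (leqnSn n) i)) w)) /\
  (forall s t, 0 <= s -> s <= t -> forall B : set R, measurable B ->
     P ((fun w => X t w - X s w) @^-1` B) =
     P ((fun w => X (t - s) w - X 0 w) @^-1` B)).

Definition sym_stable_process (r c : R) (X : R -> Omega -> R) : Prop :=
  (forall t, measurable_fun setT (X t)) /\
  stationary_indep_increments X /\
  (forall t u, 0 <= t ->
     (expectation P (fun w => cos (u * X t w))) = (expR (- (c * t * (`|u| `^ r))))%:E /\
     (expectation P (fun w => sin (u * X t w))) = 0%E).

Definition centered_normal_rv (Y : Omega -> R) : Prop :=
  P [set w | Y w = 0] = 1%E \/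
  exists s : R, 0 < s /\
    forall B : set R, measurable B -> P (Y @^-1` B) = normal_prob 0 s B.

Definition centered_gaussian_process {I : Type} (S : set I)
    (Z : I -> Omega -> R) : Prop :=
  (forall i, S i -> measurable_fun setT (Z i)) /\
  forall n (p : 'I_n -> I) (a : 'I_n -> R), (forall k, S (p k)) ->
    centered_normal_rv (fun w => \sum_(k < n) a k * Z (p k) w).

(** fractional Brownian motion with parameter r (case (b)), without the
    path condition *)
Definition frac_brownian (r : R) (X : R -> Omega -> R) : Prop :=
  centered_gaussian_process [set t | 0 <= t] X /\
  (forall s t, 0 <= s -> 0 <= t ->
     (expectation P (fun w => X s w * X t w)) =
     (((t `^ r) + (s `^ r) - (`|t - s| `^ r)) / 2)%:E).

Definition fdd_event (Y : R -> Omega -> R) (k : nat) (ts : 'I_k -> R)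
    (B : 'I_k -> set R) : set Omega :=
  \bigcap_(l in [set: 'I_k]) (Y (ts l) @^-1` B l).

Definition iid_copies (X : R -> Omega -> R) (Xs : nat -> R -> Omega -> R)
  : Prop :=
  (forall i t, measurable_fun setT (Xs i t)) /\
  (forall i k (ts : 'I_k -> R) (B : 'I_k -> set R),
     (forall l, 0 <= ts l) -> (forall l, measurable (B l)) ->
     P (fdd_event (Xs i) ts B) = P (fdd_event X ts B)) /\
  (forall n k (ts : 'I_k -> R) (B : 'I_n -> 'I_k -> set R),
     (forall l, 0 <= ts l) -> (forall i l, measurable (B i l)) ->
     P (\bigcap_(i in [set: 'I_n]) fdd_event (Xs i) ts (B i)) =
     (\prod_(i < n) P (fdd_event (Xs i) ts (B i)))%E).

Definition cdfX (X : R -> Omega -> R) (t x : R) : R :=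
  fine (P [set w | X t w <= x]).

Definition Estar (Y : Omega -> R) : \bar R :=
  ereal_inf [set (expectation P (U)) | U in [set U : Omega -> R |
     measurable_fun setT U /\ P.-integrable setT (EFin \o U) /\
     (forall w, Y w <= U w)]].

End defs.

Definition quantile {R : realType} (F : R -> R) (alpha : R) : R :=
  inf [set x | alpha <= F x].

Definition emp_cdf {R : realType} {T : Type} (Xs : nat -> R -> T -> R)
    (n : nat) (t x : R) (w : T) : R :=
  n%:R^-1 * \sum_(i < n) (if Xs i t w <= x then 1 else 0).

Definition cadlag_nonneg {R : realType} (g : R -> R) : Prop :=
  (forall t, 0 <= t -> g x @[x --> t^'+] --> g t) /\
  (forall t, 0 < t -> cvg (g x @[x --> t^'-])).

Definition cont_nonneg {R : realType} (g : R -> R) : Prop :=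
  {within [set t | 0 <= t], continuous g}.

Definition bounded_on {R : realType} {I : Type} (S : set I) (z : I -> R)
  : Prop := exists M : R, forall p, S p -> `|z p| <= M.

(** F is (the extension to all functions of) a bounded continuous
    functional on l_infty(S) with the sup norm *)
Definition bcont_linf {R : realType} {I : Type} (S : set I)
    (F : (I -> R) -> R) : Prop :=
  (exists M : R, forall z, `|F z| <= M) /\
  (forall z w, (forall p, S p -> z p = w p) -> F z = F w) /\
  (forall z, bounded_on S z -> forall e : R, 0 < e ->
     exists2 delta : R, 0 < delta &
       forall w, (forall p, S p -> `|w p - z p| <= delta) ->
         `|F w - F z| < e).

Definition intr_dist {R : realType} {d : measure_display}
    {Omega : measurableType d} (Q : probability Omega R) {I : Type}
    (G : I -> Omega -> R) (p q : I) : R :=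
  Num.sqrt (fine (expectation Q (fun w => (G p w - G q w) ^+ 2))).

(** the law of G is Radon on l_infty(S): bounded sample paths,
    uniformly continuous w.r.t. the intrinsic pseudometric *)
Definition radon_paths {R : realType} {d : measure_display}
    {Omega : measurableType d} (Q : probability Omega R) {I : Type}
    (S : set I) (G : I -> Omega -> R) : Prop :=
  forall w, bounded_on S (fun p => G p w) /\
    forall e : R, 0 < e -> exists2 delta : R, 0 < delta &
      forall p q, S p -> S q -> intr_dist Q G p q < delta ->
        `|G p w - G q w| < e.

(** W_n => G in l_infty(S) (given the Radon property of G) *)
Definition weak_conv_linf {R : realType} {I : Type} (S : set I)
    {d : measure_display} {Omega : measurableType d}
    (P : probability Omega R) (W : nat -> I -> Omega -> R)
    {d' : measure_display} {Omega' : measurableType d'}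
    (Q : probability Omega' R) (G : I -> Omega' -> R) : Prop :=
  forall F : (I -> R) -> R, bcont_linf S F ->
    measurable_fun setT (fun w' => F (fun p => G p w')) /\
    (Estar P (fun w => F (fun p => W n p w)) @[n --> \oo] -->
       (expectation Q (fun w' => F (fun p => G p w'))))%E.

Definition tau {R : realType} {d : measure_display} {Omega : measurableType d}
    (P : probability Omega R) (X : R -> Omega -> R) (t alpha : R) : R :=
  quantile (cdfX P X t) alpha.

Definition tau_n {R : realType} {T : Type} (Xs : nat -> R -> T -> R)
    (n : nat) (t alpha : R) (w : T) : R :=
  quantile (fun x => emp_cdf Xs n t x w) alpha.

(* Main.v *)
(** Both kinds of process are self-similar: with H = 1/r (stable) or H = r/2
    (fractional Brownian motion), X(t) has the law of t^H X(1), whose distribution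
    function Phi has a continuous positive density p.  Hence tau_alpha(t) = t^H q(alpha)
    with Phi (q alpha) = alpha, and an increment over time h exceeds lam with uniformly
    small probability, at most C (h^H / lam)^kap for the whole oscillation (Ottaviani's
    inequality in the stable case, dyadic chaining in the Gaussian one).

    This oscillation bound provides brackets for the half-spaces {X(t) <= t^H x}, so a
    bracketing chaining argument on each block of times [t0, 2 t0] makes the standardized
    empirical process nu_n(t, x) asymptotically equicontinuous; summing over dyadic
    blocks, the factor t^H takes care of t near 0.  A Bahadur representation then gives
    sqrt n (tau^n_alpha(t) - tau_alpha(t)) = - t^H nu_n(t, q alpha) / p (q alpha) + o(1),
    uniformly in (t, alpha); for times of order n^(-const) the samples themselves are
    o(n^(-1/2)).

    The finite-dimensional laws converge by the central limit theorem through
    characteristic functions.  The limit is built from independent normal variables,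
    obtained from X_i(1) by the quantile transform, by a Cholesky factorization on a
    countable dense set of indices, and extended by uniform continuity; a further
    null-set modification makes it constant along pairs at zero intrinsic distance, from
    which compactness gives intrinsic uniform continuity of every path.  Weak convergence
    follows by squeezing a bounded continuous functional between Lipschitz envelopes
    evaluated on finite grids. *)
Require Import Defs.
From HB Require Import structures.
From mathcomp Require Import all_boot all_order all_algebra.
From mathcomp Require Import all_classical all_reals all_analysis.
From mathcomp Require Import measurable_realfun ring lra.
Set Implicit Arguments. Unset Strict Implicit. Unset Printing Implicit Defensive.
Import Order.TTheory GRing.Theory Num.Theory.
Import numFieldNormedType.Exports.
Local Open Scope classical_set_scope.
Local Open Scope ring_scope.

(** Uniform bounds are never stated through suprema over uncountable index sets, whose measurability
    would be in doubt: each provides a measurable event [Bad] of small probability outside which all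
    indices obey the bound. Paths may jump, but an increment started at a fixed time is small with
    high probability, and this makes brackets cheap. Mass 16^-k costs about D^k brackets, while the
    exponential inequality at scale 4^k leaves the tail exp(- M 2^k), which beats any geometric
    count. Chaining stops when 4^k reaches sqrt n, where passing from a set to its bracket costs O(1
    / sqrt n). The stable density has no closed form, and its positivity comes from its positivity
    set: it is symmetric, contains s^(1/r) x + (1 - s)^(1/r) y along with x and y, and is unbounded,
    because a bounded variable has 1 - E cos(u X) = O(u^2), against |u|^r with r < 2. Expectations
    are real numbers attached to bounded functions, with sine and cosine in place of complex
    exponentials. The limit process is realized on [Omega] itself. *)

Section real_helpers.
Context {R : realType}.

Lemma near_natS_ge (x : R) : \forall n \near \oo, x <= n.+1%:R.
Proof.
exists (Num.bound `|x|) => // n /= xn; rewrite (le_trans (ler_norm _))//.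
rewrite (le_trans (ltW (archi_boundP (normr_ge0 x))))// ler_nat.
exact: leq_trans xn (leqnSn n).
Qed.

Lemma near_natSinv_le (e : R) : 0 < e -> \forall n \near \oo, n.+1%:R^-1 <= e.
Proof.
move=> e0; near=> n; rewrite -[leRHS]invrK lef_pV2 ?posrE ?invr_gt0 ?ltr0n//.
by near: n; exact: near_natS_ge.
Unshelve. all: by end_near. Qed.

Lemma ex_natSinv_le (e : R) : 0 < e -> exists n : nat, n.+1%:R^-1 <= e.
Proof. by move=> /near_natSinv_le[n _ /(_ n (leqnn n))]; exists n. Qed.

End real_helpers.

Section level_sets.
Context {R : realType} {d : measure_display} {Om : measurableType d}.
Variables (Y : Om -> R) (mY : measurable_fun setT Y).

Lemma measurable_preim B : measurable B -> measurable (Y @^-1` B).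
Proof. by move=> mB; rewrite -[X in measurable X]setTI; exact: mY. Qed.

Lemma measurable_le (c : R) : measurable [set w | Y w <= c].
Proof.
have := measurable_preim (measurable_itv `]-oo, c]).
by rewrite /preimage; under eq_set do rewrite /= in_itv/=.
Qed.

Lemma measurable_lt (c : R) : measurable [set w | Y w < c].
Proof.
have := measurable_preim (measurable_itv `]-oo, c[).
by rewrite /preimage; under eq_set do rewrite /= in_itv/=.
Qed.

Lemma measurable_ge (c : R) : measurable [set w | c <= Y w].
Proof.
have := measurable_preim (measurable_itv `[c, +oo[).
by rewrite /preimage; under eq_set do rewrite /= in_itv/= andbT.
Qed.

Lemma measurable_gt (c : R) : measurable [set w | c < Y w].
Proof.
have := measurable_preim (measurable_itv `]c, +oo[).
by rewrite /preimage; under eq_set do rewrite /= in_itv/= andbT.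
Qed.

End level_sets.

Lemma measurable_norm_gt {R : realType} {d : measure_display} {Om : measurableType d}
  (Y : Om -> R) (c : R) : measurable_fun setT Y -> measurable [set w | c < `|Y w|].
Proof. by move=> mY; apply: measurable_gt; exact: measurableT_comp. Qed.

(** * Probabilities and expectations of bounded variables *)

Section prob_basics.
Context {R : realType} {d : measure_display} {Omega : measurableType d}
  (P : probability Omega R).
Implicit Types (A B : set Omega) (Y Z : Omega -> R).

Definition pr A : R := fine (P A).

Lemma prE A : measurable A -> P A = (pr A)%:E.
Proof. by move=> mA; rewrite /pr fineK// fin_num_measure. Qed.

Lemma pr_ge0 A : 0 <= pr A.
Proof. by rewrite /pr fine_ge0. Qed.

Lemma pr_le1 A : measurable A -> pr A <= 1.
Proof. by move=> mA; rewrite -lee_fin -prE// probability_le1. Qed.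

Lemma prT : pr setT = 1.
Proof. by rewrite /pr probability_setT. Qed.

Lemma pr0 : pr set0 = 0.
Proof. by rewrite /pr measure0. Qed.

Lemma pr_le A B : measurable A -> measurable B -> A `<=` B -> pr A <= pr B.
Proof. by move=> mA mB AB; rewrite -lee_fin -!prE// le_measure// inE. Qed.

Lemma prU_disj A B : measurable A -> measurable B -> A `&` B = set0 ->
  pr (A `|` B) = pr A + pr B.
Proof.
move=> mA mB AB; apply: EFin_inj; rewrite EFinD -!prE//; last exact: measurableU.
by rewrite measureU.
Qed.

Lemma prC A : measurable A -> pr (~` A) = 1 - pr A.
Proof.
move=> mA; rewrite -prT -(setUv A) prU_disj ?setICr//; last exact: measurableC.
by rewrite addrAC subrr add0r.
Qed.

Lemma prU_le A B : measurable A -> measurable B -> pr (A `|` B) <= pr A + pr B.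
Proof.
move=> mA mB; rewrite -lee_fin EFinD -!prE//; last exact: measurableU.
by rewrite measureU2.
Qed.

Lemma prDI A B : measurable A -> measurable B ->
  pr A = pr (A `\` B) + pr (A `&` B).
Proof.
move=> mA mB; rewrite -prU_disj ?setDUK//; first by rewrite setUC setUIDK.
- exact: measurableD.
- exact: measurableI.
- by rewrite setDE -setIA (setIC (~` B)) -setIA setICr !setI0.
Qed.

Lemma pr_bigsum_le n (F : nat -> set Omega) : (forall i, measurable (F i)) ->
  pr (\big[setU/set0]_(i < n) F i) <= \sum_(i < n) pr (F i).
Proof.
move=> mF; elim: n => [|n IH]; first by rewrite !big_ord0 pr0.
rewrite !big_ord_recr/=; apply: le_trans (prU_le _ _) _ => //.
  exact: bigsetU_measurable.
by rewrite lerD2r.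
Qed.

Lemma pr_bigcup_le (F : nat -> set Omega) (c : R) :
  (forall i, measurable (F i)) -> (forall n, \sum_(i < n) pr (F i) <= c) ->
  pr (\bigcup_i F i) <= c.
Proof.
move=> mF Fc; have mU : measurable (\bigcup_i F i) by exact: bigcup_measurable.
rewrite -lee_fin -prE//.
apply: le_trans (measure_sigma_subadditive _ mF mU (@subset_refl _ _)) _.
apply: lime_le; first exact: is_cvg_nneseries.
apply: nearW => n; rewrite big_mkord.
rewrite (eq_bigr (fun i : 'I_n => (pr (F i))%:E)); last by move=> i _; rewrite -prE.
by rewrite sumEFin lee_fin; exact: Fc.
Qed.

Lemma pr_bigcap_cvg (F : nat -> set Omega) :
  (forall i, measurable (F i)) -> nonincreasing_seq F ->
  (pr (F n) @[n --> \oo] --> pr (\bigcap_i F i)).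
Proof.
move=> mF dF; have mI : measurable (\bigcap_i F i) by exact: bigcapT_measurable.
apply: fine_cvg; rewrite -prE//; apply: nonincreasing_cvg_mu => //.
exact: le_lt_trans (probability_le1 P (mF 0%N)) (ltry _).
Qed.

Lemma pr_bigcup_cvg (F : nat -> set Omega) :
  (forall i, measurable (F i)) -> nondecreasing_seq F ->
  (pr (F n) @[n --> \oo] --> pr (\bigcup_i F i)).
Proof.
move=> mF dF; have mU : measurable (\bigcup_i F i) by exact: bigcup_measurable.
apply: fine_cvg; rewrite -prE//; exact: nondecreasing_cvg_mu.
Qed.

Definition Ex Y : R := fine (\int[P]_w (Y w)%:E)%E.

(** Bounded measurable functions form an algebra on which [Ex] is a genuine real-valued linear
    functional. Second moments of Gaussian variables, which are unbounded, are handled with the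
    extended integral instead. *)
Definition bmf Y := measurable_fun setT Y /\ exists M : R, forall w, `|Y w| <= M.

Lemma bmf_integrable Y : bmf Y -> P.-integrable setT (EFin \o Y).
Proof.
move=> [mY [M YM]]; apply: measurable_bounded_integrable => //.
  exact: le_lt_trans (probability_le1 P measurableT) (ltry _).
exists M; split; first exact: num_real.
by move=> x Mx y _; exact: le_trans (YM y) (ltW Mx).
Qed.

Lemma ExE Y : bmf Y -> (\int[P]_w (Y w)%:E)%E = (Ex Y)%:E.
Proof.
move=> bY; rewrite /Ex fineK//; apply: integrable_fin_num => //.
exact: bmf_integrable.
Qed.

Lemma expectation_Ex Y : bmf Y -> expectation P Y = (Ex Y)%:E.
Proof. by move=> bY; rewrite unlock ExE. Qed.

Lemma bmf_cst c : bmf (fun=> c).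
Proof. by split; [exact: measurable_cst|exists `|c|]. Qed.

Lemma bmfD Y Z : bmf Y -> bmf Z -> bmf (fun w => Y w + Z w).
Proof.
move=> [mY [M YM]] [mZ [N ZN]]; split; first exact: measurable_funD.
by exists (M + N) => w; rewrite (le_trans (ler_normD _ _))// lerD.
Qed.

Lemma bmfM Y Z : bmf Y -> bmf Z -> bmf (fun w => Y w * Z w).
Proof.
move=> [mY [M YM]] [mZ [N ZN]]; split; first exact: measurable_funM.
by exists (M * N) => w; rewrite normrM ler_pM.
Qed.

Lemma bmfZ c Y : bmf Y -> bmf (fun w => c * Y w).
Proof. by move=> bY; apply: bmfM => //; exact: bmf_cst. Qed.

Lemma bmfN Y : bmf Y -> bmf (fun w => - Y w).
Proof.
by move=> /(bmfZ (-1)); under [X in bmf X -> _]eq_fun do rewrite mulN1r.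
Qed.

Lemma bmfB Y Z : bmf Y -> bmf Z -> bmf (fun w => Y w - Z w).
Proof. by move=> bY bZ; apply: bmfD => //; exact: bmfN. Qed.

Lemma bmf_sum (I : Type) (s : seq I) (F : I -> Omega -> R) :
  (forall i, bmf (F i)) -> bmf (fun w => \sum_(i <- s) F i w).
Proof.
move=> bF; elim: s => [|i s IH].
  by under eq_fun do rewrite big_nil; exact: bmf_cst.
by under eq_fun do rewrite big_cons; exact: bmfD.
Qed.

Lemma bmf_norm Y : bmf Y -> bmf (fun w => `|Y w|).
Proof.
move=> [mY [M YM]]; split; first exact: measurableT_comp.
by exists M => w; rewrite normr_id.
Qed.

Lemma bmf_comp (g : R -> R) Y : measurable_fun setT g -> measurable_fun setT Y ->
  (exists M : R, forall x, `|g x| <= M) -> bmf (fun w => g (Y w)).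
Proof.
by move=> mg mY [M gM]; split; [exact: measurableT_comp|exists M].
Qed.

Lemma bmf_indic A : measurable A -> bmf (\1_A).
Proof.
move=> mA; split; first exact: measurable_indic.
by exists 1 => w; rewrite indicE; case: (_ \in _); rewrite /= ?normr1// normr0.
Qed.

Lemma Ex_indic A : measurable A -> Ex (\1_A) = pr A.
Proof. by move=> mA; rewrite /Ex integral_indic// setIT. Qed.

Lemma Ex_cst c : Ex (fun=> c) = c.
Proof. by rewrite /Ex integral_cst//= probability_setT mule1. Qed.

Lemma ExD Y Z : bmf Y -> bmf Z -> Ex (fun w => Y w + Z w) = Ex Y + Ex Z.
Proof.
move=> bY bZ; rewrite /Ex; under eq_integral do rewrite EFinD.
by rewrite integralD//=; try exact: bmf_integrable; rewrite !ExE.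
Qed.

Lemma ExZ c Y : bmf Y -> Ex (fun w => c * Y w) = c * Ex Y.
Proof.
move=> bY; rewrite /Ex; under eq_integral do rewrite EFinM.
by rewrite integralZl//=; try exact: bmf_integrable; rewrite !ExE.
Qed.

Lemma ExN Y : bmf Y -> Ex (fun w => - Y w) = - Ex Y.
Proof.
by move=> bY; under [in LHS]eq_fun do rewrite -mulN1r; rewrite ExZ// mulN1r.
Qed.

Lemma ExB Y Z : bmf Y -> bmf Z -> Ex (fun w => Y w - Z w) = Ex Y - Ex Z.
Proof. by move=> bY bZ; rewrite ExD ?ExN//; exact: bmfN. Qed.

Lemma Ex_sum (I : Type) (s : seq I) (F : I -> Omega -> R) :
  (forall i, bmf (F i)) -> Ex (fun w => \sum_(i <- s) F i w) = \sum_(i <- s) Ex (F i).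
Proof.
move=> bF; elim: s => [|i s IH].
  by under [in LHS]eq_fun do rewrite big_nil; rewrite big_nil Ex_cst.
under [in LHS]eq_fun do rewrite big_cons; rewrite ExD ?IH ?big_cons//.
exact: bmf_sum.
Qed.

Lemma Ex_ge0 Y : (forall w, 0 <= Y w) -> 0 <= Ex Y.
Proof. by move=> Y0; rewrite /Ex fine_ge0// integral_ge0// => w _; rewrite lee_fin. Qed.

Lemma Ex_le Y Z : bmf Y -> bmf Z -> (forall w, Y w <= Z w) -> Ex Y <= Ex Z.
Proof.
by move=> bY bZ YZ; rewrite -subr_ge0 -ExB// Ex_ge0// => w; rewrite subr_ge0.
Qed.

Lemma Ex_norm_le Y : bmf Y -> `|Ex Y| <= Ex (fun w => `|Y w|).
Proof.
move=> bY; rewrite ler_norml -ExN; last exact: bmf_norm.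
by rewrite !Ex_le//; try (exact: bmf_norm || exact/bmfN/bmf_norm);
  move=> w; rewrite ?ler_norm// lerNl -normrN ler_norm.
Qed.

Lemma Ex_bound Y (M : R) : measurable_fun setT Y -> (forall w, `|Y w| <= M) -> `|Ex Y| <= M.
Proof.
move=> mY YM; have bY : bmf Y by split=> //; exists M.
apply: le_trans (Ex_norm_le bY) _; rewrite -[leRHS]Ex_cst Ex_le//.
  exact: bmf_norm.
exact: bmf_cst.
Qed.

Lemma Ex_close Y Z (M e : R) B : bmf Y -> bmf Z -> measurable B ->
  (forall w, `|Y w| <= M) -> (forall w, `|Z w| <= M) ->
  (forall w, ~ B w -> `|Y w - Z w| <= e) -> 0 <= e ->
  `|Ex Y - Ex Z| <= e + 2 * M * pr B.
Proof.
move=> bY bZ mB YM ZM YZ e0; rewrite -ExB//.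
apply: le_trans (Ex_norm_le _) _; first exact: bmfB.
rewrite -(Ex_cst e) -Ex_indic// -ExZ; last exact: bmf_indic.
rewrite -ExD; [|exact: bmf_cst|exact/bmfZ/bmf_indic].
apply: Ex_le; [exact/bmf_norm/bmfB|apply: bmfD; [exact: bmf_cst|exact/bmfZ/bmf_indic]|].
move=> w; rewrite indicE; case: (boolP (w \in B)) => wB /=.
  rewrite mulr1 ler_wpDl// (le_trans (ler_normB _ _))//.
  by rewrite mulr_natl mulr2n lerD.
by rewrite mulr0 addr0 YZ// => Bw; move: wB; rewrite notin_setE.
Qed.

Lemma markov_pr Y c : bmf Y -> (forall w, 0 <= Y w) -> 0 < c ->
  c * pr [set w | c <= Y w] <= Ex Y.
Proof.
move=> bY Y0 c0; have mE : measurable [set w | c <= Y w] by case: bY => mY _; exact: measurable_ge.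
rewrite -Ex_indic// -ExZ ?Ex_le//; [exact/bmfZ/bmf_indic| |exact: bmf_indic].
move=> w; rewrite indicE; case: (boolP (w \in _)) => wB /=; rewrite ?mulr0// mulr1.
by move: wB; rewrite inE.
Qed.

Lemma Ex_bounded_cvg (Yn : nat -> Omega -> R) Y (M : R) :
  (forall n, measurable_fun setT (Yn n)) -> (forall n w, `|Yn n w| <= M) ->
  (forall w, Yn n w @[n --> \oo] --> Y w) ->
  Ex (Yn n) @[n --> \oo] --> Ex Y.
Proof.
move=> mYn YnM cY.
have mY : measurable_fun setT Y by apply: (measurable_fun_cvg mYn) => w _; exact: cY.
have YM w : `|Y w| <= M.
  have nY : `|Yn n w| @[n --> \oo] --> `|Y w| by apply: cvg_norm; exact: cY.
  rewrite -(cvg_lim _ nY)//; apply: limr_le; first by apply/cvg_ex; exists `|Y w|.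
  exact: nearW.
have bY : bmf Y by split=> //; exists M.
have bYn n : bmf (Yn n) by split=> //; exists M.
have [] := @dominated_convergence _ _ _ P setT measurableT
  (fun n w => (Yn n w)%:E) (fun w => (Y w)%:E) (fun=> M%:E).
- by move=> n; exact/measurable_EFinP.
- exact/measurable_EFinP.
- by apply: aeW => w _; apply/cvg_EFin; [exact: nearW|exact: cY].
- by apply: bmf_integrable; exact: bmf_cst.
- by apply: aeW => w n _; rewrite lee_fin.
by move=> _ _; rewrite ExE// => /fine_cvgP[].
Qed.

End prob_basics.

(* Global names, for use where [pr] and [Ex] abbreviate a fixed probability. *)
Notation prob_of := pr (only parsing).
Notation mean_of := Ex (only parsing).

(** * Independence: from pi-systems to sigma-algebras and expectations *)

Section independence.
Context {R : realType} {d : measure_display} {Omega : measurableType d}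
  (P : probability Omega R).
Local Notation pr := (pr P).
Local Notation Ex := (Ex P).

(** Dynkin's argument: the measurable events A that obey the product rule with a fixed D form a
    lambda-system, so they contain the sigma-algebra of every pi-system that they contain. *)
Lemma indep_sigma (C : set (set Omega)) (D : set Omega) :
  setI_closed C -> C `<=` measurable -> measurable D ->
  (forall A, C A -> pr (A `&` D) = pr A * pr D) ->
  forall A, <<s C >> A -> measurable A /\ pr (A `&` D) = pr A * pr D.
Proof.
move=> CI Cm mD CD A; rewrite -setI_closed_g_dynkin_g_sigma_algebra//.
move=> /(_ [set A | measurable A /\ pr (A `&` D) = pr A * pr D]); apply.
split; last by move=> B CB; split; [exact: Cm|exact: CD].
split.
- by split=> //; rewrite setTI prT mul1r.
- move=> B [mB BD]; split; first exact: measurableC.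
  rewrite prC// mulrBl mul1r -BD (prDI P mD mB) setDE (setIC D B) addrK.
  by rewrite setIC.
- move=> F tF HF; have mF n : measurable (F n) by case: (HF n).
  split; first exact: bigcup_measurable.
  have mU : measurable (\bigcup_k F k) by exact: bigcup_measurable.
  apply: EFin_inj; rewrite EFinM -!prE//; last exact: measurableI.
  rewrite setI_bigcupl measure_bigcup//; last 2 first.
  - by move=> n _; exact: measurableI.
  - exact: trivIset_setIr.
  rewrite measure_bigcup//= muleC (prE P mD) -nneseriesZl//; last first.
  apply: eq_eseriesr => n _; have [_ FD] := HF n.
  by rewrite !prE//; [rewrite -EFinM FD mulrC|exact: measurableI].
Qed.

Lemma indep_sigma2 (C D : set (set Omega)) :
  setI_closed C -> C `<=` measurable -> setI_closed D -> D `<=` measurable ->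
  (forall A B, C A -> D B -> pr (A `&` B) = pr A * pr B) ->
  forall A B, <<s C >> A -> <<s D >> B -> pr (A `&` B) = pr A * pr B.
Proof.
move=> CI Cm DI Dm CD A B sA sB.
have Dsm : <<s D >> `<=` measurable.
  by apply: smallest_sub => //; exact: sigma_algebra_measurable.
have Csm : <<s C >> `<=` measurable.
  by apply: smallest_sub => //; exact: sigma_algebra_measurable.
suff H B' : D B' -> pr (A `&` B') = pr A * pr B'.
  rewrite setIC mulrC; have [] := @indep_sigma D A DI Dm (Csm _ sA) _ _ sB => //.
  by move=> B' DB'; rewrite setIC mulrC H.
move=> DB'; have [] := @indep_sigma C B' CI Cm (Dm _ DB') _ _ sA => //.
by move=> A' CA'; exact: CD.
Qed.

(* A pi-system generating the sigma-algebra of a block of a family. *)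
Definition block_rect (G : nat -> set (set Omega)) (lo hi : nat) : set (set Omega) :=
  [set E | exists2 A : nat -> set Omega, (forall i, G i (A i)) &
     E = \bigcap_(i in [set i | (lo <= i < hi)%N]) A i].

Lemma block_rect_setI G lo hi : (forall i, setI_closed (G i)) ->
  setI_closed (block_rect G lo hi).
Proof.
move=> GI _ _ [A GA ->] [B GB ->]; exists (fun i => A i `&` B i).
  by move=> i; exact: GI.
by rewrite bigcapI.
Qed.

Lemma bigcap_range_ord (A : nat -> set Omega) lo n :
  \bigcap_(i in [set i | (lo <= i < n)%N]) A i =
  \big[setI/setT]_(i < n) (if (lo <= i)%N then A i else setT).
Proof.
elim: n => [|n IH].
  by rewrite big_ord0 -subTset => w _ i/=; rewrite ltn0 andbF.
rewrite big_ord_recr/= -IH; apply/seteqP; split => [w H|w [H1 H2] i /= ].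
  split; first by move=> i /= /andP[li iN]; apply: H; rewrite /= li ltnW.
  by case: ifP => // ln; apply: H; rewrite /= ln leqnn.
move=> /andP[li]; rewrite ltnS leq_eqVlt => /predU1P[iN|iN].
  by move: H2; rewrite -iN li.
by apply: H1; rewrite /= li.
Qed.

Lemma block_rect_measurable G lo hi : (forall i, G i `<=` measurable) ->
  block_rect G lo hi `<=` measurable.
Proof.
move=> Gm _ [A GA ->]; rewrite bigcap_range_ord; apply: bigsetI_measurable => i _.
by case: ifP => // _; exact: Gm.
Qed.

(** Rectangles over the two blocks become rectangles over all indices below n once padded with
    [setT]; the product rule applies to both and to their intersection, and the padded factors
    contribute 1. *)
Lemma blocks_indep (G : nat -> set (set Omega)) (m n : nat) : (m <= n)%N ->
  (forall i, setI_closed (G i)) -> (forall i, G i setT) ->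
  (forall i, G i `<=` measurable) ->
  (forall A : nat -> set Omega, (forall i, G i (A i)) ->
    pr (\bigcap_(i in [set i | (i < n)%N]) A i) = \prod_(i < n) pr (A i)) ->
  forall A B, <<s block_rect G 0 m >> A -> <<s block_rect G m n >> B ->
  pr (A `&` B) = pr A * pr B.
Proof.
move=> mn GI GT Gm GP; apply: indep_sigma2.
- exact: block_rect_setI.
- exact: block_rect_measurable.
- exact: block_rect_setI.
- exact: block_rect_measurable.
move=> _ _ [A GA ->] [B GB ->].
pose A' i := if (i < m)%N then A i else setT.
pose B' i := if (m <= i)%N then B i else setT.
have GA' i : G i (A' i) by rewrite /A'; case: ifP.
have GB' i : G i (B' i) by rewrite /B'; case: ifP.
have EA : \bigcap_(i in [set i | (0 <= i < m)%N]) A i =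
          \bigcap_(i in [set i | (i < n)%N]) A' i.
  apply/seteqP; split=> [w H i /= iN|w H i /= im].
    by rewrite /A'; case: ifP => // im; exact: H.
  by have := H i; rewrite /A' im; apply; rewrite /= (leq_trans im).
have EB : \bigcap_(i in [set i | (m <= i < n)%N]) B i =
          \bigcap_(i in [set i | (i < n)%N]) B' i.
  apply/seteqP; split=> [w H i /= iN|w H i /= /andP[im iN]].
    by rewrite /B'; case: ifP => // im; apply: H; rewrite /= im.
  by have := H i; rewrite /B' im; apply.
rewrite EA EB -bigcapI !GP//; last by move=> i; exact: GI.
rewrite -big_split/=; apply: eq_bigr => i _.
by rewrite /A' /B'; case: ltnP => im; rewrite ?setIT ?setTI prT ?mulr1 ?mul1r.
Qed.

(** The joint law of (Y, Z) agrees with the product of the marginal laws on rectangles, hence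
    everywhere. Absolute values make the integrand nonnegative, as Tonelli's theorem asks. *)
Let Ex_indep_norm (Y Z : Omega -> R) : bmf Y -> bmf Z ->
  (forall A B, measurable A -> measurable B ->
    pr ((Y @^-1` A) `&` (Z @^-1` B)) = pr (Y @^-1` A) * pr (Z @^-1` B)) ->
  Ex (fun w => `|Y w| * `|Z w|) = Ex (fun w => `|Y w|) * Ex (fun w => `|Z w|).
Proof.
move=> bY bZ YZ; have [mY _] := bY; have [mZ _] := bZ.
have mYA A : measurable A -> measurable (Y @^-1` A).
  by move=> mA; rewrite -[X in measurable X]setTI; exact: mY.
have mZB A : measurable A -> measurable (Z @^-1` A).
  by move=> mA; rewrite -[X in measurable X]setTI; exact: mZ.
pose Yf : {mfun Omega >-> R} := mfun_Sub (mem_set mY).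
pose Zf : {mfun Omega >-> R} := mfun_Sub (mem_set mZ).
have mYZ : measurable_fun setT (fun w => (Y w, Z w)) by exact: measurable_fun_pair.
pose YZf : {mfun Omega >-> (R * R)%type} := mfun_Sub (mem_set mYZ).
have muE : forall X : set (R * R), measurable X ->
    (distribution P Yf \x distribution P Zf)%E X = distribution P YZf X.
  apply: product_measure_unique => A B mA mB.
  change (P ((Y @^-1` A) `&` (Z @^-1` B)) = (P (Y @^-1` A) * P (Z @^-1` B))%E).
  rewrite !prE//; [|exact: mZB|exact: mYA|by apply: measurableI; [exact: mYA|exact: mZB]].
  by rewrite -EFinM -YZ.
pose f (x : R * R) : \bar R := (`|x.1| * `|x.2|)%:E.
have mn : measurable_fun setT (fun x : R => (`|x|)%:E).
  by apply/measurable_EFinP; exact: normr_measurable.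
have mf : measurable_fun setT f.
  apply/measurable_EFinP; apply: measurable_funM.
  - by apply: measurableT_comp => //; exact: measurable_fst.
  - by apply: measurableT_comp => //; exact: measurable_snd.
have f0 x : (0 <= f x)%E by rewrite lee_fin mulr_ge0.
have H : (\int[P]_w (`|Y w| * `|Z w|)%:E =
  (\int[P]_w (`|Y w|)%:E) * (\int[P]_w (`|Z w|)%:E))%E.
  transitivity (\int[distribution P YZf]_x f x)%E.
    by rewrite ge0_integral_distribution.
  transitivity (\int[distribution P Yf \x distribution P Zf]_x f x)%E.
    by apply: eq_measure_integral => A mA _; exact/esym/muE.
  rewrite fubini_tonelli1//.
  transitivity (\int[distribution P Yf]_y ((`|y|)%:E * \int[P]_w (`|Z w|)%:E))%E.
    apply: eq_integral => y _; rewrite /fubini_F /f/=.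
    under eq_integral do rewrite EFinM.
    rewrite ge0_integralZl//; congr (_ * _)%E.
    by rewrite (ge0_integral_distribution Zf (f := fun z => (`|z|)%:E)).
  rewrite ge0_integralZr//; last first.
    by apply: integral_ge0 => w _; rewrite lee_fin.
  by congr (_ * _)%E; rewrite (ge0_integral_distribution Yf (f := fun z => (`|z|)%:E)).
apply: EFin_inj; rewrite EFinM -!ExE//; try exact: bmf_norm.
by apply: bmfM; exact: bmf_norm.
Qed.

(** Adding the bounds M and N makes both variables equal to their absolute values; the formula for
    the shifted variables expands by bilinearity to the one for Y and Z. *)
Lemma Ex_indep (Y Z : Omega -> R) : bmf Y -> bmf Z ->
  (forall A B, measurable A -> measurable B ->
    pr ((Y @^-1` A) `&` (Z @^-1` B)) = pr (Y @^-1` A) * pr (Z @^-1` B)) ->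
  Ex (fun w => Y w * Z w) = Ex Y * Ex Z.
Proof.
move=> bY bZ YZ; have [mY [M YM]] := bY; have [mZ [N ZN]] := bZ.
pose Y' w := Y w + M; pose Z' w := Z w + N.
have bY' : bmf Y' by apply: bmfD => //; exact: bmf_cst.
have bZ' : bmf Z' by apply: bmfD => //; exact: bmf_cst.
have aY w : `|Y' w| = Y' w.
  by rewrite ger0_norm// /Y' -lerBlDr sub0r; have := YM w; rewrite ler_norml => /andP[].
have aZ w : `|Z' w| = Z' w.
  by rewrite ger0_norm// /Z' -lerBlDr sub0r; have := ZN w; rewrite ler_norml => /andP[].
have sh (m : R) : measurable_fun setT (fun x : R => x + m) by exact: measurable_funD.
have msh (m : R) A : measurable A -> measurable [set x : R | A (x + m)].
  by move=> mA; rewrite -[X in measurable X]setTI; exact: sh.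
have {}H : forall A B, measurable A -> measurable B ->
    pr ((Y' @^-1` A) `&` (Z' @^-1` B)) = pr (Y' @^-1` A) * pr (Z' @^-1` B).
  by move=> A B mA mB; apply: (YZ _ _ (msh M _ mA) (msh N _ mB)).
have := Ex_indep_norm bY' bZ' H.
rewrite (_ : (fun w => `|Y' w| * `|Z' w|) = (fun w => Y' w * Z' w)); last first.
  by apply/funext => w; rewrite aY aZ.
rewrite (funext aY) (funext aZ) /Y' /Z'.
rewrite !ExD//; try exact: bmf_cst.
rewrite !Ex_cst => E.
have : Ex (fun w => (Y w + M) * (Z w + N)) =
   Ex (fun w => Y w * Z w) + (N * Ex Y + M * Ex Z + M * N).
  have b1 := bmfZ N bY; have b2 := bmfZ M bZ; have b3 := bmfD b1 b2.
  have b4 : bmf (fun _ : Omega => M * N) by exact: bmf_cst.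
  have b5 := bmfD b3 b4; have b6 := bmfM bY bZ.
  rewrite -(Ex_cst P (M * N)) -!ExZ// -(ExD _ b1 b2) -(ExD _ b3 b4) -(ExD _ b6 b5).
  by congr Ex; apply/funext => w; ring.
rewrite E => E2; lra.
Qed.

End independence.

(** * Laws that agree on a generating pi-system *)

Section equality_in_law.
Context {R : realType} {d1 d2 d' : measure_display} {Om1 : measurableType d1}
  {Om2 : measurableType d2} {T : measurableType d'}
  (P1 : probability Om1 R) (P2 : probability Om2 R) (f : Om1 -> T) (g : Om2 -> T).
Hypothesis mf : measurable_fun setT f.
Hypothesis mg : measurable_fun setT g.

Let mF C : measurable C -> measurable (f @^-1` C).
Proof. by move=> mC; rewrite -[X in measurable X]setTI; exact: mf. Qed.

Let mG C : measurable C -> measurable (g @^-1` C).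
Proof. by move=> mC; rewrite -[X in measurable X]setTI; exact: mg. Qed.

Lemma law_ext (G : set (set T)) : @measurable _ T = <<s G >> -> setI_closed G ->
  (forall C, G C -> pr P1 (f @^-1` C) = pr P2 (g @^-1` C)) ->
  forall C, measurable C -> pr P1 (f @^-1` C) = pr P2 (g @^-1` C).
Proof.
move=> GE GI H.
have D := @dynkin_induction _ T G [set C | pr P1 (f @^-1` C) = pr P2 (g @^-1` C)] GE GI.
rewrite GE; apply: D => //.
- by rewrite /= !preimage_setT !prT.
- move=> S mS /= E; rewrite -!preimage_setC (prC P1 (mF mS)) (prC P2 (mG mS)).
  by rewrite E.
- move=> F mFn tF E /=; rewrite !preimage_bigcup.
  have tr (Om : Type) (k : Om -> T) : trivIset setT (fun n => k @^-1` F n).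
    apply/trivIsetP => i j _ _ ij; rewrite -preimage_setI.
    by move/trivIsetP : tF => /(_ i j I I ij) ->; rewrite preimage_set0.
  have m1 : measurable (\bigcup_k f @^-1` F k).
    by apply: bigcup_measurable => n _; exact: mF.
  have m0 : measurable (\bigcup_k g @^-1` F k).
    by apply: bigcup_measurable => n _; exact: mG.
  apply: EFin_inj; rewrite -(prE P1 m1) -(prE P2 m0).
  rewrite (measure_bigcup P1); [|by move=> n _; exact: mF|exact: tr].
  rewrite (measure_bigcup P2); [|by move=> n _; exact: mG|exact: tr].
  apply: eq_eseriesr => n _.
  exact: (etrans (prE P1 (mF (mFn n))) (etrans (congr1 EFin (E n)) (esym (prE P2 (mG (mFn n)))))).
Qed.

Lemma integral_law (h : T -> \bar R) : measurable_fun setT h -> (forall x, 0 <= h x)%E ->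
  (forall C, measurable C -> pr P1 (f @^-1` C) = pr P2 (g @^-1` C)) ->
  (\int[P1]_w h (f w) = \int[P2]_w h (g w))%E.
Proof.
move=> mh h0 H.
pose f' : {mfun Om1 >-> T} := mfun_Sub (mem_set mf).
pose g' : {mfun Om2 >-> T} := mfun_Sub (mem_set mg).
transitivity (\int[distribution P1 f']_x h x)%E.
  by rewrite ge0_integral_distribution.
transitivity (\int[distribution P2 g']_x h x)%E; last first.
  by rewrite ge0_integral_distribution.
apply: eq_measure_integral => A mA _; rewrite /distribution /pushforward/=.
exact: (etrans (prE P1 (mF mA)) (etrans (congr1 EFin (H _ mA)) (esym (prE P2 (mG mA))))).
Qed.

(** The change of variables is for nonnegative integrands, so the bounded h is shifted by its bound
    M. *)
Lemma Ex_law (h : T -> R) : bmf h ->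
  (forall C, measurable C -> pr P1 (f @^-1` C) = pr P2 (g @^-1` C)) ->
  Ex P1 (fun w => h (f w)) = Ex P2 (fun w => h (g w)).
Proof.
move=> bh H; have [mh [M hM]] := bh.
have bf : bmf (fun w => h (f w)) by split; [exact: measurableT_comp|exists M].
have bg : bmf (fun w => h (g w)) by split; [exact: measurableT_comp|exists M].
have E : Ex P1 (fun w => h (f w) + M) = Ex P2 (fun w => h (g w) + M).
  congr fine; apply: (@integral_law (fun x => (h x + M)%:E)) => //.
    by apply/measurable_EFinP; exact: measurable_funD.
  by move=> x; have := hM x; rewrite lee_fin ler_norml => /andP[? _]; lra.
by move: E; rewrite !ExD ?Ex_cst//; try exact: bmf_cst; move/addIr.
Qed.

End equality_in_law.

(** * The Levy continuity theorem *)

Section trig_bounds.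
Context {R : realType}.
Implicit Types x y : R.

(** The mean value theorem without an order between x and y. The intermediate point is located
    twice: by its distance to x, for Taylor bounds, and between minimum and maximum, to stay in an
    interval where the derivative is controlled. *)
Lemma mvt_abs (f df : R -> R) : (forall x, is_derive x 1 f (df x)) ->
  forall x y, exists c, [/\ `|c - x| <= `|y - x|, Num.min x y <= c <= Num.max x y
    & f y - f x = df c * (y - x)].
Proof.
move=> fdf.
have cf : continuous f.
  by move=> x; apply: differentiable_continuous; apply/derivable1_diffP; case: (fdf x).
have H x y : x < y -> exists2 c, c \in `]x, y[%R & f y - f x = df c * (y - x).
  by move=> xy; apply: MVT => //; exact: continuous_subspaceT.
move=> x y; have [xy|yx|->] := ltgtP x y.
- have [c] := H _ _ xy; rewrite in_itv/= => /andP[xc cy] E; exists c; split=> //.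
    by rewrite !ger0_norm ?subr_ge0 ?(ltW xc) ?(ltW xy)// lerD2r ltW.
  by rewrite (ltW xc) (ltW cy).
- have [c] := H _ _ yx; rewrite in_itv/= => /andP[xc cy] E; exists c; split=> //.
    rewrite !ler0_norm ?subr_le0 ?(ltW cy) ?(ltW yx)// lerN2 lerD2r.
    exact: ltW.
    by rewrite (ltW xc) (ltW cy).
  by rewrite -opprB E; ring.
- by exists y; split; rewrite ?subrr ?normr0 ?mulr0// lexx.
Qed.

Lemma sin_le_norm x : `|sin x| <= `|x|.
Proof.
have [c [_ _]] := mvt_abs (@is_derive_sin R) 0 x.
rewrite sin0 !subr0 => ->; rewrite normrM ler_piMl//; exact: cos_max.
Qed.

Lemma onem_cos_le x : 0 <= 1 - cos x <= x ^+ 2 / 2.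
Proof.
rewrite subr_ge0 cos_le1/=.
have Ex : x = (x / 2) *+ 2 by rewrite mulr2n; lra.
have -> : cos x = 1 - 2 * sin (x / 2) ^+ 2.
  by rewrite {1}Ex cos_mulr2n cos2sin2 mulr2n; ring.
have H : sin (x / 2) ^+ 2 <= (x / 2) ^+ 2.
  rewrite -(real_normK (num_real (sin _))) -(real_normK (num_real (x / 2))).
  by rewrite ler_pXn2r// ?nnegrE// sin_le_norm.
have -> : x ^+ 2 / 2 = 2 * (x / 2) ^+ 2 by field.
lra.
Qed.

(** The derivative of sin y - y is cos y - 1, already bounded by y^2 / 2; one more mean value step
    gives order 3, with a constant that is not sharp. *)
Lemma sin_taylor x : `|sin x - x| <= `|x| ^+ 3 / 2.
Proof.
have D (z : R) : is_derive z 1 (fun y : R => sin y - y) (cos z - 1).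
  by apply: is_deriveB.
have [c [cx _]] := mvt_abs D 0 x; rewrite sin0 !subr0 => ->.
rewrite normrM -normrN opprB.
have /andP[c0 c1] := onem_cos_le c.
rewrite (ger0_norm c0) (_ : `|x| ^+ 3 / 2 = (`|x| ^+ 2 / 2) * `|x|); last by field.
rewrite ler_wpM2r// (le_trans c1)// ler_pM2r// ?invr_gt0// -real_normK ?num_real//.
by rewrite ler_pXn2r// ?nnegrE//; move: cx; rewrite !subr0.
Qed.

Lemma cos_taylor x : `|cos x - (1 - x ^+ 2 / 2)| <= x ^+ 4 / 2.
Proof.
have D (z : R) : is_derive z 1 (fun y : R => cos y - (1 - y ^+ 2 / 2)) (z - sin z).
  apply: is_derive_eq.
  by rewrite !scaler0 add0r add0r mul1r opprK /GRing.scale/=; field.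
have [c [cx _]] := mvt_abs D 0 x.
rewrite cos0 expr0n/= mul0r !subr0 subrr subr0 => ->.
rewrite normrM -normrN opprB.
move: cx; rewrite !subr0 => cx.
rewrite (_ : x ^+ 4 = `|x| ^+ 3 * `|x|); last first.
  by rewrite -exprSr -[RHS]/(`|x| ^+ (2 * 2)) exprM real_normK ?num_real// -exprM.
rewrite mulrAC ler_wpM2r// (le_trans (sin_taylor c))// ler_pM2r ?invr_gt0//.
by rewrite ler_pXn2r// ?nnegrE.
Qed.

Lemma sin_expand (x y : R) : -1 <= x <= 1 -> -1 <= y <= 1 -> x <= y ->
  cos 1 * (y - x) <= sin y - sin x.
Proof.
move=> /andP[x1 x2] /andP[y1 y2] xy.
have [c [_ + ->]] := mvt_abs (@is_derive_sin R) x y.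
rewrite (min_idPl xy) (max_idPr xy) => /andP[xc cy].
rewrite ler_wpM2r ?subr_ge0// -(cos_norm c).
have c1 : `|c| <= 1 by rewrite ler_norml (le_trans x1 xc) (le_trans cy y2).
have p1 := pihalf_ge1 R; have p2 := pi_ge2 R.
move: c1; rewrite le_eqVlt => /predU1P[->//|c1]; apply/ltW.
by rewrite ltr_cos// in_itv/= ?ler01 ?normr_ge0/=; lra.
Qed.

(** The coordinate (1 + sin (x / L)) / 2 lies in [0, 1], is trigonometric in x, and is increasing on
    [-L, L] with a Lipschitz inverse. Values s outside its range there go to the nearest endpoint,
    so the inverse is defined for every s. *)
Lemma sin_coord_inverse (L : R) : 0 < L -> exists2 K : R, 0 < K &
  forall s : R, exists2 z, `|z| <= L & forall x, `|x| <= L ->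
    `|z - x| <= K * `|s - (1 + sin (x / L)) / 2|.
Proof.
move=> L0; have c1 := @cos1_gt0 R.
pose y x := (1 + sin (x / L)) / 2.
have yE u v : `|u| <= L -> `|v| <= L -> u <= v ->
    v - u <= (2 * L / cos 1) * (y v - y u).
  rewrite !ler_norml => /andP[u1 u2] /andP[v1 v2] uv.
  have uv' : u / L <= v / L by rewrite ler_pM2r ?invr_gt0.
  have H : cos 1 * (v / L - u / L) <= sin (v / L) - sin (u / L).
    apply: sin_expand => //.
      by rewrite ler_pdivlMr// ler_pdivrMr// mulN1r mul1r u1 u2.
    by rewrite ler_pdivlMr// ler_pdivrMr// mulN1r mul1r v1 v2.
  rewrite -mulrAC ler_pdivlMr//.
  have -> : 2 * L * (y v - y u) = (sin (v / L) - sin (u / L)) * L by rewrite /y; field.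
  rewrite -ler_pdivrMr// (le_trans _ H)// le_eqVlt; apply/orP; left; apply/eqP; field.
  by rewrite gt_eqF.
have yL u v : `|u| <= L -> `|v| <= L -> `|v - u| <= (2 * L / cos 1) * `|y v - y u|.
  move=> uL vL; have [uv|vu] := leP u v.
    have := yE _ _ uL vL uv; rewrite (ger0_norm (x := v - u)) ?subr_ge0// => H.
    by rewrite (le_trans H)// ler_wpM2l ?ler_norm// divr_ge0// ltW// mulr_gt0.
  have := yE _ _ vL uL (ltW vu); rewrite distrC (ger0_norm (x := u - v)) ?subr_ge0 ?(ltW vu)// => H.
  by rewrite (le_trans H)// (distrC (y v)) ler_wpM2l ?ler_norm// divr_ge0// ltW// mulr_gt0.
have ymon u v : `|u| <= L -> `|v| <= L -> u <= v -> y u <= y v.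
  move=> uL vL uv; have := yE _ _ uL vL uv; rewrite leNgt => /negP H.
  rewrite leNgt; apply/negP => yvu; apply: H.
  rewrite (@lt_le_trans _ _ 0)// ?subr_ge0// pmulr_rlt0 ?subr_lt0//.
  by rewrite divr_gt0// mulr_gt0.
have nL : `|L| <= L by rewrite ger0_norm// ltW.
have nNL : `|- L| <= L by rewrite normrN.
exists (2 * L / cos 1); first by rewrite divr_gt0// mulr_gt0.
move=> s; have [sy|sy] := leP s (y (- L)).
  exists (- L) => // x xL; rewrite (le_trans (yL _ _ xL nNL))//.
  rewrite ler_wpM2l//; first by rewrite divr_ge0// ltW// mulr_gt0.
  have xL' : - L <= x by move: xL; rewrite ler_norml => /andP[].
  have H := ymon _ _ nNL xL xL'.
  by rewrite !ler0_norm ?subr_le0// ?(le_trans sy)// lerN2 lerD2r.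
have [sy2|sy2] := leP (y L) s.
  exists L => // x xL; rewrite (le_trans (yL _ _ xL nL))//.
  rewrite ler_wpM2l//; first by rewrite divr_ge0// ltW// mulr_gt0.
  have xL' : x <= L by move: xL; rewrite ler_norml => /andP[].
  have H := ymon _ _ xL nL xL'.
  by rewrite !ger0_norm ?subr_ge0// ?(le_trans _ sy2)// lerD2r.
have cy : continuous y.
  move=> x; apply: cvgMl; apply: cvgD; first exact: cvg_cst.
  apply: (@continuous_comp _ _ _ (fun x => x / L) (@sin R)); last exact: continuous_sin.
  by apply: cvgMl; exact: cvg_id.
have [] := @IVT R y (- L) L s.
- by rewrite ge0_cp// ltW.
- exact: continuous_subspaceT.
- by rewrite ge_min le_max (ltW sy) (ltW sy2) orbT.
move=> z; rewrite in_itv/= => zL ys; exists z; first by rewrite ler_norml.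
by move=> x xL; rewrite -ys; apply: yL => //; rewrite ler_norml.
Qed.

End trig_bounds.

(** * Bernstein weights and their moments *)

Section bernstein.
Context {R : realType}.
Implicit Types (y c : R) (g : nat -> R).

(** The binomial probability C(N, m) y^m (1 - y)^(N - m), obtained by conditioning on the last trial
    rather than from binomial coefficients, so that sums and moments follow by induction on N. *)
Fixpoint bernstein y (N m : nat) : R :=
  match N with
  | 0 => (m == 0%N)%:R
  | N'.+1 => (1 - y) * bernstein y N' m + y * (if m is m'.+1 then bernstein y N' m' else 0)
  end.

Lemma bernstein_gt y N m : (N < m)%N -> bernstein y N m = 0.
Proof.
elim: N m => [|N IH] [|m]//= Nm.
by rewrite !IH ?mulr0 ?addr0// ltnW.
Qed.

Lemma bernstein_sum_rec y N g :
  \sum_(m < N.+2) bernstein y N.+1 m * g m =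
  (1 - y) * (\sum_(m < N.+1) bernstein y N m * g m) +
  y * (\sum_(m < N.+1) bernstein y N m * g m.+1).
Proof.
have -> : \sum_(m < N.+2) bernstein y N.+1 m * g m =
  \sum_(m < N.+2) ((1 - y) * (bernstein y N m * g m)) +
  \sum_(m < N.+2) (y * ((if val m is m'.+1 then bernstein y N m' else 0) * g m)).
  by rewrite -big_split/=; apply: eq_bigr => m _; ring.
congr (_ + _).
  by rewrite big_ord_recr/= bernstein_gt// mul0r mulr0 addr0 mulr_sumr.
by rewrite big_ord_recl/= mul0r mulr0 add0r mulr_sumr; apply: eq_bigr.
Qed.

Lemma bernstein_ge0 y N m : 0 <= y <= 1 -> 0 <= bernstein y N m.
Proof.
move=> /andP[y0 y1]; elim: N m => [|N IH] m /=; first by rewrite ler0n.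
rewrite addr_ge0// mulr_ge0// ?subr_ge0//.
by case: m.
Qed.

Lemma bernstein_sum1 y N : \sum_(m < N.+1) bernstein y N m = 1.
Proof.
elim: N => [|N IH]; first by rewrite big_ord_recr big_ord0/= add0r.
have := bernstein_sum_rec y N (fun=> 1).
have E n : \sum_(m < n.+1) bernstein y n m * 1 = \sum_(m < n.+1) bernstein y n m.
  by apply: eq_bigr => m _; rewrite mulr1.
by rewrite !E IH => ->; ring.
Qed.

(** Variance plus squared bias of a binomial variable. The centre c is arbitrary because a success
    in the last trial replaces c by c - 1 in the induction. *)
Lemma bernstein_second_moment y N c :
  \sum_(m < N.+1) bernstein y N m * (m%:R - c) ^+ 2 =
  N%:R * (y * (1 - y)) + (N%:R * y - c) ^+ 2.
Proof.
elim: N c => [|N IH] c; first by rewrite big_ord_recr big_ord0/= add0r; ring.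
rewrite (bernstein_sum_rec _ _ (fun m => (m%:R - c) ^+ 2)) IH.
rewrite (_ : \sum_(m < N.+1) bernstein y N m * (m.+1%:R - c) ^+ 2 =
  \sum_(m < N.+1) bernstein y N m * (m%:R - (c - 1)) ^+ 2); last first.
  by apply: eq_bigr => m _; rewrite -natr1; ring.
rewrite IH -[in RHS]natr1; ring.
Qed.

Lemma bernstein_first_moment y N (e : R) : 0 <= y <= 1 -> 0 < e ->
  \sum_(m < N.+2) bernstein y N.+1 m * `|m%:R / N.+1%:R - y| <= e + (e * N.+1%:R)^-1.
Proof.
move=> y01 e0; have N0 : 0 < N.+1%:R :> R by rewrite ltr0n.
have b0 m := bernstein_ge0 N.+1 m y01.
(* Every deviation u satisfies |u| <= e + u^2 / e, so the second moment suffices. *)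
apply: (@le_trans _ _ (\sum_(m < N.+2) (e * bernstein y N.+1 m +
   (e * N.+1%:R ^+ 2)^-1 * (bernstein y N.+1 m * (m%:R - N.+1%:R * y) ^+ 2)))).
  apply: ler_sum => m _.
  rewrite [leRHS](_ : _ = bernstein y N.+1 m * (e + (m%:R / N.+1%:R - y) ^+ 2 / e)).
    apply: ler_wpM2l => //; set u := _ - y; rewrite -(real_normK (num_real u)).
    have [ue|ue] := leP `|u| e; first by rewrite ler_wpDr// divr_ge0 ?sqr_ge0// ltW.
    rewrite ler_wpDl ?(ltW e0)// ler_pdivlMr// expr2 ler_wpM2l// ltW//.
  by field; rewrite !gt_eqF.
rewrite big_split/= -!mulr_sumr bernstein_sum1 bernstein_second_moment mulr1 lerD2l.
rewrite subrr expr0n addr0.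
rewrite [leLHS](_ : _ = (e * N.+1%:R)^-1 * (y * (1 - y))); last by field; rewrite !gt_eqF.
rewrite ler_piMr ?invr_ge0 ?mulr_ge0 ?(ltW e0)//.
by move: y01 => /andP[? ?]; nra.
Qed.

End bernstein.

(** * Trigonometric polynomials in several variables *)

Section trig_poly.
Context {R : realType} {k : nat}.
Implicit Types (a x : 'I_k -> R) (f g h : ('I_k -> R) -> R).

Definition dot a x : R := \sum_i a i * x i.

Inductive trigpoly : (('I_k -> R) -> R) -> Prop :=
| trigpoly_cos a : trigpoly (fun x => cos (dot a x))
| trigpoly_sin a : trigpoly (fun x => sin (dot a x))
| trigpolyD f g : trigpoly f -> trigpoly g -> trigpoly (fun x => f x + g x)
| trigpolyZ c f : trigpoly f -> trigpoly (fun x => c * f x).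

Lemma dotDl a b x : dot (fun i => a i + b i) x = dot a x + dot b x.
Proof. by rewrite /dot -big_split/=; apply: eq_bigr => i _; rewrite mulrDl. Qed.

Lemma dotBl a b x : dot (fun i => a i - b i) x = dot a x - dot b x.
Proof.
by rewrite /dot -sumrB; apply: eq_bigr => i _; rewrite mulrBl.
Qed.

Lemma trigpoly_cst c : trigpoly (fun=> c).
Proof.
have -> : (fun _ : 'I_k -> R => c) = (fun x => c * cos (dot (fun=> 0) x)).
  apply/funext => x; rewrite /dot big1 ?cos0 ?mulr1// => i _; exact: mul0r.
by apply: trigpolyZ; exact: trigpoly_cos.
Qed.

(** Product-to-sum formulas on the generators; induction on both factors extends them to sums and
    multiples. *)
Lemma trigpolyM f g : trigpoly f -> trigpoly g -> trigpoly (fun x => f x * g x).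
Proof.
have D a b u v : trigpoly (fun x => u * cos (dot (fun i => a i - b i) x) +
     v * cos (dot (fun i => a i + b i) x)).
  by apply: trigpolyD; apply: trigpolyZ; exact: trigpoly_cos.
have D' a b u v : trigpoly (fun x => u * sin (dot (fun i => a i - b i) x) +
     v * sin (dot (fun i => a i + b i) x)).
  by apply: trigpolyD; apply: trigpolyZ; exact: trigpoly_sin.
have ext f1 f2 : trigpoly f1 -> f1 =1 f2 -> trigpoly f2.
  by move=> H /funext <-.
move=> Tf Tg; elim: Tf => {f} [a|a|f1 f2 _ IH1 _ IH2|c f _ IH].
- elim: Tg => {g} [b|b|g1 g2 _ IH1 _ IH2|c g _ IH].
  + apply: (ext _ _ (D a b (1/2) (1/2))) => x.
    by rewrite (dotBl a b) (dotDl a b) cosB cosD; field.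
  + apply: (ext _ _ (D' a b (-(1/2)) (1/2))) => x.
    by rewrite (dotBl a b) (dotDl a b) sinB sinD; field.
  + by apply: (ext _ _ (trigpolyD IH1 IH2)) => x; rewrite mulrDr.
  + by apply: (ext _ _ (trigpolyZ c IH)) => x; rewrite mulrCA.
- elim: Tg => {g} [b|b|g1 g2 _ IH1 _ IH2|c g _ IH].
  + apply: (ext _ _ (D' a b (1/2) (1/2))) => x.
    by rewrite (dotBl a b) (dotDl a b) sinB sinD; field.
  + apply: (ext _ _ (D a b (1/2) (-(1/2)))) => x.
    by rewrite (dotBl a b) (dotDl a b) cosB cosD; field.
  + by apply: (ext _ _ (trigpolyD IH1 IH2)) => x; rewrite mulrDr.
  + by apply: (ext _ _ (trigpolyZ c IH)) => x; rewrite mulrCA.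
- by apply: (ext _ _ (trigpolyD IH1 IH2)) => x; rewrite mulrDl.
- by apply: (ext _ _ (trigpolyZ c IH)) => x; rewrite mulrA.
Qed.

Lemma trigpoly_sum (I : Type) (s : seq I) (F : I -> ('I_k -> R) -> R) :
  (forall i, trigpoly (F i)) -> trigpoly (fun x => \sum_(i <- s) F i x).
Proof.
move=> TF; elim: s => [|i s IH].
  by under eq_fun do rewrite big_nil; exact: trigpoly_cst.
by under eq_fun do rewrite big_cons; exact: trigpolyD.
Qed.

Lemma trigpoly_prod (I : Type) (s : seq I) (F : I -> ('I_k -> R) -> R) :
  (forall i, trigpoly (F i)) -> trigpoly (fun x => \prod_(i <- s) F i x).
Proof.
move=> TF; elim: s => [|i s IH].
  by under eq_fun do rewrite big_nil; exact: trigpoly_cst.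
by under eq_fun do rewrite big_cons; exact: trigpolyM.
Qed.

Lemma trigpoly_bernstein (y : ('I_k -> R) -> R) N m : trigpoly y ->
  trigpoly (fun x => bernstein (y x) N m).
Proof.
move=> Ty; elim: N m => [|N IH] m /=; first exact: trigpoly_cst.
apply: trigpolyD.
  apply: trigpolyM => //; apply: trigpolyD; first exact: trigpoly_cst.
  by under eq_fun do rewrite -mulN1r; exact: trigpolyZ.
apply: trigpolyM => //; case: m => [|m]; [exact: trigpoly_cst|exact: IH].
Qed.

Lemma trigpoly_coord (L : R) (i : 'I_k) :
  trigpoly (fun x => (1 + sin (x i / L)) / 2).
Proof.
under eq_fun => x do rewrite mulrC.
apply: trigpolyZ; apply: trigpolyD; first exact: trigpoly_cst.
have -> : (fun x : 'I_k -> R => sin (x i / L)) =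
   (fun x => sin (dot (fun j => if j == i then L^-1 else 0) x)).
  apply/funext => x; congr sin; rewrite /dot (bigD1 i)//= eqxx big1 ?addr0 1?mulrC//.
  by move=> j /negPf ->; rewrite mul0r.
exact: trigpoly_sin.
Qed.

(** Bernstein approximation of h in the coordinates (1 + sin (x i / L)) / 2. The approximant is a
    convex combination of values of h, so it keeps the bound M on the whole space, also outside the
    cube on which it is close to h; a tail estimate can then absorb the outside. *)
Lemma trigpoly_approx h (M K L e : R) :
  (forall x, `|h x| <= M) ->
  (forall x y, `|h x - h y| <= K * \sum_i `|x i - y i|) ->
  0 < L -> 0 < e -> exists g, [/\ trigpoly g, forall x, `|g x| <= M &
    forall x, (forall i, `|x i| <= L) -> `|g x - h x| <= e].
Proof.
move=> hM hK L0 e0.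
have [c c0 H] := sin_coord_inverse L0.
have /choice[z zP] : forall s : R, exists z, `|z| <= L /\ forall x : R, `|x| <= L ->
    `|z - x| <= c * `|s - (1 + sin (x / L)) / 2|.
  by move=> s; have [z z1 z2] := H s; exists z.
pose y (u : R) := (1 + sin (u / L)) / 2.
have y01 u : 0 <= y u <= 1.
  by have := sin_geN1 (u / L); have := sin_le1 (u / L); rewrite /y; lra.
pose K' := `|K| * c * k%:R + 1.
have K'0 : 0 < K' by rewrite ltr_wpDl// !mulr_ge0// ltW.
pose d := e / (2 * K').
have d0 : 0 < d by rewrite divr_gt0// mulr_gt0.
(* The first-moment bound d + 1 / (d (N + 1)) is then at most 2 d. *)
have [N HN] : exists N : nat, (d * N.+1%:R)^-1 <= d.
  have [N HN] := ex_natSinv_le (mulr_gt0 d0 d0); exists N.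
  by rewrite invfM mulrC -ler_pdivlMr ?invr_gt0// invrK.
pose b (u : R) (m : 'I_N.+2) := bernstein (y u) N.+1 m.
have b0 u m : 0 <= b u m by exact: bernstein_ge0.
have b1 u : \sum_m b u m = 1 by exact: bernstein_sum1.
pose Z (m : {ffun 'I_k -> 'I_N.+2}) : 'I_k -> R := fun i => z ((m i)%:R / N.+1%:R).
pose g x := \sum_(m : {ffun 'I_k -> 'I_N.+2}) h (Z m) * \prod_i b (x i) (m i).
have P0 x (m : {ffun 'I_k -> 'I_N.+2}) : 0 <= \prod_i b (x i) (m i).
  by apply: prodr_ge0.
have P1 x : \sum_(m : {ffun 'I_k -> 'I_N.+2}) \prod_i b (x i) (m i) = 1.
  rewrite -(bigA_distr_bigA (fun i m => b (x i) m)) big1// => i _; exact: b1.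
exists g; split.
- apply: trigpoly_sum => m; apply: trigpolyM; first exact: trigpoly_cst.
  by apply: trigpoly_prod => i; apply: trigpoly_bernstein; exact: trigpoly_coord.
- move=> x; rewrite (le_trans (ler_norm_sum _ _ _))//.
  have -> : M = \sum_(m : {ffun 'I_k -> 'I_N.+2}) M * \prod_i b (x i) (m i).
    by rewrite -mulr_sumr P1 mulr1.
  apply: ler_sum => m _.
  by rewrite normrM (ger0_norm (P0 _ _)) ler_wpM2r.
move=> x xL.
have -> : h x = \sum_(m : {ffun 'I_k -> 'I_N.+2}) h x * \prod_i b (x i) (m i).
  by rewrite -mulr_sumr P1 mulr1.
rewrite -sumrB.
rewrite (le_trans (ler_norm_sum _ _ _))//.
(* The deviation in coordinate j is absorbed into the j-th factor of the product. The sum over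
   multi-indices then factorizes: factor j is a first moment, every other factor sums to 1. *)
apply: (@le_trans _ _ (\sum_(m : {ffun 'I_k -> 'I_N.+2}) \sum_j
   (`|K| * c) * (\prod_i (b (x i) (m i) * (if i == j then `|(m i)%:R / N.+1%:R - y (x i)| else 1))))).
  apply: ler_sum => m _; rewrite -mulrBl normrM (ger0_norm (P0 _ _)).
  rewrite -mulr_sumr.
  under [X in _ <= _ * X]eq_bigr => j _.
    rewrite big_split/= [X in _ * X](bigD1 j)//= eqxx [X in _ * (_ * X)]big1 ?mulr1; last first.
      by move=> i /negPf ->.
    over.
  rewrite -mulr_sumr mulrCA [leLHS]mulrC ler_wpM2l//.
  rewrite (le_trans (hK _ _))// (@le_trans _ _ (`|K| * \sum_i `|Z m i - x i|))//.
    by rewrite ler_wpM2r ?ler_norm// sumr_ge0.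
  rewrite -mulrA ler_wpM2l// mulr_sumr ler_sum// => i _.
  by rewrite /Z; have [_ ->] := zP ((m i)%:R / N.+1%:R).
rewrite exchange_big/=.
apply: (@le_trans _ _ (\sum_(j < k) (`|K| * c) * (d + d))).
  apply: ler_sum => j _; rewrite -mulr_sumr ler_wpM2l//; first by rewrite mulr_ge0// ltW.
  rewrite -(bigA_distr_bigA (fun i m => b (x i) m * (if i == j then `|m%:R / N.+1%:R - y (x i)| else 1))).
  rewrite (bigD1 j)//= eqxx [X in _ * X]big1 ?mulr1; last first.
    by move=> i /negPf ->; under eq_bigr do rewrite mulr1; exact: b1.
  by rewrite (le_trans (bernstein_first_moment N (y01 (x j)) d0))// lerD2l.
rewrite sumr_const card_ord -mulr_natr.
rewrite (_ : _ * _ * _ = (`|K| * c * k%:R) * (d + d)); last by ring.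
rewrite (@le_trans _ _ (K' * (d + d)))//.
  by rewrite ler_wpM2r ?addr_ge0 ?(ltW d0)// /K' lerDl.
by rewrite /d; rewrite le_eqVlt; apply/orP; left; apply/eqP; field; rewrite gt_eqF.
Qed.

End trig_poly.

(** * Convergence of means of bounded Lipschitz functions *)

Section levy_continuity.
Context {R : realType} {d1 d2 : measure_display} {Om1 : measurableType d1}
  {Om2 : measurableType d2} (P1 : probability Om1 R) (P2 : probability Om2 R).

Lemma measurable_dot {d : measure_display} {Om : measurableType d} k (a : 'I_k -> R)
  (Z : Om -> 'I_k -> R) : (forall i, measurable_fun setT (fun w => Z w i)) ->
  measurable_fun setT (fun w => dot a (Z w)).
Proof.
move=> mZ; rewrite /dot; apply: measurable_sum => i.
by apply: measurable_funM => //; exact: measurable_cst.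
Qed.

Lemma measurable_cosT : measurable_fun setT (@cos R).
Proof. by apply: continuous_measurable_fun; exact: continuous_cos. Qed.

Lemma measurable_sinT : measurable_fun setT (@sin R).
Proof. by apply: continuous_measurable_fun; exact: continuous_sin. Qed.

Lemma bmf_cos {d : measure_display} {Om : measurableType d} (Y : Om -> R) :
  measurable_fun setT Y -> bmf (fun w => cos (Y w)).
Proof.
by move=> mY; apply: bmf_comp mY _; [exact: measurable_cosT|exists 1; exact: cos_max].
Qed.

Lemma bmf_sin {d : measure_display} {Om : measurableType d} (Y : Om -> R) :
  measurable_fun setT Y -> bmf (fun w => sin (Y w)).
Proof.
by move=> mY; apply: bmf_comp mY _; [exact: measurable_sinT|exists 1; exact: sin_max].
Qed.

Lemma trigpoly_bmf {d : measure_display} {Om : measurableType d} k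
  (Z : Om -> 'I_k -> R) (g : ('I_k -> R) -> R) :
  (forall i, measurable_fun setT (fun w => Z w i)) -> trigpoly g ->
  bmf (fun w => g (Z w)).
Proof.
move=> mZ; elim => {g} [a|a|f g _ IH1 _ IH2|c f _ IH].
- by apply: bmf_cos; exact: measurable_dot.
- by apply: bmf_sin; exact: measurable_dot.
- exact: bmfD.
- exact: bmfZ.
Qed.

(** No sigma-algebra is put on the space of vectors. Composed with a measurable vector, h is a
    pointwise limit of trigonometric polynomials, whose measurability is plain. *)
Lemma measurable_lip {d : measure_display} {Om : measurableType d} k
  (Z : Om -> 'I_k -> R) (h : ('I_k -> R) -> R) (M K : R) :
  (forall i, measurable_fun setT (fun w => Z w i)) ->
  (forall x, `|h x| <= M) ->
  (forall x y, `|h x - h y| <= K * \sum_i `|x i - y i|) ->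
  measurable_fun setT (fun w => h (Z w)).
Proof.
move=> mZ hM hK.
have n0 (n : nat) : 0 < n.+1%:R :> R by rewrite ltr0n.
have n1 (n : nat) : 0 < n.+1%:R^-1 :> R by rewrite invr_gt0.
have /choice[g gP] : forall n : nat, exists g, [/\ trigpoly g, forall x, `|g x| <= M &
    forall x : 'I_k -> R, (forall i, `|x i| <= n.+1%:R) -> `|g x - h x| <= n.+1%:R^-1].
  by move=> n; exact: trigpoly_approx.
apply: (@measurable_fun_cvg _ _ _ setT (fun n w => g n (Z w))).
  by move=> n; have [Tg _ _] := gP n; have [] := trigpoly_bmf mZ Tg.
move=> w _; apply/cvgrPdist_le => e e0.
near=> n.
rewrite distrC; have [_ _ H] := gP n; rewrite (le_trans (H _ _))//.
  move=> i; rewrite (@le_trans _ _ (\sum_i `|Z w i|))//.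
    by rewrite (bigD1 i)//= lerDl sumr_ge0.
  by near: n; apply: near_natS_ge.
by near: n; apply: near_natSinv_le.
Unshelve. all: by end_near. Qed.

Lemma tight_single {d : measure_display} {Om : measurableType d}
  (P : probability Om R) (Y : Om -> R) (e : R) : measurable_fun setT Y -> 0 < e ->
  exists2 L : R, 0 < L & pr P [set w | L < `|Y w|] <= e.
Proof.
move=> mY e0; pose F n := [set w | n.+1%:R < `|Y w|].
have mF n : measurable (F n) by exact: measurable_norm_gt.
have dF : nonincreasing_seq F.
  move=> n m nm; apply/subsetPset => w; rewrite /F/=; apply: le_lt_trans.
  by rewrite ler_nat ltnS.
have := pr_bigcap_cvg (P := P) mF dF; rewrite (_ : \bigcap_i F i = set0); last first.
  rewrite -subset0 => w H.
  have := H (Num.bound `|Y w|) I; rewrite /F/= ltNge => /negP; apply.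
  rewrite (le_trans (ltW (archi_boundP (normr_ge0 _))))// ler_nat leqnSn//.
rewrite pr0 => /cvgrPdist_le/(_ e e0)[N _ /(_ N (leqnn _))].
rewrite /= sub0r normrN ger0_norm ?pr_ge0// => H.
by exists N.+1%:R => //; rewrite ltr0n.
Qed.

(** Means of trigonometric polynomials converge by hypothesis. Tightness confines the vectors to a
    cube on which such a polynomial is close to h, and the common bound M controls what happens
    outside. *)
Lemma levy_continuity k (Zn : nat -> Om1 -> 'I_k -> R) (Z : Om2 -> 'I_k -> R)
    (h : ('I_k -> R) -> R) (M K : R) :
  (forall n i, measurable_fun setT (fun w => Zn n w i)) ->
  (forall i, measurable_fun setT (fun w => Z w i)) ->
  (forall e : R, 0 < e -> exists L : R, forall n i,
     pr P1 [set w | L < `|Zn n w i|] <= e) ->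
  (forall a : 'I_k -> R, Ex P1 (fun w => cos (dot a (Zn n w))) @[n --> \oo] -->
     Ex P2 (fun w => cos (dot a (Z w)))) ->
  (forall a : 'I_k -> R, Ex P1 (fun w => sin (dot a (Zn n w))) @[n --> \oo] -->
     Ex P2 (fun w => sin (dot a (Z w)))) ->
  (forall x, `|h x| <= M) ->
  (forall x y, `|h x - h y| <= K * \sum_i `|x i - y i|) ->
  Ex P1 (fun w => h (Zn n w)) @[n --> \oo] --> Ex P2 (fun w => h (Z w)).
Proof.
move=> mZn mZ tight ccos csin hM hK.
have trig g : trigpoly g ->
    Ex P1 (fun w => g (Zn n w)) @[n --> \oo] --> Ex P2 (fun w => g (Z w)).
  elim => {g} [a|a|f g Tf IH1 Tg IH2|c f Tf IH].
  - exact: ccos.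
  - exact: csin.
  - rewrite ExD; [|exact: trigpoly_bmf|exact: trigpoly_bmf].
    rewrite (_ : (fun n => _) = (fun n => Ex P1 (fun w => f (Zn n w)) + Ex P1 (fun w => g (Zn n w)))).
      exact: cvgD.
    by apply/funext => n; rewrite ExD//; exact: trigpoly_bmf.
  - rewrite ExZ; last exact: trigpoly_bmf.
    rewrite (_ : (fun n => _) = (fun n => c * Ex P1 (fun w => f (Zn n w)))).
      by apply: cvgMr.
    by apply/funext => n; rewrite ExZ//; exact: trigpoly_bmf.
have M0 : 0 <= M by rewrite (le_trans (normr_ge0 (h (fun=> 0)))).
apply/cvgrPdist_le => e e0.
(* Replacing h by g costs [e1] on the cube and 2 M times the probability k [e1] of leaving it,
   together at most e / 4. This is paid once under each law. *)
pose e1 := e / (4 * (2 * M * k%:R + 2)).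
have K0 : 0 < 2 * M * k%:R + 2 by rewrite ltr_wpDl// !mulr_ge0.
have e10 : 0 < e1 by rewrite divr_gt0// mulr_gt0.
have [L1 HL1] := tight _ e10.
have /choice[L2 HL2] : forall i : 'I_k, exists L : R, pr P2 [set w | L < `|Z w i|] <= e1.
  by move=> i; have [L _ ?] := tight_single P2 (mZ i) e10; exists L.
pose L := `|L1| + \sum_i `|L2 i| + 1.
have L0 : 0 < L by rewrite ltr_wpDl// addr_ge0// sumr_ge0.
have [g [Tg gM gh]] := trigpoly_approx hM hK L0 e10.
have close (d : measure_display) (Om : measurableType d) (P : probability Om R)
    (V : Om -> 'I_k -> R) : (forall i, measurable_fun setT (fun w => V w i)) ->
    (forall i, pr P [set w | L < `|V w i|] <= e1) ->
    `|Ex P (fun w => g (V w)) - Ex P (fun w => h (V w))| <= e / 4.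
  move=> mV VL.
  pose F i : set Om := if insub i is Some j then [set w | L < `|V w j|] else set0.
  have mF i : measurable (F i) by rewrite /F; case: insub => // j; exact: measurable_norm_gt.
  pose B := \big[setU/set0]_(i < k) F i.
  have mB : measurable B by exact: bigsetU_measurable.
  have prB : pr P B <= k%:R * e1.
    rewrite (le_trans (pr_bigsum_le _ _ mF))//.
    rewrite mulr_natl -[X in _ *+ X]card_ord -sumr_const ler_sum// => i _.
    by rewrite /F valK.
  apply: le_trans (@Ex_close _ _ _ P _ _ M e1 B _ _ mB _ _ _ _) _ => //.
  - exact: trigpoly_bmf.
  - split; last by exists M.
    exact: measurable_lip.
  - move=> w Bw; apply: gh => i; rewrite leNgt; apply/negP => Li; apply: Bw.
    by rewrite /B -bigcup_mkord; exists i => //=; rewrite /F valK.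
  - exact: ltW.
  have : 2 * M * pr P B <= 2 * M * (k%:R * e1) by rewrite ler_wpM2l// mulr_ge0.
  have : e1 * (2 * M * k%:R + 2) = e / 4 by rewrite /e1; field; rewrite gt_eqF.
  by nra.
have L1L : L1 <= L.
  rewrite /L -addrA (le_trans (ler_norm _))// lerDl addr_ge0// sumr_ge0//.
have L2L i : L2 i <= L.
  rewrite /L (le_trans (ler_norm _))// (bigD1 i)//=.
  have : 0 <= \sum_(j | j != i) `|L2 j| by rewrite sumr_ge0.
  by have := normr_ge0 L1; lra.
have mono (d : measure_display) (Om : measurableType d) (P : probability Om R)
   (Y : Om -> R) (c : R) : measurable_fun setT Y -> c <= L ->
   pr P [set w | c < `|Y w|] <= e1 -> pr P [set w | L < `|Y w|] <= e1.
  move=> mY cL; apply: le_trans; apply: pr_le; [exact: measurable_norm_gt|exact: measurable_norm_gt|].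
  by move=> w /=; exact: le_lt_trans.
have C2 := close _ _ P2 Z mZ (fun i => mono _ _ P2 _ _ (mZ i) (L2L i) (HL2 i)).
have C1 n := close _ _ P1 (Zn n) (mZn n) (fun i => mono _ _ P1 _ _ (mZn n i) L1L (HL1 n i)).
have e4 : 0 < e / 4 by rewrite divr_gt0.
have /cvgrPdist_le/(_ _ e4) Hg := trig _ Tg.
near=> n.
have H : `|Ex P2 (fun w => g (Z w)) - Ex P1 (fun w => g (Zn n w))| <= e / 4.
  by near: n.
move: (C1 n) C2 H; rewrite !ler_norml => /andP[? ?] /andP[? ?] /andP[? ?].
by apply/andP; split; lra.
Unshelve. all: by end_near. Qed.

(** The continuity theorem for a constant sequence: a ramp falling from 1 at x to 0 at x + 1 / (n +
    1) has the same mean under both laws, and n tends to infinity. *)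
Lemma cf_unique_le (Y : Om1 -> R) (Z : Om2 -> R) (x : R) :
  measurable_fun setT Y -> measurable_fun setT Z ->
  (forall u, Ex P1 (fun w => cos (u * Y w)) = Ex P2 (fun w => cos (u * Z w))) ->
  (forall u, Ex P1 (fun w => sin (u * Y w)) = Ex P2 (fun w => sin (u * Z w))) ->
  pr P1 [set w | Y w <= x] <= pr P2 [set w | Z w <= x].
Proof.
move=> mY mZ Hc Hs.
pose F n := [set w | Z w <= x + n.+1%:R^-1].
have mF n : measurable (F n) by exact: measurable_le.
have dF : nonincreasing_seq F.
  move=> n m nm; apply/subsetPset => w; rewrite /F/= => /le_trans; apply.
  by rewrite lerD2l lef_pV2 ?posrE ?ltr0n// ler_nat ltnS.
have FE : \bigcap_i F i = [set w | Z w <= x].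
  apply/seteqP; split => w /=.
    move=> H; apply/ler_addgt0Pr => e e0.
    have [N HN] := ex_natSinv_le e0.
    by rewrite (le_trans (H N I))// lerD2l.
  by move=> H n _; rewrite /F/= (le_trans H)// lerDl invr_ge0.
have := pr_bigcap_cvg (P := P2) mF dF; rewrite FE => cv.
rewrite -(cvg_lim _ cv)//; apply: limr_ge; first by apply/cvg_ex; eexists; exact: cv.
apply: nearW => n.
pose N : R := n.+1%:R; have N0 : 0 < N by rewrite ltr0n.
pose h (v : 'I_1 -> R) : R := Num.min 1 (Num.max 0 (1 - N * (v ord0 - x))).
have h01 v : 0 <= h v <= 1 by rewrite /h le_min ler01 le_max lexx ge_min lexx.
have hM v : `|h v| <= 1 by have /andP[? ?] := h01 v; rewrite ger0_norm.
have hK v v' : `|h v - h v'| <= N * \sum_i `|v i - v' i|.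
  rewrite big_ord_recr big_ord0/= add0r.
  have -> : ord_max = ord0 :> 'I_1 by apply/val_inj.
  rewrite -(ger0_norm (ltW N0)) -normrM mulrBr /h.
  have -> : N * v ord0 - N * v' ord0 = N * (v ord0 - x) - N * (v' ord0 - x) by ring.
  set a := N * (v ord0 - x); set b := N * (v' ord0 - x).
  rewrite /Num.max /Num.min.
  by do !case: ifPn; rewrite -?leNgt => *; rewrite ler_norml; apply/andP; split;
    have := ler_norm (a - b); have := ler_norm (- (a - b)); rewrite normrN; lra.
have mY1 (i : 'I_1) : measurable_fun setT (fun w => (fun _ : 'I_1 => Y w) i) by [].
have mZ1 (i : 'I_1) : measurable_fun setT (fun w => (fun _ : 'I_1 => Z w) i) by [].
have := @levy_continuity 1 (fun _ w _ => Y w) (fun w _ => Z w) h 1 N.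
have dotE (a : 'I_1 -> R) (y : R) : dot a (fun=> y) = a ord0 * y.
  by rewrite /dot big_ord_recr big_ord0/= add0r; congr (a _ * _); apply/val_inj.
move=> /(_ (fun _ _ => mY) (fun _ => mZ)) H.
have {}H : Ex P1 (fun w => h (fun=> Y w)) = Ex P2 (fun w => h (fun=> Z w)).
  have {}H := H _ _ _ hM hK.
  suff : (fun _ : nat => Ex P1 (fun w => h (fun=> Y w))) @ \oo --> Ex P2 (fun w => h (fun=> Z w)).
    by move/cvg_lim => <- //; rewrite lim_cst.
  apply: H.
  - move=> e e0; have [L _ HL] := tight_single P1 mY e0; by exists L.
  - move=> a; under eq_fun do under [X in Ex _ X]eq_fun do rewrite dotE.
    by under [X in Ex _ X]eq_fun do rewrite dotE; rewrite -Hc; exact: cvg_cst.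
  - move=> a; under eq_fun do under [X in Ex _ X]eq_fun do rewrite dotE.
    by under [X in Ex _ X]eq_fun do rewrite dotE; rewrite -Hs; exact: cvg_cst.
have bhY : bmf (fun w => h (fun=> Y w)).
  by split; [exact: (@measurable_lip _ _ 1 (fun w _ => Y w) h 1 N)|exists 1].
have bhZ : bmf (fun w => h (fun=> Z w)).
  by split; [exact: (@measurable_lip _ _ 1 (fun w _ => Z w) h 1 N)|exists 1].
rewrite -!Ex_indic//; last exact: measurable_le.
apply: (@le_trans _ _ (Ex P1 (fun w => h (fun=> Y w)))).
  apply: Ex_le => //; first exact/bmf_indic/measurable_le.
  move=> w; rewrite indicE; case: (boolP (w \in _)) => [|_]; last by have /andP[] := h01 (fun=> Y w).
  rewrite inE/= => Yx; rewrite /h le_min lexx/= le_max; apply/orP; right.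
  by rewrite lerDl oppr_ge0 pmulr_rle0// subr_le0.
rewrite H; apply: Ex_le => //; first exact/bmf_indic.
move=> w; rewrite indicE; case: (boolP (w \in _)) => [_|]; first by have /andP[] := h01 (fun=> Z w).
rewrite notin_setE /F/= => /negP; rewrite -ltNge => Zx.
rewrite /h ge_min; apply/orP; right; rewrite ge_max lexx/= subr_le0.
by rewrite mulrC -ler_pdivrMr// div1r lerBrDl ltW.
Qed.

End levy_continuity.

Lemma cf_unique {R : realType} {d1 d2 : measure_display} {Om1 : measurableType d1}
  {Om2 : measurableType d2} (P1 : probability Om1 R) (P2 : probability Om2 R)
  (Y : Om1 -> R) (Z : Om2 -> R) (x : R) :
  measurable_fun setT Y -> measurable_fun setT Z ->
  (forall u, Ex P1 (fun w => cos (u * Y w)) = Ex P2 (fun w => cos (u * Z w))) ->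
  (forall u, Ex P1 (fun w => sin (u * Y w)) = Ex P2 (fun w => sin (u * Z w))) ->
  pr P1 [set w | Y w <= x] = pr P2 [set w | Z w <= x].
Proof.
move=> mY mZ Hc Hs; apply/eqP; rewrite eq_le !cf_unique_le// => u; exact/esym.
Qed.

(** * Gaussian laws *)

Section quad_derivative.
Context {R : realType}.
Implicit Types (x y u : R) (f g : R -> R).


(** Takes the place of differentiation under the integral sign: a quadratic remainder that is
    uniform in x and y survives integration and identifies the derivative. *)
Lemma is_derive_quad f g (C : R) :
  (forall x y, `|f y - f x - g x * (y - x)| <= C * (y - x) ^+ 2) ->
  forall x, is_derive x 1 f (g x).
Proof.
move=> H x.
have cv : h^-1 *: ((f \o shift x) (h *: 1) - f x) @[h --> 0^'] --> g x.
  apply/cvgrPdist_le => e e0.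
  have d0 : 0 < e / (`|C| + 1) by rewrite divr_gt0// ltr_wpDl.
  near=> h.
  have h0 : h != 0 by near: h; exact: nbhs_dnbhs_neq.
  have hd : `|h| <= e / (`|C| + 1).
    near: h; apply: nbhs_dnbhs.
    by apply: (@nbhs0_le _ R); rewrite ?lexx.
  rewrite distrC /= /GRing.scale/= mulr1.
  have := H x (h + x); rewrite addrK => Hh.
  rewrite -(@ler_pM2r _ `|h|) ?normr_gt0// -normrM mulrBl mulrAC mulVf// mul1r.
  rewrite (le_trans Hh)// -(real_normK (num_real h)) expr2 mulrA ler_wpM2r//.
  rewrite (@le_trans _ _ ((`|C| + 1) * `|h|))//.
    by rewrite ler_wpM2r// (le_trans (ler_norm _))// lerDl.
  by rewrite mulrC -ler_pdivlMr// ltr_wpDl.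
by apply: DeriveDef; [apply/cvg_ex; exists (g x)|exact: cvg_lim].
Unshelve. all: by end_near. Qed.

End quad_derivative.

Section gaussian.
Context {R : realType} (s : R) (s0 : 0 < s).
Local Notation mu := (@lebesgue_measure R).
Implicit Types (x y u : R) (f g : R -> R).

Definition ndens x : R := normal_pdf 0 s x.

Let c0 : R := normal_peak s.

Let sn0 : s != 0. Proof. by rewrite gt_eqF. Qed.

Lemma ndensE x : ndens x = c0 * expR (- (x ^+ 2 / (2 * s ^+ 2))).
Proof.
rewrite /ndens normal_pdfE// /normal_fun subr0 mulNr.
by rewrite -mulr_natl.
Qed.

Let c0_gt0 : 0 < c0. Proof. exact: normal_peak_gt0. Qed.

Lemma ndens_gt0 x : 0 < ndens x.
Proof. by rewrite ndensE mulr_gt0// expR_gt0. Qed.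

Lemma continuous_ndens : continuous ndens.
Proof. exact: continuous_normal_pdf. Qed.

Lemma is_derive_ndens x : is_derive x 1 ndens (- (x / s ^+ 2) * ndens x).
Proof.
have -> : ndens = (fun x => c0 * expR (- ((2 * s ^+ 2)^-1 * x ^+ 2))).
  by apply/funext => y; rewrite ndensE mulrC (mulrC (y ^+ 2)) mulrC.
apply: is_derive_eq; rewrite /GRing.scale/= ?mulr0 ?mulr1 ?add0r ?addr0.
by field.
Qed.

(** From y <= exp y at y = x^2 / (4 s^2): a factor x^2 is paid for by doubling the variance. *)
Lemma sqr_ndens_le x : x ^+ 2 * ndens x <= 4 * s ^+ 2 * c0 * expR (- (x ^+ 2 / (4 * s ^+ 2))).
Proof.
rewrite ndensE (_ : x ^+ 2 * _ = (x ^+ 2 / (4 * s ^+ 2)) *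
  (4 * s ^+ 2 * c0 * expR (- (x ^+ 2 / (2 * s ^+ 2))))); last by field.
rewrite (@le_trans _ _ (expR (x ^+ 2 / (4 * s ^+ 2)) *
  (4 * s ^+ 2 * c0 * expR (- (x ^+ 2 / (2 * s ^+ 2))))))//.
  rewrite ler_wpM2r//; first by rewrite !mulr_ge0 ?expR_ge0 ?sqr_ge0// ltW.
  by rewrite (le_trans _ (expR_ge1Dx _))// lerDr.
rewrite [leLHS]mulrCA ler_wpM2l//.
  by apply: mulr_ge0; [apply: mulr_ge0; [by []|exact: sqr_ge0]|exact: ltW].
rewrite -expRD ler_expR.
by rewrite le_eqVlt; apply/orP; left; apply/eqP; field.
Qed.

(** The dominating function combines two normal densities, of variances s^2 and 2 s^2, so no
    integral has to be computed. *)
Lemma integrable_ndensM g (C : R) : measurable_fun setT g ->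
  (forall x, `|g x| <= C * (1 + x ^+ 2)) ->
  mu.-integrable setT (EFin \o (fun x => g x * ndens x)).
Proof.
move=> mg gC.
have C0 : 0 <= C.
  by have := le_trans (normr_ge0 _) (gC 0); rewrite expr0n addr0 mulr1.
pose s2 := Num.sqrt 2 * s.
have s20 : s2 != 0 by rewrite gt_eqF// mulr_gt0// sqrtr_gt0.
have i1 := integrable_normal_pdf (0 : R) s.
have i2 := integrable_normal_pdf (0 : R) s2.
pose c1 : R := normal_peak s2.
have c10 : 0 < c1 by exact: normal_peak_gt0.
pose D x := C * normal_pdf 0 s x + (C * (4 * s ^+ 2 * c0 / c1)) * normal_pdf 0 s2 x.
have iD : mu.-integrable setT (EFin \o D).
  rewrite (_ : EFin \o D = (fun x => C%:E * (normal_pdf 0 s x)%:E +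
      (C * (4 * s ^+ 2 * c0 / c1))%:E * (normal_pdf 0 s2 x)%:E)%E) //.
  by apply: integrableD => //; apply: integrableZl.
apply: (le_integrable measurableT _ _ iD).
  apply/measurable_EFinP; apply: measurable_funM => //.
  by apply: continuous_measurable_fun; exact: continuous_ndens.
move=> x _; rewrite lee_fin normrM (ger0_norm (ltW (ndens_gt0 x))).
rewrite (le_trans _ (ler_norm _))//.
rewrite (le_trans (ler_wpM2r (ltW (ndens_gt0 x)) (gC x)))//.
rewrite /D (_ : C * (1 + x ^+ 2) * ndens x = C * normal_pdf 0 s x + C * (x ^+ 2 * ndens x)); last first.
  by rewrite /ndens; ring.
rewrite lerD2l -mulrA ler_wpM2l//.
rewrite (le_trans (sqr_ndens_le x))//.
rewrite normal_pdfE// -/c1 /normal_fun subr0 /s2 exprMn sqr_sqrtr//.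
rewrite (_ : 4 * s ^+ 2 * c0 / c1 * (c1 * _) = 4 * s ^+ 2 * c0 * expR (- x ^+ 2 / ((2 * s ^+ 2) *+ 2))); last first.
  by field; rewrite gt_eqF.
rewrite (_ : - x ^+ 2 / _ = - (x ^+ 2 / (4 * s ^+ 2)))// -mulr_natr mulNr.
by congr (- (_ / _)); ring.
Qed.

Let integrableZ (c : R) (h : R -> R) : mu.-integrable setT (EFin \o h) ->
  mu.-integrable setT (EFin \o (fun x => c * h x)).
Proof.
move=> ih; rewrite (_ : EFin \o _ = (fun x => c%:E * (h x)%:E)%E)//.
exact: integrableZl.
Qed.

Let integrable_B (h1 h2 : R -> R) : mu.-integrable setT (EFin \o h1) ->
  mu.-integrable setT (EFin \o h2) -> mu.-integrable setT (EFin \o (fun x => h1 x - h2 x)).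
Proof.
move=> i1 i2; rewrite (_ : EFin \o _ = (fun x => (h1 x)%:E - (h2 x)%:E)%E)//.
exact: integrableB.
Qed.

Definition Nint g : R := \int[mu]_x (g x * ndens x).

Lemma Nint1 : Nint (fun=> 1) = 1.
Proof.
rewrite /Nint; under eq_Rintegral do rewrite mul1r.
by rewrite /Rintegral integral_normal_pdf.
Qed.

(** Integration by parts: with phi the density, (s^2 g phi)' = s^2 g' phi - x g phi. The boundary
    terms at -n and n are O(1 / n), and dominated convergence passes from [-n, n] to the line. *)
Lemma stein g dg (C : R) : (forall x, is_derive x 1 g (dg x)) -> continuous dg ->
  (forall x, `|g x| <= C * (1 + `|x|)) -> (forall x, `|dg x| <= C) ->
  Nint (fun x => x * g x) = s ^+ 2 * Nint dg.
Proof.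
move=> gdg cdg gC dgC.
have C0 : 0 <= C by exact: le_trans (normr_ge0 _) (dgC 0).
pose h x := s ^+ 2 * (g x * ndens x).
pose dh x := s ^+ 2 * (dg x * ndens x) - x * g x * ndens x.
have hdh x : is_derive x 1 h (dh x).
  have H := is_deriveZ (s ^+ 2) (is_deriveM (gdg x) (is_derive_ndens x)).
  by apply: (is_derive_eq H); rewrite /dh /GRing.scale/=; field.
have cg : continuous g.
  by move=> x; apply: differentiable_continuous; apply/derivable1_diffP; case: (gdg x).
have ch : continuous h.
  move=> x; apply: cvgM; first exact: cvg_cst.
  by apply: cvgM; [exact: cg|exact: continuous_ndens].
have cdh : continuous dh.
  move=> x; apply: cvgB.
    apply: cvgM; first exact: cvg_cst.
    by apply: cvgM; [exact: cdg|exact: continuous_ndens].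
  apply: cvgM; last exact: continuous_ndens.
  by apply: cvgM; [exact: cvg_id|exact: cg].
have mg : measurable_fun setT g by exact: continuous_measurable_fun.
have mdg : measurable_fun setT dg by exact: continuous_measurable_fun.
have x1 x : 1 + `|x| <= 2 * (1 + x ^+ 2).
  by rewrite -(real_normK (num_real x)); have := normr_ge0 x; nra.
have x2 x : `|x| * (1 + `|x|) <= 2 * (1 + x ^+ 2).
  by rewrite -(real_normK (num_real x)); have := normr_ge0 x; nra.
have i1 : mu.-integrable setT (EFin \o (fun x => dg x * ndens x)).
  apply: (integrable_ndensM (C := C)) => // x; rewrite (le_trans (dgC x))//.
  by rewrite ler_peMr// lerDl sqr_ge0.
have i2 : mu.-integrable setT (EFin \o (fun x => x * g x * ndens x)).
  apply: (integrable_ndensM (C := 2 * C)) => [|x]; first exact: measurable_funM.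
  rewrite normrM (le_trans (ler_wpM2l (normr_ge0 _) (gC x)))//.
  by rewrite [leLHS]mulrCA (mulrC 2) -mulrA ler_wpM2l.
have idh : mu.-integrable setT (EFin \o dh).
  rewrite (_ : EFin \o dh = (fun x => (s ^+ 2)%:E * (dg x * ndens x)%:E - (x * g x * ndens x)%:E)%E).
    by apply: integrableB => //; exact: integrableZl.
  by apply/funext => x; rewrite /dh /= EFinB EFinM.
suff H : \int[mu]_x dh x = 0.
  apply/eqP; rewrite eq_sym -subr_eq0 /Nint -RintegralZl// -RintegralB//.
    by apply/eqP; exact: H.
  exact: integrableZ.
pose F n x : \bar R := (dh x * \1_(`[- n.+1%:R, n.+1%:R]%classic : set R) x)%:E.
have mdh : measurable_fun setT dh by exact: continuous_measurable_fun.
have [] := @dominated_convergence _ _ _ mu setT measurableT F (EFin \o dh) (EFin \o (fun x => `|dh x|)).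
- by move=> n; apply/measurable_EFinP; apply: measurable_funM.
- exact/measurable_EFinP.
- apply: aeW => x _; apply: cvg_near_cst.
  near=> n; rewrite /F indicE mem_set ?mulr1//= in_itv/= -ler_norml.
  by near: n; exact: near_natS_ge.
- exact: (integrable_norm idh).
- apply: aeW => x n _; rewrite lee_fin normrM ler_piMr// indicE.
  by case: (_ \in _); rewrite ?normr1 ?normr0.
move=> _ _ cv.
have FE n : (\int[mu]_x F n x)%E = (h n.+1%:R - h (- n.+1%:R))%:E.
  transitivity (\int[mu]_(x in `[(- n.+1%:R)%R, n.+1%:R%R]%classic) (dh x)%:E)%E.
    rewrite [RHS]integral_mkcond; apply: eq_integral => x _.
    rewrite /F patchE indicE; case: ifP => _; by rewrite ?mulr1 ?mulr0.
  rewrite (continuous_FTC2 (F := h)) ?EFinB//.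
  - by rewrite gtrN ?ltr0n.
  - exact: continuous_subspaceT.
  - split; first by move=> x _; case: (hdh x).
    + by apply: cvg_at_right_filter; exact: ch.
    + by apply: cvg_at_left_filter; exact: ch.
  - by move=> x _; rewrite derive1E; case: (hdh x).
pose D := 8 * C * s ^+ 4 * c0.
have D0 : 0 <= D by rewrite /D !mulr_ge0// ?exprn_ge0// ltW.
have hb x : 1 <= `|x| -> `|h x| <= D / `|x|.
  move=> xx; have x0 : 0 < `|x| by lra.
  rewrite ler_pdivlMr// /h normrM (ger0_norm (sqr_ge0 s)) normrM (ger0_norm (ltW (ndens_gt0 x))).
  apply: (@le_trans _ _ (s ^+ 2 * (C * (2 * `|x|) * ndens x) * `|x|)).
    rewrite ler_wpM2r// ler_wpM2l ?sqr_ge0// ler_wpM2r// ?(ltW (ndens_gt0 x))//.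
    by rewrite (le_trans (gC x))// ler_wpM2l//; lra.
  rewrite (_ : s ^+ 2 * (C * (2 * `|x|) * ndens x) * `|x| = 2 * s ^+ 2 * C * (x ^+ 2 * ndens x)); last first.
    by rewrite -(real_normK (num_real x)); ring.
  rewrite (_ : D = 2 * s ^+ 2 * C * (4 * s ^+ 2 * c0)); last by rewrite /D; ring.
  have p1 : 0 <= 2 * s ^+ 2 * C.
    by apply: mulr_ge0 => //; apply: mulr_ge0 => //; exact: sqr_ge0.
  have p2 : 0 <= 4 * s ^+ 2 * c0.
    by apply: mulr_ge0; [apply: mulr_ge0 => //; exact: sqr_ge0|exact: ltW].
  rewrite ler_wpM2l// (le_trans (sqr_ndens_le x))// ler_piMr//.
  rewrite -[leRHS]expR0 ler_expR oppr_le0; apply: divr_ge0; first exact: sqr_ge0.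
  by apply: mulr_ge0 => //; exact: sqr_ge0.
have cv0 : (\int[mu]_x F n x)%E @[n --> \oo] --> 0%E.
  under eq_fun do rewrite FE; apply/cvg_EFin; first exact: nearW.
  rewrite [X in X @ _ --> _](_ : _ = (fun n => h n.+1%:R - h (- n.+1%:R)))//.
  apply/cvgrPdist_le => e e0.
  have De : 0 < e / (D + D + 1) by rewrite divr_gt0// ltr_wpDl ?addr_ge0.
  near=> n.
  rewrite sub0r normrN.
  have n1 : 1 <= `|n.+1%:R| :> R by rewrite ger0_norm// ler1n.
  have n2 : 1 <= `|- n.+1%:R| :> R by rewrite normrN.
  rewrite (le_trans (ler_normB _ _))// (le_trans (lerD (hb _ n1) (hb _ n2)))//.
  rewrite normrN ger0_norm// -mulrDl mulrC.
  apply: (@le_trans _ _ (e / (D + D + 1) * (D + D + 1))); last first.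
    by rewrite mulfVK// gt_eqF// ltr_wpDl ?addr_ge0.
  apply: ler_pM; rewrite ?invr_ge0 ?addr_ge0// ?lerDl//.
  by near: n; exact: near_natSinv_le.
rewrite /Rintegral -(cvg_lim _ cv)//; first by rewrite (cvg_lim _ cv0).
Unshelve. all: by end_near. Qed.

Let normal0s : probability (measurableTypeR R) R := normal_prob (0 : R) s.

Lemma ge0_integral_normal0s (f : R -> \bar R) : measurable_fun setT f ->
  (forall x, 0 <= f x)%E ->
  (\int[normal_prob (0 : R) s]_x f x = \int[mu]_x (f x * (ndens x)%:E))%E.
Proof.
move=> mf f0.
have dom : normal_prob (0 : R) s `<< mu := normal_prob_dominates 0 s.
rewrite -(Radon_Nikodym_SigmaFinite.change_of_variables dom)//.
have mn : measurable_fun setT (fun x => (ndens x)%:E).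
  by apply/measurable_EFinP; exact: measurable_normal_pdf.
have ifn := Radon_Nikodym_SigmaFinite.f_integrable dom.
apply: ae_eq_integral => //.
- by apply: emeasurable_funM => //; exact: measurable_int ifn.
- exact: emeasurable_funM.
- apply: ae_eqe_mul2l; apply: integral_ae_eq => //=.
  by move=> E _ mE; rewrite -Radon_Nikodym_SigmaFinite.f_integral.
Qed.

Lemma Ex_normal0s g : bmf g -> Ex normal0s g = Nint g.
Proof.
move=> bg; have [mg [M gM]] := bg.
have M0 : 0 <= M by rewrite (le_trans _ (gM 0)).
have H c : 0 <= c -> (forall x, 0 <= g x + c) -> Ex normal0s g + c = Nint g + c.
  move=> c0' gc.
  have bgc : bmf (fun x => g x + c) by apply: bmfD => //; exact: bmf_cst.
  have -> : Ex normal0s g + c = Ex normal0s (fun x => g x + c).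
    rewrite ExD ?Ex_cst//; exact: bmf_cst.
  rewrite /Ex ge0_integral_normal0s//; last first.
    by apply/measurable_EFinP; case: bgc.
  have -> : Nint g + c = \int[mu]_x ((g x + c) * ndens x).
    rewrite -[c in LHS]mulr1 -Nint1 /Nint -RintegralZl//; last first.
      apply: (integrable_ndensM (C := 1)) => // x.
      by rewrite normr1 mul1r lerDl sqr_ge0.
    rewrite -RintegralD//.
    - by apply: eq_Rintegral => x _; ring.
    - apply: (integrable_ndensM (C := M)) => // x.
      by rewrite (le_trans (gM x))// ler_peMr// lerDl sqr_ge0.
    - under eq_fun do rewrite mulrA mulr1.
      apply: (integrable_ndensM (C := `|c|)) => // x.
      by rewrite ler_peMr// lerDl sqr_ge0.
  by rewrite /Rintegral; congr fine; apply: eq_integral => x _; rewrite EFinM.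
apply: (addIr M); apply: H => // x.
by have := gM x; rewrite ler_norml => /andP[]; rewrite -subr_ge0 opprK.
Qed.

Lemma Nint_sqr : Nint (fun x => x ^+ 2) = s ^+ 2.
Proof.
rewrite -[RHS]mulr1 -Nint1.
have D x : is_derive x (1 : R) (fun x : R => x) 1 by exact: is_derive_id.
rewrite -(stein (C := 1) D)//.
- by move=> x; exact: cvg_cst.
- by move=> x; rewrite mul1r lerDr.
- by move=> x; rewrite normr1.
Qed.

(** Stein's identity turns the derivative of psi(v) = E cos(v x + b) into - s^2 v psi(v), so psi(v)
    exp(s^2 v^2 / 2) is constant. The phase b yields the cosine transform at b = 0 and the sine
    transform at b = - pi / 2. *)
Lemma Nint_cosD u b : Nint (fun x => cos (u * x + b)) =
  cos b * expR (- (u ^+ 2 * s ^+ 2 / 2)).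
Proof.
pose psi v := Nint (fun x => cos (v * x + b)).
pose ds v := Nint (fun x => x * sin (v * x + b)).
have ma v : measurable_fun setT (fun x : R => v * x + b).
  by apply: measurable_funD => //; exact: measurable_funM.
have mcu v : measurable_fun setT (fun x => cos (v * x + b)).
  exact: (measurableT_comp measurable_cosT (ma v)).
have msu v : measurable_fun setT (fun x => sin (v * x + b)).
  exact: (measurableT_comp measurable_sinT (ma v)).
have ic v : mu.-integrable setT (EFin \o (fun x => cos (v * x + b) * ndens x)).
  apply: (integrable_ndensM (C := 1)) => // x.
  by rewrite mul1r (le_trans (cos_max _))// lerDl sqr_ge0.
have dsE v : ds v = s ^+ 2 * (v * psi v).
  have Ds x : is_derive x (1 : R) (fun x : R => sin (v * x + b)) (v * cos (v * x + b)).
    by apply: is_derive_eq; rewrite /GRing.scale/=; ring.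
  rewrite /ds (stein (C := `|v| + 1) Ds).
  - congr (_ * _); rewrite /psi /Nint -RintegralZl//.
    by apply: eq_Rintegral => x _; rewrite mulrA.
  - move=> x; apply: cvgM; first exact: cvg_cst.
    apply: (@continuous_comp _ _ _ (fun x => v * x + b) (@cos R)); last exact: continuous_cos.
    by apply: cvgD; [apply: cvgM; [exact: cvg_cst|exact: cvg_id]|exact: cvg_cst].
  - move=> x; rewrite (le_trans (sin_max _))//.
    by have := normr_ge0 v; have := normr_ge0 x; nra.
  - move=> x; rewrite normrM (@le_trans _ _ `|v|) ?lerDl//.
    by rewrite ler_piMr// cos_max.
(* The remainder is quadratic for all q: for sin q - q, Taylor's cubic bound serves up to |q| = 2
   and the trivial bound beyond. *)
have trig (p q : R) : `|cos (p + q) - cos p + q * sin p| <= 2 * q ^+ 2.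
  rewrite (_ : cos (p + q) - cos p + q * sin p = cos p * (cos q - 1) - sin p * (sin q - q)); last first.
    by rewrite cosD; ring.
  rewrite (le_trans (ler_normB _ _))// !normrM.
  have c1 : `|cos q - 1| <= q ^+ 2.
    rewrite -normrN opprB; have /andP[? h] := onem_cos_le q.
    by rewrite ger0_norm// (le_trans h)// ler_pdivrMr// ler_peMr ?sqr_ge0// ler1n.
  have s1 : `|sin q - q| <= q ^+ 2.
    rewrite -(real_normK (num_real q)); have [q2|q2] := leP `|q| 2.
      rewrite (le_trans (sin_taylor q))//; have := normr_ge0 q.
      by rewrite (_ : `|q| ^+ 3 = `|q| * `|q| ^+ 2); [have := sqr_ge0 `|q|; nra|ring].
    rewrite (le_trans (ler_normB _ _))//.
    by have := sin_le_norm q; rewrite expr2; nra.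
  have e1 : `|cos p| * `|cos q - 1| <= q ^+ 2.
    by rewrite (le_trans (ler_piMl _ (cos_max p))).
  have e2 : `|sin p| * `|sin q - q| <= q ^+ 2.
    by rewrite (le_trans (ler_piMl _ (sin_max p))).
  lra.
have is' v : mu.-integrable setT (EFin \o (fun x => x * sin (v * x + b) * ndens x)).
  apply: (integrable_ndensM (C := 1)) => [|x]; first exact: measurable_funM.
  rewrite mul1r normrM (@le_trans _ _ `|x|)//; first by rewrite ler_piMr// sin_max.
  by rewrite -(real_normK (num_real x)); have := normr_ge0 x; nra.
have i2 : mu.-integrable setT (EFin \o (fun x => x ^+ 2 * ndens x)).
  apply: (integrable_ndensM (C := 1)) => [|x]; first exact: measurable_funX.
  by rewrite mul1r ger0_norm ?sqr_ge0// lerDr.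
have D (v : R) : is_derive v 1 psi (- ds v).
  apply: (@is_derive_quad _ psi (fun v => - ds v) (2 * Nint (fun x => x ^+ 2))) => {}v y.
  have ib := integrable_B (ic y) (ic v).
  have iz := integrableZ (y - v) (is' v).
  have -> : psi y - psi v - - ds v * (y - v) =
    \int[mu]_x ((cos (y * x + b) - cos (v * x + b) + (y - v) * x * sin (v * x + b)) * ndens x).
    rewrite mulNr opprK mulrC /psi /ds /Nint -RintegralB// -RintegralZl// -RintegralD//.
    by apply: eq_Rintegral => x _; ring.
  have ii : mu.-integrable setT (EFin \o (fun x => (cos (y * x + b) - cos (v * x + b) + (y - v) * x * sin (v * x + b)) * ndens x)).
    rewrite (_ : EFin \o _ = (fun x => (cos (y * x + b) * ndens x - cos (v * x + b) * ndens x)%:E + ((y - v) * (x * sin (v * x + b) * ndens x))%:E)%E).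
      by apply: integrableD.
    by apply/funext => x /=; rewrite -EFinD; congr EFin; ring.
  rewrite (le_trans (le_normr_Rintegral _ ii))//.
  have -> : 2 * Nint (fun x => x ^+ 2) * (y - v) ^+ 2 =
     \int[mu]_x ((2 * (y - v) ^+ 2) * (x ^+ 2 * ndens x)).
    by rewrite RintegralZl// /Nint; ring.
  apply: le_Rintegral => //.
  - exact: (integrable_norm ii).
  - exact: integrableZ.
  move=> x _; rewrite normrM (ger0_norm (ltW (ndens_gt0 x))) mulrA ler_wpM2r ?(ltW (ndens_gt0 x))//.
  have := trig (v * x + b) ((y - v) * x).
  rewrite (_ : v * x + b + (y - v) * x = y * x + b); last by ring.
  by rewrite exprMn mulrA.
pose k v := psi v * expR (2^-1 * s ^+ 2 * v ^+ 2).
have Dk v : is_derive v (1 : R) k 0.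
  rewrite /k; have Dv := D v; apply: is_derive_eq.
  by rewrite dsE /GRing.scale/= ?mulr0 ?mulr1 ?add0r ?addr0; field.
have [c [_ _ kE]] := mvt_abs Dk 0 u.
have : k u = k 0 by apply/eqP; rewrite -subr_eq0 kE mul0r.
have -> : k 0 = cos b.
  rewrite /k expr0n mulr0 expR0 mulr1 /psi.
  rewrite /Nint; under eq_Rintegral do rewrite mul0r add0r.
  rewrite RintegralZl//; last exact: integrable_normal_pdf.
  by have := Nint1; rewrite /Nint; under eq_Rintegral do rewrite mul1r; move=> ->; rewrite mulr1.
move=> E; rewrite -E /k -mulrA -expRD.
by rewrite (_ : _ + _ = 0) ?expR0 ?mulr1//; field.
Qed.

Lemma normal_cf_cos u : Ex normal0s (fun x => cos (u * x)) = expR (- (u ^+ 2 * s ^+ 2 / 2)).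
Proof.
rewrite Ex_normal0s; last by apply: bmf_cos; exact: measurable_funM.
have := Nint_cosD u 0; rewrite cos0 mul1r => <-.
by congr Nint; apply/funext => x; rewrite addr0.
Qed.

Lemma normal_cf_sin u : Ex normal0s (fun x => sin (u * x)) = 0.
Proof.
rewrite Ex_normal0s; last by apply: bmf_sin; exact: measurable_funM.
have := Nint_cosD u (- (pi / 2)); rewrite cosN cos_pihalf mul0r => <-.
by congr Nint; apply/funext => x; rewrite cosBpihalf.
Qed.

Lemma normal_second_moment : (\int[normal0s]_x (x ^+ 2)%:E = (s ^+ 2)%:E)%E.
Proof.
rewrite ge0_integral_normal0s//; last 2 first.
- by apply/measurable_EFinP; exact: measurable_funX.
- by move=> x; rewrite lee_fin sqr_ge0.
rewrite -Nint_sqr /Nint /Rintegral fineK; last first.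
  apply: integrable_fin_num => //.
  apply: (integrable_ndensM (C := 1)) => [|x]; first exact: measurable_funX.
  by rewrite mul1r ger0_norm ?sqr_ge0// lerDr.
by apply: eq_integral => x _; rewrite EFinM.
Qed.

(** Exponential tilting: on the event, the density is at most exp(1/2 - x) times the density of the
    law shifted by sg s, whose total mass is 1. *)
Lemma normal_tail x (sg : R) : `|sg| = 1 ->
  pr normal0s [set y | s * x <= sg * y] <= expR (2^-1 - x).
Proof.
move=> sg1; set A := [set y | _].
have mA : measurable A.
  by apply: measurable_ge; exact: measurable_funM.
rewrite -Ex_indic// Ex_normal0s; last exact: bmf_indic.
have i1 : mu.-integrable setT (EFin \o (fun y => (expR (2^-1 - x)) * normal_pdf (sg * s) s y)).
  rewrite (_ : EFin \o _ = (fun y => (expR (2^-1 - x))%:E * (normal_pdf (sg * s) s y)%:E)%E)//.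
  by apply: integrableZl => //; exact: integrable_normal_pdf.
rewrite [leRHS](_ : _ = \int[mu]_y (expR (2^-1 - x) * normal_pdf (sg * s) s y)); last first.
  rewrite RintegralZl//; last exact: integrable_normal_pdf.
  by rewrite /Rintegral integral_normal_pdf/= mulr1.
apply: le_Rintegral => //.
  apply: (integrable_ndensM (C := 1)); first exact: measurable_indic.
  move=> y; rewrite mul1r (@le_trans _ _ 1) ?lerDl ?sqr_ge0//.
  by rewrite indicE; case: (_ \in _); rewrite ?normr1 ?normr0.
move=> y _; rewrite indicE; case: (boolP (y \in A)) => [|_]; last first.
  by rewrite mul0r mulr_ge0 ?expR_ge0// normal_pdf_ge0.
rewrite inE /A/= mul1r => yA.
rewrite ndensE normal_pdfE// -/c0 /normal_fun [leRHS]mulrCA ler_wpM2l ?(ltW c0_gt0)//.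
rewrite -expRD ler_expR.
have sg2 : sg ^+ 2 = 1 by rewrite -(real_normK (num_real sg)) sg1 expr1n.
have E : 2^-1 - x + - (y - sg * s) ^+ 2 / (s ^+ 2 *+ 2) =
   - (y ^+ 2 / (2 * s ^+ 2)) + (sg * y - s * x) / s.
  rewrite sqrrB exprMn sg2 mul1r -mulr_natr; field => //.
by rewrite E lerDl divr_ge0 ?(ltW s0)// subr_ge0.
Qed.

End gaussian.

(* The constraint set depends on the time only, so that finitely many cylinders
   can be rewritten over a common list of times. *)
Definition cylinder {R : realType} (ts : seq R) (B : R -> set R) : set (R -> R) :=
  [set g | forall t, t \in ts -> B t (g t)].

Definition cylinders {R : realType} : set (set (R -> R)) :=
  [set C | exists ts B, [/\ (forall t : R, t \in ts -> 0 <= t),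
     (forall t, measurable (B t : set R)) & C = cylinder ts B]].

Definition pathT (R : realType) := g_sigma_algebraType (@cylinders R).

HB.instance Definition _ (R : realType) := Measurable.on (pathT R).

(** * Independent copies as random paths *)

Section path_space.
Context {R : realType}.

Lemma cylinders_setI : setI_closed (@cylinders R).
Proof.
move=> _ _ [ts [B [ts0 mB ->]]] [ts' [B' [ts0' mB' ->]]].
exists (ts ++ ts'), (fun t => (if t \in ts then B t else setT) `&`
                              (if t \in ts' then B' t else setT)); split.
- by move=> t; rewrite mem_cat => /orP[/ts0|/ts0'].
- by move=> t; apply: measurableI; case: ifP.
apply/seteqP; split => [g [H1 H2] t _|g H].
  by split; case: ifP => // tt; [exact: H1|exact: H2].
split=> t tt; have := H t; rewrite mem_cat tt ?orbT => /(_ isT)[]//.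
Qed.

Lemma cylinders_setT : cylinders (setT : set (R -> R)).
Proof.
by exists [::], (fun=> setT); split => //; apply/seteqP; split.
Qed.

Lemma measurable_coord (t : R) : 0 <= t ->
  measurable_fun setT (fun g : pathT R => g t).
Proof.
move=> t0 _ B mB; rewrite setTI; apply: sub_sigma_algebra.
exists [:: t], (fun=> B); split => //; first by move=> u; rewrite inE => /eqP ->.
apply/seteqP; split => [g gB u|g]; first by rewrite inE => /eqP ->.
by move=> /(_ t); rewrite inE eqxx; apply.
Qed.

End path_space.

Section iid_paths.
Context {R : realType} {d : measure_display} {Omega : measurableType d}
  (P : probability Omega R) (X : R -> Omega -> R) (Xs : nat -> R -> Omega -> R).
Hypothesis mX : forall t, 0 <= t -> measurable_fun setT (X t).
Hypothesis iid : iid_copies P X Xs.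
Local Notation pr := (pr P).
Local Notation Ex := (Ex P).

Definition spath (i : nat) (w : Omega) : pathT R := fun t => Xs i t w.
Definition spath0 (w : Omega) : pathT R := fun t => X t w.

Lemma measurable_paths (Y : R -> Omega -> R) :
  (forall t, 0 <= t -> measurable_fun setT (Y t)) ->
  measurable_fun setT (fun w => (fun t => Y t w) : pathT R).
Proof.
move=> mY _ B; rewrite setTI => mB.
pose y w : R -> R := fun t => Y t w.
pose G := [set C : set (R -> R) | measurable (y @^-1` C)].
suff : <<s @cylinders R >> `<=` G by apply.
apply: smallest_sub.
  split.
  - by rewrite /G/= preimage_set0; exact: measurable0.
  - by move=> A GA; rewrite /G/= setTD -preimage_setC; exact: measurableC.
  - by move=> F GF; rewrite /G/= preimage_bigcup; apply: bigcup_measurable => k _; exact: GF.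
move=> _ [ts [C [ts0 mC ->]]]; rewrite /G/=.
rewrite (_ : _ @^-1` _ = \bigcap_(t in [set` ts]) (Y t @^-1` C t)); last first.
  by apply/seteqP; split.
apply: fin_bigcap_measurable => // t /ts0 t0; apply: measurable_preim => //; exact: mY.
Qed.

Lemma measurable_path i : measurable_fun setT (spath i).
Proof. by apply: measurable_paths => t _; case: iid => + _; apply. Qed.

Lemma measurable_path0 : measurable_fun setT spath0.
Proof. exact: measurable_paths. Qed.

Lemma measurable_path_event i (C : set (pathT R)) : measurable C ->
  measurable (spath i @^-1` C).
Proof. by move=> mC; rewrite -[X in measurable X]setTI; exact: measurable_path. Qed.

Lemma measurable_path0_event (C : set (pathT R)) : measurable C ->
  measurable (spath0 @^-1` C).
Proof. by move=> mC; rewrite -[X in measurable X]setTI; exact: measurable_path0. Qed.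

Lemma cylinder_fdd (Y : R -> Omega -> R) (ts : seq R) (B : R -> set R) :
  (fun w t => Y t w) @^-1` (cylinder ts B) =
  fdd_event Y (fun l : 'I_(size ts) => nth 0 ts l) (fun l => B (nth 0 ts l)).
Proof.
apply/seteqP; split => [w H l _|w H t tt]; first by apply: H; rewrite mem_nth.
have ti : (index t ts < size ts)%N by rewrite index_mem.
by have := H (Ordinal ti) I; rewrite /= /preimage/= nth_index.
Qed.

Lemma path_law i (C : set (pathT R)) : measurable C ->
  pr (spath i @^-1` C) = pr (spath0 @^-1` C).
Proof.
have [_ [idd _]] := iid.
apply: (law_ext (measurable_path i) measurable_path0 (G := cylinders)) => //.
  exact: cylinders_setI.
move=> _ [ts [B [ts0 mB ->]]]; congr fine.
by rewrite !cylinder_fdd; apply: idd => // l; apply: ts0; exact: mem_nth.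
Qed.

Definition plaw (C : set (pathT R)) : R := pr (spath0 @^-1` C).

Definition cyl_events (i : nat) : set (set Omega) :=
  [set A | exists2 C, cylinders C & A = spath i @^-1` C].

(** The hypothesis on the copies concerns one list of times common to all of them. The lists of the
    given cylinders are therefore concatenated, and each copy is left free at the times that it did
    not constrain. *)
Lemma cyl_events_prod n (A : nat -> set Omega) : (forall i, cyl_events i (A i)) ->
  pr (\bigcap_(i in [set i | (i < n)%N]) A i) = \prod_(i < n) pr (A i).
Proof.
move=> HA; have [mXs [_ prodX]] := iid.
have /choice[tB tBP] : forall i, exists tB : seq R * (R -> set R),
    [/\ (forall t, t \in tB.1 -> 0 <= t), (forall t, measurable (tB.2 t)) &
     A i = spath i @^-1` cylinder tB.1 tB.2].
  by move=> i; have [_ [ts [B [h1 h2 ->]]] ->] := HA i; exists (ts, B).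
pose TS := flatten [seq (tB i).1 | i <- iota 0 n].
pose BB i t := if t \in (tB i).1 then (tB i).2 t else setT.
have AE i : (i < n)%N -> A i = spath i @^-1` cylinder TS (BB i).
  move=> iN; have [_ _ ->] := tBP i; apply/seteqP; split => w H t tt /=.
    by rewrite /BB; case: ifP => // ti; exact: H.
  have : t \in TS.
    by apply/flattenP; exists (tB i).1 => //; apply: map_f; rewrite mem_iota.
  by move/H; rewrite /BB tt.
have TS0 t : t \in TS -> 0 <= t.
  move=> /flattenP[s /mapP[i _ ->]]; have [h _ _] := tBP i; exact: h.
have mBB i t : measurable (BB i t).
  by rewrite /BB; case: ifP => // _; have [_ h _] := tBP i; exact: h.
have := prodX n (size TS) (fun l => nth 0 TS l) (fun i l => BB i (nth 0 TS l)).
move=> /(_ _ _); rewrite (_ : \bigcap_(i in [set: 'I_n]) _ =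
    \bigcap_(i in [set i | (i < n)%N]) A i); last first.
  apply/seteqP; split => [w H i /= iN|w H i _].
    by have := H (Ordinal iN) I; rewrite -cylinder_fdd AE.
  by rewrite -cylinder_fdd; have := H i (ltn_ord i); rewrite AE.
move=> E; rewrite /pr E; last 2 first.
- by move=> l; apply: TS0; exact: mem_nth.
- by move=> i l; exact: mBB.
rewrite (eq_bigr (fun i : 'I_n => (pr (A i))%:E)); first by rewrite prodEFin.
move=> i _; rewrite -cylinder_fdd AE// -prE//.
rewrite -[X in measurable X]setTI; apply: measurable_path => //.
by apply: sub_sigma_algebra; exists TS, (BB i).
Qed.

Lemma cyl_events_measurable i : cyl_events i `<=` measurable.
Proof.
move=> _ [C cC ->]; rewrite -[X in measurable X]setTI; apply: measurable_path => //.
exact: sub_sigma_algebra.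
Qed.

Lemma cyl_events_setI i : setI_closed (cyl_events i).
Proof.
move=> _ _ [C cC ->] [D cD ->]; exists (C `&` D); last by rewrite preimage_setI.
exact: cylinders_setI.
Qed.

Lemma cyl_events_setT i : cyl_events i setT.
Proof. by exists setT; [exact: cylinders_setT|rewrite preimage_setT]. Qed.

(** [Omega] with the sigma-algebra of the first m copies. Being determined by the past becomes
    ordinary measurability on this type, so the usual closure lemmas apply. *)
Definition past (m : nat) := g_sigma_algebraType (block_rect cyl_events 0 m).

HB.instance Definition _ (m : nat) := Measurable.on (past m).

Lemma block_rect_path lo hi i (C : set (pathT R)) : (lo <= i < hi)%N -> measurable C ->
  <<s block_rect cyl_events lo hi >> (spath i @^-1` C).
Proof.
move=> lih mC.
pose G := [set C : set (R -> R) | <<s block_rect cyl_events lo hi >> (spath i @^-1` C)].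
suff : <<s @cylinders R >> `<=` G by apply.
have [s0 sC sU] := smallest_sigma_algebra setT (block_rect cyl_events lo hi).
apply: smallest_sub.
  split.
  - by rewrite /G/= preimage_set0.
  - by move=> A GA; rewrite /G/= setTD -preimage_setC -setTD; exact: sC.
  - by move=> F GF; rewrite /G/= preimage_bigcup; exact: sU.
move=> D cD; apply: sub_sigma_algebra.
exists (fun j => if j == i then spath i @^-1` D else setT).
  by move=> j; case: eqP => [->|_]; [exists D|exact: cyl_events_setT].
apply/seteqP; split => [w Dw j /= jlh|w H]; first by case: eqP.
by have := H i lih; rewrite eqxx.
Qed.

Lemma past_path m i : (i < m)%N -> measurable_fun setT (spath i : past m -> pathT R).
Proof. by move=> im _ C mC; rewrite setTI; apply: block_rect_path. Qed.

Lemma past_indep m (A : set Omega) (C : set (pathT R)) :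
  measurable (A : set (past m)) -> measurable C ->
  pr (A `&` spath m @^-1` C) = pr A * pr (spath m @^-1` C).
Proof.
move=> mA mC; apply: (@blocks_indep _ _ _ P cyl_events m m.+1) => //.
- exact: cyl_events_setI.
- exact: cyl_events_setT.
- exact: cyl_events_measurable.
- by move=> A' HA'; exact: cyl_events_prod.
- by apply: block_rect_path; rewrite ?leqnn.
Qed.

Lemma Ex_past_indep m (Y : Omega -> R) (y : pathT R -> R) (g h : R -> R) :
  measurable_fun setT (Y : past m -> R) -> measurable_fun setT y ->
  bmf (fun w => g (Y w)) -> bmf (fun w => h (y (spath m w))) ->
  measurable_fun setT g -> measurable_fun setT h ->
  Ex (fun w => g (Y w) * h (y (spath m w))) = Ex (fun w => g (Y w)) * Ex (fun w => h (y (spath m w))).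
Proof.
move=> mY my bg bh mg mh; apply: Ex_indep => // A B mA mB.
rewrite (_ : (fun w => h (y (spath m w))) @^-1` B = spath m @^-1` ((h \o y) @^-1` B))//.
apply: past_indep.
- have : measurable_fun setT (g \o (Y : past m -> R)) by exact: measurableT_comp.
  by move/measurable_preim; apply.
- have : measurable_fun setT (h \o y) by exact: measurableT_comp.
  by move/measurable_preim; apply.
Qed.

Lemma Ex_path i (f : pathT R -> R) : bmf f ->
  Ex (fun w => f (spath i w)) = Ex (fun w => f (spath0 w)).
Proof.
move=> bf; apply: (Ex_law (measurable_path i) measurable_path0 bf) => C mC.
exact: path_law.
Qed.

End iid_paths.

(** * The empirical process indexed by path functionals *)

Section empirical_process.
Context {R : realType} {d : measure_display} {Omega : measurableType d}
  (P : probability Omega R) (X : R -> Omega -> R) (Xs : nat -> R -> Omega -> R).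
Hypothesis mX : forall t, 0 <= t -> measurable_fun setT (X t).
Hypothesis iid : iid_copies P X Xs.
Local Notation pr := (pr P).
Local Notation Ex := (Ex P).
Local Notation path := (spath Xs).
Local Notation path0 := (spath0 X).
Implicit Types (b : pathT R -> R) (C : set (pathT R)).

Definition psum b (m : nat) (w : Omega) : R := \sum_(i < m) b (path i w).

Lemma psumS b m w : psum b m.+1 w = psum b m w + b (path m w).
Proof. by rewrite /psum big_ord_recr. Qed.

Lemma past_psum b m : measurable_fun setT b ->
  measurable_fun setT (psum b m : past Xs m -> R).
Proof.
move=> mb; apply: measurable_sum => i.
by apply: (measurableT_comp mb); exact: past_path.
Qed.

Lemma bmf_path b i : bmf b -> bmf (fun w => b (path i w)).
Proof.
move=> [mb [M bM]]; split; last by exists M.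
by apply: (measurableT_comp mb); exact: measurable_path iid i.
Qed.

Lemma bmf_path0 b : bmf b -> bmf (fun w => b (path0 w)).
Proof.
move=> [mb [M bM]]; split; last by exists M.
by apply: (measurableT_comp mb); exact: measurable_path0.
Qed.

Lemma bmf_psum b m : bmf b -> bmf (psum b m).
Proof. by move=> bb; apply: bmf_sum => i; exact: bmf_path. Qed.

Lemma bmf_expR {d' : measure_display} {T : measurableType d'} (Y : T -> R) :
  bmf Y -> bmf (fun w => expR (Y w)).
Proof.
move=> [mY [M YM]]; split; first exact: measurableT_comp.
by exists (expR M) => w; rewrite ger0_norm ?expR_ge0// ler_expR (le_trans (ler_norm _)).
Qed.

Lemma bmf_sqr {d' : measure_display} {T : measurableType d'} (Y : T -> R) :
  bmf Y -> bmf (fun w => Y w ^+ 2).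
Proof.
move=> bY; rewrite (_ : (fun w => _) = (fun w => Y w * Y w)); first exact: bmfM.
by apply/funext => w; rewrite expr2.
Qed.

Lemma psum_indep b m (g h : R -> R) : bmf b ->
  continuous g -> continuous h -> bmf (fun w => g (psum b m w)) -> bmf (fun x => h (b x)) ->
  Ex (fun w => g (psum b m w) * h (b (path m w))) =
  Ex (fun w => g (psum b m w)) * Ex (fun w => h (b (path0 w))).
Proof.
move=> [mb bb] cg ch bg bh.
have mh := continuous_measurable_fun ch; have mg := continuous_measurable_fun cg.
rewrite -(Ex_path mX iid m bh).
apply: (@Ex_past_indep R d Omega P X Xs iid m (psum b m) b g h) => //.
  exact: past_psum.
exact: (@bmf_path (fun x => h (b x))).
Qed.

Lemma Ex_exp_psum b m : bmf b ->
  Ex (fun w => expR (psum b m w)) = (Ex (fun w => expR (b (path0 w)))) ^+ m.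
Proof.
move=> bb; elim: m => [|m IH].
  by under [X in Ex X]eq_fun do rewrite /psum big_ord0 expR0; rewrite Ex_cst.
under [X in Ex X]eq_fun do rewrite psumS expRD.
rewrite psum_indep// ?IH ?exprSr//; try exact: continuous_expR.
  exact/bmf_expR/bmf_psum.
exact/bmf_expR.
Qed.

Lemma Ex_cos_psum b m : bmf b ->
  Ex (fun w => cos (psum b m.+1 w)) =
    Ex (fun w => cos (psum b m w)) * Ex (fun w => cos (b (path0 w))) -
    Ex (fun w => sin (psum b m w)) * Ex (fun w => sin (b (path0 w))) /\
  Ex (fun w => sin (psum b m.+1 w)) =
    Ex (fun w => sin (psum b m w)) * Ex (fun w => cos (b (path0 w))) +
    Ex (fun w => cos (psum b m w)) * Ex (fun w => sin (b (path0 w))).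
Proof.
move=> bb; have [mb _] := bb; have [mY _] := bmf_psum m bb.
have bcY := bmf_cos mY; have bsY := bmf_sin mY.
have [mp _] := bmf_path m bb.
have bcb := bmf_cos mp; have bsb := bmf_sin mp.
have cc := @continuous_cos R; have cs := @continuous_sin R.
rewrite -!psum_indep//; try exact: bmf_cos; try exact: bmf_sin.
rewrite -ExB; [|exact: bmfM|exact: bmfM].
rewrite -ExD; [|exact: bmfM|exact: bmfM].
by split; congr Ex; apply/funext => w; rewrite psumS ?cosD ?sinD// addrC.
Qed.

Lemma Ex_sqr_psum b m : bmf b -> Ex (fun w => b (path0 w)) = 0 ->
  Ex (fun w => psum b m w ^+ 2) = m%:R * Ex (fun w => b (path0 w) ^+ 2).
Proof.
move=> bb b0.
elim: m => [|m IH].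
  by under [X in Ex X]eq_fun do rewrite /psum big_ord0 expr0n/=; rewrite Ex_cst mul0r.
have bY := bmf_psum m bb; have bp := bmf_path m bb.
under [X in Ex X]eq_fun do rewrite psumS sqrrD.
under [X in Ex X]eq_fun do rewrite -mulr_natl.
have bYp : bmf (fun w => 2%:R * (psum b m w * b (path m w))) by exact/bmfZ/bmfM.
rewrite ExD; [|by apply: bmfD => //; exact: bmf_sqr|exact: bmf_sqr].
rewrite ExD; [|exact: bmf_sqr|by []].
rewrite ExZ; last exact: bmfM.
rewrite IH (psum_indep (g := id) (h := id))//; try by move=> x; exact: cvg_id.
rewrite b0 mulr0 mulr0 addr0 -natr1 mulrDl mul1r; congr (_ + _).
by rewrite -(@Ex_path _ _ _ P X Xs mX iid m (fun x => b x ^+ 2))//; exact: bmf_sqr.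
Qed.

Definition Epath b : R := Ex (fun w => b (path0 w)).

Definition ctr b : pathT R -> R := fun x => b x - Epath b.

Definition vpath b : R := Ex (fun w => (b (path0 w) - Epath b) ^+ 2).

Definition emp (n : nat) b (w : Omega) : R :=
  (Num.sqrt n%:R)^-1 * \sum_(i < n) (b (path i w) - Epath b).

Lemma bmf_ctr b : bmf b -> bmf (ctr b).
Proof. by move=> bb; apply: bmfB => //; exact: bmf_cst. Qed.

Lemma Epath_ctr b : bmf b -> Ex (fun w => ctr b (path0 w)) = 0.
Proof.
move=> bb; rewrite /ctr ExB ?Ex_cst ?subrr//; first exact: bmf_path0.
exact: bmf_cst.
Qed.

Lemma emp_psum n b w : emp n b w = psum (fun x => (Num.sqrt n%:R)^-1 * ctr b x) n w.
Proof. by rewrite /emp mulr_sumr. Qed.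

Lemma bmf_emp n b : bmf b -> bmf (emp n b).
Proof.
move=> bb; rewrite (funext (emp_psum n b)).
by apply: bmf_psum; apply: bmfZ; exact: bmf_ctr.
Qed.

Lemma measurable_emp n b : bmf b -> measurable_fun setT (emp n b).
Proof. by move/(bmf_emp n) => []. Qed.

Lemma Ex_sqr_emp n b : bmf b -> Ex (fun w => emp n.+1 b w ^+ 2) = vpath b.
Proof.
move=> bb; have n0 : 0 < n.+1%:R :> R by rewrite ltr0n.
under [X in Ex X]eq_fun do rewrite emp_psum.
have bz := bmf_ctr bb.
rewrite Ex_sqr_psum; [|exact: bmfZ|]; last first.
  by rewrite ExZ ?Epath_ctr ?mulr0//; exact: bmf_path0.
under [X in _ * Ex X]eq_fun do rewrite exprMn.
rewrite ExZ; last first.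
  by apply: bmf_sqr; exact: bmf_path0.
by rewrite exprVn sqr_sqrtr// mulVKf// gt_eqF.
Qed.

Lemma emp_tail2 n b (L : R) : bmf b -> 0 < L ->
  pr [set w | L < `|emp n.+1 b w|] <= vpath b / L ^+ 2.
Proof.
move=> bb L0; have L20 : 0 < L ^+ 2 by rewrite exprn_gt0.
rewrite ler_pdivlMr// mulrC -(Ex_sqr_emp n bb).
have me := measurable_emp n.+1 bb.
have bs : bmf (fun w => emp n.+1 b w ^+ 2) by apply: bmf_sqr; exact: bmf_emp.
apply: le_trans (markov_pr P bs _ L20); last by move=> w; exact: sqr_ge0.
rewrite ler_pM2l//; apply: pr_le; first exact: measurable_norm_gt.
  by apply: measurable_ge; case: bs.
move=> w /= Lw; rewrite -(real_normK (num_real (emp _ _ _))).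
by rewrite ler_pXn2r// ?nnegrE// ltW.
Qed.

(** The function exp(-z) (1 + z + z^2) has derivative exp(-z) z (1 - z), of the sign of z up to z =
    1; on [-1, 1] it is therefore smallest at 0, where it is 1. *)
Lemma expR_le_quad (y : R) : `|y| <= 1 -> expR y <= 1 + y + y ^+ 2.
Proof.
move=> y1; have /andP[ya yb] : -1 <= y <= 1 by rewrite -ler_norml.
have D1 (z : R) : is_derive z 1 (fun z : R => expR (- z) * (1 + z + z ^+ 2))
   (expR (- z) * (z * (1 - z))).
  by apply: is_derive_eq; rewrite /GRing.scale/= ?mulr0 ?mulr1; ring.
have [c [_ cb E]] := mvt_abs D1 0 y.
suff : 0 <= expR (- y) * (1 + y + y ^+ 2) - 1.
  rewrite subr_ge0 expRN mulrC ler_pdivlMr ?expR_gt0// mul1r; exact.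
move: E; rewrite oppr0 expR0 expr0n/= !addr0 mul1r => ->.
have [y0|y0] := leP 0 y.
  move: cb; rewrite (min_idPl y0) (max_idPr y0) => /andP[c1 c2].
  by rewrite !mulr_ge0 ?expR_ge0//; lra.
move: cb; rewrite (min_idPr (ltW y0)) (max_idPl (ltW y0)) => /andP[c1 c2].
rewrite mulr_le0 ?(ltW y0)// mulr_ge0_le0 ?expR_ge0// mulr_le0_ge0//; lra.
Qed.

Lemma plaw_Epath C : measurable C -> Epath (\1_C) = plaw P X C.
Proof.
move=> mC; rewrite /Epath /plaw -Ex_indic; last exact: measurable_path0_event.
by congr Ex.
Qed.

(** Chernoff's bound. The mass of C enters through the variance p (1 - p) <= p, and this is why
    small sets have small tails. *)
Lemma emp_exp_tail n C (s x sg : R) : measurable C -> `|sg| = 1 ->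
  0 <= s <= Num.sqrt n.+1%:R ->
  pr [set w | x <= sg * emp n.+1 (\1_C) w] <= expR (s ^+ 2 * plaw P X C - s * x).
Proof.
move=> mC sg1 /andP[s0 sn].
have bC : bmf (\1_C : pathT R -> R) by exact: bmf_indic.
have n0 : 0 < Num.sqrt n.+1%:R :> R by rewrite sqrtr_gt0 ltr0n.
(* The restriction s <= sqrt(n + 1) gives |th| <= 1, the range in which exp is bounded by a
   quadratic. *)
pose th := sg * s / Num.sqrt n.+1%:R.
have th1 : `|th| <= 1.
  by rewrite /th !normrM sg1 mul1r normfV !ger0_norm// ?(ltW n0)// ler_pdivrMr// mul1r.
pose b z := th * ctr (\1_C) z.
have bb : bmf b by apply: bmfZ; exact: bmf_ctr.
have p1 : 0 <= plaw P X C <= 1.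
  by rewrite pr_ge0 pr_le1//; exact: measurable_path0_event.
have eqb w : s * (sg * emp n.+1 (\1_C) w) = psum b n.+1 w.
  rewrite /emp /psum /b -mulr_sumr /th /ctr; ring.
have c1 z : `|ctr \1_C z| <= 1.
  rewrite /ctr plaw_Epath// indicE ler_norml; case: (_ \in _) => /=; move: p1; lra.
have ble : Ex (fun w => expR (b (path0 w))) <= expR (th ^+ 2 * plaw P X C).
  apply: (@le_trans _ _ (Ex (fun w => 1 + b (path0 w) + th ^+ 2 * ctr \1_C (path0 w) ^+ 2))).
    apply: Ex_le.
    - exact/bmf_expR/bmf_path0.
    - apply: bmfD; first by apply: bmfD; [exact: bmf_cst|exact: bmf_path0].
      by apply: bmfZ; apply: bmf_sqr; apply: bmf_path0; exact: bmf_ctr.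
    - move=> w; have := @expR_le_quad (b (path0 w)).
      rewrite /b exprMn; apply; rewrite normrM mulr_ile1//.
  have bc := bmf_ctr bC.
  have bq : bmf (fun w => ctr \1_C (path0 w) ^+ 2) by apply: bmf_sqr; exact: bmf_path0.
  have bb0 := bmf_path0 bb.
  rewrite ExD; [|by apply: bmfD; [exact: bmf_cst|]|exact: bmfZ].
  rewrite ExD; [|exact: bmf_cst|by []].
  rewrite Ex_cst /b ExZ; last exact: (bmf_path0 bc).
  rewrite Epath_ctr// mulr0 addr0 ExZ//.
  rewrite (le_trans _ (expR_ge1Dx _))// lerD2l ler_wpM2l ?sqr_ge0//.
  rewrite (_ : Ex _ = plaw P X C * (1 - plaw P X C)).
    by rewrite ler_piMr; move: p1; lra.
  have -> : Ex (fun w => ctr \1_C (path0 w) ^+ 2) =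
     Ex (fun w => (1 - plaw P X C *+ 2) * \1_C (path0 w) + plaw P X C ^+ 2).
    congr Ex; apply/funext => w; rewrite /ctr plaw_Epath// indicE.
    by case: (_ \in _) => /=; ring.
  rewrite ExD; [|exact/bmfZ/bmf_path0|exact: bmf_cst].
  rewrite ExZ; last exact: bmf_path0.
  rewrite Ex_cst [X in _ * X + _](_ : _ = plaw P X C); first by ring.
  by rewrite -plaw_Epath.
have := Ex_exp_psum n.+1 bb => E.
have bE : bmf (fun w => expR (psum b n.+1 w)) by exact/bmf_expR/bmf_psum.
have e0 : 0 < expR (s * x) by exact: expR_gt0.
rewrite expRD expRN ler_pdivlMr// mulrC.
apply: (@le_trans _ _ (Ex (fun w => expR (psum b n.+1 w)))).
  apply: le_trans (markov_pr P bE _ e0); last by move=> w; exact: expR_ge0.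
  rewrite ler_pM2l//; apply: pr_le.
  - by apply: measurable_ge; apply: measurable_funM => //; exact: measurable_emp.
  - by apply: measurable_ge; case: bE.
  - by move=> w /= xw; rewrite ler_expR -eqb ler_wpM2l.
rewrite E (le_trans (lerXn2r _ _ _ ble)) ?nnegrE ?expR_ge0//.
  by apply: Ex_ge0 => w; exact: expR_ge0.
rewrite -expRM_natl ler_expR le_eqVlt; apply/orP; left; apply/eqP.
rewrite /th exprMn exprVn sqr_sqrtr// exprMn -(real_normK (num_real sg)) sg1 expr1n.
by field; rewrite nat1r; rewrite gt_eqF// ltr0n.
Qed.

Lemma expRN_quad (v : R) : 0 <= v -> `|1 - v - expR (- v)| <= v ^+ 2.
Proof.
move=> v0; have h1 := expR_ge1Dx (- v).
have h2 : expR (- v) * (1 + v) <= 1.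
  rewrite expRN mulrC ler_pdivrMr ?expR_gt0// mul1r; exact: expR_ge1Dx.
have := expR_ge0 (- v); set e := expR _ in h1 h2 * => e0.
by rewrite ler_norml; apply/andP; split; nra.
Qed.

(* With Z_m the sum of m independent copies, the pair
   (E cos Z_m, E sin Z_m) follows the complex recursion phi_(m+1) = phi_m phi_1. *)
Lemma clt_bound n b (M : R) : bmf b -> (forall x, `|ctr b x| <= M) ->
  `|Ex (fun w => cos (emp n.+1 b w)) - expR (- (vpath b / 2))| + `|Ex (fun w => sin (emp n.+1 b w))| <=
  (M ^+ 4 + M ^+ 3) * (Num.sqrt n.+1%:R)^-1.
Proof.
move=> bb bM; set g := expR _; set rn := Num.sqrt n.+1%:R.
have rn0 : 0 < rn by rewrite sqrtr_gt0 ltr0n.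
have rn1 : 1 <= rn by rewrite -sqrtr1 ler_wsqrtr// ler1n.
have rn2 : rn ^+ 2 = n.+1%:R by rewrite sqr_sqrtr.
have M0 : 0 <= M by rewrite (le_trans _ (bM (fun=> 0))).
have v0 : 0 <= vpath b by apply: Ex_ge0 => w; exact: sqr_ge0.
have bc := bmf_ctr bb.
have sqb : bmf (fun w => ctr b (path0 w) ^+ 2) by apply: bmf_sqr; exact: bmf_path0.
have vM : vpath b <= M ^+ 2.
  apply: (le_trans (ler_norm _)); apply: Ex_bound; first by case: sqb.
  by move=> w; rewrite normrX ler_pXn2r// ?nnegrE//; exact: bM.
pose th := rn^-1; have th0 : 0 < th by rewrite invr_gt0.
have th1 : th <= 1 by rewrite invf_le1.
pose b1 x := th * ctr b x.
have bb1 : bmf b1 by exact: bmfZ.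
have [mb1 _] := bmf_path0 bb1.
pose c := Ex (fun w => cos (b1 (path0 w))); pose s := Ex (fun w => sin (b1 (path0 w))).
(* [e] is the Gaussian characteristic function of a single summand, so that [e ^+ n.+1] is exactly
   the target [g]. *)
pose v := vpath b * th ^+ 2 / 2; pose e := expR (- v).
have b1M w : `|b1 (path0 w)| <= M * th.
  by rewrite normrM gtr0_norm// mulrC ler_wpM2r// ltW.
have ce : `|c - e| <= M ^+ 4 * th ^+ 4.
  have : `|c - (1 - v)| <= M ^+ 4 * th ^+ 4 / 2.
    have -> : c - (1 - v) = Ex (fun w => cos (b1 (path0 w)) - (1 - b1 (path0 w) ^+ 2 / 2)).
      have -> : (fun w => cos (b1 (path0 w)) - (1 - b1 (path0 w) ^+ 2 / 2)) =
         (fun w => cos (b1 (path0 w)) - (1 - (th ^+ 2 / 2) * ctr b (path0 w) ^+ 2)).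
        by apply/funext => w; rewrite /b1; ring.
      rewrite ExB; [|exact: bmf_cos|by apply: bmfB; [exact: bmf_cst|exact: bmfZ]].
      rewrite ExB; [|exact: bmf_cst|exact: bmfZ].
      by rewrite Ex_cst ExZ// /v /vpath -/(ctr _) /c; ring.
    apply: Ex_bound.
      apply: measurable_funB; first by case: (bmf_cos mb1).
      apply: measurable_funB => //; apply: measurable_funM => //.
      exact: measurable_funX.
    move=> w; apply: le_trans (cos_taylor _) _; rewrite ler_pM2r ?invr_gt0//.
    rewrite -exprMn (_ : b1 (path0 w) ^+ 4 = `|b1 (path0 w)| ^+ 4); last first.
      by rewrite -normrX ger0_norm// exprn_even_ge0.
    by rewrite ler_pXn2r// ?nnegrE// mulr_ge0// ltW.
  have vv0 : 0 <= v by rewrite /v divr_ge0// mulr_ge0// sqr_ge0.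
  have := expRN_quad vv0; rewrite -/e.
  have : v ^+ 2 <= M ^+ 4 * th ^+ 4 / 4.
    have : v <= M ^+ 2 * th ^+ 2 / 2.
      by rewrite ler_pM2r ?invr_gt0// ler_wpM2r// sqr_ge0.
    rewrite -(ler_pXn2r (n := 2))// ?nnegrE//; last first.
      by rewrite divr_ge0// mulr_ge0 ?sqr_ge0.
    by move/le_trans; apply; rewrite le_eqVlt; apply/orP; left; apply/eqP; field.
  have : 0 <= M ^+ 4 * th ^+ 4 by rewrite mulr_ge0// exprn_ge0// ltW.
  set Q := M ^+ 4 * th ^+ 4; rewrite !ler_norml => h0 h1 /andP[? ?] /andP[? ?].
  by apply/andP; split; lra.
have se : `|s| <= M ^+ 3 * th ^+ 3 / 2.
  have -> : s = Ex (fun w => sin (b1 (path0 w)) - b1 (path0 w)).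
    rewrite ExB; [|exact: bmf_sin|exact: bmf_path0].
    by rewrite ExZ ?Epath_ctr ?mulr0 ?subr0//; exact: bmf_path0.
  apply: Ex_bound; first by apply: measurable_funB => //; case: (bmf_sin mb1).
  move=> w; apply: le_trans (sin_taylor _) _; rewrite ler_pM2r ?invr_gt0// -exprMn.
  by rewrite ler_pXn2r// ?nnegrE// mulr_ge0// ltW.
have c1 : `|c| <= 1 by apply: Ex_bound; [case: (bmf_cos mb1)|move=> w; exact: cos_max].
have e01 : 0 <= e <= 1.
  rewrite expR_ge0/= -[leRHS]expR0 ler_expR oppr_le0 divr_ge0// mulr_ge0// sqr_ge0//.
(* All factors are at most 1 in absolute value, so the errors of the single steps merely add up
   along the recursion. *)
have H m : `|Ex (fun w => cos (psum b1 m w)) - e ^+ m| + `|Ex (fun w => sin (psum b1 m w))|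
   <= m%:R * (`|c - e| + 2 * `|s|).
  elim: m => [|m IH].
    under [X in `|Ex X - _|]eq_fun do rewrite /psum big_ord0 cos0.
    under [X in _ + `|Ex X|]eq_fun do rewrite /psum big_ord0 sin0.
    by rewrite !Ex_cst expr0 subrr normr0 mul0r addr0.
  have [-> ->] := Ex_cos_psum m bb1; rewrite -/c -/s.
  have [mps _] := bmf_psum m bb1.
  have Cm1 : `|Ex (fun w => cos (psum b1 m w))| <= 1.
    by apply: Ex_bound; [case: (bmf_cos mps)|move=> w; exact: cos_max].
  have Sm1 : `|Ex (fun w => sin (psum b1 m w))| <= 1.
    by apply: Ex_bound; [case: (bmf_sin mps)|move=> w; exact: sin_max].
  set Cm := Ex _ in IH Cm1 *; set Sm := Ex _ in IH Sm1 *.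
  have -> : Cm * c - Sm * s - e ^+ m.+1 = (Cm - e ^+ m) * c + e ^+ m * (c - e) - Sm * s.
    by rewrite exprS; ring.
  have em : `|e ^+ m| <= 1 by case/andP: e01 => ? ?; rewrite ger0_norm ?exprn_ge0// exprn_ile1.
  have le1 (x y : R) : `|y| <= 1 -> `|x * y| <= `|x| by move=> ?; rewrite normrM ler_piMr.
  have := le1 (Cm - e ^+ m) _ c1; have := le1 (c - e) _ em; rewrite [(c - e) * _]mulrC.
  have := le1 s _ Sm1; have := le1 s _ Cm1; rewrite ![s * _]mulrC; have := le1 Sm _ c1.
  have := ler_normB ((Cm - e ^+ m) * c + e ^+ m * (c - e)) (Sm * s).
  have := ler_normD ((Cm - e ^+ m) * c) (e ^+ m * (c - e)).
  have := ler_normD (Sm * c) (Cm * s).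
  by move: IH; rewrite -natr1 mulrDl mul1r; lra.
have := H n.+1.
have -> : e ^+ n.+1 = g.
  rewrite -expRM_natl /g; congr expR; rewrite /v /th exprVn rn2.
  by field; rewrite nat1r gt_eqF// ltr0n.
have Ec (f : R -> R) : (fun w => f (emp n.+1 b w)) = (fun w => f (psum b1 n.+1 w)).
  by apply/funext => w; rewrite emp_psum.
rewrite !Ec => /le_trans; apply.
have -> : n.+1%:R = th ^- 2 :> R by rewrite /th exprVn invrK rn2.
have tn0 : th != 0 by rewrite gt_eqF.
apply: (@le_trans _ _ (th ^- 2 * (M ^+ 4 * th ^+ 4 + M ^+ 3 * th ^+ 3))).
  rewrite ler_wpM2l ?invr_ge0 ?exprn_ge0 ?(ltW th0)//.
  by move: ce se; lra.
rewrite (_ : th ^- 2 * _ = M ^+ 4 * th * th + M ^+ 3 * th); last by field.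
rewrite mulrDl lerD2r -mulrA ler_wpM2l ?exprn_ge0//.
by rewrite -[leRHS]mulr1 ler_wpM2l// ltW.
Qed.

Lemma emp_clt b : bmf b ->
  Ex (fun w => cos (emp n.+1 b w)) @[n --> \oo] --> expR (- (vpath b / 2)) /\
  Ex (fun w => sin (emp n.+1 b w)) @[n --> \oo] --> (0 : R).
Proof.
move=> bb; have [_ [M bM]] := bmf_ctr bb.
pose K := M ^+ 4 + M ^+ 3.
have M0 : 0 <= M by rewrite (le_trans _ (bM (fun=> 0))).
have K0 : 0 <= K by rewrite addr_ge0// exprn_ge0.
have H n := clt_bound n bb bM.
have near_small (e : R) : 0 < e -> \forall n \near \oo, K * (Num.sqrt n.+1%:R)^-1 <= e.
  move=> e0; near=> n.
  rewrite ler_pdivrMr ?sqrtr_gt0 ?ltr0n// mulrC -ler_pdivrMr//.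
  rewrite -[leLHS](@ger0_norm _ (K / e)) ?divr_ge0 ?(ltW e0)// -sqrtr_sqr ler_wsqrtr//.
  by near: n; exact: near_natS_ge.
split; apply/cvgrPdist_le => e e0; near=> n.
  rewrite distrC; apply: le_trans (_ : K * (Num.sqrt n.+1%:R)^-1 <= e); last first.
    by near: n; exact: near_small.
  by apply: le_trans (H n); rewrite lerDl.
rewrite sub0r normrN; apply: le_trans (_ : K * (Num.sqrt n.+1%:R)^-1 <= e); last first.
  by near: n; exact: near_small.
by apply: le_trans (H n); rewrite lerDr.
Unshelve. all: by end_near. Qed.

(** The Cramer-Wold device: a linear combination of coordinates is again an empirical process at one
    function, so the one-dimensional limit theorem covers all finite-dimensional laws. *)
Lemma emp_linear n k (a : 'I_k -> R) (b : 'I_k -> pathT R -> R) w :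
  (forall j, bmf (b j)) ->
  dot a (fun j => emp n (b j) w) = emp n (fun x => \sum_j a j * b j x) w.
Proof.
move=> bb; rewrite /dot /emp.
have E : Epath (fun x => \sum_j a j * b j x) = \sum_j a j * Epath (b j).
  rewrite /Epath Ex_sum; last by move=> j; apply: bmfZ; exact: bmf_path0.
  by apply: eq_bigr => j _; rewrite ExZ//; exact: bmf_path0.
rewrite E.
under [in LHS]eq_bigr do rewrite mulrCA.
rewrite -mulr_sumr; congr (_ * _).
under [in LHS]eq_bigr do rewrite mulr_sumr.
rewrite exchange_big/=; apply: eq_bigr => i _.
by rewrite -sumrB; apply: eq_bigr => j _; rewrite mulrBr.
Qed.

Definition cpath (b b' : pathT R -> R) : R :=
  Ex (fun w => (b (path0 w) - Epath b) * (b' (path0 w) - Epath b')).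

Lemma vpath_linear k (a : 'I_k -> R) (b : 'I_k -> pathT R -> R) :
  (forall j, bmf (b j)) ->
  vpath (fun x => \sum_j a j * b j x) = \sum_i \sum_j a i * a j * cpath (b i) (b j).
Proof.
move=> bb.
have bc j : bmf (fun w => b j (path0 w) - Epath (b j)).
  by apply: bmfB; [exact: bmf_path0|exact: bmf_cst].
have E : Epath (fun x => \sum_j a j * b j x) = \sum_j a j * Epath (b j).
  rewrite /Epath Ex_sum; last by move=> j; apply: bmfZ; exact: bmf_path0.
  by apply: eq_bigr => j _; rewrite ExZ//; exact: bmf_path0.
rewrite /vpath E (_ : (fun w => _) = (fun w => \sum_i \sum_j (a i * a j) *
   ((b i (path0 w) - Epath (b i)) * (b j (path0 w) - Epath (b j))))).
  rewrite Ex_sum; last first.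
    by move=> i; apply: bmf_sum => j; apply: bmfZ; exact: bmfM.
  apply: eq_bigr => i _; rewrite Ex_sum; last by move=> j; apply: bmfZ; exact: bmfM.
  by apply: eq_bigr => j _; rewrite ExZ//; exact: bmfM.
apply/funext => w; rewrite -sumrB expr2 mulr_suml; apply: eq_bigr => i _.
rewrite mulr_sumr; apply: eq_bigr => j _; ring.
Qed.
End empirical_process.

(** * Bracketing chaining *)

Section chaining_numbers.
Context {R : realType}.

Lemma ex_pow4 (x : R) : 1 <= x -> exists k : nat, 4 ^+ k <= x < 4 ^+ k.+1.
Proof.
move=> x1.
have ex : exists m : nat, x < 4 ^+ m.
  exists (Num.bound x); apply: (@lt_le_trans _ _ (Num.bound x)%:R).
    by rewrite archi_boundP// (le_trans _ x1).
  rewrite -natrX ler_nat; exact: ltnW (ltn_expl _ _).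
case: (ex_minnP ex) => -[|m] xm mmin; first by move: xm; rewrite expr0 ltNge x1.
exists m; rewrite xm andbT leNgt; apply/negP => /mmin; by rewrite ltnn.
Qed.

(** From exp y >= (y / j)^j. With j = 2 D + 1 the power 2^j is at least 2 D, which leaves a factor
    2^-k to sum over the levels, and M <= M^j leaves the factor 1 / M. *)
Lemma expRN_superpoly (D : nat) : exists2 K : R, 0 < K & forall (k : nat) (M : R),
  1 <= M -> D%:R ^+ k * expR (- (M * 2 ^+ k)) <= K * 2 ^- k / M.
Proof.
pose j := (D.*2).+1; exists (j%:R ^+ j) => [|k M M1].
  by rewrite exprn_gt0// ltr0n.
have M0 : 0 < M by apply: lt_le_trans M1.
have k0 : 0 < 2 ^+ k :> R by rewrite exprn_gt0.
have j0 : 0 < j%:R :> R by rewrite ltr0n.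
set y := M * 2 ^+ k; have y0 : 0 < y by rewrite mulr_gt0.
have ey : (y / j%:R) ^+ j <= expR y.
  have -> : expR y = expR (y / j%:R) ^+ j.
    by rewrite -expRM_natl; congr expR; field; rewrite gt_eqF.
  apply: lerXn2r; rewrite ?nnegrE ?expR_ge0 ?divr_ge0 ?(ltW y0) ?(ltW j0)//.
  by rewrite (le_trans _ (expR_ge1Dx _))// lerDr.
rewrite expRN -mulrA -invfM ler_pdivrMr ?expR_gt0//.
rewrite mulrAC ler_pdivlMr ?mulr_gt0//.
apply: le_trans (ler_wpM2l (exprn_ge0 _ (ltW j0)) ey).
rewrite -exprMn (_ : j%:R * (y / j%:R) = y); last by field; rewrite gt_eqF.
rewrite /y exprMn mulrA mulrC.
have Mj : M <= M ^+ j by rewrite -{1}(expr1 M) ler_weXn2l.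
apply: ler_pM => //; rewrite ?mulr_ge0 ?exprn_ge0 ?(ltW M0)//.
rewrite -exprMn -exprM mulnC exprM lerXn2r ?nnegrE ?mulr_ge0 ?exprn_ge0//.
rewrite -natrX -natrM ler_nat /j expnS mulnC leq_mul2l/=.
by apply: leq_trans (ltnW (ltn_expl D (ltnSn 1))) _; rewrite leq_exp2l// -addnn leq_addr.
Qed.

Lemma sum_half_le (k0 p : nat) : \sum_(m < p) 2 ^- (k0 + m) <= 2 * 2 ^- k0 :> R.
Proof.
suff -> : \sum_(m < p) 2 ^- (k0 + m) = 2 * 2 ^- k0 - 2 * 2 ^- (k0 + p) :> R.
  by rewrite gerBl mulr_ge0// invr_ge0 exprn_ge0.
elim: p => [|p IH]; first by rewrite big_ord0 addn0 subrr.
rewrite big_ord_recr/= IH addnS exprS invfM; field.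
by rewrite !expf_neq0.
Qed.

End chaining_numbers.

Lemma bigsetU_intro (T : Type) (n : nat) (F : nat -> set T) (i : nat) w :
  (i < n)%N -> F i w -> (\big[setU/set0]_(i < n) F i) w.
Proof. by move=> iN Fi; rewrite -(bigcup_mkord _ F); exists i. Qed.

Section chaining.
Context {R : realType} {d : measure_display} {Omega : measurableType d}
  (P : probability Omega R) (X : R -> Omega -> R) (Xs : nat -> R -> Omega -> R).
Hypothesis mX : forall t, 0 <= t -> measurable_fun setT (X t).
Hypothesis iid : iid_copies P X Xs.
Variable good : set (pathT R).
Hypothesis goodXs : forall i w, good (spath Xs i w).
Hypothesis goodX : forall w, good (spath0 X w).
Local Notation pr := (pr P).
Local Notation plaw := (plaw P X).
Local Notation nu n C := (emp P X Xs n (\1_C)).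
Implicit Types (A B C E L U : set (pathT R)).

Lemma plaw_ge0 A : 0 <= plaw A. Proof. exact: pr_ge0. Qed.

Lemma plaw_le A B : measurable A -> measurable B ->
  (forall g, good g -> A g -> B g) -> plaw A <= plaw B.
Proof.
move=> mA mB AB; apply: pr_le; try exact: measurable_path0_event.
by move=> w; apply: AB.
Qed.

Lemma plawU_le A B : measurable A -> measurable B -> plaw (A `|` B) <= plaw A + plaw B.
Proof.
move=> mA mB; rewrite /plaw preimage_setU; apply: prU_le; exact: measurable_path0_event.
Qed.

Lemma plawDI A B : measurable A -> measurable B ->
  plaw A = plaw (A `\` B) + plaw (A `&` B).
Proof.
move=> mA mB; rewrite /plaw (prDI P (measurable_path0_event mX mA) (measurable_path0_event mX mB)).
by congr (pr _ + pr _).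
Qed.

Lemma nuD n A B w : measurable A -> measurable B ->
  nu n A w - nu n B w = nu n (A `\` B) w - nu n (B `\` A) w.
Proof.
move=> mA mB; have mAB := measurableD mA mB; have mBA := measurableD mB mA.
rewrite /emp !plaw_Epath// -!mulrBr -!sumrB; congr (_ * _); apply: eq_bigr => i _.
have := plawDI mA mB; have := plawDI mB mA; rewrite [B `&` A]setIC => h1 h2.
suff : \1_A (spath Xs i w) - \1_B (spath Xs i w) =
       \1_(A `\` B) (spath Xs i w) - \1_(B `\` A) (spath Xs i w) :> R.
  by rewrite h1 h2; lra.
rewrite !indicE; have [ia|ia] := boolP (spath Xs i w \in A);
  have [ib|ib] := boolP (spath Xs i w \in B); rewrite !in_setD ?ia ?ib ?(negPf ia) ?(negPf ib)/=; lra.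
Qed.

(** The number of samples in A but not in L lies between 0 and the number in U but not in L. The
    centrings differ by at most the mass of the bracket, which normalization multiplies by sqrt(n +
    1). *)
Lemma nu_bracket n L U A w : measurable L -> measurable U -> measurable A ->
  (forall g, good g -> L g -> A g) -> (forall g, good g -> A g -> U g) ->
  `|nu n.+1 A w - nu n.+1 L w| <=
    `|nu n.+1 (U `\` L) w| + Num.sqrt n.+1%:R * plaw (U `\` L).
Proof.
move=> mL mU mA LA AU; have mUL := measurableD mU mL.
have n0 : 0 < n.+1%:R :> R by rewrite ltr0n.
set r := Num.sqrt _; have r0 : 0 < r by rewrite sqrtr_gt0.
have rr : r = r^-1 * n.+1%:R.
  by rewrite -[X in _ * X](@sqr_sqrtr _ n.+1%:R)// expr2 mulKf// gt_eqF.
set pe := plaw _.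
have hp : 0 <= plaw A - plaw L <= pe.
  have h1 := plaw_le mL mA LA.
  have := plawDI mA mL; have : plaw (A `&` L) <= plaw L.
    by apply: plaw_le => //; [exact: measurableI|move=> g _ []].
  have : plaw (A `\` L) <= pe.
    by apply: plaw_le => //; [exact: measurableD|move=> g gg [/(AU _ gg) ? ?]].
  by lra.
have pe0 : 0 <= pe := plaw_ge0 _.
rewrite /emp !plaw_Epath// -mulrBr -sumrB -/pe.
set S := (\sum_(i < n.+1) _ in leLHS); set T := (\sum_(i < n.+1) _ in leRHS).
have ub : S <= T + n.+1%:R * pe.
  rewrite /S /T (_ : n.+1%:R * pe = \sum_(i < n.+1) pe); last first.
    by rewrite sumr_const card_ord mulr_natl.
  rewrite -big_split/= ler_sum// => i _; rewrite !indicE.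
  have gi := goodXs i w.
  have [ia|ia] := boolP (spath Xs i w \in A); have [il|il] := boolP (spath Xs i w \in L);
    rewrite in_setD ?il ?andbF ?andbT/=; try lra.
    by move: ia; rewrite inE => /(AU _ gi)/mem_set -> /=; lra.
  by case: (_ \in U) => /=; lra.
have lb : - (n.+1%:R * pe) <= S.
  rewrite /S (_ : - (n.+1%:R * pe) = \sum_(i < n.+1) (- pe)); last first.
    by rewrite sumr_const card_ord mulr_natl mulNrn.
  rewrite ler_sum// => i _; rewrite !indicE; have gi := goodXs i w.
  have [il|il] := boolP (spath Xs i w \in L).
    by move: il; rewrite inE => /(LA _ gi)/mem_set -> /=; lra.
  by case: (_ \in A) => /=; lra.
rewrite [X in _ <= _ + X * _]rr -/r !normrM normfV (gtr0_norm r0).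
rewrite -mulrA -mulrDr ler_pM2l ?invr_gt0//.
have := ler_norm T; have := normr_ge0 T; rewrite ler_norml => ? ?.
have : 0 <= n.+1%:R * pe by rewrite mulr_ge0.
by move=> ?; apply/andP; split; lra.
Qed.

(** A geometric entropy condition; [c k a] selects the bracket of [A a] at level k. Inclusions are
    asked on [good] paths only, as they will rest on right-continuity. *)
Definition bracketed (C0 D : nat) (C : R) (Th : Type) (A : Th -> set (pathT R)) : Prop :=
  exists (c : nat -> Th -> nat) (L U : nat -> nat -> set (pathT R)),
  [/\ (forall k j, measurable (L k j)), (forall k j, measurable (U k j)),
      (forall k a, (c k a < C0 * D ^ k)%N),
      (forall k a g, good g -> (L k (c k a) g -> A a g) /\ (A a g -> U k (c k a) g)) &
      (forall k a, plaw (U k (c k a) `\` L k (c k a)) <= C * 16 ^- k)].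

(** The exponential inequality at s = 4^k: s^2 times the mass stays below C, and s times the
    threshold M 2^-k is M 2^k. *)
Lemma nu_link_tail n k E (C M : R) : measurable E -> 4 ^+ k <= Num.sqrt n.+1%:R :> R ->
  plaw E <= C * 16 ^- k ->
  pr [set w | M * 2 ^- k <= `|nu n.+1 E w|] <= 2 * expR C * expR (- (M * 2 ^+ k)).
Proof.
move=> mE kn pE.
have mnu : measurable_fun setT (nu n.+1 E).
  by apply: (measurable_emp iid); exact: bmf_indic.
have h (sg : R) : `|sg| = 1 ->
    pr [set w | M * 2 ^- k <= sg * nu n.+1 E w] <= expR C * expR (- (M * 2 ^+ k)).
  move=> sg1; have s0 : 0 <= (4 : R) ^+ k <= Num.sqrt n.+1%:R by rewrite kn exprn_ge0.
  apply: le_trans (emp_exp_tail mX iid (M * 2 ^- k) mE sg1 s0) _.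
  rewrite -expRD ler_expR.
  have -> : 4 ^+ k * (M * 2 ^- k) = M * 2 ^+ k :> R.
    rewrite (_ : 4 = 2 * 2 :> R) ?exprMn; last by rewrite -natrM.
    by field; rewrite expf_neq0.
  rewrite lerD2r -exprM mulnC exprM (_ : 4 ^+ 2 = 16); last by rewrite -natrX.
  apply: le_trans (ler_wpM2l _ pE) _; first by rewrite exprn_ge0.
  by rewrite mulrCA divff ?mulr1// expf_neq0.
have m1 := measurable_ge mnu (M * 2 ^- k).
have m2 : measurable [set w | M * 2 ^- k <= -1 * nu n.+1 E w].
  by apply: measurable_ge; exact: measurable_funM.
rewrite (_ : [set w | _] = [set w | M * 2 ^- k <= nu n.+1 E w] `|`
   [set w | M * 2 ^- k <= -1 * nu n.+1 E w]); last first.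
  by apply/seteqP; split => w /=; rewrite ler_normr mulN1r => /orP.
apply: le_trans (prU_le _ m1 m2) _.
have := h 1 (normr1 _); have := h (-1) (normrN1 _).
have -> : [set w | M * 2 ^- k <= 1 * nu n.+1 E w] = [set w | M * 2 ^- k <= nu n.+1 E w].
  by apply/seteqP; split => w /=; rewrite mul1r.
by lra.
Qed.

Lemma pr_union_le (N : nat) (F : nat -> set Omega) (x : R) :
  (forall i, measurable (F i)) -> (forall i, (i < N)%N -> pr (F i) <= x) ->
  pr (\big[setU/set0]_(i < N) F i) <= N%:R * x.
Proof.
move=> mF Fx; apply: le_trans (pr_bigsum_le _ _ mF) _.
by rewrite mulr_natl -[X in _ *+ X]card_ord -sumr_const ler_sum// => i _; exact: Fx.
Qed.

(** For each index the lower brackets of levels k0 to kn are telescoped, the last one is compared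
    with the set itself, and two indices are compared through their brackets at level k0. Only
    finitely many set differences occur, so one exceptional event serves all indices. *)
Lemma chaining (C0 D : nat) (C : R) : (0 < D)%N -> 0 <= C -> exists2 K : R, 0 < K &
  forall (Th : Type) (A : Th -> set (pathT R)),
  (forall a, measurable (A a)) -> bracketed C0 D C A ->
  forall n (M : R) k0, 1 <= M -> 4 ^+ k0 <= Num.sqrt n.+1%:R :> R ->
  exists Bad : set Omega, [/\ measurable Bad, pr Bad <= K * 2 ^- k0 / M &
    forall w, ~ Bad w -> forall a b, plaw (A a `\` A b) <= C * 16 ^- k0 ->
      plaw (A b `\` A a) <= C * 16 ^- k0 ->
      `|nu n.+1 (A a) w - nu n.+1 (A b) w| <=
      K * (M * 2 ^- k0 + (Num.sqrt n.+1%:R)^-1)].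
Proof.
move=> D0 C_ge0; have [K1 K10 HK1] := @expRN_superpoly R (D ^ 2).
(* One range for the bracket indices of levels k and k + 1, since a link joins the two. *)
pose N k := (C0 * D ^ k.+1)%N.
pose K2 : R := (C0 * D)%:R ^+ 2 * (8 * expR (2 * C)) * K1.
have K20 : 0 <= K2 by rewrite !mulr_ge0// ?expR_ge0// ltW.
pose K := 2 * K2 + 12 + 64 * C; exists K; first by rewrite /K; lra.
move=> Th A mA [c [L [U [mL mU cN LAU pUL]]]] n M k0 M1 k0n.
have M0 : 0 < M by lra.
set r := Num.sqrt n.+1%:R in k0n *.
have r0 : 0 < r by rewrite sqrtr_gt0 ltr0n.
have r2 : r ^+ 2 = n.+1%:R by rewrite sqr_sqrtr.
have [|kn /andP[knr rkn]] := @ex_pow4 _ r.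
  by rewrite -sqrtr1 ler_wsqrtr// ler1n.
have k0kn : (k0 <= kn)%N.
  rewrite -ltnS -(ltr_eXn2l (x := 4 : R)) ?ltr1n//; exact: le_lt_trans rkn.
(* At level [k0] the difference of the lower brackets of two nearby sets may have the mass of a set
   difference plus that of a bracket. *)
pose C2 := 2 * C.
(* Empty when E is too large, so that the union may run over all pairs of brackets, even those that
   no index produces. *)
pose F k E := if plaw E <= C2 * 16 ^- k then [set w | M * 2 ^- k <= `|nu n.+1 E w|] else set0.
have mnu E : measurable E -> measurable_fun setT (nu n.+1 E).
  by move=> mE; apply: (measurable_emp iid); exact: bmf_indic.
have mF k E : measurable E -> measurable (F k E).
  move=> mE; rewrite /F; case: ifP => // _.
  by apply: measurable_ge; exact: measurableT_comp (mnu _ mE).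
have prF k E : measurable E -> (k <= kn)%N -> pr (F k E) <= 2 * expR C2 * expR (- (M * 2 ^+ k)).
  move=> mE kkn; rewrite /F; case: ifP => [pE|_]; last first.
    by rewrite pr0 !mulr_ge0// expR_ge0.
  apply: nu_link_tail => //; apply: le_trans knr; rewrite ler_eXn2l//; lra.
(* Both differences of a link between consecutive levels, the bracket itself (for the last level),
   and the difference of two lower brackets of one level (for [k0]). *)
pose G4 k i j := ((F k (L k.+1 i `\` L k j)) `|` (F k (L k j `\` L k.+1 i))) `|`
   ((F k (U k i `\` L k i)) `|` (F k (L k i `\` L k j))).
have mG4 k i j : measurable (G4 k i j).
  by apply: measurableU; apply: measurableU; apply: mF; exact: measurableD.
have prG4 k i j : (k <= kn)%N -> pr (G4 k i j) <= 8 * expR C2 * expR (- (M * 2 ^+ k)).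
  move=> kkn.
  have mm1 := mF k _ (measurableD (mL k.+1 i) (mL k j)).
  have mm2 := mF k _ (measurableD (mL k j) (mL k.+1 i)).
  have mm3 := mF k _ (measurableD (mU k i) (mL k i)).
  have mm4 := mF k _ (measurableD (mL k i) (mL k j)).
  apply: le_trans (prU_le P (measurableU _ _ mm1 mm2) (measurableU _ _ mm3 mm4)) _.
  set e := expR (- _); rewrite [leRHS](_ : _ =
    (2 * expR C2 * e + 2 * expR C2 * e) + (2 * expR C2 * e + 2 * expR C2 * e)); last by ring.
  by apply: lerD; [apply: le_trans (prU_le P mm1 mm2) _|apply: le_trans (prU_le P mm3 mm4) _];
    apply: lerD; apply: prF => //; exact: measurableD.
pose G k := \big[setU/set0]_(i < N k) \big[setU/set0]_(j < N k) G4 k i j.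
have mG' k i : measurable (\big[setU/set0]_(j < N k) G4 k i j).
  by apply: bigsetU_measurable => j _; exact: mG4.
have mG k : measurable (G k).
  by apply: bigsetU_measurable => i _; exact: mG'.
have prG k : (k <= kn)%N -> pr (G k) <= K2 * 2 ^- k / M.
  move=> kkn.
  apply: (@le_trans _ _ ((N k)%:R * ((N k)%:R * (8 * expR C2 * expR (- (M * 2 ^+ k)))))).
    apply: (@pr_union_le (N k) (fun i => \big[setU/set0]_(j < N k) G4 k i j)) => // i _.
    by apply: (@pr_union_le (N k) (fun j => G4 k i j)) => // j _; exact: prG4.
  rewrite (_ : _ * _ = (C0 * D)%:R ^+ 2 * (8 * expR C2) * ((D ^ 2)%:R ^+ k * expR (- (M * 2 ^+ k)))).
    rewrite (_ : K2 * 2 ^- k / M = (C0 * D)%:R ^+ 2 * (8 * expR C2) * (K1 * 2 ^- k / M)).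
      by rewrite ler_wpM2l ?HK1// !mulr_ge0// ?expR_ge0.
    by rewrite /K2 -/C2; ring.
  by rewrite /N (natrX _ D 2) exprAC expnS !natrM natrX; ring.
have k0m m : (m < (kn - k0).+1)%N -> (k0 + m <= kn)%N.
  by rewrite ltnS => h; rewrite -(subnKC k0kn) leq_add2l.
pose Bad := \big[setU/set0]_(m < (kn - k0).+1) G (k0 + m)%N.
have KE (x : R) : 0 <= x -> 12 * x <= K * x by move=> x0; rewrite ler_wpM2r// /K; lra.
exists Bad; split.
- exact: bigsetU_measurable.
- apply: le_trans (pr_bigsum_le _ _ (fun m => mG (k0 + m)%N)) _.
  apply: (@le_trans _ _ (\sum_(m < (kn - k0).+1) (K2 / M) * 2 ^- (k0 + m))).
    apply: ler_sum => m _; rewrite mulrAC; apply: prG; exact: k0m.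
  rewrite -mulr_sumr; apply: le_trans (ler_wpM2l _ (sum_half_le _ _)) _.
    by rewrite divr_ge0// ltW.
  rewrite (_ : K2 / M * (2 * 2 ^- k0) = 2 * K2 * 2 ^- k0 / M); last by ring.
  rewrite ler_wpM2r ?invr_ge0 ?(ltW M0)// ler_wpM2r ?invr_ge0 ?exprn_ge0// /K; lra.
move=> w nB.
have nG4 k i j : (k0 <= k <= kn)%N -> (i < N k)%N -> (j < N k)%N -> ~ G4 k i j w.
  move=> /andP[kk0 kkn] iN jN g4; apply: nB.
  apply: (@bigsetU_intro _ _ (fun m => G (k0 + m)%N) (k - k0)%N); first by rewrite ltnS leq_sub2r.
  rewrite subnKC//; apply: (@bigsetU_intro _ _ (fun i => \big[setU/set0]_(j < N k) G4 k i j) i) => //.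
  exact: (@bigsetU_intro _ _ (fun j => G4 k i j) j).
have nF k E : ~ F k E w -> plaw E <= C2 * 16 ^- k -> `|nu n.+1 E w| <= M * 2 ^- k.
  by move=> + pE; rewrite /F pE/= => /negP; rewrite -ltNge => /ltW.
have Np k a : (c k a < N k)%N.
  by apply: leq_trans (cN k a) _; rewrite /N leq_mul2l leq_pexp2l ?orbT.
have c16 k : 0 <= C * 16 ^- k by rewrite mulr_ge0// invr_ge0 exprn_ge0.
have link a k : (k0 <= k <= kn)%N ->
   `|nu n.+1 (L k.+1 (c k.+1 a)) w - nu n.+1 (L k (c k a)) w| <= 2 * M * 2 ^- k.
  move=> kk; rewrite nuD//; apply: le_trans (ler_normB _ _) _.
  have := nG4 k _ _ kk (cN k.+1 a) (Np k a).
  move=> /not_orP[/not_orP[h1 h2] _].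
  have p1 : plaw (L k.+1 (c k.+1 a) `\` L k (c k a)) <= C2 * 16 ^- k.
    apply: (@le_trans _ _ (C * 16 ^- k)); last by rewrite /C2 -mulrA; have := c16 k; lra.
    apply: le_trans (pUL k a); apply: plaw_le; [exact: measurableD|exact: measurableD|].
    move=> g gg [Lg nLg]; split=> //.
    by have [+ _] := LAU k.+1 a g gg; have [_] := LAU k a g gg; move=> + h; apply; exact: h.
  have p2 : plaw (L k (c k a) `\` L k.+1 (c k.+1 a)) <= C2 * 16 ^- k.
    apply: (@le_trans _ _ (C * 16 ^- k.+1)).
      apply: le_trans (pUL k.+1 a); apply: plaw_le; [exact: measurableD|exact: measurableD|].
      move=> g gg [Lg nLg]; split=> //.
      by have [+ _] := LAU k a g gg; have [_] := LAU k.+1 a g gg; move=> + h; apply; exact: h.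
    by have := c16 k; rewrite exprS invfM /C2; lra.
  by have := nF _ _ h1 p1; have := nF _ _ h2 p2; lra.
have tel a m : (m <= kn - k0)%N ->
   `|nu n.+1 (L (k0 + m)%N (c (k0 + m)%N a)) w - nu n.+1 (L k0 (c k0 a)) w| <=
     4 * M * (2 ^- k0 - 2 ^- (k0 + m)).
  elim: m => [|m IH] mk; first by rewrite addn0 !subrr normr0 mulr0.
  have := IH (ltnW mk); have := link a (k0 + m)%N.
  rewrite leq_addr k0m//; last exact: leqW.
  move=> /(_ isT); rewrite addnS exprS invfM.
  set a1 := nu _ _ _; set a2 := nu _ _ _; set a3 := nu _ _ _ => h1 h2.
  have -> : a1 - a3 = (a1 - a2) + (a2 - a3) by lra.
  by apply: le_trans (ler_normD _ _) _; lra.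
have fin a : `|nu n.+1 (A a) w - nu n.+1 (L k0 (c k0 a)) w| <=
    5 * M * 2 ^- k0 + 16 * C * r^-1.
  have := tel a (kn - k0)%N (leqnn _); rewrite subnKC// => h1.
  have := nu_bracket n w (mL kn (c kn a)) (mU kn (c kn a)) (mA a)
    (fun g gg => proj1 (LAU kn a g gg)) (fun g gg => proj2 (LAU kn a g gg)).
  have kk : (k0 <= kn <= kn)%N by rewrite k0kn leqnn.
  have /not_orP[_ /not_orP[h _]] := nG4 kn _ _ kk (Np kn a) (Np kn a).
  have pC2 : plaw (U kn (c kn a) `\` L kn (c kn a)) <= C2 * 16 ^- kn.
    by apply: le_trans (pUL kn a) _; rewrite /C2 -mulrA; have := c16 kn; lra.
  have h3 := nF _ _ h pC2.
  have h4 : Num.sqrt n.+1%:R * plaw (U kn (c kn a) `\` L kn (c kn a)) <= 16 * C * r^-1.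
    (* As sqrt(n + 1) < 4^(kn + 1), the factor 16^-kn is at most 16 / (n + 1). *)
    apply: le_trans (ler_wpM2l (ltW r0) (pUL kn a)) _.
    rewrite ler_pdivlMr// mulrC mulrA -expr2 r2 -r2 mulrCA mulrC ler_wpM2r//.
    rewrite ler_pdivrMr ?exprn_gt0//.
    rewrite (_ : 16 = 4 ^+ 2); last by rewrite -natrX.
    rewrite -exprM mulnC exprM -exprMn -exprS lerXn2r// ?nnegrE ?exprn_ge0 ?(ltW r0)//.
    exact: ltW.
  have h5 : M * 2 ^- kn <= M * 2 ^- k0.
    by rewrite ler_pM2l// lef_pV2 ?posrE ?exprn_gt0// ler_eXn2l// ltr1n.
  have h6 : 0 <= M * 2 ^- kn by rewrite mulr_ge0 ?(ltW M0)// invr_ge0 exprn_ge0.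
  set a1 := nu _ _ _ in h1 *; set a2 := nu _ _ _ in h1 *; set a3 := nu _ _ _ => h2.
  have -> : a3 - a2 = (a3 - a1) + (a1 - a2) by lra.
  by apply: le_trans (ler_normD _ _) _; lra.
move=> a b pab pba.
have base : `|nu n.+1 (L k0 (c k0 a)) w - nu n.+1 (L k0 (c k0 b)) w| <= 2 * M * 2 ^- k0.
  have kk : (k0 <= k0 <= kn)%N by rewrite k0kn leqnn.
  have H x y : plaw (A x `\` A y) <= C * 16 ^- k0 ->
      `|nu n.+1 (L k0 (c k0 x) `\` L k0 (c k0 y)) w| <= M * 2 ^- k0.
    move=> pxy; have /not_orP[_ /not_orP[_ h]] := nG4 k0 _ _ kk (Np k0 x) (Np k0 y).
    apply: nF h _.
    apply: (@le_trans _ _ (plaw ((A x `\` A y) `|` (U k0 (c k0 y) `\` L k0 (c k0 y))))).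
      apply: plaw_le; first exact: measurableD.
        by apply: measurableU; exact: measurableD.
      move=> g gg [Lg nLg]; have Ag := proj1 (LAU k0 x g gg) Lg.
      by have [Ay|Ay] := pselect (A y g); [right; split=> //; exact: (proj2 (LAU k0 y g gg))|left].
    apply: le_trans (plawU_le _ _) _; try exact: measurableD.
    by have := pUL k0 y; rewrite /C2; lra.
  rewrite nuD//; apply: le_trans (ler_normB _ _) _.
  by have := H _ _ pab; have := H _ _ pba; lra.
have := fin a; have := fin b.
set a1 := nu _ _ _ in base *; set a2 := nu _ _ _ in base *; set a3 := nu _ _ _; set a4 := nu _ _ _.
move=> h1 h2; have -> : a4 - a3 = (a4 - a1) + (a1 - a2) - (a3 - a2) by ring.
have ri : 0 <= r^-1 by rewrite invr_ge0 ltW.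
have Mi : 0 <= M * 2 ^- k0 by rewrite mulr_ge0 ?(ltW M0)// invr_ge0 exprn_ge0.
have E1 : 12 * (M * 2 ^- k0) <= K * (M * 2 ^- k0) by exact: KE.
have E2 : 64 * (C * r^-1) <= K * r^-1 by rewrite mulrA ler_wpM2r// /K; lra.
have E3 : 0 <= C * r^-1 by rewrite mulr_ge0.
apply: le_trans (ler_normB _ _) _.
have := ler_normD (a4 - a1) (a1 - a2); move: h1 h2 base E1 E2 E3.
rewrite mulrDr -!mulrA; set x := M * _; set y := C * _.
by clear; lra.
Qed.
End chaining.

(** * Self-similar processes *)

Section oscillation.
Context {R : realType}.

Definition rcpath : set (pathT R) :=
  fun g : R -> R => forall t : R, 0 <= t -> g x @[x --> t^'+] --> g t.

Definition below (t z : R) : set (pathT R) := [set g | g t <= z].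

(** Restricting to rational times makes the set measurable for the cylinder sigma-algebra;
    right-continuity recovers the real times of [t, t + h), right endpoint excluded. *)
Definition osc (t h lam : R) : set (pathT R) :=
  [set g | exists q : rat, t <= ratr q <= t + h /\ lam < `|g (ratr q) - g t|].

Lemma measurable_below (t z : R) : 0 <= t -> measurable (below t z).
Proof. by move=> t0; apply: measurable_le; exact: measurable_coord. Qed.

Lemma measurable_osc (t h lam : R) : 0 <= t -> measurable (osc t h lam).
Proof.
move=> t0.
rewrite (_ : osc t h lam = \bigcup_(q in [set q : rat | t <= ratr q <= t + h])
    [set g : pathT R | lam < `|g (ratr q) - g t|]); last first.
  by apply/seteqP; split => [g [q [? ?]]|g [q ? ?]]; exists q.
rewrite bigcup_mkcond; apply: bigcupT_measurable_rat => q.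
case: ifPn => // /set_mem/= /andP[tq _].
apply: measurable_norm_gt; apply: measurable_funB; apply: measurable_coord => //.
exact: le_trans tq.
Qed.

Lemma osc_bound (g : R -> R) t h lam s : rcpath g -> 0 <= t -> ~ osc t h lam g ->
  t <= s < t + h -> `|g s - g t| <= lam.
Proof.
move=> gg t0 ng /andP[ts sth]; rewrite leNgt; apply/negP => lt.
have s0 : 0 <= s := le_trans t0 ts.
have cv : `|g x - g t| @[x --> s^'+] --> `|g s - g t|.
  by apply: cvg_norm; apply: cvgB; [exact: gg|exact: cvg_cst].
have hn : \forall x \near s^'+, lam < `|g x - g t|.
  by apply: cvgr_gt cv _ lt.
have h2 : \forall x \near s^'+, x < t + h by exact: nbhs_right_lt.
have [e /= e0 he] := filterI hn h2.
have [q /andP[sq qe]] : exists q : rat, s < ratr q < s + e.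
  have se : s < s + e by rewrite ltrDl.
  by have [q] := rat_in_itvoo se; rewrite in_itv/= => ?; exists q.
have := he (ratr q); rewrite /ball/= => /(_ _ sq)[].
  rewrite ltr0_norm ?subr_lt0// opprB ltrBlDl//.
move=> h4 h5; apply: ng; exists q; split=> //.
by rewrite (le_trans ts (ltW sq)) ltW.
Unshelve. all: by end_near. Qed.

End oscillation.

Lemma powRXn {R : realType} (a r : R) n : 0 <= a -> (a ^+ n) `^ r = (a `^ r) ^+ n.
Proof.
move=> a0; elim: n => [|n IH]; first by rewrite !expr0 powR1.
by rewrite !exprS powRM ?exprn_ge0// IH.
Qed.

Lemma powRV {R : realType} (a r : R) : 0 <= a -> (a^-1) `^ r = (a `^ r)^-1.
Proof. by move=> a0; rewrite -powR_inv1// -powRrM mulN1r powRN. Qed.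

(** The common interface of the two kinds of process. The oscillation bound is centred at the value
    at a fixed time t, which is why it can hold for paths with jumps. *)
Record selfsim {R : realType} {d : measure_display} {Omega : measurableType d}
  (P : probability Omega R) (X : R -> Omega -> R) (Xs : nat -> R -> Omega -> R)
  (H : R) (Phi p : R -> R) : Prop := SelfSim {
  ss_mX : forall t : R, 0 <= t -> measurable_fun setT (X t);
  ss_iid : iid_copies P X Xs;
  ss_H : 0 < H;
  ss_cdf : forall t x : R, 0 < t -> pr P [set w | X t w <= x] = Phi (x / t `^ H);
  ss_der : forall x : R, is_derive x 1 Phi (p x);
  ss_cont : continuous p;
  ss_pos : forall x, 0 < p x;
  ss_osc : exists C kap : R, [/\ 0 <= C, 0 < kap & forall t h lam : R, 0 <= t -> 0 < h -> 0 < lam ->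
    plaw P X (osc t h lam) <= C * (h `^ H / lam) `^ kap];
  ss_rcX : forall w, rcpath (spath0 X w);
  ss_rcXs : forall i w, rcpath (spath Xs i w) }.

(** * Brackets on a block of comparable times *)

Section blocks.
Context {R : realType} {d : measure_display} {Omega : measurableType d}
  (P : probability Omega R) (X : R -> Omega -> R) (Xs : nat -> R -> Omega -> R)
  (H : R) (Phi p : R -> R).
Hypothesis ss : selfsim P X Xs H Phi p.
Local Notation pr := (pr P).
Local Notation plaw := (plaw P X).
Local Notation nu n C := (emp P X Xs n (\1_C)).

Let mX := ss_mX ss.
Let iid := ss_iid ss.
Let H0 := ss_H ss.

Lemma plaw_below t z : 0 < t -> plaw (below t z) = Phi (z / t `^ H).
Proof. by move=> t0; rewrite -(ss_cdf ss). Qed.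

Lemma cont_Phi : continuous Phi.
Proof.
by move=> x; apply: differentiable_continuous; apply/derivable1_diffP; case: (ss_der ss x).
Qed.

Lemma Phi_lt x y : x < y -> Phi x < Phi y.
Proof.
move=> xy; have [c [_ _ E]] := mvt_abs (ss_der ss) x y.
by rewrite -subr_gt0 E mulr_gt0 ?subr_gt0// (ss_pos ss).
Qed.

Lemma Phi_le x y : x <= y -> Phi x <= Phi y.
Proof. by rewrite le_eqVlt => /predU1P[->//|/Phi_lt/ltW]. Qed.

Lemma Phi_itv x : 0 < Phi x < 1.
Proof.
have b y : 0 <= Phi y <= 1.
  have := ss_cdf ss y ltr01; rewrite powR1 divr1 => <-.
  by rewrite pr_ge0 pr_le1//; apply: measurable_le; exact: mX.
have x1 : x - 1 < x by rewrite ltrBlDr ltrDl.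
have x2 : x < x + 1 by rewrite ltrDl.
have /andP[h1 _] := b (x - 1); have /andP[_ h2] := b (x + 1).
by rewrite (le_lt_trans h1 (Phi_lt x1)) (lt_le_trans (Phi_lt x2) h2).
Qed.

Lemma p_bounds (B : R) : exists2 Lp : R, 0 < Lp & exists2 lp : R, 0 < lp &
  forall x, `|x| <= B -> lp <= p x <= Lp.
Proof.
have [B0|B0] := ltP B 0.
  by exists 1 => //; exists 1 => // x /le_lt_trans/(_ B0); rewrite ltNge normr_ge0.
have cp : {within `[- B, B], continuous p} by apply: continuous_subspaceT; exact: (ss_cont ss).
have BB : - B <= B by lra.
have [c1 _ h1] := EVT_max BB cp; have [c2 _ h2] := EVT_min BB cp.
exists (p c1); first exact: (ss_pos ss).
exists (p c2); first exact: (ss_pos ss).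
by move=> x; rewrite ler_norml => xB; rewrite h1 ?h2.
Qed.

Lemma Phi_lip (B : R) : exists2 Lp : R, 0 < Lp & forall x y, `|x| <= B -> `|y| <= B ->
  `|Phi y - Phi x| <= Lp * `|y - x|.
Proof.
have [Lp Lp0 [lp _ hb]] := p_bounds B; exists Lp => // x y xB yB.
have [c [_ cxy ->]] := mvt_abs (ss_der ss) x y.
have cB : `|c| <= B.
  move: xB yB cxy; rewrite !ler_norml => /andP[x1 x2] /andP[y1 y2] /andP[c1 c2].
  rewrite (le_trans _ c1) ?le_min ?x1//= (le_trans c2)// ge_max x2//.
have /andP[_ h] := hb _ cB.
by rewrite normrM ler_wpM2r// gtr0_norm//; exact: (ss_pos ss).
Qed.

(** Levels are measured in units of t0^H rather than t^H. The ratio t0^H / t^H is at most 1, so one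
    Lipschitz constant of the distribution function on [-B, B] serves all scales t0. *)
Lemma plaw_strip (B : R) : exists2 Lp : R, 0 < Lp & forall t0 t y y', 0 < t0 -> t0 <= t ->
  `|y| <= B -> `|y'| <= B -> y' <= y ->
  plaw (below t (t0 `^ H * y) `\` below t (t0 `^ H * y')) <= Lp * (y - y').
Proof.
have [Lp Lp0 hL] := Phi_lip B; exists Lp => // t0 t y y' t00 t0t yB y'B yy.
have t_gt0 : 0 < t := lt_le_trans t00 t0t.
have m1 := measurable_below (t0 `^ H * y) (ltW t_gt0).
have m2 := measurable_below (t0 `^ H * y') (ltW t_gt0).
have a0 : 0 < t0 `^ H by exact: powR_gt0.
have b0 : 0 < t `^ H by exact: powR_gt0.
have ab : t0 `^ H <= t `^ H by rewrite ge0_ler_powR ?nnegrE ?(ltW H0) ?(ltW t00) ?(ltW t_gt0).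
pose s := t0 `^ H / t `^ H.
have s1 : 0 <= s <= 1 by rewrite divr_ge0 ?(ltW a0) ?(ltW b0)//= ler_pdivrMr// mul1r.
have sB z : `|z| <= B -> `|s * z| <= B.
  move=> zB; rewrite normrM (ger0_norm (proj1 (andP s1))) (le_trans _ zB)// ler_piMl//.
  by case/andP: s1.
have := plawDI P mX m1 m2.
rewrite (_ : below t (t0 `^ H * y) `&` _ = below t (t0 `^ H * y')); last first.
  apply/seteqP; split => g; first by case.
  by rewrite /below/= => gy'; split=> //; rewrite (le_trans gy')// ler_pM2l.
move=> Epl; have -> : plaw (below t (t0 `^ H * y) `\` below t (t0 `^ H * y')) =
  plaw (below t (t0 `^ H * y)) - plaw (below t (t0 `^ H * y')) by rewrite Epl addrK.
rewrite !plaw_below//.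
rewrite !(mulrAC _ _ (t `^ H)^-1) -/s; apply: le_trans (ler_norm _) _.
apply: le_trans (hL _ _ (sB _ y'B) (sB _ yB)) _.
rewrite ler_pM2l// -mulrBr normrM (ger0_norm (proj1 (andP s1))) ger0_norm ?subr_ge0//.
by rewrite ler_piMl ?subr_ge0//; case/andP: s1.
Qed.

(** E is taken so large that E^H is at least 16^(1 / kap) 16; a time mesh E^-k then turns the
    oscillation bound at threshold 16^-k into at most 16^-k. *)
Lemma bracket_scale (kap : R) : 0 < kap -> exists2 E : nat, (0 < E)%N &
  forall k, ((E%:R ^- k) `^ H / 16 ^- k) `^ kap <= 16 ^- k :> R.
Proof.
move=> kap0.
pose x : R := ((16 `^ (kap^-1)) * 16) `^ (H^-1).
have x0 : 0 < x by rewrite powR_gt0// mulr_gt0// powR_gt0.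
exists (Num.bound x).+1 => // k; set E := (_.+1).
have E0 : 0 < E%:R :> R by rewrite ltr0n.
have xE : x <= E%:R.
  by rewrite (le_trans (ltW (archi_boundP (ltW x0))))// ler_nat.
have h : 16 `^ kap^-1 * 16 <= E%:R `^ H :> R.
  have -> : 16 `^ kap^-1 * 16 = x `^ H.
    rewrite /x -powRrM mulVf ?powRr1 ?gt_eqF//; by rewrite mulr_ge0 ?powR_ge0.
  by rewrite ge0_ler_powR ?nnegrE ?(ltW H0) ?(ltW x0) ?(ltW E0).
have Ek : (E%:R ^- k) `^ H = (E%:R `^ H) ^- k.
  by rewrite powRV ?exprn_ge0 ?(ltW E0)// powRXn ?(ltW E0).
rewrite Ek invrK -[(E%:R `^ H) ^- k]exprVn -exprMn.
set y := (E%:R `^ H)^-1 * 16.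
have y0 : 0 <= y by rewrite mulr_ge0// invr_ge0 powR_ge0.
have yk : y <= 16 `^ (- kap^-1).
  by rewrite powRN /y mulrC ler_pdivrMr ?powR_gt0// mulrC ler_pdivlMr ?powR_gt0// mulrC.
rewrite powRXn// -exprVn lerXn2r ?nnegrE ?powR_ge0 ?invr_ge0//.
rewrite (_ : 16^-1 = (16 `^ (- kap^-1)) `^ kap); last first.
  by rewrite -powRrM mulNr mulVf ?gt_eqF// powR_inv1.
by rewrite ge0_ler_powR ?nnegrE ?powR_ge0 ?(ltW kap0).
Qed.

(** Time in units of t0 and level in units of t0^H: in these coordinates bracket numbers and masses
    do not depend on t0. *)
Definition blockT (Lam B : R) := {a : R * R | (1 <= a.1 <= Lam) && (`|a.2| <= B)}.

Definition blockA Lam B (t0 : R) (a : blockT Lam B) : set (pathT R) :=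
  below (t0 * (sval a).1) (t0 `^ H * (sval a).2).

Lemma measurable_blockA Lam B t0 (a : blockT Lam B) : 0 < t0 -> measurable (blockA t0 a).
Proof.
move=> t00; apply: measurable_below; have /andP[/andP[h _] _] := valP a.
by rewrite mulr_ge0 ?(ltW t00)// (le_trans _ h).
Qed.

Lemma truncn_cell (x : R) : 0 <= x -> (Num.truncn x)%:R <= x < (Num.truncn x)%:R + 1.
Proof. by move=> x0; have := truncn_itv x0; rewrite -natr1. Qed.

(** The block is cut into cells of time length E^-k and height 16^-k. If the path moves by at most
    one height during the cell, the half-space of any point of the cell lies between two half-spaces
    at its left end. Paths that move more are removed from the lower bracket and added to the upper
    one. *)
Lemma bracket_block (Lam B : R) : 0 <= B ->
  exists (C0 D : nat) (C : R), [/\ (0 < D)%N, 1 <= C &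
    forall t0, 0 < t0 -> bracketed P X rcpath C0 D C (@blockA Lam B t0)].
Proof.
move=> B0; have [C3 [kap [C30 kap0 hosc]]] := ss_osc ss.
have [E E0 hE] := bracket_scale kap0.
have [Lp Lp0 hL] := plaw_strip (B + 3).
pose I0 := (Num.bound `|Lam|).+1; pose J0 := (Num.bound (2 * B)).+1.
(* The strip between the two half-spaces is three heights wide and accounts for 3 [Lp], the
   oscillation event for [C3]. The added 1 gives [1 <= C], so that at level 0 every pair of sets
   meets the mass condition of chaining. *)
exists (I0 * J0)%N, (E * 16)%N, (3 * Lp + C3 + 1); split.
- by rewrite muln_gt0 E0.
- by rewrite lerDr addr_ge0// mulr_ge0// ltW.
move=> t0 t00; have a0 : 0 < t0 `^ H by exact: powR_gt0.
pose u (k : nat) : R := 16 ^- k; pose e (k : nat) : R := E%:R ^- k.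
have u0 k : 0 < u k by rewrite invr_gt0 exprn_gt0.
have E1 : 1 <= E%:R :> R by rewrite ler1n.
have e0 k : 0 < e k by rewrite invr_gt0 exprn_gt0// (lt_le_trans _ E1).
have u1 k : u k <= 1 by rewrite invf_le1 ?exprn_gt0// exprn_ege1// ler1n.
pose J k := (J0 * 16 ^ k)%N.
pose ci k (a : blockT Lam B) := Num.truncn (((sval a).1 - 1) / e k).
pose cj k (a : blockT Lam B) := Num.truncn (((sval a).2 + B) / u k).
(* The time cell and the height cell coded as one number, decoded by quotient and remainder. *)
pose c k a := (ci k a * J k + cj k a)%N.
have cjJ k a : (cj k a < J k)%N.
  rewrite -(ltr_nat R); have /andP[_ aB] := valP a.
  move: aB; rewrite ler_norml => /andP[b1 b2].
  have h0 : 0 <= ((sval a).2 + B) / u k by rewrite divr_ge0 ?(ltW (u0 k))//; lra.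
  have /andP[h _] := truncn_cell h0; apply: le_lt_trans h _.
  rewrite /J natrM natrX ltr_pdivrMr// /u -mulrA divff ?expf_neq0// mulr1.
  apply: (@le_lt_trans _ _ (2 * B)); first lra.
  rewrite (lt_le_trans (archi_boundP _))//; first by rewrite mulr_ge0.
  by rewrite ler_nat.
have ciI k a : (ci k a < I0 * E ^ k)%N.
  rewrite -(ltr_nat R); have /andP[/andP[s1 s2] _] := valP a.
  have h0 : 0 <= ((sval a).1 - 1) / e k by rewrite divr_ge0 ?(ltW (e0 k))//; lra.
  have /andP[h _] := truncn_cell h0; apply: le_lt_trans h _.
  rewrite natrM natrX ltr_pdivrMr// /e -mulrA divff ?mulr1; last first.
    by rewrite expf_neq0// gt_eqF// (lt_le_trans _ E1).
  apply: (@lt_le_trans _ _ (Num.bound `|Lam|)%:R); last by rewrite ler_nat.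
  apply: le_lt_trans (archi_boundP (normr_ge0 _)).
  by apply: le_trans (ler_norm _); lra.
pose t1 k (m : nat) := t0 * (1 + (m %/ J k)%:R * e k).
pose y1 k (m : nat) := (m %% J k)%:R * u k - B.
have t1_ge k m : t0 <= t1 k m.
  by rewrite /t1 ler_peMr ?(ltW t00)// lerDl mulr_ge0// ltW.
have t1_ge0 k m : 0 <= t1 k m := le_trans (ltW t00) (t1_ge k m).
pose O k m := osc (t1 k m) (t0 * e k) (t0 `^ H * u k).
pose L k m := below (t1 k m) (t0 `^ H * (y1 k m - u k)) `\` O k m.
pose U k m := below (t1 k m) (t0 `^ H * (y1 k m + 2 * u k)) `|` O k m.
have mO k m : measurable (O k m) by exact: measurable_osc.
have Jp k : (0 < J k)%N by rewrite muln_gt0/= expn_gt0.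
have ta k a : t1 k (c k a) <= t0 * (sval a).1 < t1 k (c k a) + t0 * e k.
  have /andP[/andP[s1 s2] _] := valP a.
  have h0 : 0 <= ((sval a).1 - 1) / e k by rewrite divr_ge0 ?(ltW (e0 k))//; lra.
  have := truncn_cell h0; rewrite -/(ci k a).
  rewrite ler_pdivlMr// ltr_pdivrMr// => /andP[h1 h2].
  rewrite /t1 /c divnMDl// divn_small// addn0.
  by rewrite -mulrDr ler_pM2l// ltr_pM2l//; apply/andP; split; lra.
have ya k a : y1 k (c k a) <= (sval a).2 < y1 k (c k a) + u k.
  have /andP[_ aB] := valP a; move: aB; rewrite ler_norml => /andP[b1 b2].
  have h0 : 0 <= ((sval a).2 + B) / u k by rewrite divr_ge0 ?(ltW (u0 k))//; lra.
  have := truncn_cell h0; rewrite -/(cj k a).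
  rewrite ler_pdivlMr// ltr_pdivrMr// => /andP[h1 h2].
  rewrite /y1 /c modnMDl modn_small//; apply/andP; split; lra.
exists c, L, U; split.
- move=> k m; apply: measurableD => //; exact: measurable_below.
- move=> k m; apply: measurableU => //; exact: measurable_below.
- move=> k a; rewrite /c.
  have : (ci k a * J k + cj k a < (ci k a).+1 * J k)%N by rewrite mulSn addnC ltn_add2r.
  move=> /leq_trans; apply.
  apply: (@leq_trans (I0 * E ^ k * J k)); first by rewrite leq_mul2r ciI orbT.
  by rewrite /J expnMn mulnACA.
- move=> k a g gg; have /andP[ya1 ya2] := ya k a.
  have D : ~ O k (c k a) g -> `|g (t0 * (sval a).1) - g (t1 k (c k a))| <= t0 `^ H * u k.
    by move=> nO; apply: osc_bound (ta k a).
  rewrite /blockA /below /L /U; split.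
    move=> [/= h1 /D]; rewrite ler_norml => /andP[_ h2].
    have : t0 `^ H * y1 k (c k a) <= t0 `^ H * (sval a).2 by rewrite ler_pM2l.
    by move: h1; rewrite /below/= mulrBr; lra.
  move=> /= h1; have [Og|/D h3] := pselect (O k (c k a) g); [by right|left].
  move: h3; rewrite ler_norml => /andP[h2 _] /=.
  have : t0 `^ H * (sval a).2 <= t0 `^ H * (y1 k (c k a) + u k) by rewrite ler_pM2l// ltW.
  by rewrite /below/= !mulrDr; lra.
move=> k a; have /andP[ya1 ya2] := ya k a; have /andP[_ aB] := valP a.
move: aB; rewrite ler_norml => /andP[b1 b2].
have uk := u1 k; have uk0 := u0 k.
set m := c k a in ya1 ya2 *.
have y1B : - B <= y1 k m by rewrite /y1 lerBrDr addNr mulr_ge0// ltW.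
have h1 : plaw (below (t1 k m) (t0 `^ H * (y1 k m + 2 * u k)) `\`
    below (t1 k m) (t0 `^ H * (y1 k m - u k))) <= Lp * (3 * u k).
  apply: le_trans (hL _ _ _ _ t00 (t1_ge k m) _ _ _) _; rewrite ?ler_norml; try (apply/andP; split); lra.
have h2 : plaw (O k m) <= C3 * u k.
  apply: le_trans (hosc _ _ _ (t1_ge0 k m) _ _) _; try exact: mulr_gt0.
  rewrite ler_wpM2l// [(t0 * e k) `^ H]powRM ?(ltW t00) ?(ltW (e0 k))//.
  rewrite -mulf_div divff ?gt_eqF// mul1r; exact: hE.
apply: (@le_trans _ _ (plaw ((below (t1 k m) (t0 `^ H * (y1 k m + 2 * u k)) `\`
    below (t1 k m) (t0 `^ H * (y1 k m - u k))) `|` O k m))).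
  apply: (@plaw_le _ _ _ P X mX rcpath) => //.
  - exact: (ss_rcX ss).
  - apply: measurableD; [apply: measurableU => //|apply: measurableD => //]; exact: measurable_below.
  - apply: measurableU => //; apply: measurableD; exact: measurable_below.
  - move=> g _ [[h|h] nL]; last by right.
    have [Og|nO] := pselect (O k m g); [by right|left; split=> //].
    by move=> bg; apply: nL.
apply: le_trans (plawU_le _ _ _ _) _ => //.
  apply: measurableD; exact: measurable_below.
by rewrite -/(u k); nra.
Qed.

End blocks.

Section real_powers.
Context {R : realType}.
Implicit Types (a b s t H q e : R).

(** Through logarithms: t^H - s^H <= t^H H (ln t - ln s), from exp(-x) >= 1 - x, and ln t - ln s <=
    (t - s) / a. Staying above a keeps the slope bounded when H < 1. *)
Lemma powR_lip H a b : 0 < H -> 0 < a -> exists2 L : R, 0 < L & forall s t,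
  a <= s <= b -> a <= t <= b -> `|t `^ H - s `^ H| <= L * `|t - s|.
Proof.
move=> H0 a0; pose L := b `^ H * H / a + 1.
have b0 : 0 <= b `^ H by exact: powR_ge0.
have L1 : 0 <= b `^ H * H / a by rewrite divr_ge0 ?mulr_ge0 ?(ltW H0) ?(ltW a0).
exists L; first by rewrite /L; lra.
have main s t : a <= s -> s <= t -> t <= b -> `|t `^ H - s `^ H| <= L * `|t - s|.
  move=> sa st tb; have s0 := lt_le_trans a0 sa; have t0 := lt_le_trans s0 st.
  rewrite !ger0_norm ?subr_ge0// ?ge0_ler_powR ?nnegrE ?(ltW H0) ?(ltW s0) ?(ltW t0)//.
  have h : t `^ H - s `^ H <= t `^ H * (H * (ln t - ln s)).
    rewrite /powR !gt_eqF// (_ : expR (H * ln s) = expR (H * ln t) * expR (- (H * (ln t - ln s)))).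
      rewrite -[X in X - _]mulr1 -mulrBr ler_wpM2l ?expR_ge0//.
      by have := expR_ge1Dx (- (H * (ln t - ln s))); lra.
    by rewrite -expRD; congr expR; ring.
  have h2 : ln t - ln s <= (t - s) / a.
    rewrite -ln_div ?posrE//; have ts : 0 < t / s by rewrite divr_gt0.
    apply: (@le_trans _ _ (t / s - 1)).
      have e1 : expR (ln (t / s)) = t / s by rewrite lnK ?posrE.
      by have := expR_ge1Dx (ln (t / s)); rewrite e1; lra.
    rewrite (_ : t / s - 1 = (t - s) / s); last by field; rewrite gt_eqF.
    by rewrite ler_wpM2l ?subr_ge0// lef_pV2 ?posrE.
  apply: le_trans h _; apply: (@le_trans _ _ (b `^ H * (H * ((t - s) / a)))).
    apply: ler_pM; rewrite ?powR_ge0//.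
    - rewrite mulr_ge0 ?(ltW H0)// subr_ge0 ler_ln ?posrE//.
    - by rewrite ge0_ler_powR ?nnegrE ?(ltW H0) ?(ltW t0)// (le_trans (ltW t0)).
    - by rewrite ler_pM2l.
  rewrite (_ : b `^ H * _ = b `^ H * H / a * (t - s)); last by ring.
  by rewrite ler_wpM2r ?subr_ge0// /L lerDl.
move=> s t /andP[sa sb] /andP[ta tb]; have [st|ts] := leP s t; first exact: main.
by rewrite distrC (distrC t); apply: main => //; exact: ltW.
Qed.

Lemma ex_expn_le q e : 0 <= q < 1 -> 0 < e -> exists J : nat, q ^+ J <= e.
Proof.
move=> /andP[q0 q1] e0.
have : q ^+ n @[n --> \oo] --> 0 by apply: cvg_expr; rewrite ger0_norm.
move/cvgrPdist_le => /(_ e e0)[J _ /(_ J (leqnn J))].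
by rewrite /= sub0r normrN ger0_norm ?exprn_ge0//; exists J.
Qed.

Lemma geom_sum_le q m : 0 <= q < 1 -> \sum_(i < m) q ^+ i <= (1 - q)^-1.
Proof.
move=> /andP[q0 q1]; have q2 : 0 < 1 - q by rewrite subr_gt0.
rewrite -div1r ler_pdivlMr//.
suff -> : (\sum_(i < m) q ^+ i) * (1 - q) = 1 - q ^+ m by rewrite gerBl exprn_ge0.
elim: m => [|m IH]; first by rewrite big_ord0 mul0r expr0 subrr.
by rewrite big_ord_recr/= mulrDl IH exprS; ring.
Qed.

Lemma ex_dyadic (T t : R) (J : nat) : 0 < T -> 0 < t <= T / 2 ^+ J ->
  exists m : nat, T / 2 ^+ (J + m).+1 <= t <= T / 2 ^+ (J + m).
Proof.
move=> T0 /andP[t0 tJ].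
have ex : exists m : nat, T / 2 ^+ (J + m).+1 <= t.
  have q1 : 0 <= (2^-1 : R) < 1 by lra.
  have [m hm] := ex_expn_le q1 (divr_gt0 t0 T0); exists m.
  rewrite mulrC -ler_pdivlMr// (le_trans _ hm)// exprVn lef_pV2 ?posrE ?exprn_gt0//.
  by rewrite ler_eXn2l ?ltr1n// (leq_trans (leq_addl J m)).
case: (ex_minnP ex) => m hm mmin; exists m; rewrite hm/=.
case: m hm mmin => [|m] hm mmin; first by rewrite addn0.
rewrite addnS leNgt; apply/negP => lt.
by have := mmin m (ltW lt); rewrite ltnn.
Qed.

End real_powers.

(** * Size and equicontinuity of the standardized empirical process *)

Section block_bounds.
Context {R : realType} {d : measure_display} {Omega : measurableType d}
  (P : probability Omega R) (X : R -> Omega -> R) (Xs : nat -> R -> Omega -> R)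
  (H : R) (Phi p : R -> R).
Hypothesis ss : selfsim P X Xs H Phi p.
Local Notation pr := (pr P).
Local Notation plaw := (plaw P X).

Let mX := ss_mX ss.
Let iid := ss_iid ss.
Let H0 := ss_H ss.

Definition sbelow (t x : R) : set (pathT R) := below t (t `^ H * x).

(* The standardized empirical process nu_n(t, x) = sqrt n (F_n(t, t^H x) - Phi x). *)
Definition snu (n : nat) (t x : R) (w : Omega) : R := emp P X Xs n (\1_(sbelow t x)) w.

Lemma measurable_sbelow t x : 0 <= t -> measurable (sbelow t x).
Proof. exact: measurable_below. Qed.

Lemma measurable_snu n t x : 0 <= t -> measurable_fun setT (snu n t x).
Proof.
move=> t0; apply: (measurable_emp iid); apply: bmf_indic; exact: measurable_sbelow.
Qed.

Lemma block_point (Lam B t0 t x : R) : 0 < t0 -> t0 <= t <= Lam * t0 -> `|x| <= B ->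
  exists a : blockT Lam (B * Lam `^ H), blockA H t0 a = sbelow t x.
Proof.
move=> t00 /andP[t0t tL] xB; have t_0 := lt_le_trans t00 t0t.
have s1 : 1 <= t / t0 by rewrite ler_pdivlMr// mul1r.
have sL : t / t0 <= Lam by rewrite ler_pdivrMr.
have ok : (1 <= (t / t0, x * (t / t0) `^ H).1 <= Lam) &&
  (`|(t / t0, x * (t / t0) `^ H).2| <= B * Lam `^ H).
  rewrite /= s1 sL/= normrM (ger0_norm (powR_ge0 _ _)) ler_pM ?powR_ge0//.
  by rewrite ge0_ler_powR ?nnegrE ?(ltW H0) ?(le_trans _ s1)// (le_trans _ sL) ?(le_trans _ s1).
exists (exist (fun a : R * R => (1 <= a.1 <= Lam) && (`|a.2| <= B * Lam `^ H)) _ ok); rewrite /blockA /sbelow /=; congr below.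
  by rewrite mulrC divfK// gt_eqF.
by rewrite mulrCA mulrC -powRM ?(ltW t00) ?(le_trans _ s1)// (mulrC t0) divfK// gt_eqF.
Qed.

Lemma vpath_indic_le (C : set (pathT R)) : measurable C -> vpath P X (\1_C) <= 1.
Proof.
move=> mC; apply: le_trans (ler_norm _) _; apply: Ex_bound.
  by have [] := bmf_sqr (bmf_path0 mX (bmf_ctr P X (bmf_indic (R := R) mC))).
move=> w; rewrite plaw_Epath// normrX exprn_ile1//.
have : 0 <= plaw C <= 1 by rewrite pr_ge0 pr_le1//; exact: measurable_path0_event.
move=> /andP[p0 p1]; rewrite indicE ler_norml.
by case: (_ \in _) => /=; apply/andP; split; lra.
Qed.

Lemma block_sup (Lam B : R) : 1 <= Lam -> 0 <= B -> exists2 K : R, 0 < K &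
  forall t0 n (M : R), 0 < t0 -> 1 <= M -> exists Bad : set Omega,
  [/\ measurable Bad, pr Bad <= K / M &
    forall w, ~ Bad w -> forall t x, t0 <= t <= Lam * t0 -> `|x| <= B ->
      `|snu n.+1 t x w| <= K * M].
Proof.
move=> L1 B0; have B'0 : 0 <= B * Lam `^ H by rewrite mulr_ge0 ?powR_ge0.
have [C0 [D [C [D0 C1 hbr]]]] := bracket_block ss Lam B'0.
have Cg : 0 <= C by exact: le_trans C1.
have [K K0 hK] := chaining mX iid (ss_rcXs ss) (ss_rcX ss) C0 D0 Cg.
exists (2 * K + 1); first by lra.
move=> t0 n M t00 M1; have M0 : 0 < M by lra.
have r1 : 1 <= Num.sqrt n.+1%:R :> R by rewrite -[leLHS]sqrtr1 ler_wsqrtr// ler1n.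
have r2 : 4 ^+ 0 <= Num.sqrt n.+1%:R :> R by rewrite expr0.
have [Bad [mB pB hB]] := hK _ _ (fun a => measurable_blockA H a t00) (hbr t0 t00) n M 0%N M1 r2.
have mz := measurable_snu n.+1 0 (ltW t00).
exists (Bad `|` [set w | M < `|snu n.+1 t0 0 w|]); split.
- by apply: measurableU => //; exact: measurable_norm_gt.
- apply: le_trans (prU_le _ mB (measurable_norm_gt _ mz)) _.
  have h : pr [set w | M < `|snu n.+1 t0 0 w|] <= 1 / M.
    have ms := measurable_sbelow 0 (ltW t00).
    apply: le_trans (emp_tail2 mX iid n (bmf_indic (R := R) ms) M0) _.
    apply: (@le_trans _ _ (1 / M ^+ 2)).
      by rewrite ler_wpM2r ?invr_ge0 ?sqr_ge0// vpath_indic_le.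
    by rewrite !div1r lef_pV2 ?posrE ?exprn_gt0// expr2 ler_peMl// ltW.
  move: pB; rewrite expr0 invr1 mulr1 => pB.
  rewrite mulrDl mul1r; have : 0 <= K / M by rewrite divr_ge0 ?(ltW K0) ?(ltW M0).
  by rewrite -mulrA; lra.
move=> w /not_orP[nB /negP]; rewrite -leNgt => hz t x tL xB.
have [a ha] := block_point t00 tL xB.
have t0L : t0 <= t0 <= Lam * t0 by rewrite lexx/= ler_peMl// ltW.
have zB : `|0 : R| <= B by rewrite normr0.
have [b hb] := block_point t00 t0L zB.
have pl (E : set (pathT R)) : measurable E -> plaw E <= C * 16 ^- 0.
  move=> mE; rewrite expr0 invr1 mulr1 (le_trans _ C1)// pr_le1//.
  exact: measurable_path0_event.
have m1 : measurable (blockA H t0 a) by exact: measurable_blockA.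
have m2 : measurable (blockA H t0 b) by exact: measurable_blockA.
have := hB w nB a b (pl _ (measurableD m1 m2)) (pl _ (measurableD m2 m1)).
rewrite ha hb expr0 invr1 mulr1 -/(snu n.+1 t x w) -/(snu n.+1 t0 0 w) => h.
have ri : (Num.sqrt n.+1%:R)^-1 <= 1 :> R by rewrite invf_le1// (lt_le_trans _ r1).
have h3 : K * (M + (Num.sqrt n.+1%:R)^-1) <= K * (M + M) by rewrite ler_pM2l//; lra.
have := ler_normD (snu n.+1 t x w - snu n.+1 t0 0 w) (snu n.+1 t0 0 w).
by rewrite subrK; move: h hz h3; rewrite !mulrDr; lra.
Qed.

(** A path in the difference of the two half-spaces either lies in a narrow strip at the earlier of
    the two times or oscillates markedly just after it. *)
Lemma plaw_close (t0 Lam B e : R) : 0 < t0 -> 0 <= B -> 0 < e ->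
  exists2 del : R, 0 < del & forall t t' x x',
   t0 <= t <= Lam * t0 -> t0 <= t' <= Lam * t0 -> `|x| <= B -> `|x'| <= B ->
   `|t - t'| <= del -> `|x - x'| <= del -> plaw (sbelow t x `\` sbelow t' x') <= e.
Proof.
move=> t00 B0 e0; have [C3 [kap [C30 kap0 hosc]]] := ss_osc ss.
pose T := Lam * t0; pose a0 := t0 `^ H; have a00 : 0 < a0 by exact: powR_gt0.
pose TH := `|T| `^ H; have TH0 : 0 <= TH by exact: powR_ge0.
pose B1 := (TH * B) / a0 + 2.
have [Lp Lp0 hL] := plaw_strip ss B1.
have [L L0 hLip] := powR_lip T H0 t00.
pose u := Num.min 1 (e / (2 * (4 * Lp))).
have u0 : 0 < u by rewrite lt_min ltr01 divr_gt0// mulr_gt0// mulr_gt0.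
have u1 : u <= 1 by rewrite ge_min lexx.
have uL : Lp * (4 * u) <= e / 2.
  have : u <= e / (2 * (4 * Lp)) by rewrite ge_min lexx orbT.
  by rewrite ler_pdivlMr ?mulr_gt0//; lra.
pose th := a0 * u * (e / (2 * (C3 + 1))) `^ (kap^-1).
have e1 : 0 < e / (2 * (C3 + 1)) by rewrite divr_gt0//; lra.
have th0 : 0 < th by rewrite !mulr_gt0// powR_gt0.
pose d1 := th `^ (H^-1) / 2; have d10 : 0 < d1 by rewrite divr_gt0// powR_gt0.
pose d2 := a0 * u / (TH + B * L + 1).
have den : 0 < TH + B * L + 1 by rewrite ltr_wpDl// addr_ge0// mulr_ge0// ltW.
have d20 : 0 < d2 by rewrite divr_gt0// mulr_gt0.
have oscb s : t0 <= s -> plaw (osc s (2 * d1) (a0 * u)) <= e / 2.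
  move=> ts; have d2_0 : 0 < 2 * d1 by rewrite mulr_gt0.
  apply: le_trans (hosc _ _ _ (le_trans (ltW t00) ts) d2_0 (mulr_gt0 a00 u0)) _.
  have -> : 2 * d1 = th `^ H^-1 by rewrite /d1 mulrC divfK.
  rewrite -powRrM mulVf ?gt_eqF// powRr1 ?(ltW th0)// /th mulrAC divff ?gt_eqF ?mulr_gt0//.
  rewrite mul1r -powRrM mulVf ?gt_eqF// powRr1 ?(ltW e1)//.
  rewrite -[leRHS]mul1r (_ : C3 * _ = (C3 / (C3 + 1)) * (e / 2)); last by field; lra.
  rewrite ler_wpM2r ?divr_ge0 ?(ltW e0)// ler_pdivrMr; lra.
exists (Num.min d1 d2); first by rewrite lt_min d10.
move=> t t' x x' /andP[tt0 tT] /andP[tt0' tT'] xB x'B.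
rewrite !le_min => /andP[t1 t2] /andP[_ x2].
have t_0 := lt_le_trans t00 tt0; have t'_0 := lt_le_trans t00 tt0'.
set z := t `^ H * x; set z' := t' `^ H * x'.
have tTH s : t0 <= s -> s <= T -> s `^ H <= TH.
  move=> s1 s2; rewrite ge0_ler_powR ?nnegrE ?(ltW H0) ?(le_trans (ltW t00) s1)//.
  exact: le_trans (ler_norm _).
have zz : `|z - z'| <= a0 * u.
  have -> : z - z' = t `^ H * (x - x') + x' * (t `^ H - t' `^ H) by rewrite /z /z'; ring.
  apply: le_trans (ler_normD _ _) _; rewrite !normrM (ger0_norm (powR_ge0 _ _)).
  apply: (@le_trans _ _ (TH * d2 + B * (L * d2))).
    apply: lerD; apply: ler_pM; rewrite ?powR_ge0//; first exact: tTH.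
    apply: le_trans (hLip _ _ _ _) _; [by apply/andP|by apply/andP|by rewrite ler_pM2l].
  rewrite (_ : TH * d2 + _ = (TH + B * L) * d2); last by ring.
  apply: (@le_trans _ _ ((TH + B * L + 1) * d2)).
    by rewrite ler_wpM2r ?(ltW d20)//; lra.
  by rewrite /d2 mulrC divfK// gt_eqF.
have zB s y : t0 <= s -> s <= T -> `|y| <= B -> `|s `^ H * y / a0| <= TH * B / a0.
  move=> s1 s2 yB; rewrite !normrM (ger0_norm (powR_ge0 _ _)) normfV (gtr0_norm a00).
  by rewrite ler_wpM2r ?invr_ge0 ?(ltW a00)// ler_pM ?powR_ge0// tTH.
have fin s z0 : t0 <= s -> `|z0 / a0| <= TH * B / a0 ->
    plaw ((below s (z0 + 2 * (a0 * u)) `\` below s (z0 - 2 * (a0 * u))) `|` osc s (2 * d1) (a0 * u)) <= e.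
  move=> s1 zB1; have s0 := le_trans (ltW t00) s1.
  apply: le_trans (plawU_le P mX _ (measurable_osc _ _ s0)) _.
    by apply: measurableD; exact: measurable_below.
  rewrite [leRHS](splitr e); apply: lerD; last exact: oscb.
  have -> : z0 + 2 * (a0 * u) = a0 * (z0 / a0 + 2 * u) by field; rewrite gt_eqF.
  have -> : z0 - 2 * (a0 * u) = a0 * (z0 / a0 - 2 * u) by field; rewrite gt_eqF.
  apply: le_trans (hL _ _ _ _ t00 s1 _ _ _) _.
  - apply: le_trans (ler_normD _ _) _; rewrite (@gtr0_norm _ (2 * u)) ?mulr_gt0// /B1; lra.
  - apply: le_trans (ler_normB _ _) _; rewrite (@gtr0_norm _ (2 * u)) ?mulr_gt0// /B1; lra.
  - lra.
  - by apply: le_trans _ uL; rewrite ler_pM2l//; lra.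
have mT : measurable (sbelow t x `\` sbelow t' x').
  by apply: measurableD; apply: measurable_sbelow; exact: ltW.
have mF s z0 : t0 <= s -> measurable ((below s (z0 + 2 * (a0 * u)) `\` below s (z0 - 2 * (a0 * u))) `|` osc s (2 * d1) (a0 * u)).
  move=> s1; have s0 := le_trans (ltW t00) s1.
  apply: measurableU; last exact: measurable_osc.
  by apply: measurableD; exact: measurable_below.
move: zz; rewrite ler_norml => /andP[zz1 zz2].
move: t1; rewrite ler_norml => /andP[t1 t1'].
have [tt'|t't] := leP t t'.
  apply: le_trans (fin t z tt0 (zB _ _ tt0 tT xB)).
  apply: (@plaw_le _ _ _ P X mX rcpath (ss_rcX ss)) => //; first exact: mF.
  move=> g gg [ga ngb]; have [og|nog] := pselect (osc t (2 * d1) (a0 * u) g); [by right|left].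
  have := osc_bound gg (ltW t_0) nog (s := t'); rewrite tt'/= => /(_ _).
  have lt2 : t' < t + 2 * d1 by lra.
  move=> /(_ lt2); rewrite ler_norml => /andP[g1 g2].
  move: ga ngb; rewrite /sbelow /below/= -/z -/z' => ga /negP; rewrite -ltNge => gb.
  split=> /=; [lra|apply/negP; rewrite -ltNge; lra].
apply: le_trans (fin t' z' tt0' (zB _ _ tt0' tT' x'B)).
apply: (@plaw_le _ _ _ P X mX rcpath (ss_rcX ss)) => //; first exact: mF.
move=> g gg [ga ngb]; have [og|nog] := pselect (osc t' (2 * d1) (a0 * u) g); [by right|left].
have := osc_bound gg (ltW t'_0) nog (s := t); rewrite (ltW t't)/= => /(_ _).
have lt2 : t < t' + 2 * d1 by lra.
move=> /(_ lt2); rewrite ler_norml => /andP[g1 g2].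
move: ga ngb; rewrite /sbelow /below/= -/z -/z' => ga /negP; rewrite -ltNge => gb.
split=> /=; [lra|apply/negP; rewrite -ltNge; lra].
Qed.

Lemma near_sqrt_ge (x : R) : \forall n \near \oo, x <= Num.sqrt n.+1%:R.
Proof.
near=> n; apply: le_trans (ler_norm _) _; rewrite -sqrtr_sqr ler_wsqrtr//.
by near: n; exact: near_natS_ge.
Unshelve. all: by end_near. Qed.

(** Chaining started at a level k0 with 2^-k0 small: nearby points give sets of small symmetric
    difference, as it requires, and the remainder of order 1 / sqrt n is small for large n. *)
Lemma block_equi (t0 Lam B e eta : R) : 0 < t0 -> 1 <= Lam -> 0 <= B -> 0 < e -> 0 < eta ->
  exists2 del : R, 0 < del & \forall n \near \oo, exists Bad : set Omega,
  [/\ measurable Bad, pr Bad <= eta &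
    forall w, ~ Bad w -> forall t t' x x',
    t0 <= t <= Lam * t0 -> t0 <= t' <= Lam * t0 -> `|x| <= B -> `|x'| <= B ->
    `|t - t'| <= del -> `|x - x'| <= del ->
    `|snu n.+1 t x w - snu n.+1 t' x' w| <= e].
Proof.
move=> t00 L1 B0 e0 eta0; have B'0 : 0 <= B * Lam `^ H by rewrite mulr_ge0 ?powR_ge0.
have [C0 [D [C [D0 C1 hbr]]]] := bracket_block ss Lam B'0.
have Cg : 0 < C by exact: lt_le_trans C1.
have [K K0 hK] := chaining mX iid (ss_rcXs ss) (ss_rcX ss) C0 D0 (ltW Cg).
have q1 : 0 <= (2^-1 : R) < 1 by lra.
have e'0 : 0 < Num.min (e / 2) eta / K by rewrite divr_gt0// lt_min eta0 andbT divr_gt0.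
have [k0 hk0] := ex_expn_le q1 e'0.
have [h1 h2] : K * 2 ^- k0 <= e / 2 /\ K * 2 ^- k0 <= eta.
  move: hk0; rewrite exprVn ler_pdivlMr// mulrC => hk0.
  by split; apply: le_trans hk0 _; rewrite ge_min lexx ?orbT.
have c16 : 0 < C * 16 ^- k0 by rewrite mulr_gt0// invr_gt0 exprn_gt0.
have [del del0 hdel] := plaw_close Lam t00 B0 c16.
exists del => //; near=> n.
have n1 : 4 ^+ k0 <= Num.sqrt n.+1%:R :> R by near: n; exact: near_sqrt_ge.
have n2 : 2 * K / e <= Num.sqrt n.+1%:R :> R by near: n; exact: near_sqrt_ge.
have [Bad [mB pB hB]] := hK _ _ (fun a => measurable_blockA H a t00) (hbr t0 t00) n 1 k0 (lexx _) n1.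
exists Bad; split=> //; first by apply: le_trans pB _; rewrite divr1.
move=> w nB t t' x x' tt tt' xB xB' dt dx.
have [a ha] := block_point t00 tt xB; have [b hb] := block_point t00 tt' xB'.
have := hB w nB a b; rewrite ha hb -/(snu n.+1 t x w) -/(snu n.+1 t' x' w) => h.
apply: le_trans (h _ _) _.
- exact: hdel.
- by apply: hdel => //; rewrite distrC.
rewrite mul1r mulrDr [leRHS](splitr e) lerD//.
have r0 : 0 < Num.sqrt n.+1%:R :> R by rewrite sqrtr_gt0 ltr0n.
by rewrite ler_pdivrMr//; move: n2; rewrite ler_pdivrMr//; lra.
Unshelve. all: by end_near. Qed.

Lemma dyadic_pow (T : R) (j : nat) : 0 <= T -> (T / 2 ^+ j) `^ H = T `^ H * (2 `^ (- H)) ^+ j.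
Proof.
move=> T0; rewrite powRM ?invr_ge0 ?exprn_ge0// powRV ?exprn_ge0// powRXn//.
by rewrite powRN exprVn.
Qed.

Lemma pow2H : 0 < (2 : R) `^ (- H) < 1.
Proof.
rewrite powR_gt0//= powRN invf_lt1 ?powR_gt0//.
have : (1 : R) `^ H < 2 `^ H by rewrite gt0_ltr_powR ?nnegrE// ltr1n.
by rewrite powR1.
Qed.

(** On the block of times of order 2^-j the process may be as large as K M j with M j = (e / K)
    q^-j, since t^H <= q^j compensates. The failure probabilities K / M j = (K^2 / e) q^j form a
    geometric series that is small from j = J on. *)
Lemma snu_small (B e eta : R) : 0 <= B -> 0 < e -> 0 < eta ->
  exists2 ts : R, 0 < ts & forall n, exists Bad : set Omega,
  [/\ measurable Bad, pr Bad <= eta &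
    forall w, ~ Bad w -> forall t x, 0 < t <= ts -> `|x| <= B ->
    t `^ H * `|snu n.+1 t x w| <= e].
Proof.
move=> B0 e0 eta0; have l2 : 1 <= 2 :> R by lra.
have [K K0 hK] := block_sup l2 B0.
set q : R := 2 `^ (- H); have /andP[q0 q1] : 0 < q < 1 := pow2H.
have q01 : 0 <= q < 1 by rewrite ltW.
(* The first bound on [q ^+ J] makes every [M j] at least 1, the second makes the series at most
   [eta]. *)
have th0 : 0 < Num.min (e / K) (eta * (1 - q) * e / K ^+ 2).
  rewrite lt_min divr_gt0//= divr_gt0 ?exprn_gt0// !mulr_gt0// subr_gt0//.
have [J hJ] := ex_expn_le q01 th0.
have [hJ1 hJ2] : q ^+ J <= e / K /\ q ^+ J <= eta * (1 - q) * e / K ^+ 2.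
  by split; apply: le_trans hJ _; rewrite ge_min lexx ?orbT.
pose M j := e / K / q ^+ j.
have M1 j : (J <= j)%N -> 1 <= M j.
  move=> Jj; rewrite /M ler_pdivlMr ?exprn_gt0// mul1r (le_trans _ hJ1)//.
  by rewrite ler_wiXn2l// ltW.
exists (1 / 2 ^+ J) => [|n]; first by rewrite divr_gt0// exprn_gt0.
have /choice[Bad hBad] : forall m : nat, exists Bad : set Omega,
   [/\ measurable Bad, pr Bad <= K / M (J + m)%N & forall w, ~ Bad w -> forall t x,
     1 / 2 ^+ (J + m).+1 <= t <= 1 / 2 ^+ (J + m) -> `|x| <= B ->
      `|snu n.+1 t x w| <= K * M (J + m)%N].
  move=> m; have t00 : 0 < 1 / 2 ^+ (J + m).+1 :> R by rewrite divr_gt0// exprn_gt0.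
  have [Bad [mB pB hB]] := hK _ n _ t00 (M1 _ (leq_addr m J)).
  exists Bad; split=> // w nB t x /andP[tl tu] xB; apply: hB => //.
  rewrite tl/= (le_trans tu)// exprS le_eqVlt; apply/orP; left; apply/eqP.
  by field; rewrite expf_neq0.
exists (\bigcup_m Bad m); split.
- by apply: bigcup_measurable => m _; have [] := hBad m.
- apply: pr_bigcup_le => [m|m]; first by have [] := hBad m.
  apply: (@le_trans _ _ (\sum_(i < m) (K ^+ 2 / e * q ^+ J) * q ^+ i)).
    apply: ler_sum => i _; have [_ h _] := hBad i; apply: le_trans h _.
    rewrite /M exprD le_eqVlt; apply/orP; left; apply/eqP; field.
    by rewrite !gt_eqF ?exprn_gt0// mulr_gt0 ?exprn_gt0.
  rewrite -mulr_sumr; apply: le_trans (ler_wpM2l _ (geom_sum_le m q01)) _.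
    by rewrite !mulr_ge0 ?exprn_ge0 ?invr_ge0 ?(ltW e0) ?(ltW K0) ?(ltW q0).
  rewrite ler_pdivrMr ?subr_gt0// -mulrAC ler_pdivrMr//.
  by move: hJ2; rewrite ler_pdivlMr ?exprn_gt0// mulrC.
move=> w nB t x tJ xB.
have [m hm] := ex_dyadic ltr01 tJ.
have nBm : ~ Bad m w by move=> bm; apply: nB; exists m.
have [_ _ h] := hBad m; have {}h := h w nBm t x hm xB.
have /andP[t0 _] := tJ; have /andP[_ tu] := hm.
have th : t `^ H <= q ^+ (J + m).
  have := dyadic_pow (J + m) (@ler01 R); rewrite powR1 mul1r -/q => <-.
  by rewrite ge0_ler_powR ?nnegrE ?(ltW H0) ?(ltW t0)// divr_ge0// exprn_ge0.
apply: (@le_trans _ _ (q ^+ (J + m) * (K * M (J + m)%N))).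
  by apply: ler_pM; rewrite ?powR_ge0.
rewrite /M le_eqVlt; apply/orP; left; apply/eqP; field.
by rewrite !gt_eqF ?exprn_gt0.
Qed.

(** A union bound over J + 1 dyadic blocks, with K free of J and n, so that J may grow with n like a
    logarithm. *)
Lemma snu_range (T B : R) : 0 < T -> 0 <= B -> exists2 K : R, 0 < K &
  forall n J (M : R), 1 <= M -> exists Bad : set Omega,
  [/\ measurable Bad, pr Bad <= J.+1%:R * (K / M) &
    forall w, ~ Bad w -> forall t x, T / 2 ^+ J <= t <= T -> `|x| <= B ->
     `|snu n.+1 t x w| <= K * M].
Proof.
move=> T0 B0; have l2 : 1 <= 2 :> R by lra.
have [K K0 hK] := block_sup l2 B0; exists K => // n J M M1.
elim: J => [|J [Bad [mB pB hB]]].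
  have [Bad [mB pB hB]] := hK _ n _ T0 M1.
  exists Bad; split=> //; first by rewrite mul1r.
  move=> w nB t x; rewrite expr0 divr1 => /andP[t1 t2] xB; apply: hB => //.
  by rewrite t1/= (le_trans t2)// ler_peMl// ltW.
have t00 : 0 < T / 2 ^+ J.+1 by rewrite divr_gt0// exprn_gt0.
have [Bad' [mB' pB' hB']] := hK _ n _ t00 M1.
exists (Bad `|` Bad'); split; first exact: measurableU.
  apply: le_trans (prU_le _ mB mB') _.
  by rewrite -(natr1 J.+1) mulrDl mul1r lerD.
move=> w /not_orP[nB nB'] t x /andP[t1 t2] xB.
have [tJ|tJ] := leP (T / 2 ^+ J) t; first by apply: hB => //; rewrite tJ.
apply: hB' => //; rewrite t1/= (le_trans (ltW tJ))// exprS le_eqVlt; apply/orP; left.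
by apply/eqP; field; rewrite expf_neq0.
Qed.

Lemma snu_equi (T B e eta : R) : 0 < T -> 0 <= B -> 0 < e -> 0 < eta ->
  exists2 del : R, 0 < del & \forall n \near \oo, exists Bad : set Omega,
  [/\ measurable Bad, pr Bad <= eta &
    forall w, ~ Bad w -> forall t t' x x',
    0 <= t <= T -> 0 <= t' <= T -> `|x| <= B -> `|x'| <= B ->
    `|t - t'| <= del -> `|x - x'| <= del ->
    `|t `^ H * snu n.+1 t x w - t' `^ H * snu n.+1 t' x' w| <= e].
Proof.
move=> T0 B0 e0 eta0.
have eta3 : 0 < eta / 3 by rewrite divr_gt0.
have e2 : 0 < e / 2 by rewrite divr_gt0.
have [ts ts0 hs] := snu_small B0 e2 eta3.
pose t0 := Num.min (ts / 2) T; have t00 : 0 < t0 by rewrite lt_min T0 divr_gt0.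
have t0T : t0 <= T by rewrite ge_min lexx orbT.
pose Lam := T / t0; have L1 : 1 <= Lam by rewrite ler_pdivlMr// mul1r.
have LT : Lam * t0 = T by rewrite divfK// gt_eqF.
have TH0 : 0 < T `^ H by exact: powR_gt0.
have e3 : 0 < e / (2 * T `^ H) by rewrite divr_gt0// mulr_gt0.
have [d1 d10 hd1] := block_equi t00 L1 B0 e3 eta3.
have [K K0 hK] := block_sup L1 B0.
pose M := Num.max 1 (3 * K / eta).
have M1 : 1 <= M by rewrite le_max lexx.
have M0 : 0 < M by lra.
have KM : K / M <= eta / 3.
  rewrite ler_pdivrMr//; have : 3 * K / eta <= M by rewrite le_max lexx orbT.
  by rewrite ler_pdivrMr//; lra.
have [L L0 hL] := powR_lip T H0 t00.
pose d2 := e / (2 * L * (K * M)).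
have d20 : 0 < d2 by rewrite divr_gt0// !mulr_gt0.
exists (Num.min (Num.min d1 d2) (ts / 2)).
  by rewrite !lt_min d10 d20 divr_gt0.
near=> n.
have [B1 [mB1 pB1 hB1]] := hs n.
have [B2 [mB2 pB2 hB2]] := hK t0 n M t00 M1.
have [B3 [mB3 pB3 hB3]] : exists Bad : set Omega,
  [/\ measurable Bad, pr Bad <= eta / 3 &
    forall w, ~ Bad w -> forall t t' x x',
    t0 <= t <= Lam * t0 -> t0 <= t' <= Lam * t0 -> `|x| <= B -> `|x'| <= B ->
    `|t - t'| <= d1 -> `|x - x'| <= d1 ->
    `|snu n.+1 t x w - snu n.+1 t' x' w| <= e / (2 * T `^ H)].
  by near: n.
exists ((B1 `|` B2) `|` B3); split.
- by apply: measurableU => //; exact: measurableU.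
- apply: le_trans (prU_le _ (measurableU _ _ mB1 mB2) mB3) _.
  by have := prU_le P mB1 mB2; lra.
move=> w /not_orP[/not_orP[n1 n2] n3] t t' x x' /andP[tt0 tT] /andP[tt0' tT'] xB xB'.
rewrite !le_min => /andP[/andP[dt1 dt2] dt3] /andP[/andP[dx1 dx2] _].
have small s y : 0 <= s -> s <= ts -> `|y| <= B -> `|s `^ H * snu n.+1 s y w| <= e / 2.
  rewrite le_eqVlt => /predU1P[<-|s0] st yB.
    by rewrite powR0 ?gt_eqF// mul0r normr0 ltW.
  by rewrite normrM (ger0_norm (powR_ge0 _ _)); apply: hB1 => //; rewrite s0.
have [/andP[ht ht']|hn] := boolP ((t <= ts) && (t' <= ts)).
  apply: le_trans (ler_normB _ _) _; rewrite [leRHS](splitr e).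
  by apply: lerD; exact: small.
have [st st'] : t0 <= t /\ t0 <= t'.
  move: hn dt3; rewrite negb_and -!ltNge ler_norml /t0 !ge_min => hn /andP[? ?].
  by split; apply/orP; left; case/orP: hn => ?; lra.
have tl : t0 <= t <= Lam * t0 by rewrite LT st.
have tl' : t0 <= t' <= Lam * t0 by rewrite LT st'.
have h1 := hB3 w n3 _ _ _ _ tl tl' xB xB' dt1 dx1.
have h2 := hB2 w n2 _ _ tl' xB'.
rewrite LT in tl tl'; have h3 := hL _ _ tl' tl.
move: (snu n.+1 t x w) (snu n.+1 t' x' w) h1 h2 => v v' h1 h2.
rewrite (_ : t `^ H * v - t' `^ H * v' = t `^ H * (v - v') + (t `^ H - t' `^ H) * v'); last by ring.
apply: le_trans (ler_normD _ _) _; rewrite !normrM (ger0_norm (powR_ge0 _ _)) [leRHS](splitr e).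
apply: lerD.
  apply: (@le_trans _ _ (T `^ H * (e / (2 * T `^ H)))).
    by apply: ler_pM; rewrite ?powR_ge0// ge0_ler_powR ?nnegrE ?(ltW H0) ?(ltW T0).
  by rewrite le_eqVlt; apply/orP; left; apply/eqP; field; rewrite gt_eqF.
apply: (@le_trans _ _ (L * d2 * (K * M))).
  by apply: ler_pM => //; apply: le_trans h3 _; rewrite ler_pM2l.
by rewrite /d2 le_eqVlt; apply/orP; left; apply/eqP; field; rewrite !gt_eqF.
Unshelve. all: by end_near. Qed.


End block_bounds.

(** * Bahadur representation of the empirical quantiles *)

Section quantiles.
Context {R : realType}.

Lemma quantile_le (F : R -> R) (al x l : R) :
  (forall y, al <= F y -> l <= y) -> al <= F x -> quantile F al <= x.
Proof. by move=> lb Fx; apply: ge_inf => //; exists l. Qed.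

Lemma quantile_ge (F : R -> R) (al x u : R) :
  (forall y z, y <= z -> F y <= F z) -> al <= F u -> F x < al -> x <= quantile F al.
Proof.
move=> mF Fu Fx; apply: lb_le_inf; first by exists u.
move=> y /= Fy; rewrite leNgt; apply/negP => /ltW/mF yx.
by have := le_lt_trans (le_trans Fy yx) Fx; rewrite ltxx.
Qed.

Lemma quantile_eq (F : R -> R) (al c : R) : (forall x, (al <= F x) = (c <= x)) ->
  quantile F al = c.
Proof.
move=> h; apply/eqP; rewrite eq_le; apply/andP; split.
  by apply: (@quantile_le _ _ _ c) => [y|]; rewrite h.
by apply: lb_le_inf => [|y /=]; [exists c; rewrite /= h|rewrite h].
Qed.

End quantiles.

Section empirical_quantiles.
Context {R : realType} {Om : Type} (Xs : nat -> R -> Om -> R).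
Implicit Types (n : nat) (t x al lam : R) (w : Om).

Lemma emp_cdf_le n t x y w : x <= y -> emp_cdf Xs n t x w <= emp_cdf Xs n t y w.
Proof.
move=> xy; rewrite /emp_cdf ler_wpM2l ?invr_ge0// ler_sum// => i _.
by case: ifPn => [xx|_]; [rewrite (le_trans xx xy)|case: ifP].
Qed.

Lemma emp_cdf1 n t x w : (forall i : 'I_n.+1, Xs i t w <= x) -> emp_cdf Xs n.+1 t x w = 1.
Proof.
move=> h; rewrite /emp_cdf (eq_bigr (fun=> 1)); last by move=> i _; rewrite h.
by rewrite sumr_const card_ord mulVf.
Qed.

Lemma emp_cdf0 n t x w : (forall i : 'I_n, x < Xs i t w) -> emp_cdf Xs n t x w = 0.
Proof.
move=> h; rewrite /emp_cdf (eq_bigr (fun=> 0)); first by rewrite sumr_const mul0rn mulr0.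
by move=> i _; rewrite leNgt h.
Qed.

Lemma ex_sample_bound n t w : exists2 l : R, 0 < l & forall i : 'I_n, `|Xs i t w| < l.
Proof.
exists (\sum_(i < n) `|Xs i t w| + 1); first by rewrite ltr_wpDl// sumr_ge0.
move=> i; rewrite (bigD1 i)//= -addrA ltrDl ltr_wpDl// sumr_ge0//.
Qed.

Lemma tau_n_le n t x al w : 0 < al -> al <= emp_cdf Xs n.+1 t x w ->
  tau_n Xs n.+1 t al w <= x.
Proof.
move=> al0; have [l _ hl] := ex_sample_bound n.+1 t w.
apply: (@quantile_le _ (fun y => emp_cdf Xs n.+1 t y w) al x (- l)) => y ay; rewrite leNgt; apply/negP => yl.
have := lt_le_trans al0 ay; rewrite emp_cdf0 ?ltxx// => i.
by have := hl i; rewrite ltr_norml => /andP[h _]; exact: lt_trans yl h.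
Qed.

Lemma tau_n_ge n t x al w : al <= 1 -> emp_cdf Xs n.+1 t x w < al ->
  x <= tau_n Xs n.+1 t al w.
Proof.
move=> al1; have [l _ hl] := ex_sample_bound n.+1 t w.
apply: (@quantile_ge _ (fun y => emp_cdf Xs n.+1 t y w) al x l) => [y z|]; first exact: emp_cdf_le.
by rewrite emp_cdf1// => i; have := hl i; rewrite ltr_norml => /andP[_ /ltW].
Qed.

(** The factor 2 supplies the strict inequality that makes the empirical distribution function
    vanish at the lower bound. *)
Lemma tau_n_small n t lam al w : 0 < lam -> 0 < al <= 1 ->
  (forall i : 'I_n.+1, `|Xs i t w| <= lam) -> `|tau_n Xs n.+1 t al w| <= 2 * lam.
Proof.
move=> lam0 /andP[al0 al1] h; rewrite ler_norml; apply/andP; split.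
  apply: tau_n_ge => //; rewrite emp_cdf0// => i.
  by have := h i; rewrite ler_norml => /andP[? _]; lra.
apply: tau_n_le => //; rewrite emp_cdf1// => i.
by have := h i; rewrite ler_norml => /andP[_ ?]; lra.
Qed.

End empirical_quantiles.

Section scales.
Context {R : realType}.

(** J n is a multiple of the integer logarithm of sqrt(n + 1) in base 4. The three bounds serve the
    union over J n + 1 blocks, the size of t^H below the cut, and the union over the samples of the
    oscillation event from time 0. *)
Lemma ex_scale (q kap : R) : 0 < q < 1 -> 0 < kap -> exists J : nat -> nat,
  forall e : R, 0 < e -> \forall n \near \oo,
  [/\ (J n).+1%:R / Num.sqrt n.+1%:R <= e, Num.sqrt n.+1%:R * q ^+ J n <= e &
      n.+1%:R * (Num.sqrt n.+1%:R * q ^+ J n) `^ kap <= e].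
Proof.
move=> /andP[q0 q1] kap0; have q01 : 0 <= q < 1 by rewrite ltW.
(* With k the logarithm, n + 1 is at most 16 times 16^k, and 32 beats it: if 4 q^m <= 32^(-1 / kap),
   the third quantity is at most 16 4^kap 2^-k. The bound 4 q^m <= 1/2 serves the second. *)
pose c := Num.min (32 `^ (- kap^-1) / 4) (1 / 8 : R).
have c0 : 0 < c by rewrite lt_min !divr_gt0// powR_gt0.
have [m hm] := ex_expn_le q01 c0.
have [hm1 hm2] : 4 * q ^+ m <= 32 `^ (- kap^-1) /\ 4 * q ^+ m <= 1 / 2.
  have h1 : c <= 32 `^ (- kap^-1) / 4 by rewrite ge_min lexx.
  have h2 : c <= 1 / 8 by rewrite ge_min lexx orbT.
  by split; lra.
have /choice[k hk] : forall n : nat, exists k : nat,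
    4 ^+ k <= Num.sqrt n.+1%:R :> R /\ Num.sqrt n.+1%:R < 4 ^+ k.+1 :> R.
  move=> n; have [|k /andP[]] := @ex_pow4 R (Num.sqrt n.+1%:R); last by exists k.
  by rewrite -[leLHS]sqrtr1 ler_wsqrtr// ler1n.
have hk2 (e : R) : 0 < e -> \forall n \near \oo, 2 ^- k n <= e.
  move=> e0; have h2 : 0 <= (2^-1 : R) < 1 by lra.
  have [j hj] := ex_expn_le h2 e0; near=> n.
  apply: le_trans hj; rewrite exprVn lef_pV2 ?posrE ?exprn_gt0// ler_eXn2l ?ltr1n//.
  have h4 : 4 ^+ j <= Num.sqrt n.+1%:R :> R by near: n; exact: near_sqrt_ge.
  have [_ h5] := hk n.
  by have := le_lt_trans h4 h5; rewrite ltr_eXn2l ?ltr1n// ltnS.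
exists (fun n => (m * k n)%N) => e e0; near=> n.
set N := Num.sqrt n.+1%:R; have [k1 k2] := hk n; rewrite -/N in k1 k2.
have N0 : 0 < N by rewrite sqrtr_gt0 ltr0n.
have N2 : n.+1%:R = N ^+ 2 by rewrite sqr_sqrtr.
have t0 : 0 < 2 ^- k n :> R by rewrite invr_gt0 exprn_gt0.
have two4 (j : nat) : 4 ^+ j = 2 ^+ j * 2 ^+ j :> R.
  by rewrite -exprMn; congr (_ ^+ _); rewrite -natrM.
have NqJ : N * q ^+ (m * k n) <= 4 * (4 * q ^+ m) ^+ k n.
  rewrite exprMn -exprM mulrA ler_wpM2r ?exprn_ge0 ?(ltW q0)// -exprS; exact: ltW.
have qm0 : 0 <= 4 * q ^+ m by rewrite mulr_ge0// exprn_ge0// ltW.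
have NqJ0 : 0 <= N * q ^+ (m * k n) by rewrite mulr_ge0 ?exprn_ge0 ?(ltW N0) ?(ltW q0).
split.
- have h : m.+1%:R * 2 ^- k n <= e.
    by rewrite mulrC -ler_pdivlMr ?ltr0n//; near: n; apply: hk2; rewrite divr_gt0 ?ltr0n.
  apply: le_trans h; rewrite ler_pdivrMr//.
  apply: (@le_trans _ _ (m.+1%:R * 2 ^- k n * 4 ^+ k n)); last first.
    by rewrite ler_wpM2l// mulr_ge0// ltW.
  rewrite two4 -!mulrA mulKf ?expf_neq0// -natrX -natrM ler_nat.
  apply: (@leq_trans (m.+1 * (k n).+1)); first by rewrite mulSn mulnS addSn ltnS addnA leq_addl.
  by rewrite leq_mul2l/= ltn_expl.
- have h : 4 * 2 ^- k n <= e.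
    by rewrite mulrC -ler_pdivlMr//; near: n; apply: hk2; rewrite divr_gt0.
  apply: le_trans h; apply: le_trans NqJ _; rewrite ler_pM2l// -exprVn lerXn2r ?nnegrE//.
  by move: hm2; rewrite div1r.
have h : 16 * 4 `^ kap * 2 ^- k n <= e.
  rewrite mulrC -ler_pdivlMr ?mulr_gt0 ?powR_gt0//; near: n; apply: hk2.
  by rewrite divr_gt0// mulr_gt0// powR_gt0.
apply: le_trans h.
apply: (@le_trans _ _ ((4 ^+ (k n).+1) ^+ 2 * (4 * (4 * q ^+ m) ^+ k n) `^ kap)).
  apply: ler_pM; rewrite ?powR_ge0//.
    by rewrite N2 lerXn2r ?nnegrE ?exprn_ge0 ?(ltW N0)// ltW.
  by rewrite ge0_ler_powR ?nnegrE ?(ltW kap0)// mulr_ge0// exprn_ge0.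
rewrite powRM ?exprn_ge0// powRXn//.
have h1 : (4 * q ^+ m) `^ kap <= 32^-1.
  have -> : 32^-1 = (32 `^ (- kap^-1)) `^ kap :> R.
    by rewrite -powRrM mulNr mulVf ?gt_eqF// powR_inv1.
  by rewrite ge0_ler_powR ?nnegrE ?powR_ge0 ?(ltW kap0).
have h2 : ((4 * q ^+ m) `^ kap) ^+ k n <= (32^-1) ^+ k n by rewrite lerXn2r ?nnegrE ?powR_ge0 ?invr_ge0.
have -> : (4 ^+ (k n).+1) ^+ 2 = 16 * (4 ^+ k n) ^+ 2 :> R by rewrite [4 ^+ (k n).+1]exprS; ring.
rewrite (_ : 16 * _ * _ = 16 * 4 `^ kap * ((4 ^+ k n) ^+ 2 * ((4 * q ^+ m) `^ kap) ^+ k n)); last by ring.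
rewrite ler_wpM2l ?mulr_ge0 ?powR_ge0//.
apply: le_trans (ler_wpM2l (exprn_ge0 _ (exprn_ge0 _ _)) h2) _ => //.
have z0 : 2 ^+ k n != 0 :> R by rewrite expf_neq0.
have -> : (32^-1) ^+ k n = (2 ^+ k n) ^- 5 :> R.
  by rewrite exprVn -exprM mulnC exprM; congr ((_ ^+ _)^-1); rewrite -natrX.
by rewrite two4 le_eqVlt; apply/orP; left; apply/eqP; field.
Unshelve. all: by end_near. Qed.

End scales.

Section bahadur.
Context {R : realType} {d : measure_display} {Omega : measurableType d}
  (P : probability Omega R) (X : R -> Omega -> R) (Xs : nat -> R -> Omega -> R)
  (H : R) (Phi p : R -> R).
Hypothesis ss : selfsim P X Xs H Phi p.
Local Notation pr := (pr P).
Local Notation plaw := (plaw P X).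
Local Notation snu := (snu P X Xs H).

Let mX := ss_mX ss.
Let iid := ss_iid ss.
Let H0 := ss_H ss.

Lemma ex_quantile : exists q : R -> R, forall al : R, 0 < al < 1 -> Phi (q al) = al.
Proof.
suff /choice[q hq] : forall al : R, exists x : R, 0 < al < 1 -> Phi x = al by exists q.
move=> al; have [/andP[al0 al1]|_] := boolP (0 < al < 1); last by exists 0.
pose e := Num.min al (1 - al).
have e0 : 0 < e by rewrite lt_min al0 subr_gt0.
have m1 := mX ler01.
have [L L0 hL] := tight_single P m1 e0.
have PhiE x : pr [set w | X 1 w <= x] = Phi x.
  by rewrite (ss_cdf ss x ltr01) powR1 divr1.
have b1 : Phi (- (L + 1)) <= al.
  rewrite -PhiE; apply: (@le_trans _ _ e); last by rewrite ge_min lexx.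
  apply: le_trans hL; apply: pr_le; [exact: measurable_le|exact: measurable_norm_gt|].
  by move=> w /= h; rewrite ltr_normr; apply/orP; right; lra.
have b2 : al <= Phi (L + 1).
  rewrite -PhiE; have e1 : e <= 1 - al by rewrite ge_min lexx orbT.
  have := prC P (measurable_le m1 (L + 1)).
  have : pr (~` [set w | X 1 w <= L + 1]) <= e.
    apply: le_trans hL; apply: pr_le; [apply: measurableC; exact: measurable_le|exact: measurable_norm_gt|].
    by move=> w /= /negP; rewrite -ltNge => h; rewrite ltr_normr; apply/orP; left; lra.
  by lra.
have [|||z _ hz] := @IVT R Phi (- (L + 1)) (L + 1) al.
- by lra.
- by apply: continuous_subspaceT; exact: (cont_Phi ss).
- by rewrite ge_min le_max b1 b2 orbT.
by exists z.
Qed.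

Variable q : R -> R.
Hypothesis hq : forall al : R, 0 < al < 1 -> Phi (q al) = al.

Lemma q_le al be : 0 < al < 1 -> 0 < be < 1 -> al <= be -> q al <= q be.
Proof.
move=> a1 b1 ab; rewrite leNgt; apply/negP => /(Phi_lt ss).
by rewrite !hq// ltNge ab.
Qed.

Lemma q_bound a b : 0 < a -> b < 1 -> exists2 B : R, 0 <= B &
  forall al, a <= al <= b -> `|q al| <= B.
Proof.
move=> a0 b1; exists (`|q a| + `|q b|) => [|al /andP[aal alb]]; first exact: addr_ge0.
have ab := le_trans aal alb.
have al1 : 0 < al < 1 by rewrite (lt_le_trans a0 aal) (le_lt_trans alb b1).
have a1 : 0 < a < 1 by rewrite a0 (le_lt_trans ab b1).
have b01 : 0 < b < 1 by rewrite (lt_le_trans a0 ab).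
have := q_le a1 al1 aal; have := q_le al1 b01 alb.
have := ler_norm (q b); have := ler_norm (- q a); have := normr_ge0 (q a).
have := normr_ge0 (q b); rewrite normrN ler_norml => *; apply/andP; split; lra.
Qed.

Lemma q_lip a b : 0 < a -> b < 1 -> exists2 L : R, 0 < L &
  forall al be, a <= al <= b -> a <= be <= b -> `|q al - q be| <= L * `|al - be|.
Proof.
move=> a0 b1; have [B B0 hB] := q_bound a0 b1.
have [Lp Lp0 [lp lp0 hp]] := p_bounds ss B.
exists lp^-1 => [|al be ha hb]; first by rewrite invr_gt0.
have in01 x : a <= x <= b -> 0 < x < 1.
  by move=> /andP[h1 h2]; rewrite (lt_le_trans a0 h1) (le_lt_trans h2 b1).
have [c [_ cxy E]] := mvt_abs (ss_der ss) (q be) (q al).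
have cB : `|c| <= B.
  have := hB _ ha; have := hB _ hb; rewrite !ler_norml => /andP[x1 x2] /andP[y1 y2].
  move: cxy => /andP[c1 c2].
  by rewrite (le_trans _ c1) ?le_min ?x1//= (le_trans c2)// ge_max x2.
have /andP[h _] := hp _ cB.
rewrite mulrC ler_pdivlMr// -[X in _ <= `|X - _|](hq (in01 _ ha)) -[X in _ <= `|_ - X|](hq (in01 _ hb)).
by rewrite E normrM mulrC ler_wpM2r// (le_trans h)// ler_norm.
Qed.

Hypothesis X00 : P [set w | X 0 w = 0] = 1%E.

(** At t = 0 the law is the unit mass at 0 and both sides vanish; for t > 0 monotonicity of the
    strictly increasing [Phi] is inverted. *)
Lemma tauE t al : 0 <= t -> 0 < al < 1 -> tau P X t al = t `^ H * q al.
Proof.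
rewrite le_eqVlt => /predU1P[<-|t0] al1; apply: quantile_eq => x.
  rewrite powR0 ?gt_eqF// mul0r; have mX0 := mX (lexx 0).
  rewrite /cdfX -/(prob_of P [set w | X 0 w <= x]).
  have m0 : measurable [set w | X 0 w = 0].
    rewrite (_ : [set w | X 0 w = 0] = [set w | X 0 w <= 0] `&` [set w | 0 <= X 0 w]).
      by apply: measurableI; [exact: measurable_le|exact: measurable_ge].
    apply/seteqP; split => w /=; first by move=> ->.
    by move=> [h1 h2]; apply/eqP; rewrite eq_le h1 h2.
  have p1 : pr [set w | X 0 w = 0] = 1 by rewrite /prob_of X00.
  have mx := measurable_le mX0 x; case/andP: al1 => a0 a1.
  have [x0|x0] := leP 0 x.
    by rewrite (le_trans (ltW a1))// -p1; apply: pr_le => // w /= ->; exact: x0.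
  apply/negbTE; rewrite -ltNge (le_lt_trans _ a0)//.
  rewrite -[leRHS](subrr (1 : R)) -[X in _ <= _ - X]p1 -prC//.
  apply: pr_le => //; first exact: measurableC.
  by move=> w /= h h0; move: h; rewrite h0 leNgt x0.
rewrite /cdfX -/(prob_of P [set w | X t w <= x]) (ss_cdf ss)//.
have a0 : 0 < t `^ H by exact: powR_gt0.
rewrite -[X in X <= _](hq al1).
have -> : (t `^ H * q al <= x) = (q al <= x / t `^ H) by rewrite ler_pdivlMr// mulrC.
apply/idP/idP => h; last exact: (Phi_le ss).
by rewrite leNgt; apply/negP => /(Phi_lt ss); rewrite ltNge h.
Qed.

Lemma emp_cdf_snu n t x w : 0 < t ->
  emp_cdf Xs n.+1 t (t `^ H * x) w = Phi x + snu n.+1 t x w / Num.sqrt n.+1%:R.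
Proof.
move=> t0; have a0 : 0 < t `^ H by exact: powR_gt0.
have ms := measurable_sbelow H x (ltW t0).
have pE : Epath P X \1_(sbelow H t x) = Phi x.
  by rewrite plaw_Epath// (plaw_below ss)// mulrAC divff ?mul1r// gt_eqF.
rewrite -[snu _ _ _ _]/(emp P X Xs n.+1 (\1_(sbelow H t x)) w) /emp pE /emp_cdf sumrB sumr_const card_ord mulrBr mulrBl.
have iE (i : 'I_n.+1) : \1_(sbelow H t x) (spath Xs i w) =
    (if Xs i t w <= t `^ H * x then 1 else 0) :> R.
  rewrite indicE (_ : (_ \in _) = (Xs i t w <= t `^ H * x)); first by case: ifP.
  by apply/idP/idP; rewrite inE.
rewrite (eq_bigr _ (fun i _ => iE i)); set S := \sum_(i < n.+1) _.
have n0 : n.+1%:R != 0 :> R by rewrite pnatr_eq0.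
set N := Num.sqrt _; have NN : N ^+ 2 = n.+1%:R by rewrite sqr_sqrtr.
have N0 : N != 0 by rewrite gt_eqF// sqrtr_gt0 ltr0n.
by rewrite -[Phi x *+ _]mulr_natr -NN; field.
Qed.

Definition quant_dev (n : nat) (t al : R) (w : Omega) : R :=
  Num.sqrt n%:R * (tau_n Xs n t al w - t `^ H * q al).

(** The empirical quantile is at most t^H x as soon as the empirical distribution function at t^H x
    reaches al; x is the point that corresponds to a deviation u on the scale of [quant_dev]. *)
Lemma quant_dev_le n t al u w : 0 < t -> 0 < al < 1 ->
  let x := q al + u / (Num.sqrt n.+1%:R * t `^ H) in
  - snu n.+1 t x w <= Num.sqrt n.+1%:R * (Phi x - al) -> quant_dev n.+1 t al w <= u.
Proof.
move=> t0 al1 x; set N := Num.sqrt _ in x * => h.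
have N0 : 0 < N by rewrite sqrtr_gt0 ltr0n.
have a0 : 0 < t `^ H by exact: powR_gt0.
have : tau_n Xs n.+1 t al w <= t `^ H * x.
  apply: tau_n_le; first by case/andP: al1.
  rewrite emp_cdf_snu// -/N -lerBlDl ler_pdivlMr// mulrC.
  by move: h; rewrite mulrBr; lra.
move=> h2; rewrite /quant_dev -/N mulrC -ler_pdivlMr// lerBlDl (le_trans h2)//.
by rewrite /x mulrDr lerD2l le_eqVlt; apply/orP; left; apply/eqP; field; rewrite !gt_eqF.
Qed.

Lemma quant_dev_ge n t al u w : 0 < t -> 0 < al < 1 ->
  let x := q al + u / (Num.sqrt n.+1%:R * t `^ H) in
  snu n.+1 t x w < Num.sqrt n.+1%:R * (al - Phi x) -> u <= quant_dev n.+1 t al w.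
Proof.
move=> t0 al1 x; set N := Num.sqrt _ in x * => h.
have N0 : 0 < N by rewrite sqrtr_gt0 ltr0n.
have a0 : 0 < t `^ H by exact: powR_gt0.
have : t `^ H * x <= tau_n Xs n.+1 t al w.
  apply: tau_n_ge; first by case/andP: al1 => _ /ltW.
  rewrite emp_cdf_snu// -/N -ltrBrDl ltr_pdivrMr// mulrC.
  by move: h; rewrite mulrBr; lra.
move=> h2; rewrite /quant_dev -/N mulrC -ler_pdivrMr// lerBrDl (le_trans _ h2)//.
by rewrite /x mulrDr lerD2l le_eqVlt; apply/orP; left; apply/eqP; field; rewrite !gt_eqF.
Qed.

Lemma sample0 : pr (\bigcup_i [set w | Xs i 0 w != 0]) = 0.
Proof.
have m0 (Y : Omega -> R) : measurable_fun setT Y -> measurable [set w | Y w != 0].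
  move=> mY; rewrite (_ : [set w | _] = [set w | 0 < `|Y w|]); first exact: measurable_norm_gt.
  by apply/seteqP; split=> w /=; rewrite normr_gt0.
have mXs i : measurable_fun setT (Xs i 0) by case: iid => + _; apply.
have z i : pr [set w | Xs i 0 w != 0] = 0.
  pose C : set (pathT R) := [set g : R -> R | g 0 != 0].
  have mC : measurable C.
    rewrite (_ : C = [set g : R -> R | 0 < `|g 0|]).
      by apply: measurable_norm_gt; exact: measurable_coord.
    by apply/seteqP; split=> g /=; rewrite /C/= normr_gt0.
  have := path_law mX iid i mC; rewrite (_ : spath Xs i @^-1` C = [set w | Xs i 0 w != 0])// => ->.
  rewrite (_ : spath0 X @^-1` C = ~` [set w | X 0 w = 0]); last first.
    by apply/seteqP; split=> w /=; rewrite /C/= /spath0 => /eqP.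
  rewrite prC; last first.
    have := m0 _ (mX (lexx 0)) => /measurableC; congr measurable.
    by apply/seteqP; split=> w /=; [move=> /negP; rewrite negbK => /eqP|move=> ->; rewrite eqxx].
  by rewrite /prob_of X00 subrr.
apply/eqP; rewrite eq_le pr_ge0 andbT; apply: pr_bigcup_le => [i|n]; first exact: m0.
by rewrite big1// => i _; exact: z.
Qed.

(** A union bound over the samples for oscillation from time 0. That the samples start at 0 holds
    only almost surely, hence the additional null event. *)
Lemma sample_small (T : R) (J : nat) n (lam : R) : 0 < T -> 0 < lam ->
  exists Bad : set Omega, [/\ measurable Bad,
   pr Bad <= n.+1%:R * plaw (osc 0 (T / 2 ^+ J) lam) &
   forall w, ~ Bad w -> forall t (i : 'I_n.+1), 0 <= t < T / 2 ^+ J -> `|Xs i t w| <= lam].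
Proof.
move=> T0 lam0; pose O := osc 0 (T / 2 ^+ J) lam.
have mO : measurable O by exact: measurable_osc.
have mi i : measurable (spath Xs i @^-1` O) by exact: (measurable_path_event iid).
pose Z := \bigcup_i [set w | Xs i 0 w != 0].
have mZ : measurable Z.
  apply: bigcup_measurable => i _.
  rewrite (_ : [set w | _] = [set w | 0 < `|Xs i 0 w|]); last first.
    by apply/seteqP; split=> w /=; rewrite normr_gt0.
  by apply: measurable_norm_gt; case: iid => + _; apply.
have mU : measurable (\big[setU/set0]_(i < n.+1) spath Xs i @^-1` O).
  by apply: bigsetU_measurable => i _; exact: mi.
exists ((\big[setU/set0]_(i < n.+1) (spath Xs i @^-1` O)) `|` Z); split.
- exact: measurableU.
- apply: le_trans (prU_le _ mU mZ) _; rewrite sample0 addr0.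
  apply: (@pr_union_le _ _ _ P n.+1 (fun i => spath Xs i @^-1` O)) => // i _.
  by rewrite (path_law mX iid).
move=> w /not_orP[nO nZ] t i ti.
have X0 : Xs i 0 w = 0.
  by apply/eqP/negP => /negP h; apply: nZ; exists (val i).
have nOi : ~ O (spath Xs i w).
  by move=> h; apply: nO; apply: (@bigsetU_intro _ _ (fun i => spath Xs i @^-1` O) i).
have rc : rcpath (spath Xs i w) by exact: (ss_rcXs ss).
have := osc_bound rc (lexx 0) nOi (s := t); rewrite add0r => /(_ ti).
by rewrite /spath X0 subr0.
Qed.

Lemma p_unif (B e : R) : 0 <= B -> 0 < e -> exists2 del : R, 0 < del &
  forall x y, `|x| <= B -> `|y| <= B -> `|x - y| <= del -> `|p x - p y| <= e.
Proof.
move=> B0 e0.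
have cK : compact `[- B, B]%classic by exact: segment_compact.
have cov := (iffLR (compact_near_coveringP _)) cK.
have {}cov := cov R (0 : R)^'+ (fun del x => forall y, `|x - y| <= del -> `|p x - p y| <= e) _.
have [del del0 hdel] : exists2 del : R, 0 < del & forall x, `|x| <= B ->
    forall y, `|x - y| <= del -> `|p x - p y| <= e.
  have {}cov : \forall del \near 0^'+, `[- B, B]%classic `<=`
      (fun x => forall y, `|x - y| <= del -> `|p x - p y| <= e).
    apply: cov => x _; have e2 : 0 < e / 2 by rewrite divr_gt0.
    have cp : continuous p := ss_cont ss.
    have /cvgrPdist_le/(_ _ e2) := cp x.
    move=> [r /= r0 hr]; have r2 : 0 < r / 2 by rewrite divr_gt0.
    exists (ball x (r / 2), [set del | del < r / 2]).
      by split; [exact: nbhsx_ballx|exact: nbhs_right_lt].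
    move=> [z del] /= [xz dr] y zy.
    have h1 := hr z; have h2 := hr y; rewrite /ball/= in xz h1 h2.
    have {}h1 : `|p x - p z| <= e / 2 by apply: h1; apply: lt_trans xz _; lra.
    have {}h2 : `|p x - p y| <= e / 2.
      apply: h2; have := ler_normD (x - z) (z - y); rewrite addrA subrK; lra.
    have -> : p z - p y = (p x - p y) - (p x - p z) by ring.
    by apply: le_trans (ler_normB _ _) _; lra.
  near (0 : R)^'+ => del; exists del; first by near: del; exact: nbhs_right_gt.
  move=> x xB; have : `[- B, B]%classic x by rewrite /= in_itv/= -ler_norml.
  by apply: (near cov del).
by exists del => // x y xB _ xy; exact: hdel.
Unshelve. all: by end_near. Qed.

(* Small times are handled in two regimes: for t >= T 2^-J the deviation of the
   empirical distribution function is o(1), below that all samples are o(n^-1/2). *)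
Lemma quant_dev_small (T a b e eta : R) : 0 < T -> 0 < a -> b < 1 -> 0 < e -> 0 < eta ->
  exists2 ts : R, 0 < ts & \forall n \near \oo, exists Bad : set Omega,
  [/\ measurable Bad, pr Bad <= eta &
    forall w, ~ Bad w -> forall t al, 0 <= t <= T -> t <= ts -> a <= al <= b ->
    `|quant_dev n.+1 t al w| <= e].
Proof.
move=> T0 a0 b1 e0 eta0.
have [Q Q0 hQ] := q_bound a0 b1.
pose B := Q + 1; have B0 : 0 <= B by rewrite addr_ge0.
have [Lp Lp0 [lp lp0 hp]] := p_bounds ss B.
have eta3 : 0 < eta / 3 by rewrite divr_gt0.
have e1 : 0 < lp * e / 2 by rewrite divr_gt0// mulr_gt0.
have [ts ts0 hs] := snu_small ss B0 e1 eta3.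
have [K K0 hK] := snu_range ss T0 B0.
have [C3 [kap [C30 kap0 hosc]]] := ss_osc ss.
have [J hJ] := ex_scale (pow2H ss) kap0.
set q2 : R := 2 `^ (- H) in hJ.
have TH0 : 0 < T `^ H by exact: powR_gt0.
exists ts => //.
pose c4 := (T `^ H * 4 / e) `^ kap * C3 + 1.
have c40 : 0 < c4 by rewrite ltr_wpDl// mulr_ge0// powR_ge0.
(* The three bounds make small, in this order, the range event, the term t^H q al below the cut, and
   the event for the samples. *)
pose th := Num.min (Num.min (eta / 3 / (2 * K ^+ 2 / lp)) (e / 2 / (T `^ H * (Q + 1)))) (eta / 3 / c4).
have th0 : 0 < th.
  rewrite !lt_min; apply/andP; split; [apply/andP; split|].
  - by rewrite divr_gt0// divr_gt0// mulr_gt0// exprn_gt0.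
  - by rewrite divr_gt0 ?divr_gt0// mulr_gt0//; lra.
  - by rewrite divr_gt0.
near=> n.
have [j1 j2 j3] : [/\ (J n).+1%:R / Num.sqrt n.+1%:R <= th, Num.sqrt n.+1%:R * q2 ^+ J n <= th &
      n.+1%:R * (Num.sqrt n.+1%:R * q2 ^+ J n) `^ kap <= th].
  by near: n; exact: hJ.
set N := Num.sqrt n.+1%:R in j1 j2 j3 *.
have N0 : 0 < N by rewrite sqrtr_gt0 ltr0n.
have M1 : 1 <= lp * N / (2 * K).
  rewrite ler_pdivlMr ?mulr_gt0// mul1r [lp * N]mulrC -ler_pdivrMr//.
  by rewrite /N; near: n; exact: near_sqrt_ge.
have lam0 : 0 < e / (4 * N) by rewrite divr_gt0// mulr_gt0.
have [B1 [mB1 pB1 hB1]] := hs n.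
have [B2 [mB2 pB2 hB2]] := hK n (J n) _ M1.
have [B3 [mB3 pB3 hB3]] := sample_small (J n) n T0 lam0.
have TJ0 : 0 < T / 2 ^+ J n by rewrite divr_gt0// exprn_gt0.
have thle : [/\ th <= eta / 3 / (2 * K ^+ 2 / lp), th <= e / 2 / (T `^ H * (Q + 1)) & th <= eta / 3 / c4].
  by split; rewrite !ge_min lexx ?orbT.
have [th1 th2 th3] := thle.
have p2 : pr B2 <= eta / 3.
  apply: le_trans pB2 _.
  rewrite (_ : _ * _ = (J n).+1%:R / N * (2 * K ^+ 2 / lp)); last by field; rewrite !gt_eqF.
  rewrite -ler_pdivlMr ?divr_gt0 ?mulr_gt0 ?exprn_gt0//; exact: le_trans th1.
have p3 : pr B3 <= eta / 3.
  apply: le_trans pB3 _; apply: le_trans (ler_wpM2l _ (hosc _ _ _ (lexx 0) TJ0 lam0)) _ => //.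
  rewrite (dyadic_pow _ _ (ltW T0)) -/q2.
  rewrite (_ : T `^ H * q2 ^+ J n / (e / (4 * N)) = (T `^ H * 4 / e) * (N * q2 ^+ J n)); last first.
    by field; rewrite !gt_eqF.
  rewrite powRM; last 2 first.
  - by rewrite divr_ge0 ?mulr_ge0 ?(ltW TH0) ?(ltW e0).
  - by rewrite mulr_ge0 ?exprn_ge0 ?powR_ge0 ?(ltW N0).
  rewrite (_ : n.+1%:R * _ = (T `^ H * 4 / e) `^ kap * C3 * (n.+1%:R * (N * q2 ^+ J n) `^ kap)); last by ring.
  apply: (@le_trans _ _ (c4 * th)).
    apply: ler_pM => //; rewrite ?mulr_ge0 ?powR_ge0// /c4 lerDl//.
  by rewrite mulrC -ler_pdivlMr.
exists ((B1 `|` B2) `|` B3); split.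
- by apply: measurableU => //; exact: measurableU.
- apply: le_trans (prU_le _ (measurableU _ _ mB1 mB2) mB3) _.
  by have := prU_le P mB1 mB2; lra.
move=> w /not_orP[/not_orP[n1 n2] n3] t al /andP[t0 tT] tts ab.
have al1 : 0 < al < 1 by case/andP: ab => h1 h2; rewrite (lt_le_trans a0 h1) (le_lt_trans h2 b1).
have qQ := hQ _ ab.
have [tJ|tJ] := ltP t (T / 2 ^+ J n).
  have h1 : `|tau_n Xs n.+1 t al w| <= 2 * (e / (4 * N)).
    apply: tau_n_small => //; first by case/andP: al1 => -> /ltW ->.
    by move=> i; apply: hB3 => //; rewrite t0.
  have h2 : t `^ H <= T `^ H * q2 ^+ J n.
    rewrite -(dyadic_pow H _ (ltW T0)).
    by rewrite ge0_ler_powR ?nnegrE ?(ltW H0) ?(ltW TJ0)// ltW.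
  rewrite /quant_dev -/N normrM (gtr0_norm N0).
  apply: (@le_trans _ _ (N * (2 * (e / (4 * N)) + T `^ H * q2 ^+ J n * Q))).
    rewrite ler_pM2l// (le_trans (ler_normB _ _))// lerD// normrM (ger0_norm (powR_ge0 _ _)).
    by apply: ler_pM; rewrite ?powR_ge0.
  rewrite (_ : N * _ = e / 2 + T `^ H * Q * (N * q2 ^+ J n)); last by field; rewrite gt_eqF.
  rewrite [leRHS](splitr e) lerD2l.
  apply: (@le_trans _ _ (T `^ H * (Q + 1) * th)).
    apply: ler_pM; rewrite ?mulr_ge0 ?exprn_ge0 ?powR_ge0 ?(ltW N0)//.
    by rewrite ler_pM2l// lerDl.
  by rewrite mulrC -ler_pdivlMr// mulr_gt0//; lra.
have t_0 : 0 < t := lt_le_trans TJ0 tJ.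
have tH : 0 < t `^ H by exact: powR_gt0.
(* The step in the standardized variable that corresponds to a deviation e, cut at 1 to keep the
   test points in [-B, B]. The first branch of the minimum is settled by the small-time bound, the
   second by the range bound. *)
pose h := Num.min (e / (N * t `^ H)) 1.
have h0 : 0 < h by rewrite lt_min ltr01 andbT divr_gt0// mulr_gt0.
have hh1 : h <= 1 by rewrite ge_min lexx orbT.
pose u := h * (N * t `^ H).
have uh : u / (N * t `^ H) = h by rewrite /u mulfK// gt_eqF// mulr_gt0.
have ue : u <= e.
  by rewrite /u -ler_pdivlMr ?mulr_gt0// ge_min lexx.
have xB s : `|s| <= 1 -> `|q al + s| <= B.
  by move=> s1; rewrite (le_trans (ler_normD _ _))// /B lerD.
have snuB x : `|x| <= B -> `|snu n.+1 t x w| < N * (lp * h).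
  move=> xB1.
  have s1 := hB1 w n1 t x _ xB1; have s2 := hB2 w n2 t x _ xB1.
  have {}s1 : t `^ H * `|snu n.+1 t x w| <= lp * e / 2 by apply: s1; rewrite t_0 tts.
  have {}s2 : `|snu n.+1 t x w| <= K * (lp * N / (2 * K)) by apply: s2; rewrite tJ tT.
  rewrite /h; case: (leP (e / (N * t `^ H)) 1) => _.
    rewrite (_ : N * _ = lp * e / t `^ H); last by field; rewrite !gt_eqF.
    by rewrite ltr_pdivlMr// mulrC (le_lt_trans s1)// ltr_pdivrMr// ltr_pMr ?mulr_gt0// ltr1n.
  apply: le_lt_trans s2 _; rewrite (_ : K * _ = N * lp / 2); last by field; rewrite gt_eqF.
  by rewrite mulr1 ltr_pdivrMr// ltr_pMr ?mulr_gt0// ltr1n.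
have inc x y : `|x| <= B -> `|y| <= B -> x <= y -> lp * (y - x) <= Phi y - Phi x.
  move=> x1 y1 xy; have [c [_ cxy ->]] := mvt_abs (ss_der ss) x y.
  rewrite ler_wpM2r ?subr_ge0//; suff cB : `|c| <= B by case/andP: (hp c cB).
  move: x1 y1 cxy; rewrite (min_idPl xy) (max_idPr xy) !ler_norml => /andP[? ?] /andP[? ?] /andP[? ?].
  by apply/andP; split; lra.
have b0 := xB 0; rewrite addr0 normr0 in b0; have {}b0 := b0 ler01.
have bp := xB h; have bm := xB (- h); rewrite normrN (gtr0_norm h0) in bp bm.
have {}bp := bp hh1; have {}bm := bm hh1.
rewrite ler_norml; apply/andP; split.
  apply: (@le_trans _ _ (- u)); first by rewrite lerN2.
  apply: quant_dev_ge => //; rewrite -/N mulNr uh.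
  apply: le_lt_trans (ler_norm _) _; apply: lt_le_trans (snuB _ bm) _.
  rewrite ler_pM2l// -[X in _ <= X - _](hq al1).
  have := inc _ _ bm b0; rewrite gerDl oppr_le0 (ltW h0) => /(_ isT).
  by rewrite opprB addrC subrK.
apply: le_trans ue; apply: quant_dev_le => //; rewrite -/N uh.
apply: (@le_trans _ _ (N * (lp * h))).
  apply: le_trans (ler_norm _) _; rewrite normrN; exact: ltW (snuB _ bp).
rewrite ler_pM2l// -[X in _ <= _ - X](hq al1).
have := inc _ _ b0 bp; rewrite lerDl (ltW h0) => /(_ isT).
by rewrite addrAC subrr add0r.
Unshelve. all: by end_near. Qed.

(** With V = t^H nu_n, the quantile is tested at u0 - e and u0 + e, where u0 = - V(q al) / p (q al)
    solves the linearized equation. Near q al the process V varies by at most lp e / 4 and the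
    distribution function is linear up to lp e / 4, while the slack p (q al) e is at least lp e. For
    times below [ts] the two terms are small separately. *)
Theorem bahadur (T a b e eta : R) : 0 < T -> 0 < a -> b < 1 -> 0 < e -> 0 < eta ->
  \forall n \near \oo, exists Bad : set Omega,
  [/\ measurable Bad, pr Bad <= eta &
    forall w, ~ Bad w -> forall t al, 0 <= t <= T -> a <= al <= b ->
    `|quant_dev n.+1 t al w + t `^ H * snu n.+1 t (q al) w / p (q al)| <= e].
Proof.
move=> T0 a0 b1 e0 eta0.
have [Q Q0 hQ] := q_bound a0 b1.
pose B := Q + 1; have B0 : 0 <= B by rewrite addr_ge0.
have [Lp Lp0 [lp lp0 hp]] := p_bounds ss B.
have eta4 : 0 < eta / 4 by rewrite divr_gt0.
have e2 : 0 < e / 2 by rewrite divr_gt0.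
have e4 : 0 < lp * e / 4 by rewrite divr_gt0// mulr_gt0.
have [ts1 ts10 hs1] := quant_dev_small T0 a0 b1 e2 eta4.
have e1 : 0 < lp * e / 2 by rewrite divr_gt0// mulr_gt0.
have [ts2 ts20 hs2] := snu_small ss B0 e1 eta4.
pose ts := Num.min ts1 ts2; have ts0 : 0 < ts by rewrite lt_min ts10.
have [K K0 hK] := snu_range ss T0 B0.
have h2 : 0 <= (2^-1 : R) < 1 by lra.
have [J hJ] := ex_expn_le h2 (divr_gt0 ts0 T0).
have TJ : T / 2 ^+ J <= ts by move: hJ; rewrite exprVn ler_pdivlMr// mulrC.
pose M := Num.max 1 (J.+1%:R * K * 4 / eta).
have M1 : 1 <= M by rewrite le_max lexx.
have M0 : 0 < M by lra.
have KM : J.+1%:R * (K / M) <= eta / 4.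
  rewrite mulrA ler_pdivrMr//; have : J.+1%:R * K * 4 / eta <= M by rewrite le_max lexx orbT.
  by rewrite ler_pdivrMr//; lra.
have TH0 : 0 < T `^ H by exact: powR_gt0.
pose A := T `^ H * (K * M); have A0 : 0 < A by rewrite !mulr_gt0.
(* Bounds both test deviations, so that for n large the test points lie within [dd] of [q al]. *)
pose Cu := A / lp + e; have Cu0 : 0 < Cu by rewrite addr_gt0// divr_gt0.
have e5 : 0 < lp * e / (4 * Cu) by rewrite divr_gt0// mulr_gt0.
have [d1 d10 hd1] := p_unif B0 e5.
have [d2 d20 hd2] := snu_equi ss T0 B0 e4 eta4.
pose dd := Num.min (Num.min d1 d2) 1.
have dd0 : 0 < dd by rewrite !lt_min d10 d20 ltr01.
have tsH : 0 < ts `^ H by exact: powR_gt0.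
near=> n.
have [B1 [mB1 pB1 hB1]] : exists Bad : set Omega,
  [/\ measurable Bad, pr Bad <= eta / 4 &
    forall w, ~ Bad w -> forall t al, 0 <= t <= T -> t <= ts1 -> a <= al <= b ->
    `|quant_dev n.+1 t al w| <= e / 2] by near: n.
have [B2 [mB2 pB2 hB2]] := hs2 n.
have [B3 [mB3 pB3 hB3]] := hK n J M M1.
have [B4 [mB4 pB4 hB4]] : exists Bad : set Omega,
  [/\ measurable Bad, pr Bad <= eta / 4 &
    forall w, ~ Bad w -> forall t t' x x',
    0 <= t <= T -> 0 <= t' <= T -> `|x| <= B -> `|x'| <= B ->
    `|t - t'| <= d2 -> `|x - x'| <= d2 ->
    `|t `^ H * snu n.+1 t x w - t' `^ H * snu n.+1 t' x' w| <= lp * e / 4] by near: n.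
have Nbig : Cu / (dd * ts `^ H) <= Num.sqrt n.+1%:R by near: n; exact: near_sqrt_ge.
set N := Num.sqrt n.+1%:R in Nbig *; have N0 : 0 < N by rewrite sqrtr_gt0 ltr0n.
exists ((B1 `|` B2) `|` (B3 `|` B4)); split.
- by apply: measurableU; exact: measurableU.
- apply: le_trans (prU_le _ (measurableU _ _ mB1 mB2) (measurableU _ _ mB3 mB4)) _.
  by have := prU_le P mB1 mB2; have := prU_le P mB3 mB4; move: pB3 KM; lra.
move=> w /not_orP[/not_orP[n1 n2] /not_orP[n3 n4]] t al /andP[t0 tT] ab.
have al1 : 0 < al < 1 by case/andP: ab => h1 h3; rewrite (lt_le_trans a0 h1) (le_lt_trans h3 b1).
have qB : `|q al| <= B by rewrite (le_trans (hQ _ ab))// /B lerDl.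
have pq0 : 0 < p (q al) := ss_pos ss (q al).
have /andP[lpq pqL] := hp _ qB.
have [tts|tts] := leP t ts.
  have w1 : `|quant_dev n.+1 t al w| <= e / 2.
    by apply: hB1 => //; [rewrite t0|rewrite (le_trans tts)// ge_min lexx].
  have w2 : `|t `^ H * snu n.+1 t (q al) w / p (q al)| <= e / 2.
    move: t0; rewrite le_eqVlt => /predU1P[<-|t0].
      by rewrite powR0 ?gt_eqF// !mul0r normr0 ltW.
    have tt2 : 0 < t <= ts2 by rewrite t0 (le_trans tts)// ge_min lexx orbT.
    have := hB2 w n2 t _ tt2 qB; move: (snu n.+1 t (q al) w) => v hv.
    rewrite !normrM normfV (gtr0_norm pq0) (ger0_norm (powR_ge0 _ _)) ler_pdivrMr//.
    by apply: le_trans hv _; rewrite -mulrA mulrC ler_pM2l.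
  by apply: le_trans (ler_normD _ _) _; lra.
have t_0 : 0 < t := lt_trans ts0 tts.
have tH : 0 < t `^ H by exact: powR_gt0.
have tsHt : ts `^ H <= t `^ H by rewrite ge0_ler_powR ?nnegrE ?(ltW H0) ?(ltW ts0)// ltW.
pose V x := t `^ H * snu n.+1 t x w.
have VA : `|V (q al)| <= A.
  have tt3 : T / 2 ^+ J <= t <= T by rewrite (le_trans TJ (ltW tts)) tT.
  have := hB3 w n3 t _ tt3 qB; rewrite /V; move: (snu n.+1 t (q al) w) => v hv.
  rewrite normrM (ger0_norm (powR_ge0 _ _)) /A ler_pM ?powR_ge0//.
  by rewrite ge0_ler_powR ?nnegrE ?(ltW H0) ?(ltW T0).
pose u0 := - (V (q al) / p (q al)).
have pu0 : p (q al) * u0 = - V (q al) by rewrite /u0; field; rewrite gt_eqF.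
have u0C : `|u0| <= A / lp.
  rewrite normrN normrM normfV (gtr0_norm pq0); apply: ler_pM => //.
    by rewrite invr_ge0 ltW.
  by rewrite lef_pV2 ?posrE.
have key u : `|u| <= Cu -> let x := q al + u / (N * t `^ H) in
    [/\ `|x| <= B, `|V x - V (q al)| <= lp * e / 4 &
     `|N * t `^ H * (Phi x - al) - p (q al) * u| <= lp * e / 4].
  move=> uC x.
  have dx : `|u / (N * t `^ H)| <= dd.
    rewrite normrM normfV (gtr0_norm (mulr_gt0 N0 tH)) ler_pdivrMr ?mulr_gt0//.
    apply: le_trans uC _; move: Nbig; rewrite ler_pdivrMr ?mulr_gt0// => /le_trans; apply.
    by rewrite mulrCA ler_pM2l// ler_pM2l.
  have [dx1 dx2 dx3] : [/\ `|u / (N * t `^ H)| <= d1, `|u / (N * t `^ H)| <= d2 & `|u / (N * t `^ H)| <= 1].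
    by move: dx; rewrite !le_min => /andP[/andP[]].
  have xB : `|x| <= B.
    by rewrite (le_trans (ler_normD _ _))// /B lerD// hQ.
  split=> //.
    apply: hB4 => //; rewrite ?t0 ?tT ?subrr ?normr0 ?(ltW d20)//.
    by rewrite /x addrAC subrr add0r.
  have [c [cx _ E]] := mvt_abs (ss_der ss) (q al) x.
  have xq : x - q al = u / (N * t `^ H) by rewrite /x addrAC subrr add0r.
  have {}E : Phi x - al = p c * (u / (N * t `^ H)) by rewrite -xq -E hq.
  rewrite E.
  rewrite (_ : _ - _ = (p c - p (q al)) * u); last by field; rewrite !gt_eqF.
  rewrite normrM; apply: (@le_trans _ _ (lp * e / (4 * Cu) * Cu)); last first.
    by rewrite le_eqVlt; apply/orP; left; apply/eqP; field; rewrite gt_eqF.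
  apply: ler_pM => //; apply: hd1 => //.
    rewrite (_ : c = q al + (c - q al)); last by ring.
    by rewrite (le_trans (ler_normD _ _))// /B lerD ?hQ// (le_trans cx)// xq.
  by rewrite (le_trans cx)// xq.
have pe : lp * e <= p (q al) * e by rewrite ler_pM2r.
rewrite -[X in _ + X]opprK -/(V (q al)) -/u0.
rewrite ler_distl.
apply/andP; split.
  have uC : `|u0 - e| <= Cu by rewrite (le_trans (ler_normB _ _))// (gtr0_norm e0) /Cu lerD.
  have [xB dV dP] := key _ uC.
  apply: quant_dev_ge => //; rewrite -/N; move: xB dV dP; set x := q al + _ => xB dV dP.
  rewrite -(ltr_pM2l tH) -/(V x).
  move: dV dP; rewrite !ler_norml [p (q al) * _]mulrBr pu0 => /andP[dV1 dV2] /andP[dP1 dP2].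
  have -> : t `^ H * (N * (al - Phi x)) = - (N * t `^ H * (Phi x - al)) by ring.
  by move: e4 pe dV2 dP2; lra.
have uC : `|u0 + e| <= Cu by rewrite (le_trans (ler_normD _ _))// (gtr0_norm e0) /Cu lerD.
have [xB dV dP] := key _ uC.
apply: quant_dev_le => //; rewrite -/N; move: xB dV dP; set x := q al + _ => xB dV dP.
rewrite -(ler_pM2l tH) mulrN -/(V x).
move: dV dP; rewrite !ler_norml [p (q al) * _]mulrDr pu0 => /andP[dV1 dV2] /andP[dP1 dP2].
have -> : t `^ H * (N * (Phi x - al)) = N * t `^ H * (Phi x - al) by ring.
by move: e4 pe dV1 dP1; lra.
Unshelve. all: by end_near. Qed.

End bahadur.

(** * Gaussian families with a prescribed covariance *)

Section laws_on_the_line.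
Context {R : realType} {d1 d2 : measure_display} {Om1 : measurableType d1}
  {Om2 : measurableType d2} (P1 : probability Om1 R) (P2 : probability Om2 R).

Lemma measurable_of_le (Y : Om1 -> R) : (forall x, measurable [set w | Y w <= x]) ->
  measurable_fun setT Y.
Proof.
move=> mY; apply: (measurability _ (RGenOInfty.measurableE R)) => //.
move=> /= _ [_ [x ->] <-]; rewrite setTI.
rewrite (_ : _ @^-1` _ = ~` [set w | Y w <= x]); first exact: measurableC.
apply/seteqP; split => w /=; rewrite in_itv/= andbT.
  by move=> h; apply/negP; rewrite -ltNge.
by move=> /negP; rewrite -ltNge.
Qed.

Lemma cdf_law (Y : Om1 -> R) (Z : Om2 -> R) :
  measurable_fun setT Y -> measurable_fun setT Z ->
  (forall x, pr P1 [set w | Y w <= x] = pr P2 [set w | Z w <= x]) ->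
  forall C, measurable C -> pr P1 (Y @^-1` C) = pr P2 (Z @^-1` C).
Proof.
move=> mY mZ E; apply: (law_ext mY mZ (G := @RGenOInfty.G R)).
- exact: RGenOInfty.measurableE.
- move=> _ _ [x ->] [y ->]; exists (Num.max x y); apply/seteqP; split => z /=; rewrite !in_itv/= !andbT.
    by move=> [xz yz]; rewrite gt_max xz.
  by rewrite gt_max => /andP[].
move=> _ [x ->].
have H (d : measure_display) (Om : measurableType d) (W : Om -> R) :
    W @^-1` `]x, +oo[ = ~` [set w | W w <= x].
  apply/seteqP; split => w /=; rewrite in_itv/= andbT.
    by move=> h; apply/negP; rewrite -ltNge.
  by move=> /negP; rewrite -ltNge.
by rewrite !H !prC ?E//; exact: measurable_le.
Qed.

Lemma cdf_right_cont (Y : Om1 -> R) (c x : R) : measurable_fun setT Y ->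
  (forall e : R, 0 < e -> c <= pr P1 [set w | Y w <= x + e]) -> c <= pr P1 [set w | Y w <= x].
Proof.
move=> mY h; pose F n := [set w | Y w <= x + n.+1%:R^-1].
have mF n : measurable (F n) by exact: measurable_le.
have dF : nonincreasing_seq F.
  move=> n m nm; apply/subsetPset => w; rewrite /F/= => /le_trans; apply.
  by rewrite lerD2l lef_pV2 ?posrE ?ltr0n// ler_nat ltnS.
have FE : \bigcap_i F i = [set w | Y w <= x].
  apply/seteqP; split => w /=.
    move=> H; apply/ler_addgt0Pr => e e0.
    have [N HN] := ex_natSinv_le e0.
    by rewrite (le_trans (H N I))// lerD2l.
  by move=> H n _; rewrite /F/= (le_trans H)// lerDl invr_ge0.
have := pr_bigcap_cvg (P := P1) mF dF; rewrite FE => cv.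
rewrite -(cvg_lim _ cv)//; apply: limr_ge; first by apply/cvg_ex; eexists; exact: cv.
by apply: nearW => n; apply: h; rewrite invr_gt0 ltr0n.
Qed.

End laws_on_the_line.

Section normal_sequence.
Context {R : realType} {d : measure_display} {Omega : measurableType d}
  (P : probability Omega R) (X : R -> Omega -> R) (Xs : nat -> R -> Omega -> R)
  (H : R) (Phi p : R -> R).
Hypothesis ss : selfsim P X Xs H Phi p.
Local Notation pr := (pr P).
Local Notation Ex := (Ex P).

Let mX := ss_mX ss.
Let iid := ss_iid ss.

Let N01 : probability (measurableTypeR R) R := normal_prob (0 : R) 1.
Let PhiN (x : R) := prob_of N01 [set y : R | y <= x].

(* Transport of the law of X(1) to the standard normal law by the quantile map. *)
Lemma ex_normal_map : exists2 psi : R -> R, measurable_fun setT psi &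
  forall u, Ex (fun w => cos (u * psi (X 1 w))) = expR (- (u ^+ 2 / 2)) /\
            Ex (fun w => sin (u * psi (X 1 w))) = 0.
Proof.
have [q hq] := ex_quantile ss.
pose psi x := quantile PhiN (Phi x).
have mid : measurable_fun setT (fun y : R => y) by exact: measurable_id.
have PhiN_le x y : x <= y -> PhiN x <= PhiN y.
  move=> xy; apply: pr_le; [exact: (measurable_le mid)|exact: (measurable_le mid)|].
  by move=> z /= /le_trans; apply.
have ends x : exists l u : R, PhiN l < Phi x /\ Phi x <= PhiN u.
  have /andP[h0 h1] := Phi_itv ss x; pose e := Num.min (Phi x) (1 - Phi x) / 2.
  have e0 : 0 < e by rewrite divr_gt0// lt_min h0 subr_gt0.
  have [e1 e2] : e < Phi x /\ e <= 1 - Phi x.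
    have h2 : Num.min (Phi x) (1 - Phi x) <= Phi x by rewrite ge_min lexx.
    have h3 : Num.min (Phi x) (1 - Phi x) <= 1 - Phi x by rewrite ge_min lexx orbT.
    by split; rewrite /e; lra.
  have [L L0 hL] := tight_single N01 mid e0.
  exists (- (L + 1)), (L + 1); split.
    apply: le_lt_trans e1; apply: le_trans hL; apply: pr_le.
    - exact: (measurable_le mid).
    - exact: measurable_norm_gt.
    - by move=> y /= h; rewrite ltr_normr; apply/orP; right; lra.
  have := prC N01 (measurable_le mid (L + 1)).
  have : prob_of N01 (~` [set w | w <= L + 1]) <= e.
    apply: le_trans hL; apply: pr_le; [apply: measurableC; exact: (measurable_le mid)|exact: measurable_norm_gt|].
    by move=> w /= /negP; rewrite -ltNge => h; rewrite ltr_normr; apply/orP; left; lra.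
  by rewrite /PhiN; lra.
(* The Galois connection between quantile and distribution function; its direct implication uses
   right-continuity of the normal distribution function. *)
have gal x y : (psi x <= y) = (Phi x <= PhiN y).
  have [l [u [hl hu]]] := ends x; apply/idP/idP => h.
    apply: (@cdf_right_cont _ _ _ N01 (fun y : R => y) (Phi x) y mid) => e e0; rewrite leNgt; apply/negP => lt.
    have := quantile_ge PhiN_le hu lt; rewrite -/(psi x) => /le_trans/(_ h).
    by rewrite gerDl leNgt e0.
  apply: (quantile_le (l := l)) h => z hz; rewrite leNgt; apply/negP => /ltW/PhiN_le zl.
  by have := le_lt_trans (le_trans hz zl) hl; rewrite ltxx.
have mcP : measurable_fun setT Phi by apply: continuous_measurable_fun; exact: (cont_Phi ss).
have mpsi : measurable_fun setT psi.
  apply: measurable_of_le => y.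
  rewrite (_ : [set w | _] = [set w | Phi w <= PhiN y]); first exact: measurable_le.
  by apply/seteqP; split => x /=; rewrite gal.
exists psi => // u.
have mX1 := mX ler01; have mpX : measurable_fun setT (fun w => psi (X 1 w)) by exact: measurableT_comp.
have PhiE x : pr [set w | X 1 w <= x] = Phi x.
  by rewrite (ss_cdf ss x ltr01) powR1 divr1.
have cdfE y : pr [set w | psi (X 1 w) <= y] = prob_of N01 [set z | z <= y].
  have -> : [set w | psi (X 1 w) <= y] = [set w | Phi (X 1 w) <= PhiN y].
    by apply/seteqP; split => w /=; rewrite gal.
  rewrite -/(PhiN y); have u1 : PhiN y <= 1 by apply: pr_le1; exact: (measurable_le mid).
  have u0 : 0 <= PhiN y by exact: pr_ge0.
  (* [q] inverts [Phi] on (0, 1) only, so the values 0 and 1 of [PhiN] are treated apart. *)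
  have [v0|v0] := leP (PhiN y) 0.
    have -> : [set w | Phi (X 1 w) <= PhiN y] = set0.
      apply/seteqP; split => w //= h; have /andP[h0 _] := Phi_itv ss (X 1 w).
      by have := lt_le_trans h0 (le_trans h v0); rewrite ltxx.
    by rewrite pr0; apply/eqP; rewrite eq_le u0 v0.
  have [v1|v1] := leP 1 (PhiN y).
    have -> : [set w | Phi (X 1 w) <= PhiN y] = setT.
      apply/seteqP; split => w //= _; have /andP[_ h0] := Phi_itv ss (X 1 w).
      exact: le_trans (ltW h0) v1.
    by rewrite prT; apply/eqP; rewrite eq_le u1 v1.
  have v01 : 0 < PhiN y < 1 by rewrite v0.
  rewrite -[RHS](hq _ v01) -PhiE; congr (prob_of _ _); apply/seteqP; split => w /= h.
    by rewrite leNgt; apply/negP => /(Phi_lt ss); rewrite hq// ltNge h.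
  by rewrite -(hq _ v01); exact: (Phi_le ss).
have lawE := @cdf_law R _ _ Omega (measurableTypeR R) P N01 _ _ mpX mid cdfE.
have ExE (h : R -> R) : bmf h -> Ex (fun w => h (psi (X 1 w))) = mean_of N01 h.
  by move=> bh; apply: (@Ex_law R _ _ _ Omega (measurableTypeR R) _ P N01 _ _ mpX mid h bh lawE).
have muu : measurable_fun setT (fun x : R => u * x) by exact: measurable_funM.
split.
  rewrite (ExE _ (bmf_cos muu)) (normal_cf_cos ltr01); congr expR.
  by rewrite expr1n mulr1.
by rewrite (ExE _ (bmf_sin muu)) (normal_cf_sin ltr01).
Qed.

(** Quantile transforms of the values at time 1 of the successive copies; the induction on k uses
    the independence of a copy from the earlier ones. No enlargement of the probability space is
    made. *)
Lemma normal_sequence : exists xi : nat -> Omega -> R,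
  (forall i, measurable_fun setT (xi i)) /\
  forall k (l : nat -> R),
    Ex (fun w => cos (\sum_(i < k) l i * xi i w)) = expR (- ((\sum_(i < k) l i ^+ 2) / 2)) /\
    Ex (fun w => sin (\sum_(i < k) l i * xi i w)) = 0.
Proof.
have [psi mpsi hpsi] := ex_normal_map.
have mXs i : measurable_fun setT (Xs i 1) by case: iid => + _; apply.
exists (fun i w => psi (Xs i 1 w)); split=> [i|k l]; first exact: measurableT_comp.
have cc := @continuous_cos R; have cs := @continuous_sin R.
elim: k => [|k [IH1 IH2]].
  split.
    by under [X in Ex X]eq_fun do rewrite big_ord0 cos0; rewrite Ex_cst big_ord0 mul0r oppr0 expR0.
  by under [X in Ex X]eq_fun do rewrite big_ord0 sin0; rewrite Ex_cst.
pose Y w := \sum_(i < k) l i * psi (Xs i 1 w).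
pose y (g : pathT R) := l k * psi ((g : R -> R) 1).
have my : measurable_fun setT y.
  by apply: measurable_funM => //; apply: (measurableT_comp mpsi); exact: measurable_coord.
have mY : measurable_fun setT (Y : past Xs k -> R).
  apply: measurable_sum => i; apply: measurable_funM => //.
  apply: (measurableT_comp mpsi).
  have := measurableT_comp (@measurable_coord R 1 ler01) (past_path (Xs := Xs) (ltn_ord i)); exact.
have mY0 : measurable_fun setT Y.
  by apply: measurable_sum => i; apply: measurable_funM => //; exact: measurableT_comp.
have myk : measurable_fun setT (fun w => y (spath Xs k w)).
  have : measurable_fun setT (fun w => l k * psi (Xs k 1 w)); last exact.
  by apply: measurable_funM => //; exact: measurableT_comp.
have ind (g h : R -> R) : continuous g -> continuous h -> bmf (fun w => g (Y w)) ->
    bmf (fun x => h (y x)) ->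
    Ex (fun w => g (Y w) * h (y (spath Xs k w))) = Ex (fun w => g (Y w)) * Ex (fun w => h (l k * psi (X 1 w))).
  move=> cg ch bg bh; have mh := continuous_measurable_fun ch; have mg := continuous_measurable_fun cg.
  rewrite -[Ex (fun w => h (l k * _))](Ex_path mX iid k bh).
  apply: (@Ex_past_indep R d Omega P X Xs iid k Y y g h) => //.
  exact: (@bmf_path _ _ _ P X Xs iid (fun x => h (y x))).
have bcY := bmf_cos mY0; have bsY := bmf_sin mY0.
have bcy := bmf_cos my; have bsy := bmf_sin my.
have bck := bmf_cos myk; have bsk := bmf_sin myk.
have [c1 s1] := hpsi (l k).
split.
  have -> : (fun w => cos (\sum_(i < k.+1) l i * psi (Xs i 1 w))) =
     (fun w => cos (Y w) * cos (y (spath Xs k w)) - sin (Y w) * sin (y (spath Xs k w))).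
    by apply/funext => w; rewrite big_ord_recr/= cosD.
  rewrite ExB; [|exact: bmfM|exact: bmfM].
  rewrite !ind// c1 s1 mulr0 subr0 IH1 -expRD big_ord_recr/=; congr expR; ring.
have -> : (fun w => sin (\sum_(i < k.+1) l i * psi (Xs i 1 w))) =
   (fun w => sin (Y w) * cos (y (spath Xs k w)) + cos (Y w) * sin (y (spath Xs k w))).
  by apply/funext => w; rewrite big_ord_recr/= sinD.
rewrite ExD; [|exact: bmfM|exact: bmfM].
by rewrite !ind// IH2 s1 mul0r mulr0 addr0.
Qed.

End normal_sequence.

(** * Cholesky factorization of Gram kernels *)

Section cholesky.
Context {R : realType} {d : measure_display} {Omega : measurableType d}
  (P : probability Omega R).
Local Notation Ex := (Ex P).
Implicit Types (K : nat -> nat -> R).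

(** Positive semidefiniteness in the form of a representation: symmetry and the needed inequalities
    follow from it, and elimination acts on the representing functions. *)
Definition gram K : Prop := exists f : nat -> Omega -> R,
  (forall i, bmf (f i)) /\ forall i j, K i j = Ex (fun w => f i w * f j w).

Definition schur K (m : nat) : nat -> nat -> R :=
  fun i j => K i j - K i m * K m j / K m m.

Fixpoint schurs K (m : nat) : nat -> nat -> R :=
  if m is m'.+1 then schur (schurs K m') m' else K.

Lemma gramC K i j : gram K -> K i j = K j i.
Proof. by move=> [f [_ h]]; rewrite !h; congr Ex; apply/funext => w; rewrite mulrC. Qed.

Lemma gram_ge0 K i : gram K -> 0 <= K i i.
Proof. by move=> [f [_ ->]]; apply: Ex_ge0 => w; rewrite -expr2 sqr_ge0. Qed.

Lemma gram_comb K (c : R) i j : gram K -> 0 <= K i i + c * K i j *+ 2 + c ^+ 2 * K j j.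
Proof.
move=> [f [bf h]]; rewrite !h.
have -> : Ex (fun w => f i w * f i w) + c * Ex (fun w => f i w * f j w) *+ 2 +
   c ^+ 2 * Ex (fun w => f j w * f j w) = Ex (fun w => (f i w + c * f j w) ^+ 2).
  have b1 := bmfM (bf i) (bf i); have b2 := bmfM (bf i) (bf j); have b3 := bmfM (bf j) (bf j).
  rewrite -mulrnAl -(ExZ P (c *+ 2))// -(ExZ P (c ^+ 2))// -ExD//; last exact: bmfZ.
  rewrite -ExD; [|by apply: bmfD => //; exact: bmfZ|exact: bmfZ].
  by congr Ex; apply/funext => w; ring.
by apply: Ex_ge0 => w; exact: sqr_ge0.
Qed.

(** Cauchy-Schwarz in the degenerate case: when K m m = 0 the nonnegative quadratic in c is affine,
    and the chosen c would give it the value -1. *)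
Lemma gram_eq0 K i m : gram K -> K m m = 0 -> K i m = 0.
Proof.
move=> gK Km; apply/eqP/negP => /negP n0.
have := gram_comb (- (K i i + 1) / (K i m * 2)) i m gK.
rewrite Km mulr0 addr0 (_ : _ * _ *+ 2 = - (K i i + 1)); first by have := gram_ge0 i gK; lra.
by rewrite -mulr_natr; field.
Qed.

(** A Gram-Schmidt step: the Schur complement is the Gram kernel of f i minus its projection on f m.
    Division by a zero pivot returns 0, and then the row to be removed is zero already. *)
Lemma gram_schur K m : gram K -> gram (schur K m).
Proof.
move=> gK; have [f [bf h]] := gK.
exists (fun i w => f i w - K i m / K m m * f m w); split=> [i|i j].
  by apply: bmfB => //; exact: bmfZ.
have -> : (fun w => (f i w - K i m / K m m * f m w) * (f j w - K j m / K m m * f m w)) =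
  (fun w => (f i w * f j w - K i m / K m m * (f m w * f j w)) -
     (K j m / K m m * (f i w * f m w) - (K i m / K m m * (K j m / K m m)) * (f m w * f m w))).
  by apply/funext => w; ring.
have bb i' j' := bmfM (bf i') (bf j').
rewrite ExB; [|by apply: bmfB => //; exact: bmfZ|by apply: bmfB; exact: bmfZ].
rewrite ExB//; last exact: bmfZ.
rewrite ExB; [|exact: bmfZ|exact: bmfZ].
rewrite !ExZ// -!h /schur; have [Kmm|Kmm] := eqVneq (K m m) 0.
  by rewrite (gram_eq0 i gK Kmm) (gram_eq0 j gK Kmm) !mul0r !subr0.
by rewrite (gramC m j gK); field.
Qed.

Lemma gram_schurs K m : gram K -> gram (schurs K m).
Proof. by move=> gK; elim: m => [//|m IH] /=; exact: gram_schur. Qed.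

Lemma schurs_eq0 K m i j : gram K -> (i < m)%N -> schurs K m i j = 0.
Proof.
move=> gK; elim: m j => [//|m IH] j; rewrite ltnS leq_eqVlt /= /schur => /predU1P[->|im].
  have [Kmm|Kmm] := eqVneq (schurs K m m m) 0; last by rewrite mulrAC divff// mul1r subrr.
  by rewrite Kmm mul0r mul0r subr0 (gramC _ _ (gram_schurs m gK)) (gram_eq0 _ (gram_schurs m gK) Kmm).
by rewrite !IH// !mul0r subr0.
Qed.

Lemma schurs_diag0 K m i : gram K -> K i i = 0 -> schurs K m i i = 0.
Proof.
move=> gK Ki; apply/eqP; rewrite eq_le (gram_ge0 _ (gram_schurs m gK)) andbT.
elim: m => [|m IH] /=; first by rewrite Ki.
apply: le_trans IH; rewrite /schur gerBl (gramC m i (gram_schurs m gK)) -expr2.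
by rewrite divr_ge0 ?sqr_ge0// (gram_ge0 _ (gram_schurs m gK)).
Qed.

Definition chol K (i m : nat) : R := schurs K m i m / Num.sqrt (schurs K m m m).

(** Each elimination subtracts the rank-one term that the next summand restores, so the partial sums
    telescope, and row i is exhausted after step i. *)
Lemma chol_sum K n i j : gram K -> (i < n)%N ->
  \sum_(m < n) chol K i m * chol K j m = K i j.
Proof.
move=> gK iN; suff H (k : nat) : \sum_(m < k) chol K i m * chol K j m = K i j - schurs K k i j.
  by rewrite H schurs_eq0// subr0.
elim: k => [|k IH]; first by rewrite big_ord0 subrr.
have gk := gram_schurs k gK.
rewrite big_ord_recr/= IH /schur /chol (gramC k j gk).
have : Num.sqrt (schurs K k k k) ^+ 2 = schurs K k k k by rewrite sqr_sqrtr// gram_ge0.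
set s := Num.sqrt _ => <-.
have [->|s0] := eqVneq s 0; first by rewrite expr0n/= invr0 !mulr0 subr0 addr0.
by field.
Qed.

Lemma chol_eq0 K i m : gram K -> (i < m)%N \/ K i i = 0 -> chol K i m = 0.
Proof.
move=> gK [im|Ki]; rewrite /chol; first by rewrite schurs_eq0// mul0r.
have gm := gram_schurs m gK.
by rewrite (gramC _ _ gm) (gram_eq0 _ gm (schurs_diag0 m gK Ki)) mul0r.
Qed.

(** The factor is triangular: gam i uses xi 0 to xi i only, so one construction serves all finite
    subfamilies. A zero variance annihilates the whole row, which makes the variable 0 everywhere
    and not just almost surely. *)
Lemma gauss_family K (xi : nat -> Omega -> R) : gram K ->
  (forall i, measurable_fun setT (xi i)) ->
  (forall k (l : nat -> R),
    Ex (fun w => cos (\sum_(i < k) l i * xi i w)) = expR (- ((\sum_(i < k) l i ^+ 2) / 2)) /\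
    Ex (fun w => sin (\sum_(i < k) l i * xi i w)) = 0) ->
  exists gam : nat -> Omega -> R, [/\ forall i, measurable_fun setT (gam i),
    forall i w, K i i = 0 -> gam i w = 0 &
    forall k (a : 'I_k -> R) (s : 'I_k -> nat),
    Ex (fun w => cos (\sum_j a j * gam (s j) w)) =
      expR (- ((\sum_i \sum_j a i * a j * K (s i) (s j)) / 2)) /\
    Ex (fun w => sin (\sum_j a j * gam (s j) w)) = 0].
Proof.
move=> gK mxi hxi; pose gam i w := \sum_(m < i.+1) chol K i m * xi m w.
exists gam; split.
- by move=> i; apply: measurable_sum => m; exact: measurable_funM.
- by move=> i w Ki; rewrite /gam big1// => m _; rewrite chol_eq0 ?mul0r//; right.
move=> k a s; pose N := (\max_j s j).+1.
have sN j : (s j < N)%N by rewrite ltnS leq_bigmax.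
have gamE i w : (i < N)%N -> gam i w = \sum_(m < N) chol K i m * xi m w.
  move=> iN; rewrite /gam (big_ord_widen_cond N xpredT (fun m => chol K i m * xi m w))//.
  rewrite big_mkcond/=; apply: eq_bigr => m _; case: ifPn => //.
  by rewrite -ltnNge => im; rewrite chol_eq0 ?mul0r//; left.
pose l (m : nat) := \sum_j a j * chol K (s j) m.
have E w : \sum_j a j * gam (s j) w = \sum_(m < N) l m * xi m w.
  under eq_bigr => j _ do rewrite gamE// mulr_sumr.
  rewrite exchange_big/=; apply: eq_bigr => m _; rewrite /l mulr_suml.
  by apply: eq_bigr => j _; rewrite mulrA.
have -> : \sum_i \sum_j a i * a j * K (s i) (s j) = \sum_(m < N) l m ^+ 2.
  under eq_bigr => i _ do under eq_bigr => j _ do rewrite -(chol_sum (s j) gK (sN i)) mulr_sumr.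
  under eq_bigr => i _ do rewrite exchange_big/=.
  rewrite exchange_big/=; apply: eq_bigr => m _; rewrite expr2 /l mulr_suml.
  by apply: eq_bigr => i _; rewrite mulr_sumr; apply: eq_bigr => j _; ring.
have [h1 h2] := hxi N l.
have EE (f : R -> R) : (fun w => f (\sum_j a j * gam (s j) w)) =
   (fun w => f (\sum_(m < N) l m * xi m w)) by apply/funext => w; rewrite E.
by rewrite !EE.
Qed.

End cholesky.

(** * The limit process and weak convergence *)

Section rectangle_grids.
Context {R : realType} (T a b : R).
Hypothesis T0 : 0 < T.
Hypothesis ab : a <= b.
Implicit Types (p q : R * R) (n : nat).

Definition rect : set (R * R) := [set p : R * R | 0 <= p.1 <= T /\ a <= p.2 <= b].

Definition close (del : R) p q : bool := (`|p.1 - q.1| <= del) && (`|p.2 - q.2| <= del).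

Lemma closeC del p q : close del p q = close del q p.
Proof. by rewrite /close distrC (distrC p.2). Qed.

Lemma close_trans (d1 d2 : R) p q r : close d1 p q -> close d2 q r -> close (d1 + d2) p r.
Proof.
move=> /andP[h1 h2] /andP[h3 h4]; apply/andP; split.
  by rewrite -(subrKA q.1) (le_trans (ler_normD _ _))// lerD.
by rewrite -(subrKA q.2) (le_trans (ler_normD _ _))// lerD.
Qed.

Lemma close_le (d1 d2 : R) p q : d1 <= d2 -> close d1 p q -> close d2 p q.
Proof. by move=> d12 /andP[h1 h2]; rewrite /close (le_trans h1)// (le_trans h2). Qed.

(** The cut at 1 keeps the grid point of every code in the rectangle, also for codes that no cell
    produces. *)
Definition gridc n (i : nat) : R := Num.min 1 (i%:R / n.+1%:R).

Definition grid n (c : nat) : R * R :=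
  (T * gridc n (c %/ n.+2), a + (b - a) * gridc n (c %% n.+2)).

Definition cell n p : nat :=
  (Num.truncn (n.+1%:R * (p.1 / T)) * n.+2 + Num.truncn (n.+1%:R * ((p.2 - a) / (b - a))))%N.

Definition gridsize n := (n.+2 * n.+2)%N.

Lemma gridc_itv n i : 0 <= gridc n i <= 1.
Proof. by rewrite /gridc le_min ler01 divr_ge0//= ge_min lexx. Qed.

Lemma grid_rect n c : rect (grid n c).
Proof.
have /andP[h1 h2] := gridc_itv n (c %/ n.+2); have /andP[h3 h4] := gridc_itv n (c %% n.+2).
have ba : 0 <= b - a by rewrite subr_ge0.
rewrite /rect/=; split.
  by rewrite mulr_ge0 ?(ltW T0)//= ler_piMr// ltW.
rewrite lerDl mulr_ge0//= -lerBrDl ler_piMr//.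
Qed.

Lemma truncn_grid n (x : R) : 0 <= x <= 1 ->
  (Num.truncn (n.+1%:R * x) < n.+2)%N /\
  `|x - gridc n (Num.truncn (n.+1%:R * x))| <= n.+1%:R^-1.
Proof.
move=> /andP[x0 x1]; have n0 : 0 < n.+1%:R :> R by rewrite ltr0n.
have y0 : 0 <= n.+1%:R * x by rewrite mulr_ge0.
have /andP[h1 h2] := truncn_cell y0; set i := Num.truncn _ in h1 h2 *.
have iN : (i <= n.+1)%N by rewrite -(ler_nat R) (le_trans h1)// ler_piMr.
split; first by rewrite ltnS.
rewrite /gridc (min_idPr _); last by rewrite ler_pdivrMr// mul1r ler_nat.
rewrite ler_norml; apply/andP; split.
  apply: (@le_trans _ _ 0); first by rewrite oppr_le0 invr_ge0.
  by rewrite subr_ge0 ler_pdivrMr// mulrC.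
rewrite lerBlDr -[X in X + _]mul1r -mulrDl ler_pdivlMr// mulrC addrC; exact: ltW.
Qed.

Let mesh n := (T + (b - a)) / n.+1%:R.

(** The last clause sends the edge t = 0 to grid points of that edge, which will make the limit
    vanish there exactly. When a = b, division by 0 returns 0 and the second coordinate is a. *)
Lemma cellP n p : rect p -> [/\ (cell n p < gridsize n)%N, close (mesh n) p (grid n (cell n p)) &
   p.1 = 0 -> (grid n (cell n p)).1 = 0].
Proof.
move=> [/andP[t0 tT] /andP[pa pb]]; have ba : 0 <= b - a by rewrite subr_ge0.
have x01 : 0 <= p.1 / T <= 1 by rewrite divr_ge0 ?(ltW T0)//= ler_pdivrMr// mul1r.
have y01 : 0 <= (p.2 - a) / (b - a) <= 1.
  have [->|ne] := eqVneq b a; first by rewrite subrr invr0 mulr0 lexx ler01.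
  have ba0 : 0 < b - a by rewrite lt_neqAle ba andbT eq_sym subr_eq0.
  by rewrite divr_ge0 ?subr_ge0//= ler_pdivrMr// mul1r lerD2r.
have [iN hi] := truncn_grid n x01; have [jN hj] := truncn_grid n y01.
have Ti : T / n.+1%:R <= mesh n by rewrite ler_wpM2r ?invr_ge0// lerDl.
have bi : (b - a) / n.+1%:R <= mesh n by rewrite ler_wpM2r ?invr_ge0// lerDr ltW.
split.
- rewrite /cell /gridsize; set i := Num.truncn _ in iN *; set j := Num.truncn _ in jN *.
  apply: (@leq_trans (i.+1 * n.+2)); first by rewrite mulSn addnC ltn_add2r.
  by rewrite leq_mul2r iN orbT.
- rewrite /close /grid /cell divnMDl// divn_small// addn0 modnMDl modn_small//=.
  apply/andP; split.
    apply: le_trans Ti.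
    rewrite (_ : p.1 - _ = T * (p.1 / T - gridc n (Num.truncn (n.+1%:R * (p.1 / T))))); last first.
      by field; rewrite gt_eqF.
    by rewrite normrM (gtr0_norm T0) ler_pM2l.
  apply: le_trans bi; set g := gridc _ _ in hj *.
  rewrite (_ : p.2 - _ = (b - a) * ((p.2 - a) / (b - a) - g)); last first.
    have [E|ne] := eqVneq b a; last by field; rewrite subr_eq0.
    by rewrite E subrr !mul0r; apply/eqP; rewrite addr0 subr_eq0 eq_le pa andbT -E pb.
  by rewrite normrM (ger0_norm ba) ler_wpM2l.
move=> p0; rewrite /grid /cell p0 mul0r mulr0/= (_ : Num.truncn 0 = 0%N); last exact: truncn0.
by rewrite mul0n add0n divn_small// /gridc mul0r (min_idPr ler01) mulr0.
Qed.

Lemma near_mesh (e : R) : 0 < e -> \forall n \near \oo, mesh n <= e.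
Proof.
move=> e0; have C0 : 0 < T + (b - a) by rewrite ltr_pwDl// subr_ge0.
near=> n; rewrite /mesh mulrC -ler_pdivlMr//; near: n; apply: near_natSinv_le.
by rewrite divr_gt0.
Unshelve. all: by end_near. Qed.

Definition dense_pt (m : nat) : R * R :=
  if unpickle m is Some nc then grid nc.1 nc.2 else grid 0 0.

Definition dense_idx n p : nat := pickle (n, cell n p).

Lemma dense_ptE n p : dense_pt (dense_idx n p) = grid n (cell n p).
Proof. by rewrite /dense_pt /dense_idx pickleK. Qed.

Lemma dense_rect m : rect (dense_pt m).
Proof. by rewrite /dense_pt; case: unpickle => [[n c]|]; exact: grid_rect. Qed.

End rectangle_grids.

Lemma cvg_sum_ord {R : realType} k (u : 'I_k -> nat -> R) (l : 'I_k -> R) :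
  (forall j, u j n @[n --> \oo] --> l j) -> \sum_j u j n @[n --> \oo] --> \sum_j l j.
Proof.
elim: k u l => [u l _|k IH u l ul].
  by rewrite big_ord0; under eq_fun do rewrite big_ord0; exact: cvg_cst.
rewrite big_ord_recl; under eq_fun do rewrite big_ord_recl.
apply: cvgD; first exact: ul.
by apply: (IH (fun j => u (lift ord0 j)) (fun j => l (lift ord0 j))) => j; exact: ul.
Qed.

(** Identification by characteristic functions with a normal law or, when v = 0, with the unit mass
    at 0, which has no density and is treated apart. *)
Lemma gauss_law {R : realType} {d : measure_display} {Omega : measurableType d}
  (P : probability Omega R) (Y : Omega -> R) (v : R) : measurable_fun setT Y -> 0 <= v ->
  (forall u, Ex P (fun w => cos (u * Y w)) = expR (- (u ^+ 2 * v / 2))) ->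
  (forall u, Ex P (fun w => sin (u * Y w)) = 0) ->
  [/\ centered_normal_rv P Y, (\int[P]_w (Y w ^+ 2)%:E = v%:E)%E &
      v = 0 -> pr P [set w | Y w = 0] = 1].
Proof.
move=> mY v0 hc hs.
have msq : measurable_fun setT (fun x : R => (x ^+ 2)%:E).
  by apply/measurable_EFinP; exact: measurable_funX.
have sq0 (x : R) : (0 <= (x ^+ 2)%:E)%E by rewrite lee_fin sqr_ge0.
have [vz|vnz] := eqVneq v 0.
  have mc : measurable_fun setT (fun _ : Omega => 0 : R) by exact: measurable_cst.
  have E := cdf_law mY mc (fun x => cf_unique x mY mc _ _).
  have {}E : forall C, measurable C -> pr P (Y @^-1` C) = pr P ((fun _ : Omega => 0 : R) @^-1` C).
    apply: E => u; first by rewrite hc vz mulr0 mul0r oppr0 expR0 mulr0 cos0 Ex_cst.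
    by rewrite hs mulr0 sin0 Ex_cst.
  have p1 : pr P [set w | Y w = 0] = 1.
    rewrite (E [set 0])// -(prT P); congr prob_of; apply/seteqP; split => // w _ /=; by [].
  have m1 : measurable [set w | Y w = 0] by apply: (measurable_preim mY (B := [set 0])).
  split=> //; first by left; rewrite (prE P m1) p1.
  rewrite (integral_law mY mc msq sq0 E) vz.
  by under eq_integral do rewrite expr0n/=; rewrite integral0.
have vp : 0 < v by rewrite lt_neqAle eq_sym vnz.
have s0 : 0 < Num.sqrt v by rewrite sqrtr_gt0.
pose N : probability (measurableTypeR R) R := normal_prob (0 : R) (Num.sqrt v).
have mi : measurable_fun setT (fun x : measurableTypeR R => x : R) by exact: measurable_id.
have E : forall C, measurable C -> pr P (Y @^-1` C) = pr N ((fun x : measurableTypeR R => x : R) @^-1` C).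
  apply: (cdf_law mY mi) => x; apply: (cf_unique x mY mi) => u.
    by rewrite hc (normal_cf_cos s0) sqr_sqrtr// ltW.
  by rewrite hs (normal_cf_sin s0).
split.
- right; exists (Num.sqrt v); split=> // B mB.
  by rewrite (prE P (measurable_preim mY mB)) E// /pr fineK// fin_num_measure.
- by rewrite (integral_law mY mi msq sq0 E) (normal_second_moment s0) sqr_sqrtr// ltW.
- by move=> z; rewrite z eqxx in vnz.
Qed.

(** * Limits of equicontinuous arrays with Gaussian finite-dimensional laws *)

Section limit_process.
Context {R : realType} {d : measure_display} {Omega : measurableType d}
  (P : probability Omega R).
Variables (T a b : R).
Hypothesis T0 : 0 < T.
Hypothesis ab : a <= b.
Variables (f : R * R -> Omega -> R) (M : R).
Hypothesis mf : forall p, rect T a b p -> measurable_fun setT (f p).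
Hypothesis fM : forall p w, rect T a b p -> `|f p w| <= M.
Local Notation pr := (pr P).
Local Notation Ex := (Ex P).
Local Notation S := (rect T a b).

Definition covf (p q : R * R) : R := Ex (fun w => f p w * f q w).

Variables (V : nat -> R * R -> Omega -> R).
Hypothesis mV : forall n p, S p -> measurable_fun setT (V n p).
Hypothesis Vcf : forall k (pts : 'I_k -> R * R) (c : 'I_k -> R), (forall j, S (pts j)) ->
  Ex (fun w => cos (dot c (fun j => V n (pts j) w))) @[n --> \oo] -->
    expR (- ((\sum_i \sum_j c i * c j * covf (pts i) (pts j)) / 2)) /\
  Ex (fun w => sin (dot c (fun j => V n (pts j) w))) @[n --> \oo] --> (0 : R).
Hypothesis Vtight : forall n p (L : R), S p -> 0 < L ->
  pr [set w | L < `|V n p w|] <= covf p p / L ^+ 2.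
Hypothesis Vequi : forall e eta : R, 0 < e -> 0 < eta -> exists2 del : R, 0 < del &
  \forall n \near \oo, exists Bad : set Omega, [/\ measurable Bad, pr Bad <= eta &
    forall w, ~ Bad w -> forall p q, S p -> S q -> close del p q -> `|V n p w - V n q w| <= e].
Variable xi : nat -> Omega -> R.
Hypothesis mxi : forall i, measurable_fun setT (xi i).
Hypothesis xicf : forall k (l : nat -> R),
    Ex (fun w => cos (\sum_(i < k) l i * xi i w)) = expR (- ((\sum_(i < k) l i ^+ 2) / 2)) /\
    Ex (fun w => sin (\sum_(i < k) l i * xi i w)) = 0.

Let bf p : S p -> bmf (f p).
Proof. by move=> Sp; split; [exact: mf|exists M => w; exact: fM]. Qed.

Lemma covfC p q : covf p q = covf q p.
Proof. by rewrite /covf; congr Ex; apply/funext => w; rewrite mulrC. Qed.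

Lemma covf_ge0 p : 0 <= covf p p.
Proof. by apply: Ex_ge0 => w; rewrite -expr2 sqr_ge0. Qed.

(** The square of the intrinsic distance of the limit, computed from f before the limit exists. *)
Definition d2 p q : R := Ex (fun w => (f p w - f q w) ^+ 2).

Lemma d2E p q : S p -> S q -> d2 p q = covf p p - covf p q *+ 2 + covf q q.
Proof.
move=> Sp Sq; have b1 := bmfM (bf Sp) (bf Sp); have b2 := bmfM (bf Sp) (bf Sq).
have b3 := bmfM (bf Sq) (bf Sq).
rewrite /d2 /covf -[X in _ - X]mulr_natr [X in _ - X]mulrC -ExZ// -ExB//; last exact: bmfZ.
rewrite -ExD//; last by apply: bmfB => //; exact: bmfZ.
by congr Ex; apply/funext => w; ring.
Qed.

Lemma d2_ge0 p q : 0 <= d2 p q.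
Proof. by apply: Ex_ge0 => w; exact: sqr_ge0. Qed.

Lemma d2_tri p q p' q' : S p -> S q -> S p' -> S q' ->
  d2 p q <= 3 * (d2 p p' + d2 p' q' + d2 q' q).
Proof.
move=> Sp Sq Sp' Sq'.
have bs x y : S x -> S y -> bmf (fun w => (f x w - f y w) ^+ 2).
  by move=> Sx Sy; apply: bmf_sqr; apply: bmfB; exact: bf.
rewrite /d2 -ExD; [|exact: bs|exact: bs].
rewrite -ExD; [|by apply: bmfD; exact: bs|exact: bs].
rewrite -ExZ; last by apply: bmfD; [apply: bmfD|]; exact: bs.
apply: Ex_le; [exact: bs|by apply: bmfZ; apply: bmfD; [apply: bmfD|]; exact: bs|].
move=> w; set x := f p w; set y := f p' w; set z := f q' w; set t := f q w.
have := sqr_ge0 ((x - y) - (y - z)); have := sqr_ge0 ((y - z) - (z - t)).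
have := sqr_ge0 ((x - y) - (z - t)); nra.
Qed.

(* The variance of the limit is read off the characteristic function, so that
   asymptotic equicontinuity of [V] makes the covariance continuous. *)
Lemma d2_cont (e : R) : 0 < e -> exists2 del : R, 0 < del &
  forall p q, S p -> S q -> close del p q -> d2 p q <= e.
Proof.
(* If [d2 p q] exceeded e, the limit of E cos(V p - V q) would be below 1 - rho; equicontinuity
   keeps these means at least 1 - 3 rho / 4. *)
move=> e0; pose rho := 1 - expR (- (e / 2)).
have r1 : expR (- (e / 2)) < 1 by rewrite -[ltRHS]expR0 ltr_expR oppr_lt0 divr_gt0.
have r0 : 0 < rho by rewrite subr_gt0.
have rr : rho <= 1 by rewrite /rho gerBl expR_ge0.
have eta0 : 0 < rho / 8 by rewrite divr_gt0.
have [del del0 hdel] := Vequi r0 eta0.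
exists del => // p q Sp Sq pq.
pose pts (j : 'I_2) := if val j == 0%N then p else q.
pose c (j : 'I_2) : R := if val j == 0%N then 1 else -1.
have Spts j : S (pts j) by rewrite /pts; case: ifP.
have [cv _] := Vcf c Spts.
have dE n w : dot c (fun j => V n (pts j) w) = V n p w - V n q w.
  by rewrite /dot !big_ord_recr big_ord0/= add0r /c /pts/= mul1r mulN1r.
have sE : \sum_i \sum_j c i * c j * covf (pts i) (pts j) = d2 p q.
  rewrite !big_ord_recr !big_ord0/= !add0r /c /pts/= d2E// (covfC q p); ring.
rewrite sE in cv; rewrite leNgt; apply/negP => lt.
have l1 : expR (- (d2 p q / 2)) < expR (- (e / 2)) by rewrite ltr_expR ltrN2 ltr_pM2r.
have : 1 - rho <= expR (- (d2 p q / 2)); last by rewrite /rho; lra.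
rewrite -(cvg_lim _ cv)//; apply: limr_ge; first by apply/cvg_ex; eexists; exact: cv.
near=> n; under [X in Ex X]eq_fun do rewrite dE.
have [Bad [mB pB hB]] : exists Bad : set Omega, [/\ measurable Bad, pr Bad <= rho / 8 &
    forall w, ~ Bad w -> forall p q, S p -> S q -> close del p q -> `|V n p w - V n q w| <= rho].
  by near: n.
have bc : bmf (fun w => cos (V n p w - V n q w)).
  by apply: bmf_cos; apply: measurable_funB; exact: mV.
have := @Ex_close _ _ _ P _ _ 1 (rho / 2) Bad bc (bmf_cst 1) mB.
rewrite Ex_cst => H.
have : `|Ex (fun w => cos (V n p w - V n q w)) - 1| <= rho / 2 + 2 * 1 * pr Bad.
  apply: H.
  - by move=> w; exact: cos_max.
  - by move=> w; rewrite normr1.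
  - move=> w nB; have := hB w nB p q Sp Sq pq; set y := V n p w - V n q w => hy.
    rewrite -normrN opprB; have /andP[h1 h2] := onem_cos_le y.
    rewrite ger0_norm// (le_trans h2)// ler_pM2r ?invr_gt0// -real_normK ?num_real//.
    by apply: (@le_trans _ _ (rho ^+ 2)); [rewrite lerXn2r ?nnegrE// ltW|rewrite expr2; nra].
  - by rewrite divr_ge0// ltW.
move: pB; clear H; move: (Ex _) (pr Bad) => x y pB.
by rewrite ler_norml => /andP[h _]; lra.
Unshelve. all: by end_near. Qed.

Lemma fdd_cvg k (pts : 'I_k -> R * R) (Z : 'I_k -> Omega -> R) (h : ('I_k -> R) -> R) (B L : R) :
  (forall j, S (pts j)) -> (forall j, measurable_fun setT (Z j)) ->
  (forall c : 'I_k -> R, Ex (fun w => cos (\sum_j c j * Z j w)) =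
        expR (- ((\sum_i \sum_j c i * c j * covf (pts i) (pts j)) / 2)) /\
      Ex (fun w => sin (\sum_j c j * Z j w)) = 0) ->
  (forall x, `|h x| <= B) -> (forall x y, `|h x - h y| <= L * \sum_i `|x i - y i|) ->
  Ex (fun w => h (fun j => V n (pts j) w)) @[n --> \oo] --> Ex (fun w => h (fun j => Z j w)).
Proof.
move=> Sp mZ Zcf hB hL.
apply: (@levy_continuity R d d Omega Omega P P k (fun n w i => V n (pts i) w)
  (fun w i => Z i w) h B L) => //.
- by move=> n i; exact: mV.
- move=> e1 e10; pose C := \sum_(i < k) covf (pts i) (pts i) + 1.
  have C0 : 0 < C by rewrite ltr_wpDl// sumr_ge0// => i _; exact: covf_ge0.
  exists (Num.sqrt (C / e1)) => n i; have L0 : 0 < Num.sqrt (C / e1) by rewrite sqrtr_gt0 divr_gt0.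
  apply: le_trans (Vtight n (Sp i) L0) _; rewrite sqr_sqrtr ?divr_ge0 ?(ltW C0) ?(ltW e10)//.
  rewrite invf_div mulrA ler_pdivrMr// mulrC ler_wpM2l ?(ltW e10)//.
  rewrite /C (bigD1 i)//= -addrA lerDl addr_ge0// sumr_ge0// => j _; exact: covf_ge0.
- by move=> c; have [cv _] := Vcf c Sp; have [hc _] := Zcf c; rewrite /dot hc; exact: cv.
- by move=> c; have [_ cv] := Vcf c Sp; have [_ hs] := Zcf c; rewrite /dot hs; exact: cv.
Qed.

Let K i j := covf (dense_pt T a b i) (dense_pt T a b j).

Let gramK : gram P K.
Proof.
exists (fun i => f (dense_pt T a b i)); split=> // i; apply: bf; exact: dense_rect.
Qed.

Let D := dense_pt T a b.

Let SD i : S (D i).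
Proof. exact: dense_rect. Qed.

Section dense_family.
Variable gam : nat -> Omega -> R.
Hypothesis mgam : forall i, measurable_fun setT (gam i).
Hypothesis gamcf : forall k (c : 'I_k -> R) (s : 'I_k -> nat),
    Ex (fun w => cos (\sum_j c j * gam (s j) w)) =
      expR (- ((\sum_i \sum_j c i * c j * K (s i) (s j)) / 2)) /\
    Ex (fun w => sin (\sum_j c j * gam (s j) w)) = 0.

Definition jump (del e : R) (i j : nat) : set Omega :=
  if close del (D i) (D j) then [set w | e < `|gam i w - gam j w|] else set0.

Lemma measurable_jump del e i j : measurable (jump del e i j).
Proof.
rewrite /jump; case: ifP => // _; apply: measurable_norm_gt; exact: measurable_funB.
Qed.

Definition jumps (del e : R) (N : nat) : set Omega :=
  \big[setU/set0]_(i < N) \big[setU/set0]_(j < N) jump del e i j.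

Lemma measurable_jumps del e N : measurable (jumps del e N).
Proof.
apply: bigsetU_measurable => i _; apply: bigsetU_measurable => j _; exact: measurable_jump.
Qed.

Lemma jumpsP del e N w : jumps del e N w <-> exists i j : 'I_N, jump del e i j w.
Proof.
split.
  rewrite /jumps -(bigcup_mkord _ (fun i => \big[setU/set0]_(j < N) jump del e i j)).
  move=> [i /= iN]; rewrite -(bigcup_mkord _ (fun j => jump del e i j)) => -[j /= jN ij].
  by exists (Ordinal iN), (Ordinal jN).
move=> [i [j ij]]; apply: (@bigsetU_intro _ _ (fun i => \big[setU/set0]_(j < N) jump del e i j) i) => //.
exact: (@bigsetU_intro _ _ (fun j => jump del e i j) j).
Qed.

Let osc_max N (del : R) (x : 'I_N -> R) : R :=
  \big[Num.max/0]_(z : 'I_N * 'I_N | close del (D z.1) (D z.2)) `|x z.1 - x z.2|.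

Let osc_max_lip N del (x y : 'I_N -> R) :
  osc_max del x <= osc_max del y + 2 * \sum_i `|x i - y i|.
Proof.
have s0 : 0 <= \sum_i `|x i - y i| by apply: sumr_ge0.
apply: bigmax_le.
  by rewrite addr_ge0 ?mulr_ge0// bigmax_ge_id.
move=> z cz; have h := @le_bigmax_cond _ _ _ 0 z
  (fun z : 'I_N * 'I_N => close del (D z.1) (D z.2)) (fun z => `|y z.1 - y z.2|) cz.
have t1 (i : 'I_N) : `|x i - y i| <= \sum_i `|x i - y i|.
  by rewrite (bigD1 i)//= lerDl sumr_ge0.
have -> : x z.1 - x z.2 = (y z.1 - y z.2) + ((x z.1 - y z.1) - (x z.2 - y z.2)) by ring.
apply: le_trans (ler_normD _ _) _; apply: lerD; first exact: h.
apply: le_trans (ler_normB _ _) _; rewrite mulr_natl mulr2n; apply: lerD; exact: t1.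
Qed.

(** Equicontinuity passes from the array to the Gaussian family: the largest oscillation over close
    pairs among N points is a Lipschitz function of N coordinates, so a truncation of it converges
    in mean. As [del] comes from the array, the bound is uniform in N. *)
Lemma jumps_small (e eta : R) : 0 < e -> 0 < eta -> exists2 del : R, 0 < del &
  forall N, pr (jumps del (2 * e) N) <= eta.
Proof.
move=> e0 eta0; have [del del0 hdel] := Vequi e0 eta0; exists del => // N.
(* A ramp from 0 at e to 1 at 2 e, separating the threshold of the array from that of the limit. *)
pose cl (x : R) := Num.min 1 (Num.max 0 (x / e - 1)).
pose h (x : 'I_N -> R) := cl (osc_max del x).
have cl01 x : 0 <= cl x <= 1 by rewrite /cl le_min ler01 le_max lexx ge_min lexx.
have hM x : `|h x| <= 1 by have /andP[? ?] := cl01 (osc_max del x); rewrite ger0_norm.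
have cllip x y : `|cl x - cl y| <= `|x - y| / e.
  rewrite -[e in leRHS](gtr0_norm e0) -normf_div.
  have -> : (x - y) / e = (x / e - 1) - (y / e - 1) by field; rewrite gt_eqF.
  rewrite /cl; set u := x / e - 1; set v := y / e - 1; rewrite /Num.max /Num.min.
  by do !case: ifPn; rewrite -?leNgt => *; rewrite ler_norml; apply/andP; split;
    have := ler_norm (u - v); have := ler_norm (- (u - v)); rewrite normrN; lra.
have hK x y : `|h x - h y| <= (2 / e) * \sum_i `|x i - y i|.
  apply: le_trans (cllip _ _) _; rewrite ler_pdivrMr// mulrAC divfK ?gt_eqF//.
  have := osc_max_lip del x y; have := osc_max_lip del y x.
  have -> : \sum_i `|y i - x i| = \sum_i `|x i - y i| by apply: eq_bigr => i _; rewrite distrC.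
  by move=> h1 h2; rewrite ler_norml; apply/andP; split; lra.
have lc : Ex (fun w => h (fun i => V n (D i) w)) @[n --> \oo] --> Ex (fun w => h (fun i => gam i w)).
  apply: (fdd_cvg (fun i : 'I_N => SD i) _ _ hM hK) => [i|c]; first exact: mgam.
  exact: (gamcf c (fun i : 'I_N => val i)).
have bh (W : nat -> Omega -> R) : (forall i, measurable_fun setT (W i)) ->
    bmf (fun w => h (fun i => W i w)).
  move=> mW; split; last by exists 1.
  exact: (@measurable_lip _ _ _ N (fun w i => W i w) h 1 (2 / e)).
apply: (@le_trans _ _ (Ex (fun w => h (fun i => gam i w)))).
  have mj := measurable_jumps del (2 * e) N.
  rewrite -Ex_indic//; apply: Ex_le; [exact: bmf_indic|exact: bh|].
  move=> w; rewrite indicE; case: (boolP (w \in _)) => [|_]; last first.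
    by case/andP: (cl01 (@osc_max N del (fun i => gam i w))).
  rewrite inE => /jumpsP[i [j]]; rewrite /jump; case: ifP => // cij /= big.
  rewrite /h /cl le_min lexx/= le_max; apply/orP; right.
  rewrite lerBrDr ler_pdivlMr//.
  have := @le_bigmax_cond _ _ _ 0 (i, j) (fun z : 'I_N * 'I_N => close del (D z.1) (D z.2))
    (fun z => `|gam z.1 w - gam z.2 w|) cij.
  by move=> hle; apply: le_trans hle; apply: le_trans (ltW big); lra.
rewrite -(cvg_lim _ lc)//; apply: limr_le; first by apply/cvg_ex; eexists; exact: lc.
near=> n.
have [Bad [mB pB hB]] : exists Bad : set Omega, [/\ measurable Bad, pr Bad <= eta &
    forall w, ~ Bad w -> forall p q, S p -> S q -> close del p q -> `|V n p w - V n q w| <= e].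
  by near: n.
apply: le_trans pB; rewrite -Ex_indic//; apply: Ex_le; last first.
- move=> w; rewrite indicE; case: (boolP (w \in Bad)) => [_|].
    by case/andP: (cl01 (@osc_max N del (fun i => V n (D i) w))).
  rewrite notin_setE => nB; rewrite /h /cl ge_min; apply/orP; right.
  rewrite ge_max lexx/= subr_le0 ler_pdivrMr// mul1r; apply: bigmax_le; first exact: ltW.
  by move=> z cz; apply: hB.
- exact: bmf_indic.
- by apply: (bh (fun i => V n (D i))) => i; exact: mV.
Unshelve. all: by end_near. Qed.

Let invS (k : nat) : R := k.+1%:R^-1.

(** The sample points at which gam is not uniformly continuous on the dense set, written with
    countable operations. *)
Definition irregular : set Omega :=
  \bigcup_k \bigcap_m \bigcup_N jumps (invS m) (invS k) N.

Lemma measurable_irregular : measurable irregular.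
Proof.
apply: bigcup_measurable => k _; apply: bigcapT_measurable => m.
by apply: bigcup_measurable => N _; exact: measurable_jumps.
Qed.

Lemma jumps_sub del del' e N : del <= del' -> jumps del e N `<=` jumps del' e N.
Proof.
move=> dd w /jumpsP[i [j]]; rewrite /jump; case: ifP => // cl h.
by apply/jumpsP; exists i, j; rewrite /jump (close_le dd cl).
Qed.

Lemma pr_irregular : pr irregular = 0.
Proof.
have mN k m : measurable (\bigcup_N jumps (invS m) (invS k) N).
  by apply: bigcup_measurable => N _; exact: measurable_jumps.
have mI k : measurable (\bigcap_m \bigcup_N jumps (invS m) (invS k) N).
  by apply: bigcapT_measurable => m.
apply/eqP; rewrite eq_le pr_ge0 andbT; apply: pr_bigcup_le => [k|n]; first exact: mI.
rewrite big1// => k _; apply/eqP; rewrite eq_le pr_ge0 andbT.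
apply/ler_addgt0Pr => eta eta0; rewrite add0r.
have e0 : 0 < invS k / 2 by rewrite divr_gt0// invr_gt0 ltr0n.
have [del del0 hdel] := jumps_small e0 eta0.
have [m hm] := ex_natSinv_le del0.
apply: (@le_trans _ _ (pr (\bigcup_N jumps (invS m) (invS k) N))).
  by apply: pr_le => //; move=> w /(_ m I).
have mono : nondecreasing_seq (jumps (invS m) (invS k)).
  move=> N N' NN; apply/subsetPset => w /jumpsP[i [j ij]]; apply/jumpsP.
  by exists (widen_ord NN i), (widen_ord NN j).
have cv := pr_bigcup_cvg (P := P) (fun N => measurable_jumps (invS m) (invS k) N) mono.
rewrite -(cvg_lim _ cv)//; apply: limr_le; first by apply/cvg_ex; eexists; exact: cv.
apply: nearW => N; have := hdel N; rewrite mulrC divfK// => h.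
apply: le_trans h; apply: pr_le; [exact: measurable_jumps|exact: measurable_jumps|].
exact: jumps_sub.
Qed.

Definition rgam (i : nat) (w : Omega) : R := \1_(~` irregular) w * gam i w.

Lemma measurable_rgam i : measurable_fun setT (rgam i).
Proof.
apply: measurable_funM => //; apply: measurable_indic; apply: measurableC.
exact: measurable_irregular.
Qed.

Lemma rgam_cont w (e : R) : 0 < e -> exists2 del : R, 0 < del &
  forall i j, close del (D i) (D j) -> `|rgam i w - rgam j w| <= e.
Proof.
move=> e0; rewrite /rgam indicE; case: (boolP (w \in _)) => [|_]; last first.
  by exists 1 => // i j _; rewrite !mul0r subrr normr0 ltW.
rewrite inE => nir; have [k hk] := ex_natSinv_le e0.
have : ~ (\bigcap_m \bigcup_N jumps (invS m) (invS k) N) w.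
  by move=> h; apply: nir; exists k.
move=> /existsNP[m /not_implyP[_ nJ]]; exists (invS m); first by rewrite invr_gt0 ltr0n.
move=> i j cij; rewrite !mul1r leNgt; apply/negP => lt; apply: nJ.
exists (maxn i j).+1 => //; apply/jumpsP.
have iN : (i < (maxn i j).+1)%N by rewrite ltnS leq_maxl.
have jN : (j < (maxn i j).+1)%N by rewrite ltnS leq_maxr.
exists (Ordinal iN), (Ordinal jN); rewrite /jump /= cij /=; exact: le_lt_trans lt.
Qed.

Let appr n p w : R := rgam (dense_idx T a b n p) w.

Definition Glim (p : R * R) (w : Omega) : R := lim (appr n p w @[n --> \oo]).

Let close_idx (e : R) : 0 < e -> \forall n \near \oo, forall p, S p ->
  close e p (D (dense_idx T a b n p)).
Proof.
move=> e0; near=> n => p Sp; rewrite /D dense_ptE; have [_ h _] := cellP T0 ab n Sp.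
by apply: close_le h; near: n; exact: near_mesh.
Unshelve. all: by end_near. Qed.

Lemma Glim_cvg p w : S p -> appr n p w @[n --> \oo] --> Glim p w.
Proof.
move=> Sp; suff : cvg (appr n p w @[n --> \oo]) by [].
apply: cauchy_cvg; apply: cauchy_exP => e e0.
have e2 : 0 < e / 2 by rewrite divr_gt0.
have [del del0 hdel] := rgam_cont w e2.
have dd : 0 < del / 2 by rewrite divr_gt0.
have [N _ hN] := close_idx dd.
exists (appr N p w); exists N => // n Nn /=; rewrite /ball/=.
apply: (@le_lt_trans _ _ (e / 2)); last by rewrite ltr_pdivrMr// ltr_pMr// ltr1n.
apply: hdel; rewrite [del]splitr; apply: (@close_trans _ _ _ _ p).
  by rewrite closeC; apply: hN => //=.
exact: hN.
Qed.

Lemma Glim_cont w (e : R) : 0 < e -> exists2 del : R, 0 < del &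
  forall p q, S p -> S q -> close del p q -> `|Glim p w - Glim q w| <= e.
Proof.
move=> e0; have [del del0 hdel] := rgam_cont w e0.
have dd : 0 < del / 3 by rewrite divr_gt0.
exists (del / 3) => // p q Sp Sq pq.
have cv : `|appr n p w - appr n q w| @[n --> \oo] --> `|Glim p w - Glim q w|.
  by apply: cvg_norm; apply: cvgB; exact: Glim_cvg.
rewrite -(cvg_lim _ cv)//; apply: limr_le; first by apply/cvg_ex; eexists; exact: cv.
near=> n; have h : forall p, S p -> close (del / 3) p (D (dense_idx T a b n p)).
  by near: n; exact: close_idx.
apply: hdel; rewrite (_ : del = del / 3 + (del / 3 + del / 3)); last by field.
apply: (@close_trans _ _ _ _ p); first by rewrite closeC; exact: h.
by apply: (@close_trans _ _ _ _ q) => //; exact: h.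
Unshelve. all: by end_near. Qed.

Lemma measurable_Glim p : S p -> measurable_fun setT (Glim p).
Proof.
move=> Sp; apply: (@measurable_fun_cvg _ _ _ setT (fun n w => appr n p w)).
  by move=> n; exact: measurable_rgam.
by move=> w _; exact: Glim_cvg.
Qed.

Lemma Glim_eq0 p w : (forall i v, K i i = 0 -> gam i v = 0) ->
  (forall q, S q -> q.1 = 0 -> covf q q = 0) -> S p -> p.1 = 0 -> Glim p w = 0.
Proof.
move=> g0 f0 Sp p0; apply/cvg_lim => //; rewrite (_ : (fun n => _) = fun=> 0); first exact: cvg_cst.
apply/funext => n; rewrite /appr /rgam g0 ?mulr0//; apply: f0; first exact: SD.
by rewrite dense_ptE; have [_ _ h] := cellP T0 ab n Sp; exact: h.
Qed.

Lemma Ex_as_eq Y Z B : bmf Y -> bmf Z -> measurable B -> pr B = 0 ->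
  (forall w, ~ B w -> Y w = Z w) -> Ex Y = Ex Z.
Proof.
move=> bY bZ mB B0 YZ; have [_ [M1 YM]] := bY; have [_ [M2 ZM]] := bZ.
have := @Ex_close _ _ _ P Y Z (Num.max M1 M2) 0 B bY bZ mB.
rewrite B0 mulr0 addr0 => h; apply/eqP; rewrite -subr_eq0 -normr_le0; apply: h => //.
- by move=> w; rewrite le_max YM.
- by move=> w; rewrite le_max ZM orbT.
- by move=> w nB; rewrite YZ// subrr normr0.
Qed.

Let M0 : 0 <= M.
Proof.
have S0 := SD 0; have [w _] : (setT : set Omega) !=set0.
  apply/set0P/eqP => E; have := prT P; rewrite E pr0 => /eqP; by rewrite eq_sym oner_eq0.
exact: le_trans (fM w S0).
Qed.

(** The bound x <= eta + x^2 / eta takes the place of Cauchy-Schwarz and keeps the estimate linear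
    in [d2]. *)
Lemma covf_dist p q r (eta : R) : S p -> S q -> S r -> 0 < eta ->
  `|covf p r - covf q r| <= M * (eta + d2 p q / eta).
Proof.
move=> Sp Sq Sr eta0; have b1 := bmfB (bf Sp) (bf Sq).
have b2 := bmf_sqr b1.
rewrite /covf -ExB; [|by apply: bmfM; exact: bf|by apply: bmfM; exact: bf].
apply: (@le_trans _ _ (Ex (fun w => `|f p w * f r w - f q w * f r w|))).
  by apply: Ex_norm_le; apply: bmfB; apply: bmfM; exact: bf.
have -> : M * (eta + d2 p q / eta) =
    Ex (fun w => M * (eta + eta^-1 * (f p w - f q w) ^+ 2)).
  rewrite ExZ; last by apply: bmfD; [exact: bmf_cst|exact: bmfZ].
  by rewrite ExD; [|exact: bmf_cst|exact: bmfZ]; rewrite Ex_cst ExZ// [_ / eta]mulrC.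
apply: Ex_le.
- by apply: bmf_norm; apply: bmfB; apply: bmfM; exact: bf.
- by apply: bmfZ; apply: bmfD; [exact: bmf_cst|exact: bmfZ].
move=> w; rewrite -mulrBl normrM mulrC; apply: ler_pM => //; first exact: fM.
rewrite -real_normK ?num_real//; set x := `|_|; have x0 : 0 <= x by rewrite /x.
rewrite -(ler_pM2l eta0) mulrDr mulrA divff ?gt_eqF// mul1r.
have := sqr_ge0 (eta - x); nra.
Qed.

Lemma covf_cont (e : R) : 0 < e -> exists2 del : R, 0 < del &
  forall p q p' q', S p -> S q -> S p' -> S q' -> close del p p' -> close del q q' ->
    `|covf p q - covf p' q'| <= e.
Proof.
move=> e0; pose eta := e / (4 * (M + 1)).
have M1 : 0 < M + 1 by rewrite ltr_wpDl.
have eta0 : 0 < eta by rewrite divr_gt0// mulr_gt0.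
have [del del0 hdel] := d2_cont (exprn_gt0 2 eta0).
exists del => // p q p' q' Sp Sq Sp' Sq' pp' qq'.
have key x y z : S x -> S y -> S z -> close del x y -> `|covf x z - covf y z| <= e / 2.
  move=> Sx Sy Sz xy; apply: le_trans (covf_dist Sx Sy Sz eta0) _.
  apply: (@le_trans _ _ ((M + 1) * (eta + eta))); last first.
    rewrite /eta le_eqVlt; apply/orP; left; apply/eqP; field; exact: lt0r_neq0.
  apply: ler_pM => //; rewrite ?lerDl//.
    by rewrite addr_ge0 ?(ltW eta0)// divr_ge0 ?d2_ge0// ltW.
  by rewrite lerD2l ler_pdivrMr// -expr2; exact: hdel.
rewrite -(subrKA (covf p' q)) (le_trans (ler_normD _ _))// [e]splitr; apply: lerD; first exact: key.
by rewrite covfC (covfC p'); exact: key.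
Qed.

(** At each level the approximants belong to the Gaussian family up to a null event. Bounded
    convergence handles the means, continuity of the covariance the exponents. *)
Lemma Glim_cf k (pts : 'I_k -> R * R) (c : 'I_k -> R) : (forall j, S (pts j)) ->
  Ex (fun w => cos (\sum_j c j * Glim (pts j) w)) =
    expR (- ((\sum_i \sum_j c i * c j * covf (pts i) (pts j)) / 2)) /\
  Ex (fun w => sin (\sum_j c j * Glim (pts j) w)) = 0.
Proof.
move=> Sp; pose s n (j : 'I_k) := dense_idx T a b n (pts j).
have msum (W : 'I_k -> Omega -> R) : (forall j, measurable_fun setT (W j)) ->
    measurable_fun setT (fun w => \sum_j c j * W j w).
  by move=> mW; apply: measurable_sum => j; apply: measurable_funM.
have mr n := msum (fun j => rgam (s n j)) (fun j => measurable_rgam _).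
have mg n := msum (fun j => gam (s n j)) (fun j => mgam _).
have rE n w : ~ irregular w -> \sum_j c j * rgam (s n j) w = \sum_j c j * gam (s n j) w.
  by move=> h; apply: eq_bigr => j _; rewrite /rgam indicE mem_set// mul1r.
have mI := measurable_irregular; have I0 := pr_irregular.
have cS w : (\sum_j c j * rgam (s n j) w) @[n --> \oo] --> \sum_j c j * Glim (pts j) w.
  apply: (cvg_sum_ord (u := fun j n => c j * rgam (s n j) w)) => j.
  by apply: cvgMr; exact: Glim_cvg.
have [cc cs] := (@continuous_cos R, @continuous_sin R).
split.
- have cv : Ex (fun w => cos (\sum_j c j * rgam (s n j) w)) @[n --> \oo] -->
     Ex (fun w => cos (\sum_j c j * Glim (pts j) w)).
    apply: (@Ex_bounded_cvg _ _ _ P (fun n w => cos (\sum_j c j * rgam (s n j) w)) _ 1).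
    + by move=> n; case: (bmf_cos (mr n)).
    + by move=> n w; exact: cos_max.
    + by move=> w; apply: continuous_cvg; [exact: cc|exact: cS].
  rewrite -(cvg_lim _ cv)//; apply/cvg_lim => //.
  rewrite (_ : (fun n => _) = (fun n => expR (- ((\sum_i \sum_j c i * c j * K (s n i) (s n j)) / 2)))).
    apply: continuous_cvg; first exact: continuous_expR.
    apply: cvgN; apply: cvgMl.
    apply: (cvg_sum_ord (u := fun i n => \sum_j c i * c j * K (s n i) (s n j))) => i.
    apply: (cvg_sum_ord (u := fun j n => c i * c j * K (s n i) (s n j))) => j.
    apply: cvgMr; apply/cvgrPdist_le => e e0; have [del del0 hd] := covf_cont e0.
    near=> n; have h : forall p, S p -> close del p (D (dense_idx T a b n p)).
      by near: n; exact: close_idx.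
    by apply: hd; [exact: Sp|exact: Sp|exact: SD|exact: SD|exact: h|exact: h].
  apply/funext => n; have [<- _] := gamcf c (s n).
  by apply: (@Ex_as_eq _ _ irregular) => //; [exact: bmf_cos|exact: bmf_cos|move=> w /rE ->].
- have cv : Ex (fun w => sin (\sum_j c j * rgam (s n j) w)) @[n --> \oo] -->
     Ex (fun w => sin (\sum_j c j * Glim (pts j) w)).
    apply: (@Ex_bounded_cvg _ _ _ P (fun n w => sin (\sum_j c j * rgam (s n j) w)) _ 1).
    + by move=> n; case: (bmf_sin (mr n)).
    + by move=> n w; exact: sin_max.
    + by move=> w; apply: continuous_cvg; [exact: cs|exact: cS].
  rewrite -(cvg_lim _ cv)//; apply/cvg_lim => //.
  rewrite (_ : (fun n => _) = fun=> 0); first exact: cvg_cst.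
  apply/funext => n; transitivity (Ex (fun w => sin (\sum_j c j * gam (s n j) w))); last first.
    by have [_ ->] := gamcf c (s n).
  by apply: (@Ex_as_eq _ _ irregular) => //; [exact: bmf_sin|exact: bmf_sin|move=> w /rE ->].
Unshelve. all: by end_near. Qed.

End dense_family.

Definition gauss_cov (G : R * R -> Omega -> R) : Prop :=
  forall k (pts : 'I_k -> R * R) (c : 'I_k -> R), (forall j, S (pts j)) ->
      Ex (fun w => cos (\sum_j c j * G (pts j) w)) =
        expR (- ((\sum_i \sum_j c i * c j * covf (pts i) (pts j)) / 2)) /\
      Ex (fun w => sin (\sum_j c j * G (pts j) w)) = 0.

Section gaussian_combinations.
Variable G : R * R -> Omega -> R.
Hypothesis mG : forall p, S p -> measurable_fun setT (G p).
Hypothesis Gcf : gauss_cov G.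

Lemma covf_quad_ge0 k (pts : 'I_k -> R * R) (c : 'I_k -> R) : (forall j, S (pts j)) ->
  0 <= \sum_i \sum_j c i * c j * covf (pts i) (pts j).
Proof.
move=> Sp; have -> : \sum_i \sum_j c i * c j * covf (pts i) (pts j) =
    Ex (fun w => (\sum_i c i * f (pts i) w) ^+ 2); last by apply: Ex_ge0 => w; exact: sqr_ge0.
have bij i j : bmf (fun w => c i * c j * (f (pts i) w * f (pts j) w)).
  by apply: bmfZ; apply: bmfM; exact: bf.
transitivity (Ex (fun w => \sum_i \sum_j c i * c j * (f (pts i) w * f (pts j) w))).
  rewrite Ex_sum; last by move=> i; apply: bmf_sum.
  apply: eq_bigr => i _; rewrite Ex_sum//; apply: eq_bigr => j _.
  by rewrite ExZ//; apply: bmfM; exact: bf.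
congr Ex; apply/funext => w; rewrite expr2 mulr_suml; apply: eq_bigr => i _.
by rewrite mulr_sumr; apply: eq_bigr => j _; ring.
Qed.

Lemma gauss_comb k (pts : 'I_k -> R * R) (c : 'I_k -> R) : (forall j, S (pts j)) ->
  let Y w := \sum_j c j * G (pts j) w in
  let v := \sum_i \sum_j c i * c j * covf (pts i) (pts j) in
  [/\ centered_normal_rv P Y, (\int[P]_w (Y w ^+ 2)%:E = v%:E)%E &
      v = 0 -> pr [set w | Y w = 0] = 1].
Proof.
move=> Sp Y v; apply: gauss_law.
- by apply: measurable_sum => j; apply: measurable_funM => //; exact: mG.
- exact: covf_quad_ge0.
- move=> u; have [+ _] := Gcf (fun j => u * c j) Sp.
  under [X in Ex X]eq_fun => w do under eq_bigr do rewrite -mulrA.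
  under [X in Ex X]eq_fun => w do rewrite -mulr_sumr.
  suff -> : u ^+ 2 * v = \sum_i \sum_j u * c i * (u * c j) * covf (pts i) (pts j) by [].
  rewrite /v mulr_sumr; apply: eq_bigr => i _.
  by rewrite mulr_sumr; apply: eq_bigr => j _; ring.
- move=> u; have [_ +] := Gcf (fun j => u * c j) Sp.
  under [X in Ex X]eq_fun => w do under eq_bigr do rewrite -mulrA.
  by under [X in Ex X]eq_fun => w do rewrite -mulr_sumr.
Qed.

Lemma gauss_pair p q (x y : R) : S p -> S q ->
  let Y w := x * G p w + y * G q w in
  let v := x ^+ 2 * covf p p + 2 * x * y * covf p q + y ^+ 2 * covf q q in
  (\int[P]_w (Y w ^+ 2)%:E = v%:E)%E /\ (v = 0 -> pr [set w | Y w = 0] = 1).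
Proof.
move=> Sp Sq Y v; pose pts (j : 'I_2) := if val j == 0%N then p else q.
pose c (j : 'I_2) : R := if val j == 0%N then x else y.
have Spts j : S (pts j) by rewrite /pts; case: ifP.
have [_] := gauss_comb c Spts.
have -> : \sum_i \sum_j c i * c j * covf (pts i) (pts j) =
    x ^+ 2 * covf p p + 2 * x * y * covf p q + y ^+ 2 * covf q q.
  by rewrite !big_ord_recr !big_ord0/= !add0r /c /pts/= (covfC q p); ring.
have YE w : \sum_j c j * G (pts j) w = x * G p w + y * G q w.
  by rewrite !big_ord_recr big_ord0/= add0r /c /pts.
under eq_integral do rewrite YE; under [X in _ = 0 -> pr X = 1]eq_set do rewrite YE.
by move=> h1 h2; split.
Qed.

(** Polarization, 4 x y = (x + y)^2 - (x - y)^2. The variables are unbounded, and integrability is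
    read off the finite second moments of the two combinations. *)
Lemma gauss_cov_moment p q : S p -> S q -> expectation P (fun w => G p w * G q w) = (covf p q)%:E.
Proof.
move=> Sp Sq; have [h1 _] := gauss_pair 1 1 Sp Sq; have [h2 _] := gauss_pair 1 (-1) Sp Sq.
set Y1 := fun w => 1 * G p w + 1 * G q w; set Y2 := fun w => 1 * G p w + -1 * G q w.
have mY (x y : R) : measurable_fun setT (fun w => x * G p w + y * G q w).
  by apply: measurable_funD; apply: measurable_funM => //; exact: mG.
have iY (x y v : R) : (\int[P]_w ((x * G p w + y * G q w) ^+ 2)%:E = v%:E)%E ->
    P.-integrable setT (EFin \o (fun w => (x * G p w + y * G q w) ^+ 2)).
  move=> E; apply/integrableP; split; first by apply/measurable_EFinP; exact: measurable_funX.
  under eq_integral => w _ do rewrite /= ger0_norm ?sqr_ge0//.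
  by rewrite E ltry.
have i1 := iY _ _ _ h1; have i2 := iY _ _ _ h2.
rewrite unlock.
transitivity (\int[P]_w (4^-1%:E * ((Y1 w ^+ 2)%:E - (Y2 w ^+ 2)%:E)))%E.
  apply: eq_integral => w _; rewrite -EFinB -EFinM; congr EFin; rewrite /Y1 /Y2; field; exact: isT.
rewrite integralZl//; last exact: integrableB.
rewrite integralB// h1 h2 -EFinB -EFinM; congr EFin; field; exact: isT.
Qed.

Lemma intr_distE p q : S p -> S q -> intr_dist P G p q = Num.sqrt (d2 p q).
Proof.
move=> Sp Sq; have [h _] := gauss_pair 1 (-1) Sp Sq.
rewrite /intr_dist unlock; congr Num.sqrt.
have -> : d2 p q = fine (d2 p q)%:E by [].
congr fine; transitivity (\int[P]_w ((1 * G p w + -1 * G q w) ^+ 2)%:E)%E.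
  by apply: eq_integral => w _; rewrite mul1r mulN1r.
by rewrite h d2E//; congr EFin; ring.
Qed.

Lemma gauss_centered : centered_gaussian_process P S G.
Proof. by split=> // n pts c Sp; have [] := gauss_comb c Sp. Qed.

End gaussian_combinations.

Lemma cell_close (del : R) : 0 < del -> exists n, forall p q, S p -> S q ->
  cell T a b n p = cell T a b n q -> close del p q.
Proof.
move=> del0; have d2 : 0 < del / 2 by rewrite divr_gt0.
have [n _ hn] := near_mesh T0 ab d2; exists n => p q Sp Sq E.
have h := hn n (leqnn n); have [_ hp _] := cellP T0 ab n Sp; have [_ hq _] := cellP T0 ab n Sq.
rewrite [del]splitr; apply: (@close_trans _ _ _ _ (grid T a b n (cell T a b n p))).
  exact: close_le hp.
by rewrite E closeC; exact: close_le hq.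
Qed.

(** [radon_paths] speaks of every path, so points at intrinsic distance 0 must have equal values
    everywhere. For one pair this holds almost surely, but such pairs may be uncountably many. One
    such pair is chosen in each product of two cells of each grid that contains any; the paths that
    distinguish one of these countably many pairs are set to 0, and continuity reaches all other
    pairs. *)
Lemma limit_process : (forall q, S q -> q.1 = 0 -> covf q q = 0) ->
  exists G : R * R -> Omega -> R, [/\
    forall p, S p -> measurable_fun setT (G p),
    forall w (e : R), 0 < e -> exists2 del : R, 0 < del &
      forall p q, S p -> S q -> close del p q -> `|G p w - G q w| <= e,
    forall p w, S p -> p.1 = 0 -> G p w = 0,
    forall p q w, S p -> S q -> d2 p q = 0 -> G p w = G q w &
    gauss_cov G].
Proof.
move=> f0; have [gam [mgam gam0 gamcf]] := gauss_family gramK mxi xicf.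
have mG p : S p -> measurable_fun setT (Glim gam p) by move=> Sp; exact: measurable_Glim.
have cG w (e : R) : 0 < e -> exists2 del : R, 0 < del &
      forall p q, S p -> S q -> close del p q -> `|Glim gam p w - Glim gam q w| <= e.
  exact: Glim_cont.
have Gcf : gauss_cov (Glim gam) by move=> k pts c Sp; exact: Glim_cf.
have Glaw p q : S p -> S q -> d2 p q = 0 -> pr [set w | Glim gam p w <> Glim gam q w] = 0.
  move=> Sp Sq pq0; have [_ h] := gauss_pair mG Gcf 1 (-1) Sp Sq.
  have m1 : measurable [set w | 1 * Glim gam p w + -1 * Glim gam q w = 0].
    apply: (@measurable_preim _ _ _ (fun w => 1 * Glim gam p w + -1 * Glim gam q w) _ [set 0]) => //.
    by apply: measurable_funD; apply: measurable_funM => //; exact: mG.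
  rewrite (_ : [set w | _ <> _] = ~` [set w | 1 * Glim gam p w + -1 * Glim gam q w = 0]).
    by rewrite prC// h ?subrr// -[RHS]pq0 d2E//; ring.
  by apply/seteqP; split => w /=; rewrite mul1r mulN1r => n E; apply: n;
    apply/eqP; move/eqP: E; rewrite subr_eq0.
have mne p q : S p -> S q -> measurable [set w | Glim gam p w <> Glim gam q w].
  move=> Sp Sq; rewrite (_ : [set w | _] = ~` ((fun w => Glim gam p w - Glim gam q w) @^-1` [set 0])).
    apply: measurableC; apply: measurable_preim => //; apply: measurable_funB; exact: mG.
  by apply/seteqP; split => w /= n E; apply: n; apply/eqP; move/eqP: E; rewrite subr_eq0.
pose zero (m : nat * (nat * nat)) (z : (R * R) * (R * R)) := [/\ S z.1, S z.2, d2 z.1 z.2 = 0,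
  cell T a b m.1 z.1 = m.2.1 & cell T a b m.1 z.2 = m.2.2].
have d2pp p : d2 p p = 0.
  by rewrite /d2; under [X in Ex X]eq_fun do rewrite subrr expr0n/=; rewrite Ex_cst.
have /choice[z hz] : forall m, exists z : (R * R) * (R * R), [/\ S z.1, S z.2, d2 z.1 z.2 = 0 &
    (exists y, zero m y) -> zero m z].
  move=> m; have [[y hy]|no] := pselect (exists y, zero m y).
    by exists y; case: (hy).
  by exists (D 0, D 0); split=> //; exact: SD.
pose ne m := [set w | Glim gam (z m).1 w <> Glim gam (z m).2 w].
pose Nul := \bigcup_i (if unpickle i is Some m then ne m else set0).
have mNi i : measurable (if unpickle i is Some m then ne m else set0).
  by case: unpickle => // m; have [? ? _ _] := hz m; exact: mne.
have mN : measurable Nul by exact: bigcup_measurable.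
have N0 : pr Nul = 0.
  apply/eqP; rewrite eq_le pr_ge0 andbT; apply: pr_bigcup_le => // n.
  rewrite big1// => i _; case: unpickle => [m|]; last by rewrite pr0.
  by have [? ? ? _] := hz m; exact: Glaw.
have GN w p q : ~ Nul w -> S p -> S q -> d2 p q = 0 -> Glim gam p w = Glim gam q w.
  move=> nN Sp Sq pq0; apply/eqP; rewrite -subr_eq0 -normr_le0; apply/ler_addgt0Pr => e e0.
  have e2 : 0 < e / 2 by rewrite divr_gt0.
  have [del del0 hdel] := cG w _ e2; have [n hn] := cell_close del0.
  pose m := (n, (cell T a b n p, cell T a b n q)).
  have [S1 S2 _ h] := hz m; have [_ _ _ c1 c2] : zero m (z m) by apply: h; exists (p, q).
  have E : Glim gam (z m).1 w = Glim gam (z m).2 w.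
    by apply: contrapT => nE; apply: nN; exists (pickle m) => //; rewrite pickleK.
  have -> : Glim gam p w - Glim gam q w =
    (Glim gam p w - Glim gam (z m).1 w) + (Glim gam (z m).2 w - Glim gam q w) by rewrite E; ring.
  rewrite add0r [e]splitr (le_trans (ler_normD _ _))//; apply: lerD; apply: hdel => //.
    exact: hn.
  exact: hn.
exists (fun p w => \1_(~` Nul) w * Glim gam p w); split.
- by move=> p Sp; apply: measurable_funM; [apply: measurable_indic; exact: measurableC|exact: mG].
- move=> w e e0; have [del del0 hdel] := cG w e e0; exists del => // p q Sp Sq pq.
  rewrite -mulrBr normrM; apply: le_trans (hdel p q Sp Sq pq).
  by rewrite ler_piMl// indicE; case: (_ \in _); rewrite ?normr0// normr1.
- by move=> p w Sp p0; rewrite (@Glim_eq0 gam p w)// mulr0.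
- move=> p q w Sp Sq pq0; rewrite indicE; case: (boolP (w \in _)) => [|_]; last by rewrite !mul0r.
  by rewrite inE => nN; rewrite (GN _ _ _ nN Sp Sq pq0).
- move=> k pts c Sp; have [h1 h2] := Gcf k pts c Sp.
  have E w : ~ Nul w -> \sum_j c j * (\1_(~` Nul) w * Glim gam (pts j) w) = \sum_j c j * Glim gam (pts j) w.
    by move=> nN; apply: eq_bigr => j _; rewrite indicE mem_set// mul1r.
  have m1 : measurable_fun setT (fun w => \sum_j c j * (\1_(~` Nul) w * Glim gam (pts j) w)).
    apply: measurable_sum => j; apply: measurable_funM => //; apply: measurable_funM; last exact: mG.
    by apply: measurable_indic; exact: measurableC.
  have m2 : measurable_fun setT (fun w => \sum_j c j * Glim gam (pts j) w).
    by apply: measurable_sum => j; apply: measurable_funM => //; exact: mG.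
  split; [rewrite -h1|rewrite -[RHS]h2]; apply: (@Ex_as_eq _ _ Nul) => //;
    by [exact: bmf_cos|exact: bmf_sin|move=> w /E ->].
Qed.

(** Compactness of the set of pairs: near a pair at distance 0 the two values are close to a common
    number, near any other pair the distance stays away from 0. Hence one threshold works for all
    pairs. *)
Lemma limit_radon (G : R * R -> Omega -> R) : (forall p, S p -> measurable_fun setT (G p)) ->
  gauss_cov G ->
  (forall w (e : R), 0 < e -> exists2 del : R, 0 < del &
      forall p q, S p -> S q -> close del p q -> `|G p w - G q w| <= e) ->
  (forall p q w, S p -> S q -> d2 p q = 0 -> G p w = G q w) ->
  radon_paths P S G.
Proof.
move=> mG Gcf cG G0 w; split.
  have [del del0 hdel] := cG w 1 ltr01; have [n _ hn] := near_mesh T0 ab del0.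
  exists (\sum_(i < gridsize n) `|G (grid T a b n i) w| + 1) => p Sp.
  have [cN cp _] := cellP T0 ab n Sp; have := close_le (hn n (leqnn n)) cp.
  move=> /(hdel _ _ Sp (grid_rect T0 ab n _)) h.
  rewrite -[G p w](subrK (G (grid T a b n (cell T a b n p)) w)) addrC.
  apply: le_trans (ler_normD _ _) _; apply: lerD => //.
  by rewrite (bigD1 (Ordinal cN))//= lerDl sumr_ge0.
move=> e e0.
have cS : compact S.
  rewrite (_ : S = `[0, T] `*` `[a, b]).
    by apply: compact_setX; exact: segment_compact.
  by apply/seteqP; split => -[x y] /=; rewrite !in_itv.
have /compact_near_coveringP cov := compact_setX cS cS.
have [del1 del10 hdel1] := cG w (e / 3) (divr_gt0 e0 (ltr0Sn _ 2)).
have nearclose (z : (R * R) * (R * R)) (del : R) : 0 < del ->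
    \forall z' \near z, close del z.1 z'.1 /\ close del z.2 z'.2.
  move=> del0; exists (ball z.1 del, ball z.2 del); first by split; exact: nbhsx_ballx.
  by move=> [x y] [/= [h1 h2] [h3 h4]]; split; apply/andP; split; apply: ltW.
have : \forall n \near \oo, S `*` S `<=` [set z | d2 z.1 z.2 < n.+1%:R^-1 -> S z.1 -> S z.2 ->
     `|G z.1 w - G z.2 w| < e].
  apply: (cov nat \oo (fun n z => d2 z.1 z.2 < n.+1%:R^-1 -> S z.1 -> S z.2 ->
     `|G z.1 w - G z.2 w| < e)) => z [Sz1 Sz2].
  have [z0|znz] := eqVneq (d2 z.1 z.2) 0.
    near=> z' n => _ S1 S2.
    have [c1 c2] : close del1 z.1 z'.1 /\ close del1 z.2 z'.2 by near: z'; exact: nearclose.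
    have h1 := hdel1 _ _ Sz1 S1 c1; have h2 := hdel1 _ _ Sz2 S2 c2.
    have -> : G z'.1 w - G z'.2 w = - (G z.1 w - G z'.1 w) + (G z.2 w - G z'.2 w).
      by rewrite (G0 z.1 z.2 w)//; ring.
    apply: le_lt_trans (ler_normD _ _) _; rewrite normrN.
    by apply: le_lt_trans (lerD h1 h2) _; lra.
  (* The three-term inequality for squared distances has factor 3, and three terms of at most a
     ninth, one of them strictly smaller, contradict it. *)
  have eta0 : 0 < d2 z.1 z.2 / 9 by rewrite divr_gt0// lt_neqAle eq_sym znz d2_ge0.
  have [del2 del20 hdel2] := d2_cont eta0.
  near=> z' n => lt S1 S2; exfalso.
  have [c1 c2] : close del2 z.1 z'.1 /\ close del2 z.2 z'.2 by near: z'; exact: nearclose.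
  have h1 := hdel2 _ _ Sz1 S1 c1; have := hdel2 _ _ Sz2 S2 c2.
  move=> h2; have h3 := d2_tri Sz1 Sz2 S1 S2.
  have h4 : n.+1%:R^-1 <= d2 z.1 z.2 / 9 by near: n; exact: near_natSinv_le.
  have E : d2 z'.2 z.2 = d2 z.2 z'.2.
    by rewrite /d2; congr Ex; apply/funext => v; rewrite -sqrrN opprB.
  by rewrite E in h3; move: lt h1 h2 h3 h4 => /=; move: (d2 _ _) (d2 _ _) (d2 _ _)
    (d2 _ _) (_^-1) => ? ? ? ? ?; lra.
move=> [n _ hn]; exists (Num.sqrt n.+1%:R^-1).
  by rewrite sqrtr_gt0 invr_gt0 ltr0n.
move=> p q Sp Sq; rewrite (intr_distE mG Gcf)// ltr_sqrt ?invr_gt0 ?ltr0n// => lt.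
by have := hn n (leqnn n) (p, q) (conj Sp Sq) lt Sp Sq.
Unshelve. all: by end_near. Qed.

(** * Outer expectations squeezed between measurable envelopes *)

Section weak_convergence.
Variable (G : R * R -> Omega -> R) (W : nat -> R * R -> Omega -> R).
Hypothesis mG : forall p, S p -> measurable_fun setT (G p).
Hypothesis Gcf : gauss_cov G.
Hypothesis Gcont : forall w (e : R), 0 < e -> exists2 del : R, 0 < del &
      forall p q, S p -> S q -> close del p q -> `|G p w - G q w| <= e.
Hypothesis Gbounded : forall w, bounded_on S (fun p => G p w).
Hypothesis WV : forall e eta : R, 0 < e -> 0 < eta -> \forall n \near \oo,
  exists Bad : set Omega, [/\ measurable Bad, pr Bad <= eta &
    forall w, ~ Bad w -> forall p, S p -> `|W n.+1 p w - V n p w| <= e].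

Section functional.
Variable (F : (R * R -> R) -> R) (B : R).
Hypothesis FB : forall z, `|F z| <= B.
Hypothesis Fcont : forall z, bounded_on S z -> forall e : R, 0 < e ->
  exists2 delta : R, 0 < delta &
    forall w, (forall p, S p -> `|w p - z p| <= delta) -> `|F w - F z| < e.
Implicit Types (z u : R * R -> R) (m : nat).

Let dist_le z u (del : R) := forall p, S p -> `|z p - u p| <= del.

Let envs m z : set R :=
  [set y | exists u (del : R), [/\ 0 <= del, dist_le u z del & y = F u + m%:R * del]].

(* The Lipschitz lower envelopes of [F] increase to [F] at bounded arguments. *)
Definition lip_env m z : R := inf (envs m z).

Let env_in m z : envs m z (F z).
Proof. by exists z, 0; rewrite mulr0 addr0; split=> // p _; rewrite subrr normr0. Qed.

Let env_lb m z y : envs m z y -> - B <= y.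
Proof.
move=> [u [del [del0 _ ->]]]; have := FB u; rewrite ler_norml => /andP[h _].
by rewrite (le_trans h)// lerDl mulr_ge0.
Qed.

Let env_inf m z : has_inf (envs m z).
Proof. by split; [exists (F z); exact: env_in|exists (- B) => y; exact: env_lb]. Qed.

Lemma lip_env_le m z : lip_env m z <= F z.
Proof. by apply: ge_inf; [case: (env_inf m z)|exact: env_in]. Qed.

Lemma lip_env_bound m z : `|lip_env m z| <= B.
Proof.
rewrite ler_norml; apply/andP; split.
  by apply: lb_le_inf; [case: (env_inf m z)|move=> y; exact: env_lb].
by apply: le_trans (lip_env_le m z) _; have := FB z; rewrite ler_norml => /andP[].
Qed.

Lemma lip_env_sub m z u (del : R) : 0 <= del -> dist_le z u del ->
  lip_env m z <= lip_env m u + m%:R * del.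
Proof.
move=> del0 zu; rewrite -lerBlDr; apply: lb_le_inf; first by case: (env_inf m u).
move=> y [v [eps [eps0 vu ->]]]; rewrite lerBlDr -addrA -mulrDr.
apply: ge_inf; first by case: (env_inf m z).
exists v, (eps + del); split=> //; first exact: addr_ge0.
move=> p Sp; rewrite -(subrKA (u p)) (le_trans (ler_normD _ _))// lerD ?vu//.
by rewrite distrC; exact: zu.
Qed.

Lemma lip_env_lip m z u (del : R) : 0 <= del -> dist_le z u del ->
  `|lip_env m z - lip_env m u| <= m%:R * del.
Proof.
move=> del0 zu; have uz : dist_le u z del by move=> p Sp; rewrite distrC; exact: zu.
have h1 := lip_env_sub m del0 zu; have h2 := lip_env_sub m del0 uz.
by rewrite ler_norml; apply/andP; split; lra.
Qed.

Lemma lip_env_cvg z : bounded_on S z -> lip_env m z @[m --> \oo] --> F z.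
Proof.
move=> bz; apply/cvgrPdist_le => e e0; have [del del0 hdel] := Fcont bz e0.
near=> m; rewrite ger0_norm ?subr_ge0 ?lip_env_le// lerBlDr -lerBlDl.
apply: lb_le_inf; first by case: (env_inf m z).
move=> y [u [eps [eps0 uz ->]]]; have [small|big] := leP eps del.
  have /hdel : dist_le u z del by move=> p Sp; exact: le_trans (uz p Sp) small.
  have : 0 <= m%:R * eps by rewrite mulr_ge0.
  by rewrite ltr_norml => ? /andP[? ?]; lra.
have h : 2 * B / del <= m%:R by near: m; exact: nbhs_infty_ger.
have : 2 * B <= m%:R * eps.
  by rewrite ler_pdivrMr// in h; apply: le_trans h _; rewrite ler_wpM2l// ltW.
have := FB u; have := FB z; rewrite !ler_norml => /andP[? ?] /andP[? ?] ?; lra.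
Unshelve. all: by end_near. Qed.

(** Constant on cells, rebuilt from the grid values; through it the envelope becomes a Lipschitz
    function of finitely many coordinates. *)
Definition step N (x : 'I_(gridsize N) -> R) (p : R * R) : R :=
  if insub (cell T a b N p) is Some i then x i else 0.

Let envN m N x := lip_env m (@step N x).
Arguments envN : clear implicits.

Let envN_lip m N x y : `|envN m N x - envN m N y| <= m%:R * \sum_i `|x i - y i|.
Proof.
apply: lip_env_lip; first exact: sumr_ge0.
move=> p _; rewrite /step; case: insubP => [i _ _|_]; last by rewrite subrr normr0 sumr_ge0.
by rewrite (bigD1 i)//= lerDl sumr_ge0.
Qed.

Let envN_G_cvg m w : envN m N (fun i => G (grid T a b N i) w) @[N --> \oo] -->
  lip_env m (fun p => G p w).
Proof.
apply/cvgrPdist_le => e e0; have e1 : 0 < e / m.+1%:R by rewrite divr_gt0.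
have [del del0 hdel] := Gcont w e1.
near=> N; apply: (@le_trans _ _ (m%:R * (e / m.+1%:R))).
  apply: lip_env_lip; first exact: ltW.
  move=> p Sp; have [cN cp _] := cellP T0 ab N Sp; rewrite /step insubT//=.
  apply: hdel => //; first exact: grid_rect.
  by apply: close_le cp; near: N; exact: near_mesh.
by rewrite mulrCA ler_piMr ?(ltW e0)// ler_pdivrMr// mul1r ler_nat.
Unshelve. all: by end_near. Qed.

Let menvN (Z : R * R -> Omega -> R) m N : (forall p, S p -> measurable_fun setT (Z p)) ->
  measurable_fun setT (fun w => envN m N (fun i => Z (grid T a b N i) w)).
Proof.
move=> mZ; apply: (@measurable_lip _ _ _ _ (fun w i => Z (grid T a b N i) w) (envN m N) B m%:R).
- by move=> i; apply: mZ; exact: grid_rect.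
- by move=> x; exact: lip_env_bound.
- by move=> x y; exact: envN_lip.
Qed.

Let menv m : measurable_fun setT (fun w => lip_env m (fun p => G p w)).
Proof.
apply: (@measurable_fun_cvg _ _ _ setT
  (fun N w => envN m N (fun i => G (grid T a b N i) w))).
  by move=> N; exact: menvN.
by move=> w _; exact: envN_G_cvg.
Qed.

Lemma bmf_FG : bmf (fun w => F (fun p => G p w)).
Proof.
split; last by exists B.
apply: (@measurable_fun_cvg _ _ _ setT (fun m w => lip_env m (fun p => G p w))) => //.
by move=> w _; exact: lip_env_cvg.
Qed.

(** The minorant is the envelope of F at the grid values of V n, lowered by m times the distance
    from the step function to W, and by 2 B on the exceptional events, where only boundedness is
    known. Its mean converges through the finite-dimensional laws. *)
Lemma lower_approx (e : R) : 0 < e -> \forall n \near \oo, exists L : Omega -> R,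
  [/\ bmf L, forall w, L w <= F (fun p => W n.+1 p w) &
      Ex (fun w => F (fun p => G p w)) - e <= Ex L].
Proof.
move=> e0; have e4 : 0 < e / 4 by rewrite divr_gt0.
have B0 : 0 <= B by exact: le_trans (FB (fun=> 0)).
have cv1 : Ex (fun w => lip_env m (fun p => G p w)) @[m --> \oo] --> Ex (fun w => F (fun p => G p w)).
  apply: (Ex_bounded_cvg (M := B)) => // [m w|w]; first exact: lip_env_bound.
  exact: lip_env_cvg.
have nd (u : nat -> R) l : u n @[n --> \oo] --> l -> \forall n \near \oo, `|l - u n| <= e / 4.
  by move=> /cvgrPdist_le; exact.
have [m _ /(_ m (leqnn m)) hm] := nd _ _ cv1.
have cv2 : Ex (fun w => envN m N (fun i => G (grid T a b N i) w)) @[N --> \oo] -->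
    Ex (fun w => lip_env m (fun p => G p w)).
  apply: (Ex_bounded_cvg (M := B)) => // [N|N w]; first exact: menvN.
  exact: lip_env_bound.
(* The envelope is m-Lipschitz, so the two errors e', of the grid and of W against V, cost at most e
   / 8. *)
pose e' := e / (16 * m.+1%:R).
have e'0 : 0 < e' by rewrite divr_gt0// mulr_gt0.
have me' : m%:R * (e' + e') <= e / 8.
  apply: (@le_trans _ _ (m.+1%:R * (e' + e'))).
    by rewrite ler_wpM2r ?ler_nat// addr_ge0// ltW.
  have c0 : m.+1%:R != 0 :> R by rewrite pnatr_eq0.
  rewrite /e' le_eqVlt; apply/orP; left; apply/eqP; move: (m.+1%:R) c0 => c c0.
  by field.
pose eta := e / (32 * (B + 1)).
have eta0 : 0 < eta by rewrite divr_gt0// mulr_gt0// ltr_wpDl.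
have Beta : B * eta <= e / 32.
  rewrite /eta mulrCA ler_wpM2l ?(ltW e0)// invfM mulrCA ler_piMr//.
  by rewrite ler_pdivrMr ?mul1r ?lerDl// ltr_wpDl.
have [del del0 hdel] := Vequi e'0 eta0.
have [N [hN1 hN2]] : exists N, (T + (b - a)) / N.+1%:R <= del /\
    `|Ex (fun w => lip_env m (fun p => G p w)) -
      Ex (fun w => envN m N (fun i => G (grid T a b N i) w))| <= e / 4.
  have [N1 _ h1] := near_mesh T0 ab del0; have [N2 _ h2] := nd _ _ cv2.
  by exists (maxn N1 N2); split; [apply: h1; exact: leq_maxl|apply: h2; exact: leq_maxr].
have cv3 : Ex (fun w => envN m N (fun i => V n (grid T a b N i) w)) @[n --> \oo] -->
    Ex (fun w => envN m N (fun i => G (grid T a b N i) w)).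
  apply: (@fdd_cvg _ (fun i => grid T a b N i) (fun i => G (grid T a b N i)) (envN m N) B m%:R).
  - by move=> j; exact: grid_rect.
  - by move=> j; apply: mG; exact: grid_rect.
  - by move=> c; apply: Gcf => j; exact: grid_rect.
  - by move=> x; exact: lip_env_bound.
  - by move=> x y; exact: envN_lip.
near=> n.
have hn : `|Ex (fun w => envN m N (fun i => G (grid T a b N i) w)) -
   Ex (fun w => envN m N (fun i => V n (grid T a b N i) w))| <= e / 4.
  by near: n; exact: nd.
have [B1 [mB1 pB1 hB1]] : exists Bad : set Omega, [/\ measurable Bad, pr Bad <= eta &
    forall w, ~ Bad w -> forall p q, S p -> S q -> close del p q -> `|V n p w - V n q w| <= e'].
  by near: n.
have [B2 [mB2 pB2 hB2]] : exists Bad : set Omega, [/\ measurable Bad, pr Bad <= eta &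
    forall w, ~ Bad w -> forall p, S p -> `|W n.+1 p w - V n p w| <= e'].
  by near: n; exact: WV.
have mU : measurable (B1 `|` B2) by exact: measurableU.
have pU : pr (B1 `|` B2) <= eta + eta.
  by apply: le_trans (prU_le _ _ _) _ => //; exact: lerD.
set h := fun w => envN m N (fun i => V n (grid T a b N i) w) in hn.
have bh : bmf h by split; [apply: menvN => p; exact: mV|exists B => w; exact: lip_env_bound].
have bB : bmf (fun w => 2 * B * \1_(B1 `|` B2) w) by apply: bmfZ; exact: bmf_indic.
exists (fun w => h w - m%:R * (e' + e') - 2 * B * \1_(B1 `|` B2) w); split.
- by apply: bmfB => //; apply: bmfB => //; exact: bmf_cst.
- move=> w; rewrite indicE; case: (boolP (w \in _)) => [_|].
    have : `|h w| <= B by exact: lip_env_bound.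
    have := FB (fun p => W n.+1 p w); rewrite !ler_norml => /andP[h1 _] /andP[_ h2].
    have h3 : 0 <= m%:R * (e' + e') by rewrite mulr_ge0// addr_ge0// ltW.
    by rewrite mulr1; move: (h w) (F _) (m%:R * _) h1 h2 h3 => y1 y2 y3 ? ? ?; lra.
  rewrite notin_setE => nB; rewrite mulr0 subr0 lerBlDr.
  apply: (@le_trans _ _ (lip_env m (fun p => W n.+1 p w) + m%:R * (e' + e'))); last first.
    by rewrite lerD2r lip_env_le.
  apply: lip_env_sub; first by rewrite addr_ge0// ltW.
  move=> p Sp; have [cN cp _] := cellP T0 ab N Sp; rewrite /step insubT//=.
  rewrite distrC -(subrKA (V n p w)) (le_trans (ler_normD _ _))// lerD//.
    by apply: hB2 => // h2; apply: nB; right.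
  apply: hB1 => //; [by move=> h2; apply: nB; left|exact: grid_rect|exact: close_le cp].
rewrite ExB//; last by apply: bmfB => //; exact: bmf_cst.
rewrite ExB//; last exact: bmf_cst.
rewrite Ex_cst ExZ; last exact: bmf_indic.
rewrite Ex_indic//.
have h5 : 2 * B * pr (B1 `|` B2) <= e / 8.
  apply: (@le_trans _ _ (2 * B * (eta + eta))); first by rewrite ler_wpM2l// mulr_ge0.
  have -> : 2 * B * (eta + eta) = 4 * (B * eta) by ring.
  by move: (B * eta) Beta => y ?; lra.
move: hm hN2 hn; rewrite !ler_norml => /andP[_ +] /andP[_ +] /andP[_ +].
move: h5 me'; rewrite -/h.
move: (Ex _) (Ex _) (Ex _) (Ex _) (_ * pr _) (m%:R * _) => x1 x2 x3 x4 x5 x6 ? ? ? ? ?; lra.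
Unshelve. all: by end_near. Qed.

End functional.

Lemma Estar_ge (Y L : Omega -> R) : bmf L -> (forall w, L w <= Y w) ->
  ((Ex L)%:E <= Estar P Y)%E.
Proof.
move=> bL LY; apply: le_ereal_inf_tmp => _ [U [mU [iU YU]] <-]; rewrite -ExE// unlock.
apply: le_integral => //; first exact: bmf_integrable.
by move=> w _; rewrite lee_fin (le_trans (LY w)).
Qed.

Lemma Estar_le (Y U : Omega -> R) : bmf U -> (forall w, Y w <= U w) ->
  (Estar P Y <= (Ex U)%:E)%E.
Proof.
move=> bU YU; apply: ereal_inf_lbound; exists U; last by rewrite expectation_Ex.
by split; [case: bU|split=> //; exact: bmf_integrable].
Qed.

(** Measurable minorants are produced for F and for - F; the second one, negated, is an admissible
    majorant in the outer expectation. *)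
Lemma limit_weak_conv : weak_conv_linf S P W P G.
Proof.
move=> F [[B FB] [_ Fcont]]; have bFG := bmf_FG FB Fcont.
split; first by case: bFG.
rewrite expectation_Ex// -cvg_shiftS.
have FBN z : `|- F z| <= B by rewrite normrN.
have FcontN z : bounded_on S z -> forall e : R, 0 < e ->
    exists2 delta : R, 0 < delta &
    forall w, (forall p, S p -> `|w p - z p| <= delta) -> `|- F w - - F z| < e.
  move=> bz e e0; have [del del0 hdel] := Fcont z bz e e0; exists del => // w /hdel.
  by rewrite -opprD normrN.
have est (e : R) : 0 < e -> \forall n \near \oo,
    ((Ex (fun w => F (fun p => G p w)) - e)%:E <= Estar P (fun w => F (fun p => W n.+1 p w)) /\
     Estar P (fun w => F (fun p => W n.+1 p w)) <= (Ex (fun w => F (fun p => G p w)) + e)%:E)%E.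
  move=> e0; have h1 := lower_approx FB Fcont e0.
  have h2 := @lower_approx (fun z => - F z) B FBN FcontN e e0.
  near=> n; split.
    have [L [bL LF hL]] : exists L : Omega -> R, [/\ bmf L, forall w, L w <= F (fun p => W n.+1 p w) &
      Ex (fun w => F (fun p => G p w)) - e <= Ex L] by near: n.
    by apply: le_trans (Estar_ge bL LF); rewrite lee_fin.
  have [L [bL LF hL]] : exists L : Omega -> R, [/\ bmf L, forall w, L w <= - F (fun p => W n.+1 p w) &
      Ex (fun w => - F (fun p => G p w)) - e <= Ex L] by near: n.
  apply: le_trans (@Estar_le _ (fun w => - L w) _ _) _; first exact: bmfN.
    by move=> w; rewrite lerNr.
  by rewrite lee_fin ExN// lerNl opprD; rewrite ExN// in hL.
apply/fine_cvgP; split.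
  near=> n; have [h1 h2] : ((Ex (fun w => F (fun p => G p w)) - 1)%:E <=
        Estar P (fun w => F (fun p => W n.+1 p w)) /\
      Estar P (fun w => F (fun p => W n.+1 p w)) <= (Ex (fun w => F (fun p => G p w)) + 1)%:E)%E.
    by near: n; exact: est.
  rewrite fin_numE; apply/andP; split; first by rewrite gt_eqF// (lt_le_trans _ h1)// ltNyr.
  by rewrite lt_eqF// (le_lt_trans h2)// ltry.
apply/cvgrPdist_le => e e0; near=> n.
have [h1 h2] : ((Ex (fun w => F (fun p => G p w)) - e)%:E <=
        Estar P (fun w => F (fun p => W n.+1 p w)) /\
      Estar P (fun w => F (fun p => W n.+1 p w)) <= (Ex (fun w => F (fun p => G p w)) + e)%:E)%E.
  by near: n; exact: est.
move: h1 h2 => /=; case: (Estar _ _) => [y| |]//=; rewrite !lee_fin => h1 h2.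
by rewrite ler_norml; apply/andP; split; lra.
Unshelve. all: by end_near. Qed.

End weak_convergence.

End limit_process.

(** * The central limit theorem for the quantile process *)

Section quantile_clt.
Context {R : realType} {d : measure_display} {Omega : measurableType d}
  (P : probability Omega R) (X : R -> Omega -> R) (Xs : nat -> R -> Omega -> R)
  (H : R) (Phi p : R -> R).
Hypothesis ss : selfsim P X Xs H Phi p.
Hypothesis X00 : P [set w | X 0 w = 0] = 1%E.
Variables (T a b : R).
Hypothesis T0 : 0 < T.
Hypothesis a0 : 0 < a.
Hypothesis ab : a <= b.
Hypothesis b1 : b < 1.
Variable q : R -> R.
Hypothesis hq : forall al : R, 0 < al < 1 -> Phi (q al) = al.
Local Notation pr := (pr P).
Local Notation Ex := (Ex P).
Local Notation S := (rect T a b).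
Local Notation snu := (snu P X Xs H).

Let mX := ss_mX ss.
Let iid := ss_iid ss.
Let H0 := ss_H ss.

(** The coefficient of the leading Bahadur term. It is 0 at t = 0, so the linearized process lives
    on the closed rectangle and vanishes on that edge. *)
Definition qcoef (z : R * R) : R := - (z.1 `^ H / p (q z.2)).

Definition qfun (z : R * R) : pathT R -> R := fun g => qcoef z * \1_(sbelow H z.1 (q z.2)) g.

Let bq z : S z -> bmf (qfun z).
Proof.
move=> [/andP[t0 _] _]; apply: bmfZ; apply: bmf_indic; exact: measurable_sbelow.
Qed.

Definition qscore (z : R * R) (w : Omega) : R := qfun z (spath0 X w) - Epath P X (qfun z).

Let al01 z : S z -> 0 < z.2 < 1.
Proof. by move=> [_ /andP[h1 h2]]; rewrite (lt_le_trans a0 h1) (le_lt_trans h2 b1). Qed.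

Lemma emp_qfun n z w : S z -> emp P X Xs n (qfun z) w = - (z.1 `^ H * snu n z.1 (q z.2) w / p (q z.2)).
Proof.
move=> Sz; rewrite /emp /snu /Epath /qfun ExZ; last first.
  apply: (bmf_path0 mX); apply: bmf_indic; apply: measurable_sbelow; by case: Sz => /andP[].
under eq_bigr do rewrite -mulrBr.
by rewrite -mulr_sumr /qcoef /emp /Epath; ring.
Qed.

Lemma qscore_bound : exists M : R, forall z w, S z -> `|qscore z w| <= M.
Proof.
have [B B0 hB] := q_bound ss hq a0 b1; have [Lp Lp0 [lp lp0 hp]] := p_bounds ss B.
exists (T `^ H / lp * 2) => z w Sz; have [/andP[t0 tT] zab] := Sz.
have c0 : `|qcoef z| <= T `^ H / lp.
  rewrite /qcoef normrN ger0_norm; last by rewrite divr_ge0 ?powR_ge0// ltW// (ss_pos ss).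
  have /andP[h1 _] := hp _ (hB _ zab).
  apply: ler_pM; rewrite ?powR_ge0// ?invr_ge0 ?(ltW (ss_pos ss _))//.
    by apply: ge0_ler_powR => //; rewrite ?nnegrE ?(ltW H0)// ltW.
  by rewrite lef_pV2// posrE// (ss_pos ss).
have bs (g : pathT R) : `|qfun z g| <= T `^ H / lp.
  rewrite /qfun normrM; apply: le_trans c0; rewrite ler_piMr// indicE.
  by case: (_ \in _); rewrite ?normr1// normr0.
rewrite mulr_natr mulr2n /qscore; apply: le_trans (ler_normB _ _) _; apply: lerD; first exact: bs.
apply: Ex_bound => [|v]; last exact: bs.
by case: (bmf_path0 mX (bq Sz)).
Qed.

Lemma qscore_covE z z' : S z -> S z' -> 0 < z.1 -> 0 < z'.1 -> covf P qscore z z' =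
  (pr [set w | X z.1 w <= z.1 `^ H * q z.2 /\ X z'.1 w <= z'.1 `^ H * q z'.2] - z'.2 * z.2) /
  ((p (q z.2) / z.1 `^ H) * (p (q z'.2) / z'.1 `^ H)).
Proof.
move=> Sz Sz' t0 t0'.
have mA y : S y -> measurable [set w | X y.1 w <= y.1 `^ H * q y.2].
  by move=> [/andP[y0 _] _]; apply: measurable_le; exact: mX.
have E y : S y -> 0 < y.1 -> Epath P X (qfun y) = qcoef y * y.2.
  move=> Sy y0; rewrite /Epath /qfun ExZ; last first.
    by apply: (bmf_path0 mX); apply: bmf_indic; apply: measurable_sbelow; exact: ltW.
  congr (_ * _); rewrite -[RHS](hq (al01 Sy)) -[RHS](congr1 Phi (mulfK (lt0r_neq0 (powR_gt0 H y0)) (q y.2))).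
  rewrite -(ss_cdf ss)// mulrC -Ex_indic; last exact: mA.
  by congr Ex; apply/funext => w; rewrite !indicE; congr (_%:R); apply/idP/idP; rewrite !inE.
have b1' y : S y -> bmf (\1_([set w | X y.1 w <= y.1 `^ H * q y.2]) : Omega -> R).
  by move=> Sy; apply: bmf_indic; exact: mA.
have qE y w : qfun y (spath0 X w) = qcoef y * \1_([set w | X y.1 w <= y.1 `^ H * q y.2]) w.
  by rewrite /qfun !indicE; congr (_ * _%:R); apply/idP/idP; rewrite !inE.
rewrite /covf /qscore !E//.
pose A := [set w | X z.1 w <= z.1 `^ H * q z.2].
pose B := [set w | X z'.1 w <= z'.1 `^ H * q z'.2].
have Ez : Ex (\1_A) = z.2.
  have := E z Sz t0; rewrite /Epath (funext (qE z)) ExZ; last exact: b1'.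
  apply: mulfI; rewrite /qcoef oppr_eq0 mulf_neq0 ?invr_eq0 ?lt0r_neq0 ?powR_gt0//.
  exact: ss_pos ss _.
have Ez' : Ex (\1_B) = z'.2.
  have := E z' Sz' t0'; rewrite /Epath (funext (qE z')) ExZ; last exact: b1'.
  apply: mulfI; rewrite /qcoef oppr_eq0 mulf_neq0 ?invr_eq0 ?lt0r_neq0 ?powR_gt0//.
  exact: ss_pos ss _.
transitivity (qcoef z * qcoef z' * (Ex (\1_(A `&` B)) - z'.2 * z.2)).
  have bA := b1' z Sz; have bB := b1' z' Sz'.
  have bAB : bmf (\1_(A `&` B) : Omega -> R) by apply: bmf_indic; apply: measurableI; exact: mA.
  transitivity (Ex (fun w => qcoef z * qcoef z' *
     (\1_(A `&` B) w - z'.2 * \1_A w - (z.2 * \1_B w - z'.2 * z.2)))).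
    congr Ex; apply/funext => w; rewrite !qE -/A -/B indicI/=; ring.
  rewrite ExZ; last first.
    by apply: bmfB; apply: bmfB => //; [exact: bmfZ|exact: bmfZ|exact: bmf_cst].
  congr (_ * _); rewrite ExB; [|by apply: bmfB => //; exact: bmfZ|
    by apply: bmfB; [exact: bmfZ|exact: bmf_cst]].
  rewrite ExB//; last exact: bmfZ.
  rewrite ExB; [|exact: bmfZ|exact: bmf_cst].
  rewrite (Ex_cst P (z'.2 * z.2)) ExZ; last exact: bA.
  by rewrite ExZ; [rewrite Ez Ez'; ring|exact: bB].
rewrite Ex_indic; last by apply: measurableI; exact: mA.
have n1 := lt0r_neq0 (ss_pos ss (q z.2)); have n2 := lt0r_neq0 (ss_pos ss (q z'.2)).
have n3 := lt0r_neq0 (powR_gt0 H t0); have n4 := lt0r_neq0 (powR_gt0 H t0').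
rewrite /qcoef -[A `&` B]/[set w | X z.1 w <= z.1 `^ H * q z.2 /\ X z'.1 w <= z'.1 `^ H * q z'.2].
by move: (pr _) => y; field; rewrite n1 n2 n3 n4.
Qed.

Let V n z w := emp P X Xs n.+1 (qfun z) w.

Lemma qV_cf k (pts : 'I_k -> R * R) (c : 'I_k -> R) : (forall j, S (pts j)) ->
  Ex (fun w => cos (dot c (fun j => V n (pts j) w))) @[n --> \oo] -->
    expR (- ((\sum_i \sum_j c i * c j * covf P qscore (pts i) (pts j)) / 2)) /\
  Ex (fun w => sin (dot c (fun j => V n (pts j) w))) @[n --> \oo] --> (0 : R).
Proof.
move=> Sp; have bj j : bmf (qfun (pts j)) by exact: bq.
have bs : bmf (fun x => \sum_j c j * qfun (pts j) x) by apply: bmf_sum => j; exact: bmfZ.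
have [h1 h2] := emp_clt mX iid bs.
rewrite (vpath_linear P mX)// in h1.
have E n w : dot c (fun j => V n (pts j) w) = emp P X Xs n.+1 (fun x => \sum_j c j * qfun (pts j) x) w.
  by rewrite /V emp_linear.
by split; [move: h1|move: h2]; under eq_fun => n do under [X in Ex X]eq_fun => w do rewrite -E.
Qed.

(** Equicontinuity of t^H nu_n is known; since the factor 1 / p (q al) varies as well, its variation
    has to be multiplied by a bound on t^H nu_n itself. *)
Lemma qV_equi (e eta : R) : 0 < e -> 0 < eta -> exists2 del : R, 0 < del &
  \forall n \near \oo, exists Bad : set Omega, [/\ measurable Bad, pr Bad <= eta &
    forall w, ~ Bad w -> forall z z', S z -> S z' -> close del z z' -> `|V n z w - V n z' w| <= e].
Proof.
move=> e0 eta0.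
have [B B0 hB] := q_bound ss hq a0 b1; have [Lp Lp0 [lp lp0 hp]] := p_bounds ss B.
have [L L0 hL] := q_lip ss hq a0 b1.
have eta2 : 0 < eta / 2 by rewrite divr_gt0.
have [d1 d10 h1] := snu_equi ss T0 B0 (ltr01 : 0 < 1 :> R) eta2.
pose K := (Num.truncn (T / d1)).+1.
have KT : T <= K%:R * d1.
  by rewrite -ler_pdivrMr// ltW// truncnS_gt// divr_ge0// ltW.
have Kp : 0 < K%:R :> R by rewrite ltr0n.
have e20 : 0 < e * lp / 2 by rewrite divr_gt0// mulr_gt0.
have [d2 d20 h2] := snu_equi ss T0 B0 e20 eta2.
have e30 : 0 < e * lp ^+ 2 / (2 * K%:R) by rewrite divr_gt0// mulr_gt0// exprn_gt0.
have [d3 d30 h3] := p_unif ss B0 e30.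
exists (Num.min d2 (Num.min (d2 / L) (d3 / L))); first by rewrite !lt_min d20 !divr_gt0.
near=> n.
have [B1 [mB1 pB1 hB1]] : exists Bad : set Omega,
  [/\ measurable Bad, pr Bad <= eta / 2 &
    forall w, ~ Bad w -> forall t t' x x',
    0 <= t <= T -> 0 <= t' <= T -> `|x| <= B -> `|x'| <= B ->
    `|t - t'| <= d1 -> `|x - x'| <= d1 ->
    `|t `^ H * snu n.+1 t x w - t' `^ H * snu n.+1 t' x' w| <= 1] by near: n.
have [B2 [mB2 pB2 hB2]] : exists Bad : set Omega,
  [/\ measurable Bad, pr Bad <= eta / 2 &
    forall w, ~ Bad w -> forall t t' x x',
    0 <= t <= T -> 0 <= t' <= T -> `|x| <= B -> `|x'| <= B ->
    `|t - t'| <= d2 -> `|x - x'| <= d2 ->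
    `|t `^ H * snu n.+1 t x w - t' `^ H * snu n.+1 t' x' w| <= e * lp / 2] by near: n.
exists (B1 `|` B2); split; first exact: measurableU.
  by apply: le_trans (prU_le _ _ _) _ => //; rewrite [eta]splitr; exact: lerD.
move=> w nB z z' Sz Sz' /andP[]; rewrite !le_min => /andP[c1 _] /and3P[_ c2 c3].
have n1 : ~ B1 w by move=> h; apply: nB; left.
have n2 : ~ B2 w by move=> h; apply: nB; right.
(* A walk back to t = 0, where t^H nu_n is 0, in k steps of length at most [d1], each of which
   changes the value by at most 1. *)
have bound k t x : (k%:R * d1 >= t) -> 0 <= t <= T -> `|x| <= B ->
    `|t `^ H * snu n.+1 t x w| <= k%:R.
  elim: k t => [|k IH] t tk /andP[t0 tT] xB.
    have -> : t = 0 by apply/eqP; rewrite eq_le t0 andbT; rewrite mul0r in tk.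
    by rewrite powR0 ?gt_eqF// mul0r normr0.
  pose s := Num.max 0 (t - d1).
  have s0 : 0 <= s by rewrite le_max lexx.
  have st : s <= t by rewrite ge_max t0 gerBl ltW.
  have sT := le_trans st tT.
  have h := hB1 w n1 t s x x; rewrite t0 tT s0 sT subrr normr0 in h.
  have {}h := h isT isT xB xB _ (ltW d10).
  have sk : s <= k%:R * d1.
    by rewrite ge_max mulr_ge0 ?(ltW d10)//= lerBlDr -[X in _ + X]mul1r -mulrDl natr1.
  have := IH s sk; rewrite s0 sT => /(_ isT xB) IHs.
  rewrite -[X in `|X|](subrK (s `^ H * snu n.+1 s x w)) -natr1 addrC.
  apply: le_trans (ler_normD _ _) _; apply: lerD => //; apply: h.
  by rewrite ger0_norm ?subr_ge0// lerBlDl -lerBlDr /s le_max lexx orbT.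
have [zt zab] := Sz; have [zt' zab'] := Sz'.
rewrite /V !emp_qfun// -opprD normrN.
have qq : `|q z.2 - q z'.2| <= L * `|z.2 - z'.2| by exact: hL.
have q2 : `|q z.2 - q z'.2| <= d2.
  by apply: le_trans qq _; rewrite mulrC -ler_pdivlMr.
have q3 : `|q z.2 - q z'.2| <= d3.
  by apply: le_trans qq _; rewrite mulrC -ler_pdivlMr.
have y12 := hB2 w n2 _ _ _ _ zt zt' (hB _ zab) (hB _ zab') c1 q2.
have yK := bound K z'.1 (q z'.2) (le_trans (proj2 (andP zt')) KT) zt' (hB _ zab').
have pp := h3 _ _ (hB _ zab) (hB _ zab') q3.
have /andP[l1 _] := hp _ (hB _ zab); have /andP[l2 _] := hp _ (hB _ zab').
move: (z.1 `^ H * _) (z'.1 `^ H * _) y12 yK => y y' y12 yK.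
have p1 := ss_pos ss (q z.2); have p2 := ss_pos ss (q z'.2).
move: (p (q z.2)) (p (q z'.2)) p1 p2 l1 l2 pp => r r' r0 r0' l1 l2 pp.
have -> : y / r - y' / r' = (y - y') / r + y' * ((r' - r) / (r * r')).
  by field; rewrite !gt_eqF.
apply: le_trans (ler_normD _ _) _; rewrite [e]splitr; apply: lerD.
  rewrite normrM normfV (gtr0_norm r0) ler_pdivrMr//; apply: le_trans y12 _.
  by rewrite mulrAC ler_wpM2l// divr_ge0// ltW.
rewrite normrM normrM normfV (gtr0_norm (mulr_gt0 r0 r0')).
apply: (@le_trans _ _ (K%:R * (e * lp ^+ 2 / (2 * K%:R) / lp ^+ 2))).
  apply: ler_pM => //; rewrite ?divr_ge0 ?mulr_ge0 ?(ltW r0) ?(ltW r0')//.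
  apply: ler_pM; rewrite ?invr_ge0 ?mulr_ge0 ?(ltW r0) ?(ltW r0')//; first by rewrite distrC.
  rewrite lef_pV2 ?posrE ?mulr_gt0 ?exprn_gt0//; rewrite expr2.
  by apply: ler_pM => //; exact: ltW.
have K0 := lt0r_neq0 Kp; have lp1 := lt0r_neq0 lp0.
rewrite le_eqVlt; apply/orP; left; apply/eqP; move: (K%:R) K0 => k K0.
by field; rewrite K0 lp1.
Unshelve. all: by end_near. Qed.

Theorem quantile_clt : exists G : R * R -> Omega -> R,
  [/\ centered_gaussian_process P S G, radon_paths P S G,
      forall al w, a <= al <= b -> G (0, al) w = 0,
      forall z z', S z -> S z' -> 0 < z.1 -> 0 < z'.1 ->
        expectation P (fun w => G z w * G z' w) =
        ((pr [set w | X z.1 w <= z.1 `^ H * q z.2 /\ X z'.1 w <= z'.1 `^ H * q z'.2] - z'.2 * z.2) /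
        ((p (q z.2) / z.1 `^ H) * (p (q z'.2) / z'.1 `^ H)))%:E &
      weak_conv_linf S P (fun n z w => quant_dev Xs H q n z.1 z.2 w) P G].
Proof.
have [M hM] := qscore_bound.
have mf z : S z -> measurable_fun setT (qscore z).
  move=> Sz; have [h _] := bmfB (bmf_path0 mX (bq Sz)) (bmf_cst (Epath P X (qfun z))).
  exact: h.
have mV n z : S z -> measurable_fun setT (V n z).
  by move=> Sz; apply: (measurable_emp iid); exact: bq.
have Vt n z (L : R) : S z -> 0 < L -> pr [set w | L < `|V n z w|] <= covf P qscore z z / L ^+ 2.
  move=> Sz L0; apply: le_trans (emp_tail2 mX iid n (bq Sz) L0) _; rewrite /vpath /covf.
  by under [X in Ex X / _ <= _]eq_fun do rewrite expr2.
have [xi [mxi xicf]] := normal_sequence ss.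
have f0 z : S z -> z.1 = 0 -> covf P qscore z z = 0.
  move=> Sz z0; have E g : qfun z g = 0.
    by rewrite /qfun /qcoef z0 powR0 ?gt_eqF// mul0r oppr0 mul0r.
  rewrite /covf /qscore /Epath; under [X in Ex X]eq_fun do rewrite E.
  rewrite Ex_cst (_ : Ex _ = 0) ?subrr ?mul0r//.
  by under [X in Ex X]eq_fun do rewrite E; rewrite Ex_cst.
have [G [mG cG G0 Gd Gcf]] := limit_process T0 ab mf hM mV qV_cf Vt qV_equi mxi xicf f0.
have rad := limit_radon T0 ab mf hM mV qV_cf qV_equi mG Gcf cG Gd.
exists G; split=> //.
- exact: (gauss_centered mf hM mG Gcf).
- move=> al w hal; apply: G0 => //; split=> //=; by rewrite lexx ltW.
- move=> z z' Sz Sz' z0 z0'; rewrite (gauss_cov_moment mf hM mG Gcf)//.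
  by rewrite qscore_covE.
- apply: (limit_weak_conv T0 ab mV qV_cf Vt qV_equi mG Gcf cG) => [w|e eta e0 eta0].
    by have [] := rad w.
  have := bahadur ss hq X00 T0 a0 b1 e0 eta0; apply: filterS => n [Bad [mB pB hB]].
  exists Bad; split=> // w nB z Sz; have [zt zab] := Sz.
  by rewrite /V emp_qfun// opprK; exact: hB.
Qed.

End quantile_clt.

(** * Oscillation and marginals *)

Section dyadic_oscillation.
Context {R : realType} {d : measure_display} {Omega : measurableType d}
  (P : probability Omega R) (X : R -> Omega -> R).
Hypothesis mX : forall t : R, 0 <= t -> measurable_fun setT (X t).
Hypothesis rcX : forall w, rcpath (spath0 X w).
Variables t h : R.
Hypothesis t0 : 0 <= t.
Hypothesis h0 : 0 < h.
Local Notation pr := (pr P).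

Definition dyad (j k : nat) : R := t + h * (k%:R / 2 ^+ j).

Lemma dyad_ge0 j k : 0 <= dyad j k.
Proof. by rewrite addr_ge0// mulr_ge0 ?(ltW h0)// divr_ge0// exprn_ge0. Qed.

(** A rational time below t + h is approached from the right by subdivision points, and
    right-continuity transfers the excess. The endpoint t + h has no room to its right but is itself
    a subdivision point. *)
Lemma osc_dyadic (lam : R) (g : R -> R) : rcpath g -> osc t h lam g ->
  exists j k, (k <= 2 ^ j)%N /\ lam < `|g (dyad j k) - g t|.
Proof.
move=> gg [q [/andP[tq qth] lt]]; have q0 : 0 <= ratr q := le_trans t0 tq.
have [E|ne] := eqVneq (ratr q) (t + h).
  by exists 0%N, 1%N; split=> //; rewrite /dyad expr0 divr1 mulr1 -E.
have qt : ratr q < t + h by rewrite lt_neqAle ne.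
have cv : `|g x - g t| @[x --> (ratr q)^'+] --> `|g (ratr q) - g t|.
  by apply: cvg_norm; apply: cvgB; [exact: gg|exact: cvg_cst].
have [e /= e0 he] : \forall x \near (ratr q)^'+, lam < `|g x - g t| by apply: cvgr_gt cv _ lt.
have e2 : 0 < e / (2 * h) by rewrite divr_gt0// mulr_gt0.
have [j hj] : exists j : nat, (2^-1 : R) ^+ j <= e / (2 * h).
  by apply: ex_expn_le => //; lra.
have p2 : 0 < 2 ^+ j :> R by rewrite exprn_gt0.
pose y := (ratr q - t) / h * 2 ^+ j.
have y0 : 0 <= y by rewrite mulr_ge0 ?(ltW p2)// divr_ge0 ?subr_ge0// ltW.
have /andP[y1 y2] := truncn_cell y0.
have hy : h * (y / 2 ^+ j) = ratr q - t.
  by rewrite /y mulfK ?lt0r_neq0// mulrC divfK ?lt0r_neq0.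
have k1 : (Num.truncn y < 2 ^ j)%N.
  rewrite -(ltr_nat R) (le_lt_trans y1)// natrX /y -[ltRHS]mul1r ltr_pM2r//.
  by rewrite ltr_pdivrMr// mul1r ltrBlDl.
exists j, (Num.truncn y).+1; split=> //; apply: he; last first.
  rewrite /dyad -ltrBlDl -hy ltr_pM2l// ltr_pM2r ?invr_gt0// -natr1.
  exact: y2.
rewrite /ball/= distrC ger0_norm; last first.
  rewrite subr_ge0 /dyad -lerBlDl -hy ler_pM2l// ler_pM2r ?invr_gt0// -natr1.
  exact: ltW.
have -> : dyad j (Num.truncn y).+1 - ratr q = h * (((Num.truncn y)%:R - y + 1) / 2 ^+ j).
  by rewrite /dyad -natr1 -(subrK t (ratr q)) -hy; ring.
have h2 : ((Num.truncn y)%:R - y + 1) / 2 ^+ j <= e / (2 * h).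
  apply: le_trans hj; rewrite exprVn ler_piMl ?invr_ge0 ?exprn_ge0//.
  by rewrite gerDr subr_le0.
apply: (@le_lt_trans _ _ (h * (e / (2 * h)))); first by rewrite ler_pM2l.
have hn := lt0r_neq0 h0.
rewrite (_ : h * (e / (2 * h)) = e / 2); last by field.
by rewrite ltr_pdivrMr// ltr_pMr// ltr1n.
Qed.

Definition dyadic_jump (lam : R) (j : nat) : set Omega :=
  \bigcup_(k in [set k | (k <= 2 ^ j)%N]) [set w | lam < `|X (dyad j k) w - X t w|].

Lemma measurable_dyadic_jump lam j : measurable (dyadic_jump lam j).
Proof.
apply: bigcup_measurable => k _; apply: measurable_norm_gt.
by apply: measurable_funB; apply: mX => //; exact: dyad_ge0.
Qed.

Lemma plaw_osc_le (lam c : R) : (forall j, pr (dyadic_jump lam j) <= c) ->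
  plaw P X (osc t h lam) <= c.
Proof.
move=> hc; have mj := measurable_dyadic_jump lam.
have mono : nondecreasing_seq (dyadic_jump lam).
  apply/nondecreasing_seqP => j; apply/subsetPset => w [k /= kj hk].
  exists (2 * k)%N; first by rewrite /= expnS leq_mul2l.
  suff <- : dyad j k = dyad j.+1 (2 * k) by [].
  have n2 : 2 ^+ j != 0 :> R by rewrite expf_neq0.
  by rewrite /dyad exprS natrM; congr (_ + _ * _); field.
have cv := pr_bigcup_cvg (P := P) mj mono.
apply: (@le_trans _ _ (pr (\bigcup_j dyadic_jump lam j))).
  apply: pr_le; [by apply: (measurable_path0_event mX); exact: measurable_osc|
    by apply: bigcup_measurable|].
  by move=> w osc_w; have [j [k [kj hk]]] := osc_dyadic (@rcX w) osc_w; exists j => //; exists k.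
rewrite -(cvg_lim _ cv)//; apply: limr_le; first by apply/cvg_ex; eexists; exact: cv.
exact: nearW.
Qed.

End dyadic_oscillation.

(** The fundamental theorem of calculus; it makes a continuous density unique, as the derivative of
    the distribution function. *)
Lemma density_derive {R : realType} (F g : R -> R) : continuous g -> (forall y, 0 <= g y) ->
  (forall x, (F x)%:E = (\int[lebesgue_measure]_(y in [set y : R | (y <= x)%R]) (g y)%:E)%E) ->
  forall x : R, is_derive x 1 F (g x).
Proof.
move=> cg g0 hF x.
have sE (u : R) : [set y : R | y <= u] = [set` Interval -oo%O (BRight u)].
  by apply/seteqP; split => y /=; rewrite in_itv/=.
have xu : x < x + 1 by rewrite ltrDl.
have ig : lebesgue_measure.-integrable [set` Interval -oo%O (BRight (x + 1))] (EFin \o g).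
  apply/integrableP; split.
    apply/measurable_EFinP; apply: measurable_funTS; exact: continuous_measurable_fun.
  rewrite -sE; under eq_integral => y _ do rewrite /= ger0_norm//.
  by rewrite -hF ltry.
have FE : F = fun y => \int[lebesgue_measure]_(t in [set` Interval -oo%O (BRight y)]) (g t).
  by apply/funext => y; rewrite /Rintegral -sE -hF.
have [|//|h1 h2] := continuous_FTC1 xu ig; [by rewrite ltNyr|exact: cg|].
by rewrite FE; split; [exact: h1|rewrite -derive1E].
Qed.

Section marginals.
Context {R : realType} {d : measure_display} {Omega : measurableType d}
  (P : probability Omega R) (X : R -> Omega -> R) (f : R -> R -> R) (H : R) (psi : R -> R).
Hypothesis mX : forall t : R, 0 <= t -> measurable_fun setT (X t).
Hypothesis hf : forall t : R, 0 < t ->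
     continuous (f t) /\ (forall y, 0 <= f t y) /\
     forall x, P [set w | X t w <= x] =
       (\int[lebesgue_measure]_(y in [set y : R | (y <= x)%R]) (f t y)%:E)%E.
Hypothesis hcf : forall t u : R, 0 < t -> Ex P (fun w => cos (u * X t w)) = psi (t `^ H * u) /\
  Ex P (fun w => sin (u * X t w)) = 0.
Local Notation pr := (pr P).

Lemma marginal_derive (t x : R) : 0 < t ->
  is_derive x 1 (fun x => pr [set w | X t w <= x]) (f t x).
Proof.
move=> t0; have [cf [f0 hfx]] := hf t0; apply: density_derive => // y.
by rewrite -hfx -prE//; apply: measurable_le; apply: mX; exact: ltW.
Qed.

Lemma marginal_scale t x : 0 < t ->
  pr [set w | X t w <= x] = pr [set w | X 1 w <= x / t `^ H].
Proof.
move=> t0; have tH : 0 < t `^ H by exact: powR_gt0.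
have -> : [set w | X t w <= x] = [set w | X t w / t `^ H <= x / t `^ H].
  by apply/seteqP; split => w /=; rewrite ler_pM2r ?invr_gt0.
have mt := mX (ltW t0).
have E u w : u * (X t w / t `^ H) = (u / t `^ H) * X t w by ring.
have E1 u : t `^ H * (u / t `^ H) = u by rewrite mulrC divfK ?lt0r_neq0.
apply: cf_unique; [exact: measurable_funM|exact: mX|move=> u|move=> u];
  have [c1 s1] := hcf (u / t `^ H) t0; have [c2 s2] := hcf u ltr01.
- under [X in mean_of P X]eq_fun do rewrite E.
  by rewrite c1 E1 c2 powR1 mul1r.
- under [X in mean_of P X]eq_fun do rewrite E.
  by rewrite s1 s2.
Qed.

Lemma density_scale t x : 0 < t -> f t x = f 1 (x / t `^ H) / t `^ H.
Proof.
move=> t0; have h1 := marginal_derive x t0.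
have E : (fun x => pr [set w | X t w <= x]) =
    (fun y => pr [set w | X 1 w <= y]) \o (fun y => y / t `^ H).
  by apply/funext => y /=; exact: marginal_scale.
have h2 := marginal_derive (x / t `^ H) ltr01.
have h3 : is_derive x 1 (fun y : R => y / t `^ H) (t `^ H)^-1.
  have -> : (fun y : R => y / t `^ H) = (fun y => (t `^ H)^-1 * y).
    by apply/funext => y; rewrite mulrC.
  by apply: is_derive_eq; rewrite /GRing.scale/= mulr1.
have h4 := @is_derive1_comp _ (fun y => pr [set w | X 1 w <= y]) (fun y => y / t `^ H) _ _ _ h2 h3; rewrite -E in h4.
have [_ <-] := h1; have [_ ->] := h4; by rewrite mulrC.
Qed.

End marginals.

(** * Symmetric stable processes *)

Section ottaviani.
Context {R : realType} {d : measure_display} {Omega : measurableType d}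
  (P : probability Omega R).
Local Notation pr := (pr P).

Lemma pr_disjoint_sum_le n (F : nat -> set Omega) B : (forall k, measurable (F k)) ->
  measurable B -> trivIset setT F -> (forall k, F k `<=` B) -> \sum_(i < n) pr (F i) <= pr B.
Proof.
move=> mF mB tF FB.
have mU : measurable (\big[setU/set0]_(i < n) F i) by exact: bigsetU_measurable.
apply: (@le_trans _ _ (pr (\big[setU/set0]_(i < n) F i))); last first.
  by apply: pr_le => //; rewrite -bigcup_mkord => w [k _ /FB].
rewrite -lee_fin -prE// (measure_bigsetU _ _ tF)// -sumEFin le_eqVlt; apply/orP; left.
by apply/eqP; apply: eq_bigr => i _; exact/esym/prE.
Qed.

(** T is left free so that measurability can be stated for the sigma-algebra of the first steps as
    well as for [Omega]. *)
Definition first_passage {T : Type} (S : nat -> T -> R) (lam : R) (k : nat) : set T :=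
  [set w | lam < `|S k w|] `&` \bigcap_(i in [set i | (i < k)%N]) ~` [set w | lam < `|S i w|].

Lemma measurable_first_passage {d' : measure_display} {T : measurableType d'}
    (S : nat -> T -> R) lam k :
  (forall i, (i <= k)%N -> measurable_fun setT (S i)) -> measurable (first_passage S lam k).
Proof.
move=> mS; apply: measurableI; first by apply: measurable_norm_gt; exact: mS.
rewrite -setC_bigcup; apply: measurableC; apply: bigcup_measurable => i /= ik.
by apply: measurable_norm_gt; apply: mS; exact: ltnW.
Qed.

Variables (D : nat -> Omega -> R) (n : nat).
Hypothesis mD : forall i, measurable_fun setT (D i).
Hypothesis indepD : forall B : nat -> set R, (forall i, measurable (B i)) ->
  pr (\bigcap_(i in [set i | (i < n)%N]) (D i @^-1` B i)) = \prod_(i < n) pr (D i @^-1` B i).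

Let G i : set (set Omega) := [set A | exists2 B, measurable B & A = D i @^-1` B].

Let block lo hi := g_sigma_algebraType (block_rect G lo hi).

Let measurable_block lo hi i : (lo <= i < hi)%N ->
  measurable_fun setT (D i : block lo hi -> R).
Proof.
move=> lih _ B mB; rewrite setTI; apply: sub_sigma_algebra.
exists (fun j => if j == i then D i @^-1` B else setT).
  move=> j; case: eqP => [->|_]; first by exists B.
  by exists setT => //; rewrite preimage_setT.
apply/seteqP; split => [w Dw j /= jlh|w H]; first by case: eqP.
by have := H i lih; rewrite eqxx.
Qed.

Let S (k : nat) (w : Omega) : R := \sum_(i < k) D i w.

Let mS k : measurable_fun setT (S k).
Proof. exact: measurable_sum. Qed.

(** At the first k with |S k| > lam, the remaining increment is independent of the past and at most
    lam / 2 with probability at least 1/2; in that case |S n| > lam / 2. The events so obtained for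
    different k are disjoint. *)
Lemma ottaviani (lam : R) : 0 < lam ->
  (forall k, (k <= n)%N -> pr [set w | lam / 2 < `|S n w - S k w|] <= 2^-1) ->
  pr (\bigcup_(k in [set k | (k <= n)%N]) [set w | lam < `|S k w|]) <=
    2 * pr [set w | lam / 2 < `|S n w|].
Proof.
move=> lam0 hS.
pose E k := first_passage S lam k.
pose F k := ~` [set w | lam / 2 < `|S n w - S k w|].
have mE k : measurable (E k) by apply: measurable_first_passage => i _.
have mF k : measurable (F k).
  by apply: measurableC; apply: measurable_norm_gt; exact: measurable_funB.
have mA : measurable [set w | lam / 2 < `|S n w|] by exact: measurable_norm_gt.
pose EF k := if (k <= n)%N then E k `&` F k else set0.
have mEF k : measurable (EF k) by rewrite /EF; case: ifP => // _; exact: measurableI.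
have tE i j w : E i w -> E j w -> ~ (i < j)%N.
  by move=> [h1 _] [_ h2] ij; exact: (h2 i ij).
have tEF : trivIset setT EF.
  apply/trivIsetP => i j _ _ ij; apply/seteqP; split => // w; rewrite /EF => -[].
  case: ifP => // _ [Ei _]; case: ifP => // _ [Ej _].
  by case: (ltngtP i j) ij => // h _; [exact: (tE i j w)|exact: (tE j i w)].
have sEF k : EF k `<=` [set w | lam / 2 < `|S n w|].
  move=> w; rewrite /EF; case: ifP => // _ [[/= h1 _] /negP]; rewrite -leNgt => h2.
  rewrite ltNge; apply/negP => h3.
  have : `|S k w| <= lam / 2 + lam / 2.
    rewrite -[S k w](subKr (S n w)) (le_trans (ler_normB _ _))//; exact: lerD.
  by rewrite -splitr leNgt h1.
have hE k : (k <= n)%N -> pr (E k) <= 2 * pr (EF k).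
  move=> kn; have -> : pr (EF k) = pr (E k) * pr (F k).
    rewrite /EF kn; apply: (@blocks_indep _ _ _ P G k n kn).
    - move=> i _ _ [B mB ->] [C mC ->]; exists (B `&` C); first exact: measurableI.
      by rewrite preimage_setI.
    - by move=> i; exists setT => //; rewrite preimage_setT.
    - by move=> i _ [B mB ->]; exact: measurable_preim.
    - move=> A hA; have [B hB] := choice (fun i => let: ex_intro2 B mB AE := hA i in ex_intro _ B (conj mB AE)).
      rewrite (eq_bigcapr (fun i _ => (hB i).2)) indepD; last by move=> i; case: (hB i).
      by apply: eq_bigr => i _; rewrite -(hB i).2.
    - apply: (@measurable_first_passage _ (block 0 k) S lam k) => i ik.
      rewrite /S; apply: (@measurable_sum _ (block 0 k)) => l.
      by apply: measurable_block; rewrite /= (leq_trans (ltn_ord l)).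
    - apply: (@measurableC _ (block k n)).
      apply: (@measurable_norm_gt _ _ (block k n)).
      rewrite (_ : (fun w => S n w - S k w) = (fun w => \sum_(i < n - k) D (k + i) w)).
        apply: (@measurable_sum _ (block k n)) => l.
        by apply: measurable_block; rewrite leq_addr/= -ltn_subRL.
      apply/funext => w; rewrite /S -!(big_mkord xpredT (fun i => D i w)).
      rewrite (big_cat_nat (leq0n k) kn)/= addrAC subrr add0r -{1}[k]add0n big_addn big_mkord.
      by apply: eq_bigr => i _; rewrite addnC.
  have hF : 2^-1 <= pr (F k).
    rewrite prC; last by apply: measurable_norm_gt; exact: measurable_funB.
    by have := hS k kn; lra.
  by have := pr_ge0 P (E k); nra.
have mJ : measurable (\bigcup_(k in [set k | (k <= n)%N]) [set w | lam < `|S k w|]).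
  by apply: bigcup_measurable => k _; apply: measurable_norm_gt.
apply: (@le_trans _ _ (pr (\big[setU/set0]_(k < n.+1) E k))).
  apply: pr_le => //; first exact: bigsetU_measurable.
  move=> w [k /= kn hk]; rewrite -bigcup_mkord.
  have ex : exists k, lam < `|S k w| by exists k.
  case: (ex_minnP ex) => m hm mmin; exists m.
    by rewrite /= ltnS (leq_trans _ kn)// mmin.
  split=> // i /= im h; have := mmin i h; by rewrite leqNgt im.
apply: le_trans (pr_bigsum_le _ _ _) _ => //.
apply: (@le_trans _ _ (\sum_(k < n.+1) 2 * pr (EF k))).
  by apply: ler_sum => k _; apply: hE; rewrite -ltnS.
by rewrite -mulr_sumr ler_pM2l//; exact: pr_disjoint_sum_le.
Qed.

End ottaviani.

(** With z = y^2 in [1/16, 1/4], Taylor's lower bound is (z - z^2) / 2, smallest at z = 1/16. *)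
Lemma cos_cell_ge {R : realType} (y : R) : 4^-1 <= `|y| <= 2^-1 -> 3 / 128 <= 1 - cos y.
Proof.
move=> /andP[h1 h2]; have := cos_taylor y; rewrite ler_norml => /andP[_].
have -> : y ^+ 4 = (y ^+ 2) ^+ 2 by ring.
have E : y ^+ 2 = `|y| ^+ 2 by rewrite real_normK// num_real.
have : (4^-1 : R) ^+ 2 <= y ^+ 2 by rewrite E lerXn2r ?nnegrE//.
have : y ^+ 2 <= (2^-1 : R) ^+ 2 by rewrite E lerXn2r ?nnegrE//.
move: (y ^+ 2) => z h3 h4 h5.
have h6 : 0 <= (z - (4^-1) ^+ 2) * (15 / 16 - z) by rewrite mulr_ge0//; nra.
nra.
Qed.

Section stable.
Context {R : realType} {d : measure_display} {Omega : measurableType d}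
  (P : probability Omega R) (X : R -> Omega -> R) (f : R -> R -> R) (r c : R).
Hypothesis r02 : 0 < r < 2.
Hypothesis c0 : 0 < c.
Hypothesis st : sym_stable_process P r c X.
Hypothesis cad : forall w, cadlag_nonneg (fun t => X t w).
Hypothesis X00 : P [set w | X 0 w = 0] = 1%E.
Hypothesis hf : forall t : R, 0 < t ->
     continuous (f t) /\ (forall y, 0 <= f t y) /\
     forall x, P [set w | X t w <= x] =
       (\int[lebesgue_measure]_(y in [set y : R | (y <= x)%R]) (f t y)%:E)%E.
Local Notation pr := (pr P).
Local Notation Ex := (Ex P).

Let mX (t : R) : 0 <= t -> measurable_fun setT (X t).
Proof. by move=> _; case: st. Qed.

Let r0 : 0 < r. Proof. by case/andP: r02. Qed.

Let m0 : measurable [set w | X 0 w = 0].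
Proof. exact: (measurable_preim (mX (lexx 0)) (B := [set 0])). Qed.

Let N0 : pr (~` [set w | X 0 w = 0]) = 0.
Proof. by rewrite prC// /pr X00 /= subrr. Qed.

Lemma stable_rc w : rcpath (spath0 X w).
Proof. by move=> t t0; case: (cad w) => h _; exact: h. Qed.

Lemma stable_cf t u : 0 <= t -> Ex (fun w => cos (u * X t w)) = expR (- (c * t * `|u| `^ r)) /\
  Ex (fun w => sin (u * X t w)) = 0.
Proof.
move=> t0; have [_ [_ /(_ t u t0)]] := st.
have mu : measurable_fun setT (fun w => u * X t w) by apply: measurable_funM => //; exact: mX.
rewrite !expectation_Ex; [|exact: bmf_sin|exact: bmf_cos].
by move=> [h1 h2]; split; exact: EFin_inj.
Qed.

Lemma stable_cf_scale (t u : R) : 0 < t ->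
  Ex (fun w => cos (u * X t w)) = expR (- (c * `|t `^ r^-1 * u| `^ r)) /\
  Ex (fun w => sin (u * X t w)) = 0.
Proof.
move=> t0; have [-> ->] := stable_cf u (ltW t0); split=> //.
rewrite normrM powRM// ger0_norm ?powR_ge0// -powRrM mulVf ?gt_eqF// powRr1 ?(ltW t0)//.
by rewrite mulrA.
Qed.

Lemma pow2r : 0 < (2 : R) `^ (- r) < 1.
Proof.
rewrite powR_gt0//= powRN invf_lt1 ?powR_gt0//.
have : (1 : R) `^ r < 2 `^ r by rewrite gt0_ltr_powR ?nnegrE// ltr1n.
by rewrite powR1.
Qed.

(** On the shell 2^j x <= |X t| <= 2^(j + 1) x, the choice u = 1 / (2^(j + 2) x) puts u X in the
    range where 1 - cos is at least 3/128, while the mean of 1 - cos is at most c t u^r. Over the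
    shells this is a geometric series of ratio 2^-r. *)
Lemma stable_tail : exists2 K : R, 0 <= K & forall t x : R, 0 <= t -> 0 < x ->
  pr [set w | x < `|X t w|] <= K * (t / x `^ r).
Proof.
have /andP[q0 q1] := pow2r; set q := 2 `^ (- r) in q0 q1.
have q2 : 0 < 1 - q by rewrite subr_gt0.
exists (128 / 3 * c / (1 - q)) => [|t x t0 x0]; first by rewrite !mulr_ge0// ?(ltW c0)// invr_ge0 ltW.
have mt := mX t0.
pose A j := [set w | 2 ^+ j * x <= `|X t w|] `&` [set w | `|X t w| <= 2 ^+ j.+1 * x].
have mn : measurable_fun setT (fun w => `|X t w|) by exact: measurableT_comp.
have mA j : measurable (A j).
  by apply: measurableI; [exact: measurable_ge|exact: measurable_le].
have xr : 0 < x `^ r by exact: powR_gt0.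
have hA (j : nat) : pr (A j) <= 128 / 3 * c * (t / x `^ r) * q ^+ j.
  pose u := (2 ^+ j.+2 * x)^-1.
  have u1 : 0 < 2 ^+ j.+2 * x by rewrite mulr_gt0// exprn_gt0.
  have u0 : 0 < u by rewrite invr_gt0.
  have mu : measurable_fun setT (fun w => u * X t w) by exact: measurable_funM.
  have [hc _] := stable_cf u t0.
  have h1 : 3 / 128 * pr (A j) <= 1 - Ex (fun w => cos (u * X t w)).
    rewrite -[X in X - _](Ex_cst P) -ExB; [|exact: bmf_cst|exact: bmf_cos].
    rewrite -Ex_indic// -ExZ; last exact: bmf_indic.
    apply: Ex_le; [by apply: bmfZ; exact: bmf_indic|by apply: bmfB; [exact: bmf_cst|exact: bmf_cos]|].
    move=> w; rewrite indicE; case: (boolP (w \in A j)) => [|_]; last first.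
      by rewrite mulr0 subr_ge0; have := cos_max (u * X t w); rewrite ler_norml => /andP[].
    rewrite inE => -[/= a1 a2]; rewrite mulr1; apply: cos_cell_ge.
    rewrite normrM (gtr0_norm u0) /u mulrC ler_pdivlMr// ler_pdivrMr//.
    have -> : 4^-1 * (2 ^+ j.+2 * x) = 2 ^+ j * x by rewrite !exprS; field.
    have -> : 2^-1 * (2 ^+ j.+2 * x) = 2 ^+ j.+1 * x by rewrite !exprS; field.
    by rewrite a1 a2.
  have h2 : 1 - Ex (fun w => cos (u * X t w)) <= c * t * `|u| `^ r.
    by rewrite hc; have := expR_ge1Dx (- (c * t * `|u| `^ r)); lra.
  have h3 : `|u| `^ r <= q ^+ j / x `^ r.
    rewrite (gtr0_norm u0) /u powRV ?(ltW u1)// powRM ?exprn_ge0 ?(ltW x0)//.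
    rewrite invfM ler_pM2r ?invr_gt0// powRXn// /q powRN exprVn.
    rewrite lef_pV2 ?posrE ?exprn_gt0 ?powR_gt0//; apply: ler_weXn2l.
      by rewrite -[leLHS](powRr0 2) ler_powR ?ler1n// ltW.
    by do 2!apply: leqW.
  have h4 : c * t * `|u| `^ r <= c * t * (q ^+ j / x `^ r).
    by rewrite ler_wpM2l// mulr_ge0// ltW.
  have := le_trans h1 (le_trans h2 h4).
  have -> : c * t * (q ^+ j / x `^ r) = c * (t / x `^ r) * q ^+ j by ring.
  by rewrite -[128 / 3 * c * _ * _]mulrA -[128 / 3 * c * _]mulrA; lra.
apply: (@le_trans _ _ (pr (\bigcup_j A j))).
  apply: pr_le; [exact: measurable_norm_gt|exact: bigcup_measurable|].
  move=> w /= xw; have yx : 0 < x <= `|X t w| / 2 ^+ 0 by rewrite x0 expr0 divr1 ltW.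
  have [m] := ex_dyadic (lt_trans x0 xw) yx; rewrite add0n.
  rewrite ler_pdivrMr ?exprn_gt0// ler_pdivlMr ?exprn_gt0// => /andP[h1 h2].
  by exists m => //; split => /=; rewrite mulrC.
apply: pr_bigcup_le => // n.
apply: (@le_trans _ _ (\sum_(i < n) 128 / 3 * c * (t / x `^ r) * q ^+ i)).
  by apply: ler_sum => i _; exact: hA.
rewrite -mulr_sumr; have := @geom_sum_le _ q n; rewrite (ltW q0) q1 => /(_ isT) hg.
apply: (@le_trans _ _ (128 / 3 * c * (t / x `^ r) * (1 - q)^-1)).
  apply: ler_wpM2l => //; apply: mulr_ge0; last by rewrite divr_ge0// ltW.
  by apply: mulr_ge0; [exact: divr_ge0|exact: ltW].
by rewrite le_eqVlt; apply/orP; left; apply/eqP; ring.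
Qed.

Lemma stable_increment_tail : exists2 K : R, 0 <= K & forall s t x : R, 0 <= s <= t -> 0 < x ->
  pr [set w | x < `|X t w - X s w|] <= K * ((t - s) / x `^ r).
Proof.
have [K K0 hK] := stable_tail; exists K => // s t x /andP[s0 stt] x0.
have ts : 0 <= t - s by rewrite subr_ge0.
apply: le_trans (hK _ _ ts x0).
have [_ [[_ hst] _]] := st.
have mB : measurable [set y : R | x < `|y|] by apply: measurable_norm_gt; exact: measurable_id.
have E := hst s t s0 stt _ mB.
have -> : pr [set w | x < `|X t w - X s w|] = pr [set w | x < `|X (t - s) w - X 0 w|].
  by rewrite /pr -[[set w | x < `|X t w - X s w|]]/((fun w => X t w - X s w) @^-1` [set y | x < `|y|]) E.
have m1 : measurable [set w | x < `|X (t - s) w|] by apply: measurable_norm_gt; exact: mX.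
apply: (@le_trans _ _ (pr ([set w | x < `|X (t - s) w|] `|` ~` [set w | X 0 w = 0]))).
  apply: pr_le.
  - by apply: measurable_norm_gt; apply: measurable_funB; exact: mX.
  - by apply: measurableU => //; exact: measurableC.
  - move=> w /= h; have [E0|] := pselect (X 0 w = 0); last by right.
    by left; rewrite E0 subr0 in h.
by apply: le_trans (prU_le _ _ _) _ => //; [exact: measurableC|rewrite N0 addr0].
Qed.

(** The exponent kap is r. Ottaviani's inequality along dyadic subdivisions requires the increment
    tail [del] to be at most 1/2; when [del] is larger, the claimed bound 2 [del] is at least 1. *)
Lemma stable_osc : exists C kap : R, [/\ 0 <= C, 0 < kap &
  forall t h lam : R, 0 <= t -> 0 < h -> 0 < lam ->
    plaw P X (osc t h lam) <= C * (h `^ r^-1 / lam) `^ kap].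
Proof.
have [K K0 hK] := stable_increment_tail.
exists (2 * K * 2 `^ r), r; split=> //; first by rewrite !mulr_ge0// powR_ge0.
move=> t h lam t0 h0 lam0.
have lam2 : 0 < lam / 2 by rewrite divr_gt0.
have E : 2 * K * 2 `^ r * (h `^ r^-1 / lam) `^ r = 2 * (K * (h / (lam / 2) `^ r)).
  rewrite powRM ?powR_ge0 ?invr_ge0 ?(ltW lam0)// -powRrM mulVf ?gt_eqF// powRr1 ?(ltW h0)//.
  rewrite powRM ?(ltW lam0)// ?invr_ge0//.
  rewrite !powRV ?(ltW lam0)//; have := lt0r_neq0 (powR_gt0 r lam0).
  have : (2 : R) `^ r != 0 by apply: lt0r_neq0; exact: powR_gt0.
  by move: (lam `^ r) (2 `^ r) => y z y0 z0; field; rewrite y0 z0.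
rewrite E; set del := K * _.
have [big|small] := leP 2^-1 del.
  apply: (@le_trans _ _ 1); last by lra.
  by apply: pr_le1; apply: (measurable_path0_event mX); exact: measurable_osc.
apply: (plaw_osc_le mX stable_rc t0 h0) => j.
pose n := (2 ^ j)%N; pose s i := dyad t h j i.
have s_ge i : 0 <= s i by exact: dyad_ge0.
have s_lt i k : (i < k)%N -> s i < s k.
  by move=> ik; rewrite /s /dyad ltrD2l ltr_pM2l// ltr_pM2r ?invr_gt0 ?exprn_gt0// ltr_nat.
have s_le i k : (i <= k)%N -> s i <= s k.
  by rewrite leq_eqVlt => /predU1P[->//|/s_lt/ltW].
have s0 : s 0%N = t by rewrite /s /dyad mul0r mulr0 addr0.
have sn : s n = t + h by rewrite /s /dyad /n natrX divff ?mulr1// expf_neq0.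
pose D i w := X (s i.+1) w - X (s i) w.
have mD i : measurable_fun setT (D i) by apply: measurable_funB; exact: mX.
have SE k w : \sum_(i < k) D i w = X (s k) w - X t w.
  by rewrite -(big_mkord xpredT (fun i => D i w)) telescope_sumr// s0.
have tail k : (k <= n)%N ->
    pr [set w | lam / 2 < `|\sum_(i < n) D i w - \sum_(i < k) D i w|] <= del.
  move=> kn; under eq_set do rewrite !SE opprB addrA subrK.
  apply: le_trans (hK (s k) (s n) _ _ lam2) _; first by rewrite s_ge s_le.
  rewrite ler_wpM2l// ler_wpM2r ?invr_ge0 ?powR_ge0// sn lerBlDl.
  by rewrite lerD2r -s0 s_le.
have indepD (B : nat -> set R) : (forall i, measurable (B i)) ->
    pr (\bigcap_(i in [set i | (i < n)%N]) (D i @^-1` B i)) = \prod_(i < n) pr (D i @^-1` B i).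
  move=> mB; have [_ [[/(_ n (fun i => s i)) ind _] _]] := st.
  have {}ind := ind (s_ge _) (fun i k => s_lt i k) (fun i => B i) (fun i => mB i).
  apply: EFin_inj; rewrite -prE; last first.
    by apply: bigcap_measurable; [exists 0%N; rewrite /= expn_gt0|move=> i _; exact: measurable_preim].
  rewrite (_ : \bigcap_(i in _) _ = \bigcap_(i in [set: 'I_n]) (D i @^-1` B i)); last first.
    apply/seteqP; split => [w hw i _|w hw i /= ilt]; first exact: (hw i (ltn_ord i)).
    exact: (hw (Ordinal ilt) I).
  rewrite [LHS]ind -prodEFin; apply: eq_bigr => i _.
  by rewrite -prE//; exact: measurable_preim.
have := ottaviani mD indepD lam0 (fun k kn => le_trans (tail k kn) (ltW small)).
have -> : \bigcup_(k in [set k | (k <= n)%N]) [set w | lam < `|\sum_(i < k) D i w|] =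
    dyadic_jump X t h lam j.
  by apply: eq_bigcupr => k _; apply/seteqP; split => w /=; rewrite SE.
move=> h1; apply: le_trans h1 _; rewrite ler_pM2l//.
have := tail 0%N (leq0n n); rewrite (_ : [set w | _] = [set w | lam / 2 < `|\sum_(i < n) D i w|])//.
by apply/seteqP; split => w /=; rewrite big_ord0 subr0.
Qed.

Let Phi (t x : R) := pr [set w | X t w <= x].

Let dPhi (t x : R) : 0 < t -> is_derive x 1 (Phi t) (f t x).
Proof. by move=> t0; exact: marginal_derive. Qed.

Let pr_itv (t x y : R) : 0 < t -> x <= y -> pr (X t @^-1` `]x, y]) = Phi t y - Phi t x.
Proof.
move=> t0 xy; have mt := mX (ltW t0).
have mx : measurable [set w | X t w <= x] by exact: measurable_le.
have my : measurable [set w | X t w <= y] by exact: measurable_le.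
rewrite /Phi (prDI P my mx) (_ : _ `&` _ = [set w | X t w <= x]); last first.
  by apply/seteqP; split => [w []//|w /= h]; split => //=; exact: le_trans xy.
rewrite addrK; congr prob_of; apply/seteqP; split => w /=; rewrite in_itv/=.
  by move=> /andP[h1 h2]; split=> //; apply/negP; rewrite -ltNge.
by move=> [h1 /negP]; rewrite -ltNge h1 andbT.
Qed.

Let Phi_ge (t x y del : R) : 0 < t -> x <= y -> (forall z, x <= z <= y -> del <= f t z) ->
  del * (y - x) <= Phi t y - Phi t x.
Proof.
move=> t0 xy h; have [z [_ zxy ->]] := mvt_abs (fun v => dPhi v t0) x y.
rewrite (min_idPl xy) (max_idPr xy) in zxy.
by rewrite ler_wpM2r ?subr_ge0// h.
Qed.

Let Phi_le (t x y eps : R) : 0 < t -> x <= y -> (forall z, x <= z <= y -> f t z <= eps) ->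
  Phi t y - Phi t x <= eps * (y - x).
Proof.
move=> t0 xy h; have [z [_ zxy ->]] := mvt_abs (fun v => dPhi v t0) x y.
rewrite (min_idPl xy) (max_idPr xy) in zxy.
by rewrite ler_wpM2r ?subr_ge0// h.
Qed.

Let pr_as_eq A B N : measurable A -> measurable B -> measurable N -> pr N = 0 ->
  (forall w, ~ N w -> A w <-> B w) -> pr A = pr B.
Proof.
move=> mA mB mN pN AB; rewrite -!Ex_indic//; apply: (@Ex_as_eq _ _ _ P _ _ N) => //; try exact: bmf_indic.
move=> w /AB h; rewrite !indicE; suff -> : (w \in A) = (w \in B) by [].
by apply/idP/idP; rewrite !inE => /h.
Qed.

Let dens_ball (t x : R) : 0 < t -> 0 < f t x -> exists2 rho : R, 0 < rho &
  forall z, `|z - x| <= rho -> f t x / 2 <= f t z.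
Proof.
move=> t0 fx; have [cf _] := hf t0.
have : \forall z \near x, f t x / 2 < f t z.
  by apply: (cvgr_gt (f t x) (cf x)); rewrite ltr_pdivrMr// ltr_pMr// ltr1n.
move=> [rho /= rho0 h]; exists (rho / 2) => [|z hz]; first by rewrite divr_gt0.
apply: ltW; apply: h; rewrite /ball/= distrC (le_lt_trans hz)//.
by rewrite ltr_pdivrMr// ltr_pMr// ltr1n.
Qed.

(* Splitting the range of the first summand into cells of width [eta] bounds
   P(|X 1 - x - y| <= 2 eta) from below by a multiple of [eta]. *)
Lemma stable_density_add (s x y : R) : 0 < s < 1 -> 0 < f s x -> 0 < f (1 - s) y ->
  0 < f 1 (x + y).
Proof.
move=> /andP[s0 s1] fx fy; have u0 : 0 < 1 - s by rewrite subr_gt0.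
have [c1 [f0 _]] := hf ltr01.
rewrite lt_neqAle f0 andbT eq_sym; apply/negP => /eqP fz.
have [r1 r10 h1] := dens_ball s0 fx; have [r2 r20 h2] := dens_ball u0 fy.
pose rho : R := Num.min r1 r2 / 3.
have rho0 : 0 < rho by rewrite divr_gt0// lt_min r10.
have rr1 : 3 * rho <= r1 by rewrite /rho mulrC divfK// ge_min lexx.
have rr2 : 3 * rho <= r2 by rewrite /rho mulrC divfK// ge_min lexx orbT.
set d1 := f s x / 2 in h1; set d2 := f (1 - s) y / 2 in h2.
have d10 : 0 < d1 by rewrite divr_gt0.
have d20 : 0 < d2 by rewrite divr_gt0.
(* A zero of the density at x + y would bound the probability of being within 2 eta of x + y by 4
   eps eta, half of the lower bound 2 d1 d2 rho eta coming from the cells. *)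
pose eps := d1 * d2 * rho / 4.
have eps0 : 0 < eps by apply: divr_gt0 => //; apply: mulr_gt0 => //; exact: mulr_gt0.
have [e /= e0 he] : \forall z \near (x + y), f 1 z < eps.
  by apply: (cvgr_lt (f 1 (x + y)) (c1 (x + y))); rewrite fz.
have e3 : 0 < e / (3 * rho) by rewrite divr_gt0// mulr_gt0.
have [N hN] := ex_natSinv_le e3.
pose eta := rho / N.+1%:R.
have N0' : 0 < N.+1%:R :> R by rewrite ltr0n.
have eta0 : 0 < eta by rewrite divr_gt0.
have etarho : N.+1%:R * eta = rho by rewrite /eta mulrC divfK ?lt0r_neq0.
have eta_e : 3 * eta <= e.
  have r30 : 0 < 3 * rho by exact: mulr_gt0.
  rewrite ler_pdivlMr// in hN.
  by apply: le_trans hN; rewrite /eta le_eqVlt; apply/orP; left; apply/eqP; ring.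
(* The times 0, s, 1, whose two successive increments are independent. *)
pose ts (i : 'I_3) : R := if val i == 0%N then 0 else if val i == 1%N then s else 1.
pose Y (i : 'I_2) w := X (ts (lift ord0 i)) w - X (ts (widen_ord (leqnSn 2) i)) w.
have [_ [[ind stat] _]] := st.
have lt_ts (i k : 'I_3) : (i < k)%N -> ts i < ts k.
  case: i k => [[|[|[|i]]] hi] [[|[|[|k]]] hk] //= _; rewrite /ts //=; exact: lt_trans s1.
have {}ind := ind 2 ts (lexx _) lt_ts.
pose Y1 w := X s w - X 0 w; pose Y2 w := X 1 w - X s w.
have mY1 : measurable_fun setT Y1 by apply: measurable_funB; apply: mX => //; exact: ltW.
have mY2 : measurable_fun setT Y2 by apply: measurable_funB; apply: mX => //; exact: ltW.
have ind2 B1 B2 : measurable B1 -> measurable B2 ->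
    pr (Y1 @^-1` B1 `&` Y2 @^-1` B2) = pr (Y1 @^-1` B1) * pr (Y2 @^-1` B2).
  move=> mB1 mB2; pose B (i : 'I_2) := if val i == 0%N then B1 else B2.
  have mB i : measurable (B i) by rewrite /B; case: ifP.
  have := ind B mB; rewrite !big_ord_recr big_ord0/= mul1e => E.
  apply: EFin_inj; rewrite EFinM -!prE; [|exact: measurable_preim|exact: measurable_preim|
    by apply: measurableI; exact: measurable_preim].
  rewrite -[RHS]E; congr (P _); apply/seteqP; split => w.
    move=> [w1 w2] [[|[|i]] hi] _ //=.
  by move=> hw; split; [exact: (hw ord0 I)|exact: (hw (lift ord0 ord0) I)].
have law1 B : measurable B -> pr (Y1 @^-1` B) = pr (X s @^-1` B).
  move=> mB; apply: (@pr_as_eq _ _ (~` [set w | X 0 w = 0])) => //.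
  - exact: measurable_preim.
  - by apply: measurable_preim => //; apply: mX; exact: ltW.
  - exact: measurableC.
  - by move=> w /contrapT/= E; rewrite /Y1 E subr0.
have law2 B : measurable B -> pr (Y2 @^-1` B) = pr (X (1 - s) @^-1` B).
  move=> mB; rewrite /pr (stat s 1 (ltW s0) (ltW s1) B mB) -!/(prob_of P _).
  apply: (@pr_as_eq _ _ (~` [set w | X 0 w = 0])) => //.
  - by apply: measurable_preim => //; apply: measurable_funB; apply: mX => //; exact: ltW.
  - by apply: measurable_preim => //; apply: mX; exact: ltW.
  - exact: measurableC.
  - by move=> w /contrapT/= E; rewrite E subr0.
pose z := x + y.
pose C k : set R := `]x + k%:R * eta, x + k.+1%:R * eta]%classic.
(* If the first increment is in [C k] and the second in [D k], the sum is within 2 eta of x + y. *)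
pose D k : set R := `]y - k.+1%:R * eta - eta, y - k.+1%:R * eta + eta]%classic.
pose F k := Y1 @^-1` C k `&` Y2 @^-1` D k.
pose B := [set w | z - 2 * eta < X 1 w - X 0 w <= z + 2 * eta].
have mC k : measurable (C k) by exact: measurable_itv.
have mD k : measurable (D k) by exact: measurable_itv.
have mF k : measurable (F k) by apply: measurableI; exact: measurable_preim.
have mB : measurable B.
  rewrite (_ : B = (fun w => X 1 w - X 0 w) @^-1` `]z - 2 * eta, z + 2 * eta]).
    by apply: measurable_preim => //; apply: measurable_funB; exact: mX.
  by apply/seteqP; split => w /=; rewrite in_itv.
have tF : trivIset setT F.
  have main i k w : F i w -> F k w -> ~ (i < k)%N.
    move=> [+ _] [+ _]; rewrite /C/= !in_itv/= => /andP[_ h3] /andP[h4 _] ik.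
    have : x + i.+1%:R * eta <= x + k%:R * eta by rewrite lerD2l ler_pM2r// ler_nat.
    by move=> /(le_trans h3)/(lt_le_trans h4); rewrite ltxx.
  apply/trivIsetP => i k _ _ ik; apply/seteqP; split => // w [Fi Fk].
  by case: (ltngtP i k) ik => // h _; [exact: (main i k w)|exact: (main k i w)].
have FB k : F k `<=` B.
  move=> w [+ +]; rewrite /C /D/= !in_itv/= /B/= -natr1 /z => /andP[a1 a2] /andP[a3 a4].
  have -> : X 1 w - X 0 w = Y1 w + Y2 w by rewrite /Y1 /Y2; ring.
  move: (Y1 w) (Y2 w) a1 a2 a3 a4 => y1 y2; rewrite mulrDl mul1r; move: (k%:R * eta) => ke a1 a2 a3 a4.
  by apply/andP; split; lra.
have lowF k : (k < N.+1)%N -> d1 * d2 * (2 * eta ^+ 2) <= pr (F k).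
  move=> kN; rewrite ind2// law1// law2//.
  have ke : 0 <= k%:R * eta by rewrite mulr_ge0// ltW.
  have ke1 : k.+1%:R * eta <= rho by rewrite -etarho ler_pM2r// ler_nat.
  have er : eta <= rho by rewrite -etarho ler_peMl ?(ltW eta0)// ler1n.
  have -> : d1 * d2 * (2 * eta ^+ 2) = (d1 * eta) * (d2 * (2 * eta)) by ring.
  have k1E : k.+1%:R * eta = k%:R * eta + eta by rewrite -natr1 mulrDl mul1r.
  apply: ler_pM.
  - exact: (mulr_ge0 (ltW d10) (ltW eta0)).
  - by apply: (mulr_ge0 (ltW d20)); apply: mulr_ge0 => //; exact: ltW.
  - have le1 : x + k%:R * eta <= x + k.+1%:R * eta by rewrite k1E; lra.
    rewrite /C (pr_itv s0 le1).
    rewrite [X in d1 * X](_ : eta = x + k.+1%:R * eta - (x + k%:R * eta)); last by rewrite k1E; ring.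
    apply: Phi_ge => // v /andP[v1 v2]; apply: h1; rewrite ger0_norm; lra.
  have le2 : y - k.+1%:R * eta - eta <= y - k.+1%:R * eta + eta by lra.
  rewrite /D (pr_itv u0 le2).
  have -> : 2 * eta = y - k.+1%:R * eta + eta - (y - k.+1%:R * eta - eta) by ring.
  apply: Phi_ge => // v /andP[v1 v2]; apply: h2.
  by rewrite k1E in v1 v2 ke1; rewrite ler_norml; apply/andP; split; lra.
have upB : pr B <= eps * (4 * eta).
  rewrite (@pr_as_eq B (X 1 @^-1` `]z - 2 * eta, z + 2 * eta]) (~` [set w | X 0 w = 0]))//.
  - have le3 : z - 2 * eta <= z + 2 * eta by lra.
    rewrite (pr_itv ltr01 le3); have -> : 4 * eta = z + 2 * eta - (z - 2 * eta) by ring.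
    apply: Phi_le => // v /andP[v1 v2]; apply: ltW; apply: he; rewrite /ball/= -/z.
    by apply: lt_le_trans eta_e; rewrite distrC ltr_norml; apply/andP; split; lra.
  - by apply: measurable_preim => //; exact: mX.
  - exact: measurableC.
  - by move=> w /contrapT/= E; rewrite /B/= E subr0 in_itv.
have := pr_disjoint_sum_le P N.+1 mF mB tF FB.
have : \sum_(i < N.+1) d1 * d2 * (2 * eta ^+ 2) <= \sum_(i < N.+1) pr (F i).
  by apply: ler_sum => i _; exact: lowF.
rewrite sumr_const card_ord -[X in X <= _ -> _]mulr_natl.
have -> : N.+1%:R * (d1 * d2 * (2 * eta ^+ 2)) = 2 * (d1 * d2 * rho) * eta by rewrite -etarho; ring.
move=> a1 a2; have := le_trans a1 (le_trans a2 upB).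
have -> : eps * (4 * eta) = d1 * d2 * rho * eta by rewrite /eps; field.
have : 0 < d1 * d2 * rho * eta.
  by apply: mulr_gt0 => //; apply: mulr_gt0 => //; exact: mulr_gt0.
by rewrite -[2 * _ * eta]mulrA; lra.
Qed.

Let m1 : measurable_fun setT (X 1). Proof. exact: mX. Qed.

Let symX x : Phi 1 x = pr [set w | - X 1 w <= x].
Proof.
apply: cf_unique => //; first exact: measurable_funN.
  by move=> u; under [in RHS]eq_fun do rewrite mulrN cosN.
move=> u; have [_ h] := stable_cf u ler01; rewrite h; symmetry.
under eq_fun do rewrite mulrN sinN.
by rewrite ExN ?h ?oppr0//; apply: bmf_sin; exact: measurable_funM.
Qed.

(** The derivative of Phi(x) = 1 - Phi(-x); strict and weak inequalities have the same probability
    because Phi is continuous. *)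
Lemma stable_density_sym x : f 1 (- x) = f 1 x.
Proof.
have lt_le y : pr [set w | X 1 w < y] = Phi 1 y.
  apply/eqP; rewrite eq_le; apply/andP; split.
    by apply: pr_le; [exact: measurable_lt|exact: measurable_le|move=> w /= /ltW].
  apply/ler_addgt0Pr => e e0.
  have cPhi : {for y, continuous (Phi 1)}.
    apply: differentiable_continuous; apply/derivable1_diffP; by case: (dPhi y ltr01).
  have [h /= h0 hh] : \forall z \near y, Phi 1 y - e < Phi 1 z.
    by apply: (cvgr_gt (Phi 1 y) cPhi); rewrite ltrBlDr ltrDl.
  have := hh (y - h / 2); rewrite /ball/= opprB addrC subrK gtr0_norm ?divr_gt0//.
  rewrite ltr_pdivrMr// ltr_pMr// ltr1n => /(_ isT) h1.
  have h2 : Phi 1 (y - h / 2) <= pr [set w | X 1 w < y].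
    apply: pr_le; [exact: measurable_le|exact: measurable_lt|move=> w /= /le_lt_trans]; apply.
    by rewrite ltrBlDr ltrDl divr_gt0.
  by rewrite -lerBlDr (le_trans (ltW h1)).
have E : Phi 1 = cst 1 - (Phi 1 \o -%R).
  apply/funext => y; rewrite !fctE; rewrite symX -lt_le -prC; last exact: measurable_lt.
  by congr prob_of; apply/seteqP; split => w /=; rewrite lerNl leNgt => /negP.
have h1 := dPhi x ltr01; have h2 := dPhi (- x) ltr01.
have h3 : is_derive x 1 (-%R : R -> R) (-1) by exact: is_deriveNid.
have h4 := @is_derive1_comp _ (Phi 1) -%R _ _ _ h2 h3.
have h5 : is_derive x 1 (cst 1 - (Phi 1 \o -%R)) (0 - f 1 (- x) * -1) by exact: is_deriveB.
rewrite -E in h5; have [_ <-] := h1; have [_ ->] := h5.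
by rewrite mulrN1 opprK add0r.
Qed.

(** If the density vanished beyond L, symmetry would bound |X 1| by L almost surely, whence 1 -
    exp(- c u^r) <= u^2 L^2 / 2 for all u > 0. This fails for small u since r < 2. *)
Lemma stable_unbounded (L : R) : 0 < L -> exists2 x, L <= x & 0 < f 1 x.
Proof.
move=> L0; apply: contrapT => no.
have [_ [f0 _]] := hf ltr01.
have fL x : L <= x -> f 1 x <= 0.
  by move=> Lx; rewrite leNgt; apply/negP => fx; apply: no; exists x.
have mgt : measurable [set w | L < X 1 w] by exact: measurable_gt.
have p1 : pr [set w | L < X 1 w] = 0.
  apply/eqP; rewrite eq_le pr_ge0 andbT.
  have mi n : measurable (X 1 @^-1` `]L, L + n%:R]) by exact: measurable_preim.
  apply: (@le_trans _ _ (pr (\bigcup_n X 1 @^-1` `]L, L + n%:R]))).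
    apply: pr_le => //; first exact: bigcup_measurable.
    move=> w /= Lw; exists (Num.truncn (X 1 w - L)).+1 => //=.
    rewrite in_itv/= Lw/= -lerBlDl ltW// truncnS_gt// subr_ge0 ltW//.
  apply: pr_bigcup_le => // n; rewrite big1// => i _; apply/eqP; rewrite eq_le pr_ge0 andbT.
  have le1 : L <= L + i%:R by rewrite lerDl.
  rewrite (pr_itv ltr01 le1); have := @Phi_le 1 L (L + i%:R) 0 ltr01 le1; rewrite mul0r; apply.
  by move=> z /andP[Lz _]; exact: fL.
have p2 : pr [set w | L < - X 1 w] = 0.
  have -> : [set w | L < - X 1 w] = ~` [set w | - X 1 w <= L].
    by apply/seteqP; split => w /=; rewrite ltNge => /negP.
  rewrite prC; last by apply: measurable_le; exact: measurable_funN.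
  rewrite -symX -prC; last exact: measurable_le.
  by rewrite -[RHS]p1; congr prob_of; apply/seteqP; split => w /=; rewrite ltNge => /negP.
pose N := [set w | L < `|X 1 w|].
have mN : measurable N by exact: measurable_norm_gt.
have pN : pr N = 0.
  apply/eqP; rewrite eq_le pr_ge0 andbT.
  apply: (@le_trans _ _ (pr ([set w | L < X 1 w] `|` [set w | L < - X 1 w]))).
    apply: pr_le => //.
      by apply: measurableU => //; apply: measurable_gt; exact: measurable_funN.
    by move=> w; rewrite /N/= lter_normr => /orP[]; [left|right].
  apply: le_trans (prU_le _ _ _) _ => //; first by apply: measurable_gt; exact: measurable_funN.
  by rewrite p1 p2 addr0.
have bound u : 0 < u -> 1 - expR (- (c * u `^ r)) <= u ^+ 2 * L ^+ 2 / 2.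
  move=> u0; have [h _] := stable_cf u ler01; rewrite mulr1 (gtr0_norm u0) in h.
  rewrite -h -[X in X - _](Ex_cst P).
  have mu : measurable_fun setT (fun w => u * X 1 w) by exact: measurable_funM.
  have bc : bmf (fun w => 1 - cos (u * X 1 w)).
    by apply: bmfB; [exact: bmf_cst|exact: bmf_cos].
  rewrite -ExB; [|exact: bmf_cst|exact: bmf_cos].
  have bi : bmf (fun w => \1_(~` N) w * (1 - cos (u * X 1 w))).
    by apply: bmfM => //; apply: bmf_indic; exact: measurableC.
  rewrite (@Ex_as_eq _ _ _ P _ _ N bc bi mN pN); last first.
    by move=> w nN; rewrite indicE mem_set// mul1r.
  rewrite -[leRHS](Ex_cst P); apply: Ex_le => //; first exact: bmf_cst.
  move=> w; rewrite indicE; case: (boolP (w \in _)) => [|_]; last first.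
    by rewrite mul0r divr_ge0// mulr_ge0// sqr_ge0.
  rewrite inE mul1r => /negP; rewrite -leNgt => hw.
  have /andP[_ h2] := onem_cos_le (u * X 1 w); apply: le_trans h2 _.
  rewrite ler_pM2r ?invr_gt0// exprMn ler_pM2l ?exprn_gt0//.
  by rewrite -real_normK ?num_real// lerXn2r ?nnegrE// ltW.
have r2 : 0 < 2 - r by case/andP: r02 => _; rewrite subr_gt0.
have L2 : 0 < L ^+ 2 by rewrite exprn_gt0.
(* [u1] makes c u^r at most 1/2, so that 1 - exp(- c u^r) is at least half of c u^r; [u2] makes u^2
   L^2 / 2 at most a quarter of it. *)
pose u1 := (2 * c)^-1 `^ r^-1; pose u2 := (c / (2 * L ^+ 2)) `^ (2 - r)^-1.
pose u := Num.min u1 u2.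
have cc : 0 < (2 * c)^-1 by rewrite invr_gt0 mulr_gt0.
have cL : 0 < c / (2 * L ^+ 2) by rewrite divr_gt0// mulr_gt0.
have u0 : 0 < u by rewrite lt_min !powR_gt0.
have ur : u `^ r <= (2 * c)^-1.
  have -> : (2 * c)^-1 = u1 `^ r by rewrite /u1 -powRrM mulVf ?gt_eqF// powRr1// ltW.
  by apply: ge0_ler_powR; rewrite ?nnegrE ?(ltW r0) ?(ltW u0) ?powR_ge0// ge_min lexx.
have u2r : u `^ (2 - r) <= c / (2 * L ^+ 2).
  have -> : c / (2 * L ^+ 2) = u2 `^ (2 - r).
    by rewrite /u2 -powRrM mulVf ?gt_eqF// powRr1// ltW.
  by apply: ge0_ler_powR; rewrite ?nnegrE ?(ltW r2) ?(ltW u0) ?powR_ge0// ge_min lexx orbT.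
have uu : u ^+ 2 = u `^ r * u `^ (2 - r).
  rewrite -powRD; last by rewrite (gt_eqF u0)//= implybT.
  by rewrite addrC subrK -powR_mulrn// ltW.
have v0 : 0 < c * u `^ r by rewrite mulr_gt0// powR_gt0.
have v2 : c * u `^ r <= 2^-1.
  by rewrite -ler_pdivlMl//; apply: le_trans ur _; rewrite invfM mulrC.
have h1 := bound _ u0; have := expRN_quad (ltW v0); rewrite ler_norml => /andP[h2 h3].
have h4 : u ^+ 2 * L ^+ 2 / 2 <= c * u `^ r / 4.
  have -> : c * u `^ r / 4 = u `^ r * (c / 4) by ring.
  rewrite uu -[_ * _ / 2]mulrA -[_ * _ * (_ / 2)]mulrA ler_pM2l ?powR_gt0//.
  apply: (@le_trans _ _ (c / (2 * L ^+ 2) * (L ^+ 2 / 2))).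
    by rewrite ler_pM2r// divr_gt0.
  by rewrite le_eqVlt; apply/orP; left; apply/eqP; field; rewrite lt0r_neq0.
by move: (c * u `^ r) (u ^+ 2 * L ^+ 2) (expR _) v0 v2 h1 h2 h3 h4 => v z y *; nra.
Qed.

Lemma stable_density_scale (t x : R) : 0 < t -> f t x = f 1 (x / t `^ r^-1) / t `^ r^-1.
Proof.
exact: (density_scale (psi := fun v => expR (- (c * `|v| `^ r))) mX hf stable_cf_scale).
Qed.

(** A point of positivity and its opposite, both scaled to time 1/2, add up to 0. Then v > 0 is
    s^(1/r) y + 0 with y > v a point of positivity and s = (v / y)^r, and symmetry covers negative
    points. *)
Lemma stable_density_gt0 x : 0 < f 1 x.
Proof.
have pos_s (s y : R) : 0 < s -> 0 < f 1 y -> 0 < f s (s `^ r^-1 * y).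
  move=> s0 fy; have sH : 0 < s `^ r^-1 by exact: powR_gt0.
  by rewrite stable_density_scale// mulrAC divff ?lt0r_neq0// mul1r divr_gt0.
have h12 : 0 < (2^-1 : R) < 1 by lra.
have zero : 0 < f 1 0.
  have [y _ fy] := stable_unbounded (ltr01 : 0 < 1 :> R).
  have fy' : 0 < f 1 (- y) by rewrite stable_density_sym.
  have h0 : 0 < 2^-1 :> R by lra.
  have h1 : 0 < 1 - 2^-1 :> R by lra.
  have := stable_density_add h12 (pos_s _ _ h0 fy) (pos_s _ _ h1 fy').
  have -> : 1 - 2^-1 = 2^-1 :> R by lra.
  by rewrite mulrN subrr.
have main v : 0 < v -> 0 < f 1 v.
  move=> v0; have [y vy fy] := stable_unbounded (ltr_wpDl (ltW v0) v0).
  have y0 : 0 < y by apply: lt_le_trans vy; rewrite addr_gt0.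
  have vy1 : v < y by apply: lt_le_trans vy; rewrite ltrDl.
  pose s := (v / y) `^ r.
  have s0 : 0 < s by rewrite powR_gt0// divr_gt0.
  have s1 : s < 1.
    have : (v / y) `^ r < 1 `^ r.
      by apply: gt0_ltr_powR; rewrite ?nnegrE ?divr_ge0 ?(ltW v0) ?(ltW y0)// ltr_pdivrMr// mul1r.
    by rewrite powR1.
  have s01 : 0 < s < 1 by rewrite s0.
  have sy : s `^ r^-1 * y = v.
    rewrite /s -powRrM divff ?gt_eqF// powRr1 ?divr_ge0 ?(ltW v0) ?(ltW y0)//.
    by rewrite divfK// gt_eqF.
  have u0 : 0 < 1 - s by rewrite subr_gt0.
  have := stable_density_add s01 (pos_s _ _ s0 fy) (pos_s _ _ u0 zero).
  by rewrite sy mulr0 addr0.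
have [x0|x0|<-] := ltgtP 0 x; [exact: main| |exact: zero].
by rewrite -[x]opprK stable_density_sym; apply: main; rewrite oppr_gt0.
Qed.

Lemma stable_selfsim (Xs : nat -> R -> Omega -> R) : iid_copies P X Xs ->
  (forall i w, cadlag_nonneg (fun t => Xs i t w)) ->
  selfsim P X Xs r^-1 (Phi 1) (f 1).
Proof.
move=> iid cadX; split=> //.
- by rewrite invr_gt0.
- move=> t x t0.
  exact: (marginal_scale (psi := fun v => expR (- (c * `|v| `^ r))) mX stable_cf_scale).
- by move=> x; exact: dPhi.
- by case: (hf ltr01).
- exact: stable_density_gt0.
- exact: stable_osc.
- exact: stable_rc.
- by move=> i w t t0; case: (cadX i w) => h _; exact: h.
Qed.

End stable.

(** * Fractional Brownian motion *)

Section normal_identification.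
Context {R : realType} {d : measure_display} {Omega : measurableType d}
  (P : probability Omega R).

(** [centered_normal_rv] leaves the variance free; the second moment excludes the degenerate
    alternative and fixes it. *)
Lemma normal_of_moment (Y : Omega -> R) (v : R) : measurable_fun setT Y -> 0 < v ->
  centered_normal_rv P Y -> (\int[P]_w (Y w ^+ 2)%:E = (v ^+ 2)%:E)%E ->
  forall B : set R, measurable B ->
    pr P (Y @^-1` B) = pr (normal_prob (0 : R) v : probability (measurableTypeR R) R) B.
Proof.
move=> mY v0 gY EY.
have msq : measurable_fun setT (fun x : R => (x ^+ 2)%:E).
  by apply/measurable_EFinP; exact: measurable_funX.
have sq0 (x : R) : (0 <= (x ^+ 2)%:E)%E by rewrite lee_fin sqr_ge0.
case: gY => [Y0|[s [s0 hs]]].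
  exfalso; have m0 : measurable [set w | Y w = 0] by exact: (measurable_preim mY (B := [set 0])).
  have n0 : P (~` [set w | Y w = 0]) = 0%E.
    by rewrite (prE P (measurableC m0)) (prC P m0) /pr Y0 subrr.
  have : (\int[P]_w (Y w ^+ 2)%:E = 0)%E.
    have -> : (0 = \int[P]_w (cst 0 : Omega -> \bar R) w)%E by rewrite integral_cst// mul0e.
    apply: ae_eq_integral => //; first by apply/measurable_EFinP; exact: measurable_funX.
    exists (~` [set w | Y w = 0]); split=> //; first exact: measurableC.
    by move=> w /= h E; apply: h => _; rewrite E expr0n.
  by rewrite EY => -[] /eqP; rewrite expf_eq0/= gt_eqF.
pose N : probability (measurableTypeR R) R := normal_prob (0 : R) s.
have mi : measurable_fun setT (fun x : measurableTypeR R => x : R) by exact: measurable_id.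
have E : forall C, measurable C -> pr P (Y @^-1` C) = pr N ((fun x : measurableTypeR R => x : R) @^-1` C).
  by move=> C mC; rewrite /pr hs.
have : (s ^+ 2)%:E = (v ^+ 2)%:E.
  by rewrite -EY (integral_law mY mi msq sq0 E) (normal_second_moment s0).
move=> [] /eqP; rewrite eqrXn2 ?(ltW s0) ?(ltW v0)// => /eqP sv.
by move=> B mB; rewrite E// /N sv.
Qed.

End normal_identification.

Lemma expRN_poly {R : realType} (k : nat) (x : R) : 0 < x -> expR (- x) <= k%:R ^+ k / x ^+ k.
Proof.
move=> x0; case: k => [|k].
  by rewrite !expr0 divr1 -[leRHS]expR0 ler_expR oppr_le0 ltW.
have k0 : 0 < k.+1%:R :> R by rewrite ltr0n.
rewrite -expr_div_n -[leRHS]invrK expRN lef_pV2 ?posrE ?expR_gt0 ?invr_gt0 ?exprn_gt0 ?divr_gt0//.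
rewrite -exprVn invf_div.
have -> : expR x = expR (x / k.+1%:R) ^+ k.+1.
  by rewrite -expRM_natl mulrC divfK// gt_eqF.
rewrite lerXn2r ?nnegrE ?expR_ge0 ?divr_ge0 ?(ltW x0)//.
by apply: le_trans (expR_ge1Dx _); rewrite lerDr.
Qed.

Lemma cont_rcpath {R : realType} (g : R -> R) : cont_nonneg g -> rcpath g.
Proof.
move=> /subspace_continuousP h t t0; have := h t t0; apply: cvg_trans; apply: cvg_app.
move=> A hA; apply: (filterS _ (hA : nbhs t (fun u => 0 <= u -> A u))) => u uA tu.
by apply: uA; exact: le_trans t0 (ltW tu).
Qed.

Section fractional.
Context {R : realType} {d : measure_display} {Omega : measurableType d}
  (P : probability Omega R) (X : R -> Omega -> R) (f : R -> R -> R) (r : R).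
Hypothesis r02 : 0 < r < 2.
Hypothesis fb : frac_brownian P r X.
Hypothesis contX : forall w, cont_nonneg (fun t => X t w).
Hypothesis hf : forall t : R, 0 < t ->
     continuous (f t) /\ (forall y, 0 <= f t y) /\
     forall x, P [set w | X t w <= x] =
       (\int[lebesgue_measure]_(y in [set y : R | (y <= x)%R]) (f t y)%:E)%E.
Local Notation pr := (pr P).
Local Notation Ex := (Ex P).
Local Notation Nm v := (normal_prob (0 : R) v : probability (measurableTypeR R) R).

Let mX (t : R) : 0 <= t -> measurable_fun setT (X t).
Proof. by move=> t0; case: fb => -[h _] _; exact: h. Qed.

Let r0 : 0 < r. Proof. by case/andP: r02. Qed.

Let H := r / 2.

Let H0 : 0 < H. Proof. by rewrite divr_gt0. Qed.

Let powH (t : R) : 0 <= t -> t `^ r = (t `^ H) ^+ 2.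
Proof. by move=> t0; rewrite -powR_mulrn ?powR_ge0// -powRrM /H divfK. Qed.

Let Eprod s t : 0 <= s -> 0 <= t -> (\int[P]_w (X s w * X t w)%:E =
  (((t `^ r) + (s `^ r) - (`|t - s| `^ r)) / 2)%:E)%E.
Proof. by move=> s0 t0; case: fb => _ h; have := h s t s0 t0; rewrite unlock. Qed.

Let iprod s t : 0 <= s -> 0 <= t -> P.-integrable setT (EFin \o (fun w => X s w * X t w)).
Proof.
have isq u : 0 <= u -> P.-integrable setT (EFin \o (fun w => X u w * X u w)).
  move=> u0; apply/integrableP; split.
    by apply/measurable_EFinP; apply: measurable_funM; exact: mX.
  under eq_integral => w _ do rewrite /= ger0_norm -?expr2 ?sqr_ge0// expr2.
  by rewrite Eprod// ltry.
move=> s0 t0; apply: (le_integrable measurableT) (integrableD measurableT (isq _ s0) (isq _ t0)).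
  by apply/measurable_EFinP; apply: measurable_funM; exact: mX.
move=> w _ /=; rewrite lee_fin [leRHS]ger0_norm; last by rewrite addr_ge0// -expr2 sqr_ge0.
rewrite ler_norml; apply/andP; split.
  by have := sqr_ge0 (X s w + X t w); nra.
by have := sqr_ge0 (X s w - X t w); nra.
Qed.

Lemma fbm_increment s t : 0 <= s -> 0 <= t -> s != t -> forall B, measurable B ->
  pr ((fun w => X t w - X s w) @^-1` B) = prob_of (Nm (`|t - s| `^ H)) B.
Proof.
move=> s0 t0 st; have ts : 0 < `|t - s| by rewrite normr_gt0 subr_eq0 eq_sym.
have [[_ gau] _] := fb.
pose pts (k : 'I_2) := if val k == 0%N then t else s.
pose a (k : 'I_2) : R := if val k == 0%N then 1 else -1.
have hp k : [set t : R | 0 <= t] (pts k) by rewrite /pts; case: ifP.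
have := gau 2 pts a hp.
rewrite (_ : (fun w => _) = (fun w => X t w - X s w)); last first.
  by apply/funext => w; rewrite !big_ord_recr big_ord0/= add0r /a /pts/= mul1r mulN1r.
move=> gY; apply: normal_of_moment => //.
- by apply: measurable_funB; exact: mX.
- exact: powR_gt0.
have i1 := iprod t0 t0; have i2 := iprod s0 t0; have i3 := iprod s0 s0.
have i4 := integrableZl measurableT (- 2) i2.
transitivity (\int[P]_w (((X t w * X t w)%:E + (- 2)%:E * (X s w * X t w)%:E) + (X s w * X s w)%:E))%E.
  by apply: eq_integral => w _; rewrite -EFinM -!EFinD; congr EFin; ring.
rewrite integralD//=; last exact: integrableD.
rewrite integralD//= integralZl// !Eprod// -EFinM -!EFinD; congr EFin.
rewrite -powH// !subrr normr0 powR0 ?gt_eqF//; field; exact: isT.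
Qed.

Lemma fbm_marginal (t : R) : 0 < t -> forall B, measurable B ->
  pr (X t @^-1` B) = prob_of (Nm (t `^ H)) B.
Proof.
move=> t0; have t00 := ltW t0; have [[_ gau] _] := fb.
have := gau 1 (fun=> t) (fun=> 1) (fun=> t00).
rewrite (_ : (fun w => _) = X t); last by apply/funext => w; rewrite big_ord1 mul1r.
move=> gY; apply: normal_of_moment => //; [exact: mX|exact: powR_gt0|].
under eq_integral do rewrite expr2.
by rewrite Eprod// -powH// subrr normr0 powR0 ?gt_eqF//; congr EFin; field.
Qed.

Let mid : measurable_fun setT (fun x : measurableTypeR R => x : R).
Proof. exact: measurable_id. Qed.

Lemma fbm_cf (t u : R) : 0 < t ->
  Ex (fun w => cos (u * X t w)) = expR (- ((t `^ H * u) ^+ 2 / 2)) /\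
  Ex (fun w => sin (u * X t w)) = 0.
Proof.
move=> t0; have tH : 0 < t `^ H by exact: powR_gt0.
have E : forall C, measurable C ->
    pr (X t @^-1` C) = prob_of (Nm (t `^ H)) ((fun x : measurableTypeR R => x : R) @^-1` C).
  exact: fbm_marginal.
have mt := mX (ltW t0).
have mu : measurable_fun setT (fun x : R => u * x) by exact: measurable_funM.
split.
  rewrite (Ex_law mt mid (h := fun x => cos (u * x)) (bmf_cos mu) E) (normal_cf_cos tH).
  by rewrite exprMn [X in X / 2]mulrC.
by rewrite (Ex_law mt mid (h := fun x => sin (u * x)) (bmf_sin mu) E) (normal_cf_sin tH).
Qed.

(** The exponential normal tail is weakened to a power k, to be taken so large that a union over 2^i
    increments is affordable. *)
Lemma fbm_tail (k : nat) : exists2 C : R, 0 <= C & forall s t lam : R, 0 <= s -> 0 <= t -> 0 < lam ->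
  pr [set w | lam < `|X t w - X s w|] <= C * (`|t - s| `^ H / lam) ^+ k.
Proof.
exists (2 * expR 2^-1 * k%:R ^+ k); first by rewrite !mulr_ge0// expR_ge0.
move=> s t lam s0 t0 lam0; have [<-|st] := eqVneq s t.
  rewrite (_ : [set w | _] = set0) ?pr0; last first.
    by apply/seteqP; split => // w /=; rewrite subrr normr0 ltNge ltW.
  apply: mulr_ge0; first by rewrite !mulr_ge0// expR_ge0.
  by rewrite exprn_ge0// divr_ge0 ?powR_ge0// ltW.
have ts : 0 < `|t - s| by rewrite normr_gt0 subr_eq0 eq_sym.
set sg := `|t - s| `^ H; have sg0 : 0 < sg by exact: powR_gt0.
have mB : measurable [set y : R | lam < `|y|] by apply: measurable_norm_gt; exact: measurable_id.
rewrite -[[set w | _]]/((fun w => X t w - X s w) @^-1` [set y | lam < `|y|]) (fbm_increment s0 t0 st mB).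
pose x := lam / sg; have x0 : 0 < x by rewrite divr_gt0.
have xE : sg * x = lam by rewrite /x mulrC divfK// gt_eqF.
have mg (e : R) : measurable [set y : R | sg * x <= e * y].
  by apply: measurable_ge; exact: measurable_funM.
apply: (@le_trans _ _ (prob_of (Nm sg) ([set y : R | sg * x <= 1 * y] `|` [set y : R | sg * x <= -1 * y]))).
  apply: pr_le; [exact: mB|by apply: measurableU; exact: mg|].
  move=> y /=; rewrite xE mul1r mulN1r lter_normr => /orP[h|h]; [left|right]; exact: ltW.
apply: (@le_trans _ _ (prob_of (Nm sg) [set y : R | sg * x <= 1 * y] +
    prob_of (Nm sg) [set y : R | sg * x <= -1 * y])); first by apply: prU_le; exact: mg.
have n1 : `|1 : R| = 1 by rewrite normr1.
have n2 : `|- 1 : R| = 1 by rewrite normrN1.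
apply: le_trans (lerD (normal_tail sg0 x n1) (normal_tail sg0 x n2)) _.
have -> : expR (2^-1 - x) + expR (2^-1 - x) = 2 * expR 2^-1 * expR (- x) by rewrite expRD; ring.
rewrite -[leRHS]mulrA ler_pM2l; last by rewrite mulr_gt0// expR_gt0.
apply: le_trans (expRN_poly k x0) _.
by rewrite /x -exprVn invf_div.
Qed.

(** Chaining with thresholds lam (1 - th) th^i, whose sum is at most lam. An increment over h 2^-i
    has scale h^H th^(2 i), so it exceeds the i-th threshold with probability of order th^(i k). *)
Lemma fbm_osc : exists C kap : R, [/\ 0 <= C, 0 < kap &
  forall t h lam : R, 0 <= t -> 0 < h -> 0 < lam ->
    plaw P X (osc t h lam) <= C * (h `^ H / lam) `^ kap].
Proof.
have H2 : 0 < H / 2 by rewrite divr_gt0.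
pose th : R := 2 `^ (- (H / 2)).
have th0 : 0 < th by exact: powR_gt0.
have th1 : th < 1.
  rewrite /th powRN invf_lt1 ?powR_gt0//.
  have : (1 : R) `^ (H / 2) < 2 `^ (H / 2) by rewrite gt0_ltr_powR ?nnegrE// ltr1n.
  by rewrite powR1.
have thH : (2^-1 : R) `^ H = th ^+ 2.
  by rewrite /th -powR_mulrn ?powR_ge0// -powRrM mulNr divfK// powRN powRV.
have thp : 0 < 1 - th by rewrite subr_gt0.
(* Then 2^i th^(i k) <= 2^-i, and the sum over levels costs a factor 2. *)
have [k hk] : exists k : nat, th ^+ k <= 4^-1 by apply: ex_expn_le; rewrite ?(ltW th0)//; lra.
have k0 : (0 < k)%N by case: k hk => //; rewrite expr0; lra.
have [C C0 hC] := fbm_tail k.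
exists (C * (1 - th) ^- k * 2), k%:R; split.
- by rewrite !mulr_ge0// invr_ge0 exprn_ge0// ltW.
- by rewrite ltr0n.
move=> t h lam t0 h0 lam0; set y := h `^ H / lam.
have y0 : 0 <= y by rewrite divr_ge0 ?powR_ge0// ltW.
rewrite powR_mulrn//.
have rc w : rcpath (spath0 X w) by exact: (cont_rcpath (@contX w)).
apply: (plaw_osc_le mX rc t0 h0) => j.
pose lm (i : nat) := lam * (1 - th) * th ^+ i.
have lm0 i : 0 < lm i by rewrite !mulr_gt0// exprn_gt0.
pose A (i l : nat) := [set w | lm i < `|X (dyad t h i l.+1) w - X (dyad t h i l) w|].
have dg i l : 0 <= dyad t h i l by exact: dyad_ge0.
have mA i l : measurable (A i l).
  by apply: measurable_norm_gt; apply: measurable_funB; exact: mX.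
pose B i := \big[setU/set0]_(l < 2 ^ i) A i l.
have mB i : measurable (B i) by exact: bigsetU_measurable.
have pA i l : pr (A i l) <= C * (y / (1 - th) * th ^+ i) ^+ k.
  apply: le_trans (hC _ _ _ (dg i l) (dg i l.+1) (lm0 i)) _.
  have -> : dyad t h i l.+1 - dyad t h i l = h * 2^-1 ^+ i.
    by rewrite /dyad -natr1 exprVn; ring.
  rewrite ger0_norm ?mulr_ge0 ?(ltW h0) ?exprn_ge0// powRM ?(ltW h0) ?exprn_ge0//.
  rewrite powRXn// thH (_ : h `^ H * _ / lm i = y / (1 - th) * th ^+ i)//.
  have n1 := lt0r_neq0 lam0; have n2 := lt0r_neq0 thp; have n3 := lt0r_neq0 (exprn_gt0 i th0).
  rewrite /y /lm -exprM mulnC exprM; move: (th ^+ i) n3 => z z0.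
  by field; rewrite n1 n2 z0.
have pB i : pr (B i) <= C * (y / (1 - th)) ^+ k * 2^-1 ^+ i.
  apply: le_trans (pr_bigsum_le _ _ _) _ => //.
  apply: (@le_trans _ _ (\sum_(l < 2 ^ i) C * (y / (1 - th) * th ^+ i) ^+ k)).
    by apply: ler_sum => l _; exact: pA.
  rewrite sumr_const card_ord -[leLHS]mulr_natl natrX exprMn.
  have -> : 2 ^+ i * (C * ((y / (1 - th)) ^+ k * th ^+ i ^+ k)) =
    C * (y / (1 - th)) ^+ k * (2 * th ^+ k) ^+ i by
      rewrite [(2 * _) ^+ i]exprMn [th ^+ i ^+ k]exprAC; move: (_ ^+ k) (2 ^+ i : R) (th ^+ k ^+ i) => *; ring.
  rewrite ler_wpM2l//; first by rewrite mulr_ge0// exprn_ge0// divr_ge0// ltW.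
  by rewrite lerXn2r ?nnegrE// ?mulr_ge0 ?exprn_ge0 ?(ltW th0)//; move: (th ^+ k) hk => z; lra.
apply: (@le_trans _ _ (pr (\bigcup_i B i))).
  apply: pr_le; [exact: measurable_dyadic_jump|exact: bigcup_measurable|].
  move=> w [l /= lj hl]; apply: contrapT => nB.
  have inc i m : (m < 2 ^ i)%N -> `|X (dyad t h i m.+1) w - X (dyad t h i m) w| <= lm i.
    move=> mi; rewrite leNgt; apply/negP => lt; apply: nB; exists i => //.
    exact: (@bigsetU_intro _ _ (fun l => A i l) m).
  (* Induction on the level: an even point belongs to the previous subdivision, and an odd one is a
     single increment away from its left neighbour, which does. *)
  have chain i : forall m, (m <= 2 ^ i)%N ->
      `|X (dyad t h i m) w - X t w| <= \sum_(n < i.+1) lm n.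
    have d0 n : dyad t h n 0 = t by rewrite /dyad mul0r mulr0 addr0.
    elim: i => [|i IH] m mi.
      rewrite big_ord1; case: m mi => [|[|//]] _; first by rewrite d0 subrr normr0 ltW.
      by have := inc 0%N 0%N isT; rewrite d0.
    have dd n : dyad t h i.+1 n.*2 = dyad t h i n.
      rewrite /dyad -mul2n natrM exprS; congr (_ + h * _).
      have n2 : 2 ^+ i != 0 :> R by rewrite expf_neq0.
      by move: (2 ^+ i : R) n2 => z z0; field.
    rewrite big_ord_recr/= -(odd_double_half m); case: (boolP (odd m)) => om /=.
      have mh : (m./2 < 2 ^ i)%N.
        have := odd_double_half m; rewrite om/= add1n => E.
        by rewrite -ltn_double -[X in (_ < X)%N]mul2n -expnS; apply: leq_trans mi; rewrite -[leqRHS]E.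
      rewrite add1n addrC -(subrKA (X (dyad t h i.+1 (m./2).*2) w)).
      apply: le_trans (ler_normD _ _) _; apply: lerD.
        by apply: inc; rewrite expnS mul2n ltn_double.
      by rewrite dd; apply: IH; exact: ltnW.
    rewrite add0n dd ler_wpDr ?(ltW (lm0 _))//; apply: IH.
    have := odd_double_half m; rewrite (negbTE om) add0n => E.
    by rewrite -leq_double E -mul2n -expnS.
  have := chain j l lj; rewrite leNgt => /negP; apply; apply: le_lt_trans hl.
  rewrite /lm -mulr_sumr; have := @geom_sum_le _ th j.+1; rewrite (ltW th0) th1 => /(_ isT) hg.
  apply: (@le_trans _ _ (lam * (1 - th) * (1 - th)^-1)).
    by rewrite ler_wpM2l// mulr_ge0// ltW.
  by rewrite mulfK// gt_eqF.
apply: pr_bigcup_le => // n.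
apply: (@le_trans _ _ (\sum_(i < n) C * (y / (1 - th)) ^+ k * 2^-1 ^+ i)).
  by apply: ler_sum => i _; exact: pB.
rewrite -mulr_sumr; have h12 : 0 <= (2^-1 : R) < 1 by lra.
have hg := geom_sum_le n h12.
have -> : C * (1 - th) ^- k * 2 * y ^+ k = C * (y / (1 - th)) ^+ k * (1 - 2^-1)^-1.
  rewrite [(y / _) ^+ k]expr_div_n; have -> : (1 - 2^-1)^-1 = 2 :> R by field.
  ring.
by rewrite ler_wpM2l// mulr_ge0// exprn_ge0// divr_ge0// ltW.
Qed.

Lemma fbm_density x : f 1 x = ndens 1 x.
Proof.
have h1 := marginal_derive mX hf x ltr01.
have h2 : is_derive x 1 (fun x => prob_of (Nm 1) [set y : R | y <= x]) (ndens 1 x).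
  apply: (@density_derive R (fun x => prob_of (Nm 1) [set y : R | y <= x])) => [|y|y].
  - exact: continuous_ndens.
  - by apply: ltW; exact: ndens_gt0.
  - by rewrite -prE//; apply: measurable_le; exact: measurable_id.
have E : (fun x => pr [set w | X 1 w <= x]) = (fun x => prob_of (Nm 1) [set y : R | y <= x]).
  apply/funext => y; have mB : measurable [set z : R | z <= y].
    by apply: measurable_le; exact: measurable_id.
  by have := fbm_marginal ltr01 mB; rewrite powR1.
by rewrite E in h1; have [_ <-] := h1; have [_ <-] := h2.
Qed.

Lemma fbm_density_scale (t x : R) : 0 < t -> f t x = f 1 (x / t `^ H) / t `^ H.
Proof. exact: (density_scale (psi := fun v => expR (- (v ^+ 2 / 2))) mX hf fbm_cf). Qed.

Lemma fbm_selfsim (Xs : nat -> R -> Omega -> R) : iid_copies P X Xs ->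
  (forall i w, cont_nonneg (fun t => Xs i t w)) ->
  selfsim P X Xs H (fun x => pr [set w | X 1 w <= x]) (f 1).
Proof.
move=> iid cXs; split=> //.
- move=> t x t0; exact: (marginal_scale (psi := fun v => expR (- (v ^+ 2 / 2))) mX fbm_cf).
- by move=> x; apply: (marginal_derive mX hf).
- by case: (hf ltr01).
- by move=> x; rewrite fbm_density; exact: ndens_gt0.
- exact: fbm_osc.
- by move=> w; exact: (cont_rcpath (@contX w)).
- by move=> i w; exact: (cont_rcpath (@cXs i w)).
Qed.

End fractional.

Theorem theorem2 (R : realType) (d : measure_display) (Omega : measurableType d)
  (P : probability Omega R) (r : R) (X : R -> Omega -> R)
  (Xs : nat -> R -> Omega -> R) (f : R -> R -> R) (a b T : R) :
  0 < r < 2 ->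
  ((exists c : R, 0 < c /\ sym_stable_process P r c X /\
      (forall w, cadlag_nonneg (fun t => X t w)) /\
      (forall i w, cadlag_nonneg (fun t => Xs i t w)))
   \/
   (frac_brownian P r X /\
      (forall w, cont_nonneg (fun t => X t w)) /\
      (forall i w, cont_nonneg (fun t => Xs i t w)))) ->
  P [set w | X 0 w = 0] = 1%E ->
  iid_copies P X Xs ->
  (* f(t, .) is the (continuous) density of X(t), t > 0 *)
  (forall t, 0 < t ->
     continuous (f t) /\ (forall y, 0 <= f t y) /\
     forall x, P [set w | X t w <= x] =
       (\int[lebesgue_measure]_(y in [set y : R | (y <= x)%R]) (f t y)%:E)%E) ->
  (* I = [a, b] is a closed subinterval of (0, 1) *)
  0 < a -> a <= b -> b < 1 ->
  0 < T ->
  exists (d' : measure_display) (Omega' : measurableType d')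
         (Q : probability Omega' R) (G : R * R -> Omega' -> R),
    let S := [set p : R * R | 0 <= p.1 <= T /\ a <= p.2 <= b] in
    centered_gaussian_process Q S G /\
    radon_paths Q S G /\
    (forall alpha, a <= alpha <= b -> forall w, G (0, alpha) w = 0) /\
    (forall s beta t alpha, 0 < s <= T -> a <= beta <= b ->
       0 < t <= T -> a <= alpha <= b ->
       expectation Q (fun w => G (s, beta) w * G (t, alpha) w) =
       ((fine (P [set w | X s w <= tau P X s beta /\ X t w <= tau P X t alpha])
          - alpha * beta)
        / (f s (tau P X s beta) * f t (tau P X t alpha)))%:E) /\
    weak_conv_linf S P
      (fun n (p : R * R) w =>
         Num.sqrt n%:R * (tau_n Xs n p.1 p.2 w - tau P X p.1 p.2)) Q G.
Proof.
move=> r02 kind X00 iid hf a0 ab b1 T0.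
(* Both kinds of process meet here: beyond self-similarity, only the scaling of the given densities
   is used to express the covariance. *)
suff main (H : R) (Phi p : R -> R) : selfsim P X Xs H Phi p ->
    (forall t x, 0 < t -> f t x = p (x / t `^ H) / t `^ H) ->
    exists G : R * R -> Omega -> R,
    let S := [set p : R * R | 0 <= p.1 <= T /\ a <= p.2 <= b] in
    centered_gaussian_process P S G /\
    radon_paths P S G /\
    (forall alpha, a <= alpha <= b -> forall w, G (0, alpha) w = 0) /\
    (forall s beta t alpha, 0 < s <= T -> a <= beta <= b ->
       0 < t <= T -> a <= alpha <= b ->
       expectation P (fun w => G (s, beta) w * G (t, alpha) w) =
       ((fine (P [set w | X s w <= tau P X s beta /\ X t w <= tau P X t alpha])
          - alpha * beta)
        / (f s (tau P X s beta) * f t (tau P X t alpha)))%:E) /\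
    weak_conv_linf S P
      (fun n (p : R * R) w =>
         Num.sqrt n%:R * (tau_n Xs n p.1 p.2 w - tau P X p.1 p.2)) P G.
  exists d, Omega, P.
  case: kind => [[c [c0 [st [cad cadXs]]]]|[fb [contX contXs]]].
    apply: (main r^-1 _ (f 1) (stable_selfsim r02 c0 st cad X00 hf iid cadXs)).
    by move=> t x; exact: (stable_density_scale r02 st hf).
  apply: (main (r / 2) _ (f 1) (fbm_selfsim r02 fb contX hf iid contXs)).
  by move=> t x; exact: (fbm_density_scale r02 fb hf).
move=> ss hfs; have [q hq] := ex_quantile ss.
have [G [gau rad G0 cov wc]] := quantile_clt ss X00 T0 a0 ab b1 hq.
have H0 := ss_H ss.
have al01 al : a <= al <= b -> 0 < al < 1.
  by move=> /andP[h1 h2]; rewrite (lt_le_trans a0 h1) (le_lt_trans h2 b1).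
have tE t al : 0 <= t -> a <= al <= b -> tau P X t al = t `^ H * q al.
  by move=> t0 hal; apply: (tauE ss hq X00) => //; exact: al01.
have fE t al : 0 < t -> a <= al <= b -> f t (tau P X t al) = p (q al) / t `^ H.
  move=> t0 hal; rewrite hfs// tE ?(ltW t0)// mulrAC divff ?mul1r//.
  by rewrite lt0r_neq0// powR_gt0.
exists G; split=> //; split=> //; split; first by move=> al hal w; exact: G0.
split.
  move=> s be t al /andP[s0 sT] hbe /andP[t0 tT] hal.
  have Ss : rect T a b (s, be) by split=> //=; rewrite (ltW s0).
  have St : rect T a b (t, al) by split=> //=; rewrite (ltW t0).
  by rewrite (cov _ _ Ss St s0 t0)/= !fE// !tE// ltW.
(* The functional depends on the values on S only, where [tau] equals t^H q; the two processes may
   differ off S. *)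
move=> F bF; have [mF cF] := wc F bF; split=> //.
have [_ [Fext _]] := bF.
rewrite (_ : (fun n : nat => _) =
    (fun n => Estar P (fun w => F (fun z => quant_dev Xs H q n z.1 z.2 w)))) //.
apply/funext => n; congr Estar; apply/funext => w; apply: Fext => z [/andP[z0 _] hz].
by rewrite /quant_dev tE.
Qed.
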